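(* Let $M$ and $N$ be $3$-manifolds, and let $\overline{M}$ denote $M$ with the opposite orientation. Then the embedding number $\varepsilon$ satisfies the following properties: (1) $\varepsilon(M) = \varepsilon(\overline M)$; (2) $\varepsilon(M \# N) \leq \varepsilon(M) + \varepsilon(N)$; (3) $\varepsilon(M \# \overline{M}) \leq \varepsilon(M)$.
   Context: All manifolds and maps are smooth and all manifolds are oriented. $\#_k S^2\times S^2$ denotes the connected sum of $k$ copies of $S^2\times S^2$, where by convention the empty connected sum ($k=0$) is $S^4$. Every $3$-manifold embeds in $\#_k S^2\times S^2$ for some $k$; for a $3$-manifold $M$, the embedding number $\varepsilon(M)$ is the minimum $k\geq 0$ such that $M$ smoothly embeds in $\#_k S^2\times S^2$. The symbol $\#$ between $3$-manifolds denotes connected sum. *)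

(* Defs.v *)
From mathcomp Require Import all_boot all_order all_algebra.
From mathcomp Require Import all_classical all_reals all_analysis.
Import Order.TTheory GRing.Theory Num.Theory.
Import numFieldNormedType.Exports.
Set Implicit Arguments.
Unset Strict Implicit.
Unset Printing Implicit Defensive.
Local Open Scope classical_set_scope.
Local Open Scope ring_scope.

(* The domain U is meant to be open in the next two definitions. *)
Fixpoint Ck_on (R : realType) (m n k : nat) (U : set 'rV[R]_m)
    (f : 'rV[R]_m -> 'rV[R]_n) : Prop :=
  (forall x, U x -> {for x, continuous f}) /\
  (if k is k'.+1 then
     forall i : 'I_m, (forall x, U x -> derivable f x (delta_mx 0 i)) /\
                      Ck_on k' U (fun x => 'D_(delta_mx 0 i) f x)
   else True).

Definition Coo_on (R : realType) (m n : nat) (U : set 'rV[R]_m)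
    (f : 'rV[R]_m -> 'rV[R]_n) : Prop :=
  forall k, Ck_on k U f.

(* chart_map and chart_inv are total functions; their values outside
   chart_dom and chart_cod are irrelevant. *)
Record chart (R : realType) (n : nat) (T : topologicalType) := Chart {
  chart_map :> T -> 'rV[R]_n ;
  chart_inv : 'rV[R]_n -> T ;
  chart_dom : set T ;
  chart_cod := chart_map @` chart_dom ;
  chart_dom_open : open chart_dom ;
  chart_cod_open : open chart_cod ;
  chart_mapK : forall x, chart_dom x -> chart_inv (chart_map x) = x ;
  chart_map_cont : forall x, chart_dom x -> {for x, continuous chart_map} ;
  chart_inv_cont : forall y, chart_cod y -> {for y, continuous chart_inv} }.

Record manifold (R : realType) (n : nat) := Manifold {
  mcarrier :> topologicalType ;
  atlas : set (chart R n mcarrier) ;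
  atlas_cover : forall x, exists2 a, atlas a & chart_dom a x ;
  atlas_compat : forall a b, atlas a -> atlas b ->
    Coo_on (a @` (chart_dom a `&` chart_dom b)) (b \o chart_inv a) ;
  manifold_hausdorff : hausdorff_space mcarrier ;
  manifold_second_countable : @second_countable mcarrier }.

(* orientation a x says whether the chart a is positively oriented at x, i.e.
   whether a maps the chosen orientation of the tangent space at x to the
   standard orientation of R^n.  It is only meaningful for a in the atlas and
   x in the domain of a. *)
Record oriented_manifold (R : realType) (n : nat) := OrientedManifold {
  omanifold :> manifold R n ;
  orientation : chart R n omanifold -> omanifold -> bool ;
  orientation_locally_constant : forall a x, atlas a -> chart_dom a x ->
    \forall y \near x, orientation a y = orientation a x ;
  orientation_compat : forall a b x, atlas a -> atlas b ->
    chart_dom a x -> chart_dom b x ->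
    (orientation a x == orientation b x) =
    (0 < \det ('J (b \o chart_inv a) (a x))) }.

Section Opposite.
Context (R : realType) (n : nat) (M : oriented_manifold R n).

Let opp_orientation (a : chart R n M) (x : M) := ~~ orientation a x.

Let opp_locally_constant (a : chart R n M) x : atlas a -> chart_dom a x ->
  \forall y \near x, opp_orientation a y = opp_orientation a x.
Proof.
move=> Aa ax; apply: filterS (orientation_locally_constant Aa ax) => y.
by rewrite /opp_orientation => ->.
Qed.

Let opp_compat (a b : chart R n M) x : atlas a -> atlas b ->
  chart_dom a x -> chart_dom b x ->
  (opp_orientation a x == opp_orientation b x) =
  (0 < \det ('J (b \o chart_inv a) (a x))).
Proof.
move=> Aa Ab ax bx; rewrite -(orientation_compat Aa Ab ax bx).
by rewrite /opp_orientation; case: orientation; case: orientation.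
Qed.

Definition opposite : oriented_manifold R n :=
  OrientedManifold opp_locally_constant opp_compat.

End Opposite.

Section Euclidean.
Context (R : realType) (n : nat).

Let id_cod_open : open ((id : 'rV[R]_n -> 'rV[R]_n) @` setT).
Proof. by rewrite image_id; exact: openT. Qed.

Let id_cont (y : 'rV[R]_n) : {for y, continuous id}.
Proof. exact: cvg_id. Qed.

Definition id_chart : chart R n 'rV[R]_n :=
  Chart openT id_cod_open (fun _ _ => erefl) (fun x _ => @id_cont x)
    (fun y _ => @id_cont y).

Let Ck_cst (k : nat) U (c : 'rV[R]_n) : Ck_on k U (cst c : 'rV[R]_n -> _).
Proof.
elim: k c => [|k IH] c /=; (split; first by move=> x _; exact: cst_continuous) => //.
move=> i; split; first by move=> x _; exact: derivable_cst.
rewrite (_ : (fun x => _) = cst 0); first exact: IH.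
by apply/funext => x /=; rewrite derive_cst.
Qed.

Let Coo_id U : Coo_on U (id : 'rV[R]_n -> 'rV[R]_n).
Proof.
case=> [|k] /=; (split; first by move=> x _; exact: cvg_id) => //.
move=> i; split; first by move=> x _; exact: derivable_id.
rewrite (_ : (fun x => _) = cst (delta_mx 0 i)); first exact: Ck_cst.
by apply/funext => x /=; rewrite derive_id.
Qed.

Let euclid_cover (x : 'rV[R]_n) :
  exists2 a, [set id_chart] a & chart_dom a x.
Proof. by exists id_chart. Qed.

Let euclid_compat (a b : chart R n 'rV[R]_n) :
  [set id_chart] a -> [set id_chart] b ->
  Coo_on (a @` (chart_dom a `&` chart_dom b)) (b \o chart_inv a).
Proof. by move=> -> ->; exact: Coo_id. Qed.

Let euclid_second_countable : @second_countable 'rV[R]_n.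
Proof.
pose B (p : 'rV[rat]_n * nat) : set 'rV[R]_n :=
  ball (map_mx ratr p.1 : 'rV[R]_n) p.2.+1%:R^-1.
exists (range B); first exact: sub_countable (card_image_le _ _) (countableP _).
split=> [_ [[q k] _ <-]|x V /nbhs_ballP[_/posnumP[e] xeV]].
  exact: ball_open.
have [//|k] := @ltr_add_invr R 0 (e%:num / 2) _; rewrite add0r => ke.
have qP (i : 'I_n) : exists q : rat, ball (x 0 i) k.+1%:R^-1 (ratr q : R).
  have : x 0 i < x 0 i + k.+1%:R^-1 by rewrite ltrDl invr_gt0.
  move=> /rat_in_itvoo[q /itvP qx]; exists q.
  by rewrite /ball /= distrC gtr0_norm ?subr_gt0 ?qx // ltrBlDl qx.
pose q : 'rV[rat]_n := \row_i xchoose (qP i).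
have qx : ball (map_mx ratr q : 'rV[R]_n) k.+1%:R^-1 x.
  split=> [|i j]; first by rewrite invr_gt0.
  by rewrite !mxE ord1; apply: ball_sym; exact: (xchooseP (qP j)).
exists (B (q, k)); first by split=> //; exists (q, k).
move=> z qz; apply: xeV; rewrite [_%:num]splitr.
apply: (@ball_triangle _ _ (map_mx ratr q : 'rV[R]_n)).
  by apply: (le_ball (ltW ke)); exact: ball_sym.
exact: (le_ball (ltW ke)).
Qed.

Definition euclidean_manifold : manifold R n :=
  Manifold euclid_cover euclid_compat (@norm_hausdorff R 'rV[R]_n)
           euclid_second_countable.

Let euclid_orientation_locally_constant (a : chart R n 'rV[R]_n) x :
  [set id_chart] a -> chart_dom a x -> \forall y \near x, true = true.
Proof. by move=> _ _; exact: filterE. Qed.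

Let euclid_orientation_compat (a b : chart R n 'rV[R]_n) (x : 'rV[R]_n) :
  [set id_chart] a -> [set id_chart] b -> chart_dom a x -> chart_dom b x ->
  (true == true) = (0 < \det ('J (b \o chart_inv a) (a x))).
Proof.
move=> -> -> _ _; rewrite (_ : 'J id _ = 1%:M).
  by rewrite det1 ltr01.
apply/row_matrixP => i; rewrite !rowE -deriveEjacobian ?mulmx1 ?derive_id //.
Qed.

Definition euclidean : oriented_manifold R n :=
  @OrientedManifold R n euclidean_manifold (fun _ _ => true)
    euclid_orientation_locally_constant euclid_orientation_compat.

End Euclidean.

Section Maps.
Context (R : realType).

(* The domain U is meant to be open. *)
Definition smooth_on (m n : nat) (M : manifold R m) (N : manifold R n)
    (U : set M) (f : M -> N) : Prop :=
  (forall x, U x -> {for x, continuous f}) /\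
  (forall a b, atlas a -> atlas b ->
     Coo_on (a @` (chart_dom a `&` U `&` f @^-1` chart_dom b))
            (b \o f \o chart_inv a)).

(* The Jacobian acts on row vectors by right multiplication, so that the
   differential is injective if and only if the Jacobian is row_free. *)
Definition immersion_on (m n : nat) (M : manifold R m) (N : manifold R n)
    (U : set M) (f : M -> N) : Prop :=
  smooth_on U f /\
  (forall x a b, U x -> atlas a -> chart_dom a x -> atlas b ->
     chart_dom b (f x) -> row_free ('J (b \o f \o chart_inv a) (a x))).

(* The last clause says that the inverse of f : U -> f @` U is continuous for
   the subspace topologies. *)
Definition smooth_embedding_on (m n : nat) (M : manifold R m)
    (N : manifold R n) (U : set M) (f : M -> N) : Prop :=
  [/\ immersion_on U f,
      (forall x y, U x -> U y -> f x = f y -> x = y) &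
      forall V, open V -> exists2 W, open W & U `&` V = U `&` f @^-1` W].

Definition smooth_embedding (m n : nat) (M : manifold R m) (N : manifold R n)
    (f : M -> N) : Prop := smooth_embedding_on setT f.

Definition orientation_preserving_on (n : nat) (M N : oriented_manifold R n)
    (U : set M) (f : M -> N) : Prop :=
  forall x a b, U x -> atlas a -> chart_dom a x -> atlas b ->
    chart_dom b (f x) ->
    (orientation a x == orientation b (f x)) =
    (0 < \det ('J (b \o f \o chart_inv a) (a x))).

End Maps.

Section ConnectedSum.
Context (R : realType).

Definition inversion (n : nat) (v : 'rV[R]_n) : 'rV[R]_n :=
  (\sum_i v 0 i ^+ 2)^-1 *: v.

(* P is a model of the connected sum M # N.  Take an orientation-preserving
   embedding phi of R^n in M and an orientation-reversing embedding psi of R^n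
   in N, and glue M minus phi 0 and N minus psi 0 by identifying phi v and
   psi (inversion v) for all v <> 0.  Since inversion exchanges the inside and
   the outside of the unit sphere, this amounts to removing the two open unit
   balls and gluing along their boundary spheres, but needs no smoothing of
   corners. *)
Definition is_connected_sum (n : nat) (M N P : oriented_manifold R n) : Prop :=
  exists (phi : euclidean R n -> M) (psi : euclidean R n -> opposite N)
         (i : M -> P) (j : N -> P),
  [/\ smooth_embedding phi /\ orientation_preserving_on setT phi,
      smooth_embedding psi /\ orientation_preserving_on setT psi,
      smooth_embedding_on [set~ phi 0] i /\
        orientation_preserving_on [set~ phi 0] i,
      smooth_embedding_on [set~ psi 0 : N] j /\
        orientation_preserving_on [set~ psi 0 : N] j &
      i @` [set~ phi 0] `|` j @` [set~ psi 0 : N] = setT /\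
      forall x y, x <> phi 0 -> y <> psi 0 ->
        (i x = j y <->
         exists v : 'rV[R]_n, [/\ v <> 0, x = phi v & y = psi (inversion v)])].

End ConnectedSum.

Section Models.
Context (R : realType).

(* X is orientation-preservingly diffeomorphic to the n-dimensional
   submanifold S of R^(k + n), oriented by the normal frame nu: a basis of the
   tangent space of S at z is positive if the k rows of nu z followed by this
   basis form a positive basis of R^(k + n). *)
Definition diffeomorphic_to_submanifold (k n : nat)
    (X : oriented_manifold R n) (S : set 'rV[R]_(k + n))
    (nu : 'rV[R]_(k + n) -> 'M[R]_(k, k + n)) : Prop :=
  exists f : X -> euclidean R (k + n),
  [/\ smooth_embedding f, range f = S &
      forall (a : chart R n X) (x : X), atlas a -> chart_dom a x ->
        orientation a x =
        (0 < \det (col_mx (nu (f x))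
                     ('J (f \o chart_inv a : _ -> 'rV[R]_(k + n)) (a x))))].

Definition unit_sphere (n : nat) : set 'rV[R]_n.+1 :=
  [set z | \sum_i z 0 i ^+ 2 = 1].

Definition is_sphere (n : nat) (X : oriented_manifold R n) : Prop :=
  @diffeomorphic_to_submanifold 1 n X (@unit_sphere n) id.

(* S^2 x S^2 inside R^3 x R^3; the normal frame at (x, y) is (x, 0), (0, y),
   which induces the product orientation since S^2 has even dimension. *)
Definition is_S2xS2 (X : oriented_manifold R 4) : Prop :=
  @diffeomorphic_to_submanifold 2 4 X
    [set z : 'rV[R]_(3 + 3) | unit_sphere (lsubmx z) /\
                              unit_sphere (rsubmx z)]
    (fun z : 'rV[R]_(3 + 3) => block_mx (lsubmx z) 0 0 (rsubmx z)).

Fixpoint is_sum_S2xS2 (k : nat) (X : oriented_manifold R 4) : Prop :=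
  match k with
  | 0 => is_sphere X
  | k'.+1 =>
    if k' is 0 then is_S2xS2 X
    else exists Y Z : oriented_manifold R 4,
      [/\ is_sum_S2xS2 k' Y, is_S2xS2 Z & is_connected_sum Y Z X]
  end.

End Models.

Section EmbeddingNumber.
Context (R : realType).

Definition closed_connected (n : nat) (M : manifold R n) : Prop :=
  compact [set: M] /\ connected [set: M].

Definition embeds_in_sum_S2xS2 (k : nat) (M : manifold R 3) : Prop :=
  exists (X : oriented_manifold R 4) (f : M -> X),
    is_sum_S2xS2 k X /\ smooth_embedding f.

(* The infimum of a set of natural numbers is its minimum, and +oo if the set
   is empty. *)
Definition embedding_number (M : manifold R 3) : \bar R :=
  ereal_inf [set (k%:R)%:E | k in embeds_in_sum_S2xS2 ^~ M].

End EmbeddingNumber.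

(* Main.v *)
(** Smoothly embedding a 3-manifold does not involve its orientation, so (1) is
    immediate.

    For (2), let f : M -> X and g : N -> Y be embeddings.  The gluing disc of M is
    the equatorial part of a disc Phi of X which meets f(M) nowhere else, and
    similarly for N.  Gluing X and Y along these thicker discs glues f(M) and g(N)
    into a copy of M # N.  A connected sum of k and of l copies of S^2 x S^2 is a
    sum of k + l copies if k, l >= 1, by a weak form of associativity: up to
    shrinking, the disc along which X and Y' # Z' are glued lies in Y' or in Z'.
    If X is S^4, then X minus Phi(0) is R^4 by stereographic projection, and M
    minus its disc is pushed into the disc of Y.

    For (3), push f(M) off itself along its positive normal direction.  This gives
    a disjoint parallel copy f'(M), and M # -M is embedded as f(M) and f'(M)
    joined by a tube inside one slice chart.  This requires the two gluing discs
    to coincide, which is achieved by a diffeomorphism of M: connected manifolds are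
    homogeneous, and every germ at 0 of an orientation-preserving diffeomorphism
    of R^n extends to a diffeomorphism of R^n with compact support. *)

Require Import Defs.
From HB Require Import structures.
From mathcomp Require Import all_boot all_order all_algebra perm.
From mathcomp Require Import all_classical all_reals all_analysis.
From mathcomp Require Import ring lra.
Import Order.TTheory GRing.Theory Num.Theory.
Import numFieldNormedType.Exports.
Set Implicit Arguments.
Unset Strict Implicit.
Unset Printing Implicit Defensive.
Local Open Scope classical_set_scope.
Local Open Scope ring_scope.

(** * Smooth germs on R^n *)

(** A connected sum comes with fixed discs, so the proof keeps [P] and modifies only the discs and
    the two inclusions. The basic move is [csum_shrink]: a disc is replaced by its composite with a
    contraction onto a small ball. The gluing discs then fit into slice charts; the contraction has
    the same radial factor in every dimension, so it commutes with the equatorial inclusion. In (2)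
    a small disc lies on one side of a neck. In (3) only germs of discs at [0] matter, and the disc
    theorem reduces to straightening a germ.

    The sphere is treated apart in (2) because a sum of [0 + l] copies must be [Y] itself and not
    [Y # S^4]: the manifold [P] has to be placed directly in [Y].

    In (3) the push-off is a finite composition of diffeomorphisms of [X], each supported in one
    slice chart and of a size chosen after the preceding ones. It works because charts with matching
    orientations on [M] and [X] agree, close to [f(M)], on which side of [f(M)] is positive, and the
    pushes are small enough to stay in that region. *)

Section Calculus.
Context {R : realType}.
Implicit Types (m n k : nat).

(* Ckp is the version of Ck_on at a single point, sm means smooth in a
   neighbourhood of x. All the smoothness arguments below use such germs. *)
Fixpoint Ckp m (V : normedModType R) k (f : 'rV[R]_m -> V) (x : 'rV[R]_m) : Prop :=
  {for x, continuous f} /\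
  (if k is k'.+1 then forall i : 'I_m, derivable f x (delta_mx 0 i) /\
     Ckp k' (fun y => 'D_(delta_mx 0 i) f y) x else True).

Definition sm m (V : normedModType R) (f : 'rV[R]_m -> V) (x : 'rV[R]_m) : Prop :=
  \forall y \near x, forall k, Ckp k f y.

(** The inductions run on this finite order: a partial derivative takes [Ckn k.+1] to [Ckn k],
    whereas [sm] carries no number that decreases. *)
Definition Ckn m (V : normedModType R) k (f : 'rV[R]_m -> V) (x : 'rV[R]_m) : Prop :=
  \forall y \near x, Ckp k f y.

Lemma near_all (T : topologicalType) (x : T) (P : T -> Prop) :
  (forall y, P y) -> \forall y \near x, P y.
Proof. by move=> H; apply: filterE. Qed.

Lemma Ck_onP m n k U (f : 'rV[R]_m -> 'rV[R]_n) :
  Ck_on k U f <-> forall x, U x -> Ckp k f x.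
Proof.
elim: k f => [|k IH] f /=.
  split=> [[cf _] x Ux|cf]; first by split=> //; exact: cf.
  by split=> // x Ux; have [] := cf x Ux.
split=> [[cf df] x Ux|cf].
  split; first exact: cf.
  by move=> i; have [dfi /IH Ci] := df i; split; [exact: dfi|exact: Ci].
split=> [x /cf[]//|i]; split=> [x /cf[_ /(_ i)[]]//|].
by apply/IH => x /cf[_ /(_ i)[]].
Qed.

Lemma Ckp_cont m (V : normedModType R) k (f : 'rV[R]_m -> V) (x : 'rV[R]_m) : Ckp k f x -> {for x, continuous f}.
Proof. by case: k => [|k] []. Qed.

Lemma near_eqD m (V : normedModType R) (f g : 'rV[R]_m -> V) v (x : 'rV[R]_m) :
  (\forall y \near x, f y = g y) -> \forall y \near x, 'D_v f y = 'D_v g y.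
Proof. by move=> /near_join fg; near do apply: near_eq_derive.
Unshelve. all: by end_near. Qed.

Lemma near_eq_continuous (S T : topologicalType) (f g : S -> T) (x : S) :
  (\forall y \near x, f y = g y) -> {for x, continuous f} -> {for x, continuous g}.
Proof.
move=> fg; rewrite /prop_for/= /continuous_at (nbhs_singleton fg) => fx.
by apply: cvg_trans fx; apply: near_eq_cvg; near=> y; near: y; apply: filterS fg.
Unshelve. all: by end_near. Qed.

Lemma Ckp_near m (V : normedModType R) k (f g : 'rV[R]_m -> V) (x : 'rV[R]_m) :
  (\forall y \near x, f y = g y) -> Ckp k f x -> Ckp k g x.
Proof.
elim: k f g => [|k IH] f g fg /= [cf df]; (split; first exact: near_eq_continuous cf) => //.
move=> i; have [dfi Cfi] := df i; split; first exact: near_eq_derivable dfi.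
by apply: IH Cfi; exact: near_eqD.
Qed.

Lemma sm_near_eq m (V : normedModType R) (f g : 'rV[R]_m -> V) (x : 'rV[R]_m) :
  (\forall y \near x, f y = g y) -> sm f x -> sm g x.
Proof.
move=> /near_join fg sf; near=> y => k; apply: (@Ckp_near _ _ _ f); first by near: y.
by apply: (near sf y).
Unshelve. all: by end_near. Qed.

Lemma sm_near m (V : normedModType R) (f : 'rV[R]_m -> V) (x : 'rV[R]_m) : sm f x -> \forall y \near x, sm f y.
Proof. exact: near_join. Qed.

Lemma sm_cont m (V : normedModType R) (f : 'rV[R]_m -> V) (x : 'rV[R]_m) : sm f x -> {for x, continuous f}.
Proof. by move=> /nbhs_singleton/(_ 0%N)[]. Qed.

Lemma sm_derivable m (V : normedModType R) (f : 'rV[R]_m -> V) (x : 'rV[R]_m) i :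
  sm f x -> derivable f x (delta_mx 0 i).
Proof. by move=> /nbhs_singleton/(_ 1%N)[_ /(_ i)[]]. Qed.

Lemma sm_derive m (V : normedModType R) (f : 'rV[R]_m -> V) (x : 'rV[R]_m) i :
  sm f x -> sm (fun y => 'D_(delta_mx 0 i) f y) x.
Proof. by rewrite /sm => sf; near=> y => k; have [//|_ /(_ i)[]] := near sf y _ k.+1.
Unshelve. all: by end_near. Qed.

Lemma Coo_onP m n U (f : 'rV[R]_m -> 'rV[R]_n) : open U ->
  Coo_on U f <-> forall x, U x -> sm f x.
Proof.
move=> oU; split=> [Cf x Ux|Cf k].
  have : nbhs x U by exact: open_nbhs_nbhs.
  by apply: filterS => y Uy k; exact: (Ck_onP _ _ _).1.
by apply/Ck_onP => x /Cf /nbhs_singleton.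
Qed.

Lemma CkpS m (V : normedModType R) k (f : 'rV[R]_m -> V) (x : 'rV[R]_m) : Ckp k.+1 f x -> Ckp k f x.
Proof.
elim: k f => [|k IH] f /= [cf df]; split=> // i; have [dfi Ci] := df i.
by split => //; exact: IH.
Qed.

Lemma CknS m (V : normedModType R) k (f : 'rV[R]_m -> V) (x : 'rV[R]_m) : Ckn k.+1 f x -> Ckn k f x.
Proof. by apply: filterS => y; exact: CkpS. Qed.

Lemma Ckn_derive m (V : normedModType R) k (f : 'rV[R]_m -> V) (x : 'rV[R]_m) i :
  Ckn k.+1 f x -> Ckn k (fun y => 'D_(delta_mx 0 i) f y) x.
Proof. by apply: filterS => y [_ /(_ i)[]]. Qed.

Lemma Ckn_near_eq m (V : normedModType R) k (f g : 'rV[R]_m -> V) (x : 'rV[R]_m) :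
  (\forall y \near x, f y = g y) -> Ckn k f x -> Ckn k g x.
Proof.
move=> /near_join fg sf; near=> y; apply: (@Ckp_near _ _ _ f); first by near: y.
by apply: (near sf y).
Unshelve. all: by end_near. Qed.

(** Each index [i] brings its own neighbourhood; a common one exists because ['I_m] is finite. *)
Lemma CknS_intro m (V : normedModType R) k (f : 'rV[R]_m -> V) (x : 'rV[R]_m) :
  (\forall y \near x, {for y, continuous f}) ->
  (forall i, \forall y \near x, derivable f y (delta_mx 0 i)) ->
  (forall i, Ckn k (fun y => 'D_(delta_mx 0 i) f y) x) -> Ckn k.+1 f x.
Proof.
move=> cf df Df; near=> y; split; first by near: y.
move=> i; split.
  by move: i; near: y; apply: filter_forall.
by move: i; near: y; apply: filter_forall.
Unshelve. all: by end_near. Qed.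

Lemma Ckn_cst m (V : normedModType R) k (c : V) (x : 'rV[R]_m) : Ckn k (fun=> c) x.
Proof.
elim: k c x => [|k IH] c x; first by apply: near_all => y; split=> //; exact: cst_continuous.
apply: CknS_intro.
- by apply: near_all => y; exact: cst_continuous.
- by move=> i; apply: near_all => y; exact: derivable_cst.
- move=> i; apply: Ckn_near_eq (IH 0 x).
  by apply: near_all => y; rewrite (derive_cst c).
Qed.

Lemma Ckn_add m (V : normedModType R) k (f g : 'rV[R]_m -> V) (x : 'rV[R]_m) :
  Ckn k f x -> Ckn k g x -> Ckn k (fun y => f y + g y) x.
Proof.
elim: k f g x => [|k IH] f g x Cf Cg.
  near=> y; split=> //; apply: (@continuousD _ _ _ f g); apply: (@Ckp_cont _ _ 0).
    by near: y.
  by near: y.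
have Cfd (i : 'I_m) : \forall y \near x, derivable f y (delta_mx 0 i).
  by apply: filterS Cf => y [_ /(_ i)[]].
have Cgd (i : 'I_m) : \forall y \near x, derivable g y (delta_mx 0 i).
  by apply: filterS Cg => y [_ /(_ i)[]].
apply: CknS_intro.
- near=> y; apply: (@continuousD _ _ _ f g); apply: (@Ckp_cont _ _ k.+1).
    by near: y.
  by near: y.
- by move=> i; near=> y; apply: derivableD; near: y; [exact: Cfd|exact: Cgd].
- move=> i; apply: Ckn_near_eq (IH _ _ _ (Ckn_derive i Cf) (Ckn_derive i Cg)).
  by near=> y; rewrite deriveD//; near: y; [exact: Cfd|exact: Cgd].
Unshelve. all: by end_near. Qed.

Lemma Ckn_mul m k (f g : 'rV[R]_m -> R) (x : 'rV[R]_m) :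
  Ckn k f x -> Ckn k g x -> Ckn k (fun y => f y * g y) x.
Proof.
elim: k f g x => [|k IH] f g x Cf Cg.
  near=> y; split=> //; apply: (@continuousM _ _ f g); apply: (@Ckp_cont _ _ 0).
    by near: y.
  by near: y.
have Cfd (i : 'I_m) : \forall y \near x, derivable f y (delta_mx 0 i).
  by apply: filterS Cf => y [_ /(_ i)[]].
have Cgd (i : 'I_m) : \forall y \near x, derivable g y (delta_mx 0 i).
  by apply: filterS Cg => y [_ /(_ i)[]].
apply: CknS_intro.
- near=> y; apply: (@continuousM _ _ f g); apply: (@Ckp_cont _ _ k.+1).
    by near: y.
  by near: y.
- by move=> i; apply: filterS2 (Cfd i) (Cgd i) => y; exact: derivableM.
- move=> i; apply: Ckn_near_eq (Ckn_add (IH _ _ _ (CknS Cf) (Ckn_derive i Cg)) (IH _ _ _ (CknS Cg) (Ckn_derive i Cf))).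
  by apply: filterS2 (Cfd i) (Cgd i) => y dfy dgy; rewrite deriveM.
Unshelve. all: by end_near. Qed.

Lemma sm_Ckn m (V : normedModType R) (f : 'rV[R]_m -> V) x k : sm f x -> Ckn k f x.
Proof. by apply: filterS. Qed.

(** The order of quantifiers is the point: [sm] wants one neighbourhood for all orders, while each
    [Ckn k] brings its own. Since the hypothesis holds at all nearby [y], each [Ckn k f y] is used
    only at its centre [y], and the neighbourhood becomes uniform. *)
Lemma sm_intro m (V : normedModType R) (f : 'rV[R]_m -> V) (x : 'rV[R]_m) :
  (\forall y \near x, forall k, Ckn k f y) -> sm f x.
Proof. by apply: filterS => y Cf k; exact: nbhs_singleton (Cf k). Qed.

Lemma sm_cst m (V : normedModType R) (c : V) (x : 'rV[R]_m) : sm (fun=> c) x.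
Proof. by apply: sm_intro; apply: near_all => y k; exact: Ckn_cst. Qed.

Lemma sm_add m (V : normedModType R) (f g : 'rV[R]_m -> V) (x : 'rV[R]_m) :
  sm f x -> sm g x -> sm (fun y => f y + g y) x.
Proof.
move=> /sm_near sf /sm_near sg; apply: sm_intro; near=> y => k.
by apply: Ckn_add; apply: sm_Ckn; near: y.
Unshelve. all: by end_near. Qed.

Lemma sm_mul m (f g : 'rV[R]_m -> R) (x : 'rV[R]_m) :
  sm f x -> sm g x -> sm (fun y => f y * g y) x.
Proof.
move=> /sm_near sf /sm_near sg; apply: sm_intro; near=> y => k.
by apply: Ckn_mul; apply: sm_Ckn; near: y.
Unshelve. all: by end_near. Qed.

Lemma sm_sum m (V : normedModType R) (I : Type) (r : seq I) (P : pred I)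
    (f : I -> 'rV[R]_m -> V) (x : 'rV[R]_m) :
  (forall i, P i -> sm (f i) x) -> sm (fun y => \sum_(i <- r | P i) f i y) x.
Proof.
move=> sf; elim: r => [|i r IH].
  by rewrite (_ : (fun _ => _) = fun=> 0) ?funeqE; [exact: sm_cst|move=> y; rewrite big_nil].
have [Pi|Pi] := boolP (P i).
  rewrite (_ : (fun _ => _) = fun y => f i y + \sum_(j <- r | P j) f j y).
    by apply: sm_add => //; exact: sf.
  by rewrite funeqE => y; rewrite big_cons Pi.
rewrite (_ : (fun _ => _) = fun y => \sum_(j <- r | P j) f j y) //.
by rewrite funeqE => y; rewrite big_cons (negbTE Pi).
Qed.

Lemma is_derive_coord m (j : 'I_m) (x v : 'rV[R]_m) :
  is_derive x v (fun y : 'rV[R]_m => y 0 j : R) (v 0 j).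
Proof.
have dj := @differentiable_coord R 1 m x 0 j.
apply: DeriveDef; first exact: diff_derivable.
have := @derive_mx R _ 1 m (@id 'rV[R]_m) x v (@derivable_id _ _ _ _).
by rewrite derive_id => /matrixP/(_ 0 j); rewrite mxE.
Qed.

Lemma sm_coord m (j : 'I_m) (x : 'rV[R]_m) : sm (fun y : 'rV[R]_m => y 0 j : R) x.
Proof.
apply: sm_intro; apply: near_all => y [|k].
  by apply: near_all => z; split=> //; exact: coord_continuous.
apply: CknS_intro.
- by apply: near_all => z; exact: coord_continuous.
- by move=> i; apply: near_all => z; apply: (@ex_derive _ _ _ _ _ _ _ (is_derive_coord j z _)).
- move=> i; apply: Ckn_near_eq (Ckn_cst k (delta_mx 0 i 0 j : R) y).
  by apply: near_all => z; rewrite (@derive_val _ _ _ _ _ _ _ (is_derive_coord j z _)).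
Qed.

Lemma is_derive_line m (V : normedModType R) (f : 'rV[R]_m -> V) p v (s : R) :
  derivable f (p + s *: v) v ->
  is_derive s (1:R) (fun t : R => f (p + t *: v)) ('D_v f (p + s *: v)).
Proof.
have E : (fun h : R => h^-1 *: (((fun t : R => f (p + t *: v)) \o shift s) (h *: 1) - f (p + s *: v)))
    = (fun h : R => h^-1 *: ((f \o shift (p + s *: v)) (h *: v) - f (p + s *: v))).
  rewrite funeqE => h /=; congr (_ *: (f _ - _)).
  by rewrite [h *: 1]mulr1 scalerDl addrCA.
move=> df; apply: DeriveDef; first by rewrite /derivable E.
by rewrite /derive E.
Qed.

(** Bounding the parameter by [|a|] covers both signs of [a]; the mean value theorem is applied on
    the interval between [0] and [a], oriented accordingly. *)
Lemma line_increment m (f : 'rV[R]_m -> R) p v (a : R) :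
  (forall s, `|s| <= `|a| -> {for p + s *: v, continuous f} /\ derivable f (p + s *: v) v) ->
  exists2 s, `|s| <= `|a| & f (p + a *: v) - f p = a * 'D_v f (p + s *: v).
Proof.
move=> H; have cl s : `|s| <= `|a| -> {for s, continuous (fun t : R => f (p + t *: v))}.
  move=> sa; apply: (@continuous_comp R 'rV[R]_m R (fun t : R => p + t *: v) f).
    by apply: cvgD; [exact: cvg_cst|exact: scalel_continuous].
  by have [] := H s sa.
have dl s : `|s| <= `|a| -> is_derive s (1:R) (fun t : R => f (p + t *: v)) ('D_v f (p + s *: v)).
  by move=> sa; apply: is_derive_line; have [] := H s sa.
have cw (l u : R) : (forall s, s \in `[l, u] -> `|s| <= `|a|) ->
    {within `[l, u], continuous (fun t : R => f (p + t *: v))}.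
  by move=> lu; apply: continuous_in_subspaceT => s /set_mem /lu; exact: cl.
have [a0|a0] := leP 0 a.
  have lu s : s \in `[0, a] -> `|s| <= `|a|.
    by rewrite in_itv/= => /andP[s0 sa]; rewrite !ger0_norm.
  have [] := @MVT_segment R (fun t : R => f (p + t *: v)) (fun s => 'D_v f (p + s *: v)) 0 a a0.
  - move=> s /subset_itv_oo_cc; by move=> /lu; exact: dl.
  - exact: cw.
  - move=> s /lu sa; rewrite scale0r addr0 subr0 => ->; exists s => //; exact: mulrC.
have lu s : s \in `[a, 0] -> `|s| <= `|a|.
  by rewrite in_itv/= => /andP[s0 sa]; rewrite !ler0_norm ?lerN2// ltW.
have [] := @MVT_segment R (fun t : R => f (p + t *: v)) (fun s => 'D_v f (p + s *: v)) a 0 (ltW a0).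
- move=> s /subset_itv_oo_cc; by move=> /lu; exact: dl.
- exact: cw.
- move=> s /lu sa; rewrite scale0r addr0 sub0r => E; exists s => //.
  by apply: oppr_inj; rewrite opprB E mulrN mulrC.
Qed.

Lemma differentiable_intro (V W : normedModType R) (f : V -> W) (df : {linear V -> W}) x :
  continuous df -> f \o shift x = cst (f x) + df +o_ 0 id -> differentiable f x.
Proof.
move=> dfc dxf; apply/diff_locallyP; have dE := diff_unique dfc dxf.
by rewrite dE.
Qed.

Lemma coord_row_le m (h : 'rV[R]_m) (j : 'I_m) : `|h 0 j| <= `|h|.
Proof.
rewrite [leRHS]/Num.Def.normr/= mx_normrE.
exact: (le_bigmax _ (fun i : 'I_1 * 'I_m => `|h i.1 i.2|) (0, j)).
Qed.

Lemma norm_row_le m (h : 'rV[R]_m) (e : R) : 0 <= e ->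
  (forall j, `|h 0 j| <= e) -> `|h| <= e.
Proof.
move=> e0 H; rewrite [leLHS]/Num.Def.normr/= mx_normrE bigmax_le// => -[i j] _ /=.
by rewrite ord1.
Qed.

(** The points [x + trunc_row h k] are the corners of a path from [x] to [x + h] that changes one
    coordinate at a time. For the sup norm it stays within [|h|] of [x]. *)
Definition trunc_row m (h : 'rV[R]_m) (k : nat) : 'rV[R]_m :=
  \row_j (if (j < k)%N then h 0 j else 0).

Lemma trunc_rowS m (h : 'rV[R]_m) (k : 'I_m) :
  trunc_row h k.+1 = trunc_row h k + h 0 k *: delta_mx 0 k.
Proof.
apply/rowP => j; rewrite !mxE eqxx/= ltnS leq_eqVlt.
have [->|jk] := eqVneq j k; first by rewrite eqxx ltnn mulr1 add0r.
by rewrite (negbTE (jk : nat_of_ord j != k)) /= mulr0 addr0.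
Qed.

Lemma norm_trunc_row m (h : 'rV[R]_m) k (s : R) (j : 'I_m) : `|s| <= `|h| ->
  j = k :> nat -> `|trunc_row h k + s *: delta_mx 0 j| <= `|h|.
Proof.
move=> sh jk; apply: norm_row_le => // i; rewrite !mxE eqxx/=.
have [->|ij] := eqVneq i j; first by rewrite jk ltnn add0r mulr1.
by rewrite mulr0 addr0; case: ifP => _; rewrite ?normr0// coord_row_le.
Qed.

(* The mean value theorem is applied along the coordinates one after the other. *)
Lemma small_partials m (f : 'rV[R]_m -> R) (x h : 'rV[R]_m) (e : R) :
  (forall y, `|y - x| <= `|h| -> {for y, continuous f} /\
     forall i, derivable f y (delta_mx 0 i) /\ `|'D_(delta_mx 0 i) f y| <= e) ->
  `|f (x + h) - f x| <= m%:R * e * `|h|.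
Proof.
move=> H.
have H0 : forall k, (k <= m)%N -> `|f (x + trunc_row h k) - f x| <= k%:R * e * `|h|.
  elim=> [_|k IH km].
    rewrite (_ : trunc_row h 0 = 0) ?addr0 ?subrr ?normr0 ?mul0r//.
    by apply/rowP => j; rewrite !mxE.
  pose i := Ordinal km.
  have := @line_increment m f (x + trunc_row h k) (delta_mx 0 i) (h 0 i).
  case=> [s si|s si E].
    have [|cf df] := H (x + trunc_row h k + s *: delta_mx 0 i).
      rewrite addrC !addrA addNr add0r; apply: norm_trunc_row => //.
      exact: le_trans si (coord_row_le _ _).
    by split=> //; have [] := df i.
  rewrite (trunc_rowS h i) addrA -(subrKA (f (x + trunc_row h k))) (_ : k.+1%:R = k%:R + 1 :> R); last by rewrite natr1.
  rewrite mulrDl mulrDl.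
  rewrite [leRHS]addrC (le_trans (ler_normD _ _))// lerD ?IH ?(ltnW km)//.
  rewrite E normrM mul1r mulrC ler_pM ?coord_row_le//.
  have [|_ /(_ i)[]//] := H (x + trunc_row h k + s *: delta_mx 0 i).
  rewrite addrC !addrA addNr add0r; apply: norm_trunc_row => //.
  exact: le_trans si (coord_row_le _ _).
have := H0 m (leqnn m); rewrite (_ : trunc_row h m = h)//.
by apply/rowP => j; rewrite !mxE ltn_ord.
Qed.

Lemma Ckn1_differentiable0 m (f : 'rV[R]_m -> R) (x : 'rV[R]_m) : Ckn 1 f x ->
  (forall i, 'D_(delta_mx 0 i) f x = 0) -> differentiable f x.
Proof.
move=> C1 D0.
apply: (@differentiable_intro _ _ f \0 x); first exact: cst_continuous.
apply/eqaddoP => _/posnumP[e].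
have m1 : 0 < m%:R + 1 :> R by rewrite ltr_wpDl.
(* The factor [m%:R] produced by [small_partials] is compensated in advance; the [+ 1] covers
   [m = 0]. *)
pose d := e%:num / (m%:R + 1).
have d0 : 0 < d by rewrite divr_gt0.
have H : \forall y \near x, {for y, continuous f} /\
    forall i : 'I_m, derivable f y (delta_mx 0 i) /\ `|'D_(delta_mx 0 i) f y| <= d.
  have Dd (i : 'I_m) : \forall y \near x, derivable f y (delta_mx 0 i) /\ `|'D_(delta_mx 0 i) f y| <= d.
    have /nbhs_singleton[cD _] := Ckn_derive i C1.
    have : \forall y \near x, `|'D_(delta_mx 0 i) f y| <= d.
      move/cvgrPdist_le : cD => /(_ _ d0); apply: filterS => y /=.
      by rewrite D0 sub0r normrN.
    by apply: filterS2 C1 => y [_ /(_ i)[]].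
  near=> y; split.
    by apply: (@Ckp_cont _ _ 1); near: y.
  by move=> i; move: i; near: y; apply: filter_forall.
move/nbhs_ballP : H => [r /= r0 xr].
apply: filterS (@nbhs0_lt _ 'rV[R]_m _ r0) => h hr.
rewrite (_ : (_ - _) h = f (x + h) - f x); last by rewrite !fctE/= addr0 [h + x]addrC.
apply: le_trans (@small_partials m f x h d _) _.
  move=> y yh; apply: xr; rewrite -ball_normE/= distrC.
  exact: le_lt_trans yh hr.
rewrite ler_wpM2r// mulrA ler_pdivrMr// mulrC ler_wpM2l// ler_wpDr//.
Unshelve. all: by end_near. Qed.

(** Adding the linear form [L] with the opposite partial derivatives at [x] reduces to the case of
    vanishing partials. *)
Lemma Ckn_differentiable m (f : 'rV[R]_m -> R) (x : 'rV[R]_m) : Ckn 1 f x -> differentiable f x.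
Proof.
move=> C1.
pose L (y : 'rV[R]_m) := \sum_i - 'D_(delta_mx 0 i) f x * y 0 i.
have sL y : sm L y.
  by apply: sm_sum => i _; apply: sm_mul; [exact: sm_cst|exact: sm_coord].
have dL y : differentiable L y.
  rewrite /L (_ : (fun y : 'rV[R]_m => _) = \sum_i (fun y : 'rV[R]_m => - 'D_(delta_mx 0 i) f x * y 0 i)).
    apply: differentiable_sum => i.
    by apply: differentiableZ; exact: differentiable_coord.
  by rewrite funeqE => z; rewrite fct_sumE.
have DL i : 'D_(delta_mx 0 i) L x = - 'D_(delta_mx 0 i) f x.
  rewrite /L (_ : (fun y : 'rV[R]_m => _) = \sum_i (fun y : 'rV[R]_m => - 'D_(delta_mx 0 i) f x * y 0 i)); last first.
    by rewrite funeqE => z; rewrite fct_sumE.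
  rewrite derive_sum => [|j]; last first.
    by apply: derivableZ; apply: (@ex_derive _ _ _ _ _ _ _ (is_derive_coord j x _)).
  rewrite (bigD1 i)//= big1 ?addr0 => [|j ji].
    rewrite deriveZ; last by apply: (@ex_derive _ _ _ _ _ _ _ (is_derive_coord i x _)).
    rewrite (@derive_val _ _ _ _ _ _ _ (is_derive_coord i x _)) mxE !eqxx/= .
    exact: mulr1.
  rewrite deriveZ; last by apply: (@ex_derive _ _ _ _ _ _ _ (is_derive_coord j x _)).
  rewrite (@derive_val _ _ _ _ _ _ _ (is_derive_coord j x _)) mxE eqxx/= (negbTE ji).
  exact: scaler0.
have dg : differentiable (fun y => f y + L y) x.
  apply: Ckn1_differentiable0; first exact: (@Ckn_add _ _ 1 f L x C1 (sm_Ckn 1 (sL x))).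
  move=> i; rewrite deriveD ?DL ?subrr//.
    by have /nbhs_singleton[_ /(_ i)[]] := C1.
  exact: sm_derivable.
rewrite (_ : f = (fun y => f y + L y) - L); last first.
  by rewrite funeqE => y; rewrite !fctE addrK.
exact: differentiableB.
Unshelve. all: by end_near. Qed.

End Calculus.

(** * Components, chain rule and Jacobians *)

Section Composition.
Context {R : realType}.
Implicit Types (m n k : nat).

Lemma near_forall (I : finType) (T : topologicalType) (x : T) (P : I -> T -> Prop) :
  (forall i, \forall y \near x, P i y) -> \forall y \near x, forall i, P i y.
Proof. by move=> H; apply: (@filter_forall T I P (nbhs x)). Qed.

Lemma near_comp (S T : topologicalType) (f : S -> T) (x : S) (P : T -> Prop) :
  {for x, continuous f} -> (\forall z \near f x, P z) -> \forall y \near x, P (f y).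
Proof. by move=> cf HP; exact: cf. Qed.

Lemma continuous_rowP (T : topologicalType) n (f : T -> 'rV[R]_n) (x : T) :
  {for x, continuous f} <-> forall j, {for x, continuous (fun y => f y 0 j : R)}.
Proof.
split=> [cf j|cf].
  exact: (@continuous_comp T 'rV[R]_n R f (fun y => y 0 j) x cf (@coord_continuous _ _ _ 0 j (f x))).
apply/(@cvgrPdist_le R 'rV[R]_n) => e e0.
have H (j : 'I_n) : \forall y \near x, `|f x 0 j - f y 0 j| <= e.
  by move: (cf j) => /(@cvgrPdist_le R R) /(_ e e0).
have : \forall y \near x, forall j, `|f x 0 j - f y 0 j| <= e by exact: near_forall.
by apply: filterS => y Hy; apply: norm_row_le (ltW e0) _ => j; rewrite !mxE; exact: Hy.
Qed.

Lemma derivable_rowP (V : normedModType R) n (f : V -> 'rV[R]_n) (x v : V) :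
  derivable f x v <-> forall j, derivable (fun y => f y 0 j : R) x v.
Proof.
split=> [/derivable_mxP df j|df]; first exact: df.
by apply/derivable_mxP => i j; rewrite ord1; exact: df.
Qed.

Lemma derive_row (V : normedModType R) n (f : V -> 'rV[R]_n) (x v : V) j :
  derivable f x v -> 'D_v (fun y => f y 0 j : R) x = ('D_v f x) 0 j.
Proof. by move=> df; rewrite derive_mx// mxE. Qed.

Lemma Ckn_rowP m n k (f : 'rV[R]_m -> 'rV[R]_n) (x : 'rV[R]_m) :
  Ckn k f x <-> forall j, Ckn k (fun y => f y 0 j : R) x.
Proof.
elim: k f => [|k IH] f; split.
- move=> Cf j; apply: filterS Cf => y [cf _]; split=> //.
  by move/continuous_rowP : cf; exact.
- move=> Cf; have : \forall y \near x, forall j, Ckp 0 (fun y => f y 0 j : R) y.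
    exact: near_forall.
  by apply: filterS => y Cy; split=> //; apply/continuous_rowP => j; have [] := Cy j.
- move=> Cf j; apply: CknS_intro.
  + by apply: filterS Cf => y [cf _]; move/continuous_rowP : cf; exact.
  + by move=> i; apply: filterS Cf => y [_ /(_ i)[/derivable_rowP df _]]; exact: df.
  + move=> i; have /IH/(_ j) := Ckn_derive i Cf; apply: Ckn_near_eq.
    by apply: filterS Cf => y [_ /(_ i)[df _]]; rewrite derive_row.
- move=> Cf.
  have H : \forall y \near x, forall j, Ckp k.+1 (fun y => f y 0 j : R) y.
    exact: near_forall.
  have dfi i : \forall y \near x, derivable f y (delta_mx 0 i).
    by apply: filterS H => y Cy; apply/derivable_rowP => j; have [_ /(_ i)[]] := Cy j.
  apply: CknS_intro => //.
  + by apply: filterS H => y Cy; apply/continuous_rowP => j; have [] := Cy j.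
  + move=> i; apply/IH => j; apply: Ckn_near_eq (Ckn_derive i (Cf j)).
    by apply: filterS (dfi i) => y df; rewrite derive_row.
Qed.

Lemma sm_rowP m n (f : 'rV[R]_m -> 'rV[R]_n) (x : 'rV[R]_m) :
  sm f x <-> forall j, sm (fun y => f y 0 j : R) x.
Proof.
split=> [/sm_near sf j|sf].
  apply: sm_intro; apply: filterS sf => y sf k.
  by have /Ckn_rowP := sm_Ckn k sf; exact.
have : \forall y \near x, forall j, sm (fun y => f y 0 j : R) y.
  by apply: near_forall => j; exact: sm_near.
move=> H; apply: sm_intro; apply: filterS H => y sfy k.
by apply/Ckn_rowP => j; exact: sm_Ckn.
Qed.

Lemma differentiable_row (V : normedModType R) n (f : V -> 'rV[R]_n) (x : V) :
  (forall j, differentiable (fun y => f y 0 j : R) x) -> differentiable f x.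
Proof.
move=> df; rewrite (_ : f = \sum_j (fun y => f y 0 j *: delta_mx 0 j)).
  by apply: differentiable_sum => j; apply: differentiableZl; exact: df.
by rewrite funeqE => y; rewrite fct_sumE -row_sum_delta.
Qed.

Lemma sm_differentiableR m (f : 'rV[R]_m -> R) (x : 'rV[R]_m) : sm f x -> differentiable f x.
Proof. by move=> sf; apply: Ckn_differentiable; exact: sm_Ckn. Qed.

Lemma sm_differentiable m n (f : 'rV[R]_m -> 'rV[R]_n) (x : 'rV[R]_m) :
  sm f x -> differentiable f x.
Proof.
by move=> /sm_rowP sf; apply: differentiable_row => j; exact: sm_differentiableR (sf j).
Qed.

Lemma derive_comp_row m n (f : 'rV[R]_m -> 'rV[R]_n) (g : 'rV[R]_n -> R) (x v : 'rV[R]_m) :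
  differentiable f x -> differentiable g (f x) ->
  'D_v (fun y => g (f y)) x = \sum_j 'D_v (fun y => f y 0 j : R) x * 'D_(delta_mx 0 j) g (f x).
Proof.
move=> df dg; have dgf : differentiable (g \o f) x by exact: differentiable_comp.
rewrite [LHS](deriveE _ dgf) (diff_comp df dg) /=.
rewrite {1}(row_sum_delta ('d f x v)) linear_sum; apply: eq_bigr => j _.
by rewrite derive_row ?(deriveE _ df)// ?(deriveE _ dg) ?linearZ//; exact: diff_derivable.
Qed.

(** By the chain rule a derivative is a sum of products of a derivative of [f] with ['D g] composed
    with [f], so the induction needs [g] in a class stable under derivation. The inner map has
    finite order only; this is what lets [inverse_sm] gain one order at a time. *)
Lemma Ckn_comp m n k (f : 'rV[R]_m -> 'rV[R]_n) (g : 'rV[R]_n -> R) (x : 'rV[R]_m) :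
  Ckn k f x -> sm g (f x) -> Ckn k (fun y => g (f y)) x.
Proof.
elim: k g x => [|k IH] g x Cf sg.
  have cf := Ckp_cont (nbhs_singleton Cf).
  apply: filterS2 Cf (near_comp cf (sm_near sg)) => y Cfy sgy; split=> //.
  by apply: continuous_comp; [exact: Ckp_cont Cfy|exact: sm_cont sgy].
have cf := Ckp_cont (nbhs_singleton Cf).
have H : \forall y \near x, Ckn k.+1 f y /\ sm g (f y).
  by apply: filterS2 (near_join Cf) (near_comp cf (sm_near sg)).
have df y : Ckn k.+1 f y -> differentiable f y.
  move=> /Ckn_rowP Cfy; apply: differentiable_row => j; apply: Ckn_differentiable.
  by elim: (k) (Cfy j) => // k' IHk /CknS.
apply: CknS_intro.
- apply: filterS H => y [Cfy sgy].
  by apply: continuous_comp; [exact: Ckp_cont (nbhs_singleton Cfy)|exact: sm_cont sgy].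
- move=> i; apply: filterS H => y [Cfy sgy].
  apply: diff_derivable; apply: differentiable_comp; first exact: df.
  exact: sm_differentiableR.
- move=> i.
  apply: (@Ckn_near_eq _ _ _ _ (fun y => \sum_j 'D_(delta_mx 0 i) (fun y => f y 0 j : R) y * 'D_(delta_mx 0 j) g (f y))).
    apply: filterS H => y [Cfy sgy]; rewrite derive_comp_row//; first exact: df.
    exact: sm_differentiableR.
  have Cs (j : 'I_n) : Ckn k (fun y => 'D_(delta_mx 0 i) (fun y => f y 0 j : R) y * 'D_(delta_mx 0 j) g (f y)) x.
    apply: Ckn_mul.
      by apply: Ckn_derive; move/Ckn_rowP : Cf; exact.
    by apply: (IH (fun z => 'D_(delta_mx 0 j) g z)); [exact: CknS|exact: sm_derive].
  elim: (index_enum _) => [|j r IHr].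
    by apply: Ckn_near_eq (Ckn_cst k 0 x); apply: near_all => y; rewrite big_nil.
  apply: Ckn_near_eq (Ckn_add (Cs j) IHr).
  by apply: near_all => y; rewrite big_cons.
Qed.

Lemma sm_compR m n (f : 'rV[R]_m -> 'rV[R]_n) (g : 'rV[R]_n -> R) (x : 'rV[R]_m) :
  sm f x -> sm g (f x) -> sm (fun y => g (f y)) x.
Proof.
move=> sf sg; have sgf := near_comp (sm_cont sf) (sm_near sg).
by apply: sm_intro; apply: filterS2 (sm_near sf) sgf => y sfy sgy k; apply: Ckn_comp => //; exact: sm_Ckn.
Qed.

Lemma sm_comp m n p (f : 'rV[R]_m -> 'rV[R]_n) (g : 'rV[R]_n -> 'rV[R]_p) (x : 'rV[R]_m) :
  sm f x -> sm g (f x) -> sm (fun y => g (f y)) x.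
Proof.
move=> sf /sm_rowP sg; apply/sm_rowP => j.
exact: (sm_compR (g := fun z => g z 0 j : R) sf (sg j)).
Qed.

Lemma sm_id m (x : 'rV[R]_m) : sm (fun y => y) x.
Proof. by apply/sm_rowP => j; exact: sm_coord. Qed.

Lemma sm_opp m (f : 'rV[R]_m -> R) (x : 'rV[R]_m) : sm f x -> sm (fun y => - f y) x.
Proof.
move=> sf; apply: sm_near_eq (sm_mul (sm_cst (-1 : R) x) sf).
by apply: near_all => y; rewrite mulN1r.
Qed.

Lemma sm_sub m (f g : 'rV[R]_m -> R) (x : 'rV[R]_m) : sm f x -> sm g x -> sm (fun y => f y - g y) x.
Proof. by move=> sf sg; apply: (sm_add sf); exact: sm_opp. Qed.

Lemma sm_addv m n (f g : 'rV[R]_m -> 'rV[R]_n) (x : 'rV[R]_m) :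
  sm f x -> sm g x -> sm (fun y => f y + g y) x.
Proof. exact: sm_add. Qed.

Lemma sm_scale m n (c : 'rV[R]_m -> R) (f : 'rV[R]_m -> 'rV[R]_n) (x : 'rV[R]_m) :
  sm c x -> sm f x -> sm (fun y => c y *: f y) x.
Proof.
move=> sc /sm_rowP sf; apply/sm_rowP => j; apply: sm_near_eq (sm_mul sc (sf j)).
by apply: near_all => y; rewrite mxE.
Qed.

Lemma sm_oppv m n (f : 'rV[R]_m -> 'rV[R]_n) (x : 'rV[R]_m) : sm f x -> sm (fun y => - f y) x.
Proof.
move=> sf; apply: sm_near_eq (sm_scale (sm_cst (-1 : R) x) sf).
by apply: near_all => y; rewrite scaleN1r.
Qed.

Lemma sm_subv m n (f g : 'rV[R]_m -> 'rV[R]_n) (x : 'rV[R]_m) :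
  sm f x -> sm g x -> sm (fun y => f y - g y) x.
Proof. by move=> sf sg; apply: sm_addv => //; exact: sm_oppv. Qed.

Lemma sm_mulmx m n p (f : 'rV[R]_m -> 'rV[R]_n) (A : 'M[R]_(n, p)) (x : 'rV[R]_m) :
  sm f x -> sm (fun y => f y *m A) x.
Proof.
move=> /sm_rowP sf; apply/sm_rowP => j.
apply: (@sm_near_eq _ _ _ (fun y => \sum_i f y 0 i * A i j)).
  by apply: near_all => y; rewrite mxE.
by apply: sm_sum => i _; apply: sm_mul; [exact: sf|exact: sm_cst].
Qed.

Lemma sm_row_mx m n p (f : 'rV[R]_m -> 'rV[R]_n) (g : 'rV[R]_m -> 'rV[R]_p) (x : 'rV[R]_m) :
  sm f x -> sm g x -> sm (fun y => row_mx (f y) (g y)) x.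
Proof.
move=> /sm_rowP sf /sm_rowP sg; apply/sm_rowP => j.
case: (splitP j) => i ji.
  apply: sm_near_eq (sf i); apply: near_all => y.
  by rewrite (_ : j = lshift _ i) ?row_mxEl//; exact: val_inj.
apply: sm_near_eq (sg i); apply: near_all => y.
by rewrite (_ : j = rshift _ i) ?row_mxEr//; exact: val_inj.
Qed.

Lemma sm_rsubmx m n p (f : 'rV[R]_m -> 'rV[R]_(n + p)) (x : 'rV[R]_m) :
  sm f x -> sm (fun y => rsubmx (f y)) x.
Proof.
move=> /sm_rowP sf; apply/sm_rowP => j; apply: sm_near_eq (sf (rshift n j)).
by apply: near_all => y; rewrite mxE.
Qed.

Lemma mulmx_jacobian m n (f : 'rV[R]_m -> 'rV[R]_n) (x v : 'rV[R]_m) :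
  sm f x -> v *m 'J f x = 'D_v f x.
Proof. by move=> /sm_differentiable df; rewrite deriveEjacobian. Qed.

Lemma row_jacobian m n (f : 'rV[R]_m -> 'rV[R]_n) (x : 'rV[R]_m) i :
  sm f x -> row i ('J f x) = 'D_(delta_mx 0 i) f x.
Proof. by move=> sf; rewrite rowE mulmx_jacobian. Qed.

Opaque jacobian.

(** Jacobians act on rows from the right, so the factors appear in the order in which the maps are
    applied. *)
Lemma jacobian_comp m n p (f : 'rV[R]_m -> 'rV[R]_n) (g : 'rV[R]_n -> 'rV[R]_p) (x : 'rV[R]_m) :
  sm f x -> sm g (f x) -> 'J (fun y => g (f y)) x = 'J f x *m 'J g (f x).
Proof.
move=> sf sg; have df := sm_differentiable sf; have dg := sm_differentiable sg.
have dgf : differentiable (g \o f) x by exact: differentiable_comp.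
apply/row_matrixP => i; rewrite row_jacobian; last exact: sm_comp.
rewrite (deriveE _ dgf) (diff_comp df dg) /= rowE mulmxA (mulmx_jacobian _ sf).
by rewrite (mulmx_jacobian _ sg) (deriveE _ dg) (deriveE _ df).
Qed.

Lemma jacobian_near_eq m n (f g : 'rV[R]_m -> 'rV[R]_n) (x : 'rV[R]_m) :
  sm f x -> (\forall y \near x, f y = g y) -> 'J f x = 'J g x.
Proof.
move=> sf fg; have sg := sm_near_eq fg sf.
apply/row_matrixP => i; apply: (etrans (row_jacobian i sf)); apply: etrans (esym (row_jacobian i sg)).
exact: near_eq_derive.
Qed.

Lemma jacobian_id m (x : 'rV[R]_m) : 'J (fun y : 'rV[R]_m => y) x = 1%:M.
Proof.
apply/row_matrixP => i; rewrite !rowE -deriveEjacobian ?mulmx1; last exact: sm_differentiable (sm_id x).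
exact: derive_id.
Qed.

Lemma jacobian_mulmx m n (A : 'M[R]_(m, n)) (x : 'rV[R]_m) : 'J (fun y : 'rV[R]_m => y *m A) x = A.
Proof.
have sA : sm (fun y : 'rV[R]_m => y *m A) x by apply: sm_mulmx; exact: sm_id.
apply/row_matrixP => i; rewrite !rowE -deriveEjacobian; last exact: sm_differentiable.
rewrite /derive (_ : (fun h : R => _) = (fun h : R => h^-1 *: (h *: (delta_mx 0 i *m A)))); last first.
  by rewrite funeqE => h /=; rewrite mulmxDl addrK scalemxAl.
apply: cvg_lim => //; apply: cvg_near_cst.
have : \forall h \near (0 : R)^', h != 0 by exact: nbhs_dnbhs_neq.
by apply: filterS => h h0; rewrite scalerA mulVf// scale1r.
Qed.

Lemma jacobian_add m n (f g : 'rV[R]_m -> 'rV[R]_n) (x : 'rV[R]_m) :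
  sm f x -> sm g x -> 'J (fun y => f y + g y) x = 'J f x + 'J g x.
Proof.
move=> sf sg; have sfg := sm_addv sf sg.
apply/row_matrixP => i; apply: (etrans (row_jacobian i sfg)).
rewrite deriveD; [|exact: sm_derivable sf|exact: sm_derivable sg].
rewrite -(row_jacobian i sf) -(row_jacobian i sg).
by rewrite [RHS]linearD.
Qed.

Lemma jacobian_cst m n (c : 'rV[R]_n) (x : 'rV[R]_m) : 'J (fun=> c) x = 0.
Proof.
by apply/row_matrixP => i; rewrite (row_jacobian i (sm_cst c x)) row0 (derive_cst c).
Qed.

Lemma jacobianE m n (f : 'rV[R]_m -> 'rV[R]_n) (x : 'rV[R]_m) i j :
  sm f x -> 'J f x i j = 'D_(delta_mx 0 i) (fun y => f y 0 j : R) x.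
Proof.
move=> sf; rewrite derive_row; last exact: sm_derivable.
by have /rowP/(_ j) := row_jacobian i sf; rewrite [LHS]mxE.
Qed.

Lemma sm_jacobian m n (f : 'rV[R]_m -> 'rV[R]_n) (x : 'rV[R]_m) i j :
  sm f x -> sm (fun y => 'J f y i j : R) x.
Proof.
move=> sf; apply: (@sm_near_eq _ _ _ (fun y => 'D_(delta_mx 0 i) (fun y => f y 0 j : R) y)).
  by apply: filterS (sm_near sf) => y sfy; rewrite jacobianE.
by apply: sm_derive; move/sm_rowP : sf; exact.
Qed.

End Composition.

(** * Inverses of functions, matrices and maps *)

Section Inverse.
Context {R : realType}.
Implicit Types (m n k : nat).

Lemma cvg_dist (T : topologicalType) (V : normedModType R) (g : T -> V) (y : T) :
  (forall e : R, 0 < e -> \forall z \near y, `|g y - g z| <= e) -> {for y, continuous g}.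
Proof. by move=> H; apply/(@cvgrPdist_le R V). Qed.

Lemma continuous_lip (V W : normedModType R) (g : V -> W) (y : V) (C : R) : 0 <= C ->
  (\forall z \near y, `|g z - g y| <= C * `|z - y|) -> {for y, continuous g}.
Proof.
move=> C0 gC; apply: cvg_dist => d d0.
have CC0 : 0 < C + 1 by rewrite ltr_wpDl.
have : \forall z \near y, `|y - z| <= d / (C + 1).
  have := @cvg_id _ (nbhs y) => /(@cvgrPdist_le R V); apply; exact: divr_gt0.
apply: filterS2 gC => z gz zd; rewrite distrC (le_trans gz)// distrC.
apply: (@le_trans _ _ (C * (d / (C + 1)))); first by rewrite ler_wpM2l.
by rewrite mulrA ler_pdivrMr// mulrC ler_wpM2l ?(ltW d0)// lerDl.
Qed.

Lemma near_neq0 (T : topologicalType) (f : T -> R) (x : T) :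
  {for x, continuous f} -> f x != 0 -> \forall y \near x, f y != 0.
Proof. by move=> cf f0; exact: cvgr_neq0 cf f0. Qed.

(** The derivative of [1/f] is [-(1/f)^2] times that of [f], and it involves [1/f] only at the lower
    order. *)
Lemma Ckn_inv m k (f : 'rV[R]_m -> R) (x : 'rV[R]_m) :
  sm f x -> f x != 0 -> Ckn k (fun y => (f y)^-1) x.
Proof.
move=> sf fx0; elim: k => [|k IH].
  have f0 := near_neq0 (sm_cont sf) fx0.
  apply: filterS2 (sm_near sf) f0 => y sfy fy0; split=> //.
  exact: (@cvgV _ _ _ _ f (f y) fy0 (sm_cont sfy)).
have f0 := near_neq0 (sm_cont sf) fx0.
have H : \forall y \near x, sm f y /\ f y != 0 by apply: filterS2 (sm_near sf) f0.
apply: CknS_intro.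
- by apply: filterS H => y [sfy fy0]; exact: (@cvgV _ _ _ _ f (f y) fy0 (sm_cont sfy)).
- move=> i; apply: filterS H => y [sfy fy0].
  by apply: (@derivableV _ _ f) => //; exact: sm_derivable.
- move=> i; apply: (@Ckn_near_eq _ _ _ _ (fun y => - ((f y)^-1 * (f y)^-1 * 'D_(delta_mx 0 i) f y))).
    apply: filterS H => y [sfy fy0]; rewrite (@deriveV _ _ f)//; last exact: sm_derivable.
    by rewrite -exprVn expr2 scaleNr.
  apply: (@Ckn_near_eq _ _ _ _ (fun y => (-1) * ((f y)^-1 * (f y)^-1 * 'D_(delta_mx 0 i) f y))).
    by apply: near_all => y; rewrite mulN1r.
  apply: Ckn_mul; first exact: Ckn_cst.
  by apply: Ckn_mul; [exact: Ckn_mul|apply: sm_Ckn; exact: sm_derive].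
Qed.

Lemma sm_inv m (f : 'rV[R]_m -> R) (x : 'rV[R]_m) :
  sm f x -> f x != 0 -> sm (fun y => (f y)^-1) x.
Proof.
move=> sf fx0.
have f0 := near_neq0 (sm_cont sf) fx0.
by apply: sm_intro; apply: filterS2 (sm_near sf) f0 => y sfy fy0 k; exact: Ckn_inv.
Qed.

Lemma sm_prod m (I : Type) (r : seq I) (f : I -> 'rV[R]_m -> R) (x : 'rV[R]_m) :
  (forall i, sm (f i) x) -> sm (fun y => \prod_(i <- r) f i y) x.
Proof.
move=> sf; elim: r => [|i r IH].
  by apply: sm_near_eq (sm_cst (1 : R) x); apply: near_all => y; rewrite big_nil.
apply: sm_near_eq (sm_mul (sf i) IH).
by apply: near_all => y; rewrite big_cons.
Qed.

Lemma sm_det m n (A : 'rV[R]_m -> 'M[R]_n) (x : 'rV[R]_m) :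
  (forall i j, sm (fun y => A y i j : R) x) -> sm (fun y => \det (A y)) x.
Proof.
move=> sA; apply: (@sm_near_eq _ _ _ (fun y => \sum_(s : 'S_n) (-1) ^+ s * \prod_i A y i (s i))).
  exact: near_all.
by apply: sm_sum => s _; apply: sm_mul; [exact: sm_cst|exact: sm_prod].
Qed.

(** Cramer's rule: near [x] the determinant does not vanish, and the entries of the inverse are
    cofactors divided by it. *)
Lemma sm_invmx m n (A : 'rV[R]_m -> 'M[R]_n) (x : 'rV[R]_m) :
  (forall i j, sm (fun y => A y i j : R) x) -> A x \in unitmx ->
  forall i j, sm (fun y => (invmx (A y)) i j : R) x.
Proof.
move=> sA Ax i j; have sd := sm_det sA.
have dx : \det (A x) != 0 by rewrite unitmxE unitfE in Ax.
have d0 := near_neq0 (sm_cont sd) dx.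
apply: (@sm_near_eq _ _ _ (fun y => (\det (A y))^-1 * ((-1) ^+ (j + i) * \det (row' j (col' i (A y)))))).
  apply: filterS d0 => y dy; rewrite /invmx unitmxE unitfE dy.
  by rewrite 2!mxE /cofactor.
apply: sm_mul; first exact: sm_inv.
apply: sm_mul; first exact: sm_cst.
apply: sm_det => k l; apply: sm_near_eq (sA (lift j k) (lift i l)).
by apply: near_all => y; rewrite !mxE.
Qed.

Lemma norm_mulmx_le m n (v : 'rV[R]_m) (A : 'M[R]_(m, n)) : exists2 C : R, 0 <= C &
  forall v : 'rV[R]_m, `|v *m A| <= C * `|v|.
Proof.
exists (\sum_i \sum_j `|A i j|).
  by apply: sumr_ge0 => i _; apply: sumr_ge0.
move=> w; apply: norm_row_le => [|j].
  by rewrite mulr_ge0//; apply: sumr_ge0 => i _; apply: sumr_ge0.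
rewrite mxE (le_trans (ler_norm_sum _ _ _))// mulr_suml ler_sum// => i _.
rewrite normrM mulrC ler_pM ?coord_row_le//.
by rewrite (bigD1 j)//= lerDl sumr_ge0.
Qed.

(** Put [k = g (t v + y0) - x0]. Differentiability of [h] gives [t v = k J + o(k)], and the
    Lipschitz bound gives [k = O(t)]. Multiplying by the inverse of [J] and dividing by [t] yields
    the limit. *)
Lemma derivable_inverse m (h g : 'rV[R]_m -> 'rV[R]_m) (y0 v : 'rV[R]_m) (C : R) :
  0 <= C -> (\forall y \near y0, `|g y - g y0| <= C * `|y - y0|) ->
  (\forall y \near y0, h (g y) = y) -> sm h (g y0) -> 'J h (g y0) \in unitmx ->
  derivable g y0 v /\ 'D_v g y0 = v *m invmx ('J h (g y0)).
Proof.
move=> C0 gC hg sh Ju; set J := 'J h (g y0); set x0 := g y0.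
suff H : (h^-1 *: (g (h *: v + y0) - x0)) @[h --> (0 : R)^'] --> v *m invmx J.
  by split; [apply/cvg_ex; exists (v *m invmx J)|exact: cvg_lim H].
have [CJ CJ0 HCJ] := norm_mulmx_le 0 (invmx J).
apply/(@cvgrPdist_le R 'rV[R]_m) => e e0.
pose K := CJ * C * `|v| + 1.
have K0 : 0 < K by rewrite ltr_wpDl// !mulr_ge0.
have eta0 : 0 < e / K by rewrite divr_gt0.
have Hd : \forall k \near (0 : 'rV[R]_m), `|h (k + x0) - (h x0 + k *m J)| <= e / K * `|k|.
  have dh := sm_differentiable sh.
  have /diff_locallyP[_ /eqaddoP hE] := dh.
  have := hE _ eta0; apply: filterS => k; rewrite /= !fctE.
  by rewrite mulmx_jacobian// (deriveE _ dh).
have cv : (fun t : R => t *: v + y0) @ (0 : R) --> y0.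
  rewrite -[X in _ --> X]add0r -(scale0r v); apply: cvgD; last exact: cvg_cst.
  exact: scalel_continuous.
have cg : {for y0, continuous g}.
  exact: continuous_lip gC.
have ck : (fun t : R => g (t *: v + y0) - x0) @ (0 : R) --> (0 : 'rV[R]_m).
  rewrite -[X in _ --> X](subrr x0); apply: cvgB; last exact: cvg_cst.
  by apply: (cvg_comp _ _ cv); exact: cg.
have L (P : 'rV[R]_m -> Prop) : (\forall y \near y0, P y) -> \forall t \near (0 : R), P (t *: v + y0).
  by move=> HP; exact: cv _ HP.
have n1 : \forall t \near (0 : R), `|g (t *: v + y0) - x0| <= C * (`|t| * `|v|).
  by apply: filterS (L _ gC) => t /=; rewrite addrK normrZ.
have n2 : \forall t \near (0 : R), h (g (t *: v + y0)) = t *: v + y0 by exact: L _ hg.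
have n3 : \forall t \near (0 : R), `|h (g (t *: v + y0) - x0 + x0) - (h x0 + (g (t *: v + y0) - x0) *m J)| <= e / K * `|g (t *: v + y0) - x0|.
  by exact: ck _ Hd.
have n4 : h x0 = y0 by exact: nbhs_singleton hg.
change (\forall t \near (0 : R), t != 0 -> `|v *m invmx J - t^-1 *: (g (t *: v + y0) - x0)| <= e).
apply: filterS3 n1 n2 n3 => t n1 n2 n3 /= t0.
set k := g (t *: v + y0) - x0 in n1 n3 *.
move: n3; rewrite /= -/k subrK n2 n4 => n3.
clearbody k.
have -> : v *m invmx J - t^-1 *: k = t^-1 *: ((t *: v - k *m J) *m invmx J).
  by rewrite mulmxBl mulmxK// scalerBr; congr (_ - _); rewrite -scalemxAl scalerA mulVf ?scale1r.
rewrite normrZ normfV ler_pdivrMl ?normr_gt0//.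
apply: (le_trans (HCJ _)).
have -> : t *: v - k *m J = t *: v + y0 - (y0 + k *m J) by rewrite opprD addrA addrK.
apply: (@le_trans _ _ (CJ * (e / K * (C * (`|t| * `|v|))))).
  rewrite ler_wpM2l// (le_trans n3)// ler_wpM2l// ltW//.
rewrite (_ : CJ * _ = `|t| * e * (CJ * C * `|v| / K)); last by ring.
rewrite -[leRHS]mulr1 ler_wpM2l// ?mulr_ge0 ?(ltW e0)//.
by rewrite ler_pdivrMr// mul1r lerDl.
Qed.

(** Bootstrapping: the partial derivatives of [g] are entries of [invmx ('J h)] composed with [g],
    so order [k] of [g] gives order [k.+1]. The Lipschitz bound starts the induction with
    continuity. *)
Lemma inverse_sm m (h g : 'rV[R]_m -> 'rV[R]_m) (y0 : 'rV[R]_m) (C : R) : 0 <= C ->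
  (\forall y \near y0, \forall z \near y, `|g z - g y| <= C * `|z - y|) ->
  (\forall y \near y0, h (g y) = y) -> sm h (g y0) -> 'J h (g y0) \in unitmx -> sm g y0.
Proof.
move=> C0 gC hg sh Ju.
have cg (y : 'rV[R]_m) : (\forall z \near y, `|g z - g y| <= C * `|z - y|) -> {for y, continuous g}.
  exact: continuous_lip.
pose P (y : 'rV[R]_m) := [/\ \forall z \near y, `|g z - g y| <= C * `|z - y|,
  \forall z \near y, h (g z) = z, sm h (g y) & 'J h (g y) \in unitmx].
have cg0 := cg _ (nbhs_singleton gC).
have HP : \forall y \near y0, P y.
  have hJ : \forall x \near g y0, sm h x /\ 'J h x \in unitmx.
    have sd : sm (fun x => \det ('J h x)) (g y0) by apply: sm_det => i j; exact: sm_jacobian.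
    have d0 : \forall x \near g y0, \det ('J h x) != 0.
      by apply: near_neq0 (sm_cont sd) _; rewrite unitmxE unitfE in Ju.
    by apply: filterS2 (sm_near sh) d0 => x shx dx; rewrite unitmxE unitfE.
  by apply: filterS3 gC (near_join hg) (near_comp cg0 hJ) => y gy hgy [].
have Ck k (y : 'rV[R]_m) : P y -> (\forall z \near y, P z) -> Ckn k g y.
  elim: k y => [|k IH] y Py nPy.
    by apply: filterS nPy => z [gz _ _ _]; split=> //; exact: cg.
  apply: CknS_intro.
  - by apply: filterS nPy => z [gz _ _ _]; exact: cg.
  - move=> i; apply: filterS nPy => z [gz hz sz Jz].
    by have [] := derivable_inverse (delta_mx 0 i) C0 gz hz sz Jz.
  - move=> i; apply/Ckn_rowP => j.
    apply: (@Ckn_near_eq _ _ _ _ (fun z => invmx ('J h (g z)) i j)).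
      apply: filterS nPy => z [gz hz sz Jz].
      have [_ ->] := derivable_inverse (delta_mx 0 i) C0 gz hz sz Jz.
      by rewrite -rowE mxE.
    apply: (@Ckn_comp _ _ _ _ g (fun x => invmx ('J h x) i j)); first exact: IH.
    case: Py => _ _ sy Jy; apply: sm_invmx => // k' l; exact: sm_jacobian.
by apply: sm_intro; apply: filterS2 HP (near_join HP) => y Py nPy k; exact: Ck.
Qed.

End Inverse.

(** * Flat functions and smooth steps *)

Section Bump.
Context {R : realType}.
Implicit Types (m n k : nat).

(** A real variable is encoded as a row of length one, so that the closure properties of [sm] carry
    over. *)
Definition sm1 (u : R -> R) (t : R) : Prop := sm (fun w : 'rV[R]_1 => u (w 0 0)) (const_mx t).

Lemma sm1_comp m (u : R -> R) (f : 'rV[R]_m -> R) (x : 'rV[R]_m) :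
  sm1 u (f x) -> sm f x -> sm (fun y => u (f y)) x.
Proof.
move=> su sf.
have sF : sm (fun y => const_mx (f y) : 'rV[R]_1) x.
  by apply/sm_rowP => j; apply: sm_near_eq sf; apply: near_all => y; rewrite mxE.
apply: sm_near_eq (sm_compR sF su).
by apply: near_all => y; rewrite mxE.
Qed.

Lemma sm1_comp1 (u v : R -> R) (t : R) : sm1 v t -> sm1 u (v t) -> sm1 (fun s => u (v s)) t.
Proof. by move=> sv su; apply: (sm1_comp _ sv); rewrite mxE. Qed.

Lemma near_sm1 (P : R -> Prop) (t : R) : (\forall s \near t, P s) ->
  nbhs (const_mx t : 'rV[R]_1) (fun w : 'rV[R]_1 => P (w 0 0)).
Proof.
move=> HP; apply: (@near_comp _ _ (fun w : 'rV[R]_1 => w 0 0)); last by rewrite mxE.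
exact: coord_continuous.
Qed.

Lemma sm1_near_eq (u v : R -> R) (t : R) : (\forall s \near t, u s = v s) -> sm1 u t -> sm1 v t.
Proof. by move=> uv; apply: sm_near_eq; exact: near_sm1 uv. Qed.

Lemma sm1_id (t : R) : sm1 (fun s => s) t. Proof. exact: sm_coord. Qed.
Lemma sm1_cst (c t : R) : sm1 (fun=> c) t. Proof. exact: sm_cst. Qed.
Lemma sm1_add (u v : R -> R) (t : R) : sm1 u t -> sm1 v t -> sm1 (fun s => u s + v s) t.
Proof. exact: sm_add. Qed.
Lemma sm1_mul (u v : R -> R) (t : R) : sm1 u t -> sm1 v t -> sm1 (fun s => u s * v s) t.
Proof. exact: sm_mul. Qed.
Lemma sm1_sub (u v : R -> R) (t : R) : sm1 u t -> sm1 v t -> sm1 (fun s => u s - v s) t.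
Proof. exact: sm_sub. Qed.
Lemma sm1_inv (u : R -> R) (t : R) : sm1 u t -> u t != 0 -> sm1 (fun s => (u s)^-1) t.
Proof. by move=> su ut; apply: (sm_inv su); rewrite mxE. Qed.

Lemma is_derive_lift (u : R -> R) (w : 'rV[R]_1) (d : R) (i : 'I_1) : is_derive (w 0 0) (1 : R) u d ->
  is_derive w (delta_mx 0 i) (fun w : 'rV[R]_1 => u (w 0 0)) d.
Proof.
have E : (fun h : R => h^-1 *: (((fun w : 'rV[R]_1 => u (w 0 0)) \o shift w) (h *: delta_mx 0 i) - u (w 0 0)))
    = (fun h : R => h^-1 *: ((u \o shift (w 0 0)) (h *: 1) - u (w 0 0))).
  by rewrite funeqE => h /=; rewrite !mxE ord1 !eqxx.
by move=> [du <-]; apply: DeriveDef; rewrite /derivable /derive E.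
Qed.

Lemma is_derive_cont (u : R -> R) (t d : R) : is_derive t (1 : R) u d -> {for t, continuous u}.
Proof. by move=> ud; apply: differentiable_continuous; apply/derivable1_diffP. Qed.

(* Smoothness by coinduction: Q is a family closed under derivation. *)
Lemma sm1_coind (Q : (R -> R) -> Prop) :
  (forall u, Q u -> exists2 v, Q v & forall t, is_derive t (1 : R) u (v t)) ->
  forall u t, Q u -> sm1 u t.
Proof.
move=> H u t Qu; apply: sm_intro; apply: near_all => w k.
elim: k u Qu w => [|k IH] u Qu w; have [v Qv uv] := H u Qu.
  apply: near_all => z; split=> //.
  apply: (@continuous_comp _ _ _ (fun w : 'rV[R]_1 => w 0 0) u); first exact: coord_continuous.
  exact: is_derive_cont (uv _).
apply: CknS_intro.
- apply: near_all => z.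
  apply: (@continuous_comp _ _ _ (fun w : 'rV[R]_1 => w 0 0) u); first exact: coord_continuous.
  exact: is_derive_cont (uv _).
- by move=> i; apply: near_all => z; exact: (@ex_derive _ _ _ _ _ _ _ (is_derive_lift i (uv _))).
- move=> i; apply: Ckn_near_eq (IH v Qv w); apply: near_all => z.
  by rewrite (@derive_val _ _ _ _ _ _ _ (is_derive_lift i (uv _))).
Qed.

(* The functions P(1/t) e^(-1/t) form a family closed under derivation, hence are
   smooth at 0. *)
Definition flatp (P : {poly R}) (t : R) : R := if 0 < t then P.[t^-1] * expR (- t^-1) else 0.

(** With [s = 1/t >= 1] and [d = size P], the polynomial is at most [A s^d], while the exponential
    series gives [e^(-s) <= (d+2)! / s^(d+2)]. The exponent [d + 2] leaves the two powers of [t]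
    that make the derivative at [0] vanish. *)
Lemma flatp_bound (P : {poly R}) : exists2 C : R, 0 <= C &
  forall t, `|t| <= 1 -> `|flatp P t| <= C * t ^+ 2.
Proof.
set d := size P; pose A := \sum_(i < d) `|P`_i|.
have A0 : 0 <= A by apply: sumr_ge0.
exists (A * (d.+2)`!%:R) => [|t t1]; first by rewrite mulr_ge0.
rewrite /flatp; case: ifP => [t0|_]; last first.
  by rewrite normr0; exact: mulr_ge0 (mulr_ge0 A0 (ler0n _ _)) (sqr_ge0 _).
rewrite gtr0_norm // in t1.
set s := t^-1; have s1 : 1 <= s by rewrite invf_ge1.
have s0 : 0 < s by exact: lt_le_trans s1.
have Ps : `|P.[s]| <= A * s ^+ d.
  rewrite horner_coef (le_trans (ler_norm_sum _ _ _))// mulr_suml ler_sum// => i _.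
  rewrite normrM normrX (gtr0_norm s0) ler_wpM2l// ler_weXn2l// ltnW//.
have es : expR (- s) <= (d.+2)`!%:R / s ^+ d.+2.
  rewrite expRN -[leRHS]invrK lef_pV2 ?posrE ?expR_gt0 ?invr_gt0 ?divr_gt0 ?exprn_gt0 ?ltr0n ?fact_gt0//.
  rewrite invf_div; have := @expR_ge1Dxn _ s d.+1 (ltW s0); apply: le_trans.
  by rewrite lerDr.
rewrite normrM (gtr0_norm (expR_gt0 _)) (le_trans (ler_pM _ _ Ps es)) ?expR_ge0//.
rewrite -mulrA (_ : s ^+ d * _ = (d.+2)`!%:R * t ^+ 2) ?mulrA//.
rewrite (_ : t = s^-1); last by rewrite /s invrK.
clearbody s; move: (d.+2)`!%:R => F; rewrite !exprS; field.
by rewrite expf_neq0 ?gt_eqF.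
Qed.

Lemma is_derive_horner (P : {poly R}) (t : R) : is_derive t (1 : R) (horner P) P^`().[t].
Proof. by apply: DeriveDef; [exact: derivable_horner|rewrite derivE derive1E]. Qed.

(** For [t > 0] the derivative of [P(1/t) e^(-1/t)] is [t^-2 (P - P')(1/t) e^(-1/t)], of the same
    form. At [0] the difference quotient is [O(t)] by [flatp_bound]. *)
Lemma is_derive_flatp (P : {poly R}) (t : R) :
  is_derive t (1 : R) (flatp P) (flatp (('X^2) * (P - P^`())) t).
Proof.
have [t0|t0|t0] := ltgtP t 0.
- have E : \forall y \near t, 0 = flatp P y.
    by apply: filterS (lt_nbhsl t0) => y y0; rewrite /flatp ltNge ltW.
  apply: near_eq_is_derive E _; rewrite /flatp ltNge ltW//=; exact: is_derive_cst.
- have E : \forall y \near t, P.[y^-1] * expR (- y^-1) = flatp P y.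
    by apply: filterS (lt_nbhsr t0) => y y0; rewrite /flatp y0.
  apply: near_eq_is_derive E _; rewrite /flatp t0.
  have dV : is_derive t (1 : R) (fun y : R => y^-1) (- t ^- 2).
    apply: is_derive_eq; first by apply: is_deriveV; rewrite gt_eqF.
    by rewrite /GRing.scale/= mulr1.
  have dP : is_derive t (1 : R) (fun y : R => P.[y^-1]) (P^`().[t^-1] * - t ^- 2).
    exact: (@is_derive1_comp _ (horner P) (fun y => y^-1) _ _ _ (is_derive_horner _ _) dV).
  have dE : is_derive t (1 : R) (fun y : R => expR (- y^-1)) (expR (- t^-1) * - - t ^- 2).
    apply: (@is_derive1_comp _ expR (fun y => - y^-1)); exact: is_derive_expR || exact: is_deriveN.
  change (is_derive t (1 : R) ((fun y : R => P.[y^-1]) * (fun y : R => expR (- y^-1))) (('X^2 * (P - P^`())).[t^-1] * expR (- t^-1))).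
  apply: (is_derive_eq (is_deriveM dP dE)).
  rewrite /GRing.scale/= hornerM hornerD hornerN hornerXn exprVn; ring.
- rewrite t0 [X in is_derive _ _ _ X](_ : _ = 0); last by rewrite /flatp ltxx.
  have [C C0 HC] := flatp_bound P.
  have H : (h^-1 *: (flatp P (h *: 1 + 0) - flatp P 0)) @[h --> (0 : R)^'] --> (0 : R).
    apply/cvgrPdist_le => e e0.
    change (\forall h \near (0 : R), h != 0 -> `|0 - h^-1 *: (flatp P (h *: 1 + 0) - flatp P 0)| <= e).
    have n1 : \forall h \near (0 : R), `|h| < 1 by exact: nbhs0_lt.
    have n2 : \forall h \near (0 : R), `|h| < e / (C + 1).
      by apply: nbhs0_lt; rewrite divr_gt0// ltr_wpDl.
    apply: filterS2 n1 n2 => h h1 h2 h0.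
    rewrite sub0r normrN addr0 [h *: 1]mulr1 {2}/flatp ltxx subr0 normrZ normfV.
    rewrite ler_pdivrMl ?normr_gt0//.
    apply: (le_trans (HC h (ltW h1))).
    rewrite -real_normK ?num_real// expr2 mulrA mulrC ler_wpM2l//.
    apply: (@le_trans _ _ (C * (e / (C + 1)))); first by rewrite ler_wpM2l// ltW.
    have C1 : 0 < C + 1 by rewrite ltr_wpDl.
    by rewrite mulrA ler_pdivrMr// mulrC ler_wpM2l ?(ltW e0)// lerDl.
  by apply: DeriveDef; [apply/cvg_ex; exists 0|exact: cvg_lim H].
Qed.

Definition flat (t : R) : R := if 0 < t then expR (- t^-1) else 0.

Lemma flatE : flat = flatp 1.
Proof. by rewrite funeqE => t; rewrite /flat /flatp; case: ifP => //; rewrite hornerC mul1r. Qed.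

Lemma sm1_flat (t : R) : sm1 flat t.
Proof.
rewrite flatE; apply: (@sm1_coind (fun u => exists P, u = flatp P)); last by exists 1.
by move=> _ [P ->]; eexists; [eexists; reflexivity|exact: is_derive_flatp].
Qed.

Lemma flat_gt0 (t : R) : (0 < flat t) = (0 < t).
Proof. by rewrite /flat; case: ifP => // _; rewrite ?expR_gt0 ?ltxx. Qed.

Lemma flat_ge0 (t : R) : 0 <= flat t.
Proof. by rewrite /flat; case: ifP => // _; rewrite ?expR_ge0. Qed.

Lemma flat0 (t : R) : t <= 0 -> flat t = 0.
Proof. by move=> t0; rewrite /flat ltNge t0. Qed.

Lemma flat_le (s t : R) : s <= t -> flat s <= flat t.
Proof.
move=> st; have [s0|s0] := leP s 0; first by rewrite (flat0 s0) flat_ge0.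
have t0 : 0 < t by exact: lt_le_trans st.
by rewrite /flat s0 t0 ler_expR lerN2 lef_pV2.
Qed.

(** The usual smooth transition from [0] to [1] over the unit interval; the denominator is positive
    because [t] and [1 - t] are never both nonpositive. *)
Definition step (t : R) : R := flat t / (flat t + flat (1 - t)).

Lemma step_den (t : R) : 0 < flat t + flat (1 - t).
Proof.
have [t0|t0] := leP t 0; last by rewrite ltr_wpDr ?flat_ge0 ?flat_gt0.
by rewrite ltr_wpDl ?flat_ge0// flat_gt0 subr_gt0 (le_lt_trans t0).
Qed.

Lemma sm1_step (t : R) : sm1 step t.
Proof.
have s1 : sm1 (fun t => flat (1 - t)) t.
  by apply: (@sm1_comp1 flat (fun t => 1 - t)); [apply: sm1_sub; [exact: sm1_cst|exact: sm1_id]|exact: sm1_flat].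
apply: sm1_mul; first exact: sm1_flat.
by apply: sm1_inv; [apply: sm1_add => //; exact: sm1_flat|rewrite gt_eqF// step_den].
Qed.

Lemma step0 (t : R) : t <= 0 -> step t = 0.
Proof. by move=> t0; rewrite /step flat0// mul0r. Qed.

Lemma step1 (t : R) : 1 <= t -> step t = 1.
Proof.
move=> t1; rewrite /step (flat0 (t := 1 - t)) ?subr_le0// addr0 mulfV// gt_eqF// flat_gt0.
exact: lt_le_trans t1.
Qed.

Lemma step_ge0 (t : R) : 0 <= step t.
Proof. by rewrite /step divr_ge0 ?flat_ge0// ltW// step_den. Qed.

Lemma step_le1 (t : R) : step t <= 1.
Proof. by rewrite /step ler_pdivrMr ?step_den// mul1r lerDl flat_ge0. Qed.

Lemma step_gt0 (t : R) : 0 < t -> 0 < step t.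
Proof. by move=> t0; rewrite /step divr_gt0 ?step_den// flat_gt0. Qed.

End Bump.

(** * Perturbations of the identity and the inverse function theorem *)

Section Cutoff.
Context {R : realType}.
Implicit Types (m n k : nat).

(** The norm of a row is the sup norm, which is not smooth in general. The square of the Euclidean
    norm is smooth, and the balls inside discs are measured with it. *)
Definition N2 m (x : 'rV[R]_m) : R := \sum_i x 0 i ^+ 2.

Lemma sm_N2 m n (f : 'rV[R]_m -> 'rV[R]_n) (x : 'rV[R]_m) : sm f x -> sm (fun y => N2 (f y)) x.
Proof. by move=> /sm_rowP sf; apply: sm_sum => i _; exact: sm_mul. Qed.

Lemma N2_ge0 m (x : 'rV[R]_m) : 0 <= N2 x.
Proof. by apply: sumr_ge0 => i _; exact: sqr_ge0. Qed.

Lemma N2_eq0 m (x : 'rV[R]_m) : (N2 x == 0) = (x == 0).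
Proof.
apply/idP/eqP => [|->]; last by rewrite /N2 big1// => i _; rewrite mxE expr0n.
rewrite psumr_eq0 => [/allP H|i _]; last exact: sqr_ge0.
by apply/rowP => i; rewrite mxE; apply/eqP; rewrite -sqrf_eq0; apply: H; rewrite mem_index_enum.
Qed.

Lemma N2_gt0 m (x : 'rV[R]_m) : (0 < N2 x) = (x != 0).
Proof. by rewrite lt0r N2_eq0 N2_ge0 andbT. Qed.

Lemma N20 m : N2 (0 : 'rV[R]_m) = 0. Proof. by apply/eqP; rewrite N2_eq0. Qed.

Lemma N2Z m (c : R) (x : 'rV[R]_m) : N2 (c *: x) = c ^+ 2 * N2 x.
Proof. by rewrite /N2 mulr_sumr; apply: eq_bigr => i _; rewrite mxE exprMn. Qed.

Lemma norm_le_N2 m (x : 'rV[R]_m) : `|x| ^+ 2 <= N2 x.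
Proof.
rewrite -[leRHS]sqr_sqrtr ?N2_ge0// ler_sqr ?nnegrE ?sqrtr_ge0//.
apply: norm_row_le => [|j]; first exact: sqrtr_ge0.
rewrite -(ler_sqr (normr_ge0 _) (sqrtr_ge0 _)) sqr_sqrtr ?N2_ge0// real_normK ?num_real//.
by rewrite /N2 (bigD1 j)//= lerDl sumr_ge0// => i _; exact: sqr_ge0.
Qed.

Lemma N2_le_norm m (x : 'rV[R]_m) : N2 x <= m%:R * `|x| ^+ 2.
Proof.
apply: (@le_trans _ _ (\sum_(i < m) `|x| ^+ 2)); last by rewrite sumr_const card_ord mulr_natl.
apply: ler_sum => i _; by rewrite -(real_normK (num_real (x 0 i))) ler_sqr ?nnegrE ?coord_row_le.
Qed.

Lemma near_ltr (T : topologicalType) (f : T -> R) (x : T) (r : R) :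
  {for x, continuous f} -> f x < r -> \forall y \near x, f y < r.
Proof. by move=> cf; exact: cvgr_lt cf _. Qed.

Lemma near_gtr (T : topologicalType) (f : T -> R) (x : T) (r : R) :
  {for x, continuous f} -> r < f x -> \forall y \near x, r < f y.
Proof. by move=> cf; exact: cvgr_gt cf _. Qed.

Lemma norm_cont m (x : 'rV[R]_m) : {for x, continuous (fun y : 'rV[R]_m => `|y|)}.
Proof. exact: norm_continuous. Qed.

Lemma N2_cont m (x : 'rV[R]_m) : {for x, continuous (@N2 m)}.
Proof. exact: sm_cont (sm_N2 (sm_id x)). Qed.

Lemma compact_norm_le m (r : R) : compact [set x : 'rV[R]_m | `|x| <= r].
Proof.
apply: bounded_closed_compact.
  by exists r; split; [exact: num_real|move=> M rM x /= xr; rewrite (le_trans xr)// ltW].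
apply: closed_comp (@closed_le R r) => x _; exact: norm_continuous.
Qed.

Definition cut m (x : 'rV[R]_m) : R := step (2 - N2 x).

Lemma sm_cut m (x : 'rV[R]_m) : sm (@cut m) x.
Proof.
apply: sm1_comp; first exact: sm1_step.
by apply: sm_sub; [exact: sm_cst|exact: sm_N2 (sm_id _)].
Qed.

Lemma cut_ge0 m (x : 'rV[R]_m) : 0 <= cut x. Proof. exact: step_ge0. Qed.
Lemma cut_le1 m (x : 'rV[R]_m) : cut x <= 1. Proof. exact: step_le1. Qed.

Lemma cut1 m (x : 'rV[R]_m) : N2 x <= 1 -> cut x = 1.
Proof. by move=> x1; apply: step1; rewrite lerBrDr; lra. Qed.

Lemma cut0 m (x : 'rV[R]_m) : 2 <= N2 x -> cut x = 0.
Proof. by move=> x1; apply: step0; rewrite subr_le0. Qed.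

Lemma cut0_norm m (x : 'rV[R]_m) : 2 <= `|x| -> cut x = 0.
Proof.
move=> x1; apply: cut0; apply: le_trans (norm_le_N2 x).
by rewrite (le_trans _ (_ : 2 ^+ 2 <= _)) ?ler_sqr ?nnegrE//; lra.
Qed.

(** The partial derivatives of [cut] are continuous, hence bounded on the compact set [|x| <= 3],
    and they vanish where [|x| > 2]. Bounded partials give a Lipschitz constant. *)
Lemma cut_lipschitz m : exists2 L : R, 0 <= L &
  forall x y : 'rV[R]_m, `|cut x - cut y| <= L * `|x - y|.
Proof.
have B (i : 'I_m) : exists2 M : R, 0 <= M & forall y, `|'D_(delta_mx 0 i) (@cut m) y| <= M.
  have sD y : sm (fun y => 'D_(delta_mx 0 i) (@cut m) y) y by apply: sm_derive; exact: sm_cut.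
  have [||c _ Hc] := @compact_EVT_max _ R (fun y => `|'D_(delta_mx 0 i) (@cut m) y|) _ _ (@compact_norm_le m 3).
  - by exists 0; rewrite /= normr0.
  - apply: continuous_subspaceT => y.
    exact: (@cvg_norm _ _ _ _ _ _ _ (sm_cont (sD y))).
  exists `|'D_(delta_mx 0 i) (@cut m) c|; first exact: normr_ge0.
  move=> y.
  have [y3|y3] := leP `|y| 3; first by apply: Hc; rewrite inE.
  have E : \forall z \near y, (fun=> 0) z = cut z.
    have y2 : 2 < `|y| by lra.
    apply: filterS (near_gtr (norm_cont (x := y)) y2) => z z2.
    by rewrite cut0_norm// ltW.
  by rewrite -(near_eq_derive _ E) (derive_cst (0 : R)) normr0.
pose M i := sval (cid2 (B i)); have M0 i : 0 <= M i by rewrite /M; case: cid2.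
have HM i y : `|'D_(delta_mx 0 i) (@cut m) y| <= M i by rewrite /M; case: cid2.
exists (m%:R * \sum_i M i) => [|x y]; first by rewrite mulr_ge0// sumr_ge0.
have := @small_partials R m (@cut m) y (x - y) (\sum_i M i).
rewrite [y + _]addrC subrK; apply => z _; split; first exact: sm_cont (sm_cut z).
move=> i; split; first exact: sm_derivable (sm_cut z).
by apply: le_trans (HM i z) _; rewrite (bigD1 i)//= lerDl sumr_ge0.
Qed.

(* The factor t^-1 *: x of the cutoff has Lipschitz constant of order 1/t, which
   is compensated by the smallness of w on the ball of radius 2 t. *)
Lemma cut_mul_lipschitz m n (L e t : R) (w : 'rV[R]_m -> 'rV[R]_n) :
  0 <= L -> 0 < t -> 0 <= e ->
  (forall x y : 'rV[R]_m, `|cut x - cut y| <= L * `|x - y|) ->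
  (forall x, `|x| <= 2 * t -> `|w x| <= e * t) ->
  (forall x y, `|x| <= 2 * t -> `|y| <= 2 * t -> `|w x - w y| <= e * `|x - y|) ->
  forall x y, `|cut (t^-1 *: x) *: w x - cut (t^-1 *: y) *: w y| <= (e * (L + 1)) * `|x - y|.
Proof.
move=> L0 t0 e0 HL w1 w2.
have cL (x y : 'rV[R]_m) : `|cut (t^-1 *: x) - cut (t^-1 *: y)| * t <= L * `|x - y|.
  rewrite -ler_pdivlMr// (le_trans (HL _ _))// -scalerBr normrZ gtr0_norm ?invr_gt0//.
  by rewrite mulrA mulrAC.
have out (x : 'rV[R]_m) : 2 * t < `|x| -> cut (t^-1 *: x) = 0.
  move=> xt; apply: cut0_norm; rewrite normrZ gtr0_norm ?invr_gt0// mulrC ler_pdivlMr//.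
  exact: ltW.
(* If only [x] lies in the ball, the factor at [y] is [0], so [cut] at [x] may be replaced by the
   difference of its values at [x] and [y]. *)
have half (x y : 'rV[R]_m) : `|x| <= 2 * t -> `|y| > 2 * t ->
    `|cut (t^-1 *: x) *: w x - cut (t^-1 *: y) *: w y| <= (e * (L + 1)) * `|x - y|.
  move=> xt yt; rewrite (out y yt) scale0r subr0 normrZ -[X in `|X|]subr0 -(out y yt).
  apply: (@le_trans _ _ (`|cut (t^-1 *: x) - cut (t^-1 *: y)| * (e * t))).
    by rewrite ler_wpM2l// w1.
  rewrite mulrCA -mulrA ler_wpM2l// (le_trans (cL _ _))// ler_wpM2r// lerDl//.
move=> x y; have [xt|xt] := leP `|x| (2 * t); have [yt|yt] := leP `|y| (2 * t).
- rewrite (_ : _ - _ = (cut (t^-1 *: x) - cut (t^-1 *: y)) *: w x + cut (t^-1 *: y) *: (w x - w y)); last first.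
    by rewrite scalerBl scalerBr addrA subrK.
  rewrite (le_trans (ler_normD _ _))// mulrDr mulr1 mulrDl lerD//.
    rewrite normrZ (@le_trans _ _ (`|cut (t^-1 *: x) - cut (t^-1 *: y)| * (e * t)))//.
      by rewrite ler_wpM2l// w1.
    by rewrite mulrCA -mulrA ler_wpM2l.
  rewrite normrZ ger0_norm ?cut_ge0// (le_trans _ (w2 _ _ xt yt))//.
  by rewrite ler_piMl// cut_le1.
- exact: half.
- by rewrite distrC [`|x - y|]distrC; exact: half.
- by rewrite !out// !scale0r subrr normr0 mulr_ge0// mulr_ge0// addr_ge0.
Qed.

(** [g y] is the fixed point of [x -> y - u x], a contraction of ratio [1/2]. The map [id + u]
    shrinks distances by at most the factor [2], whence its injectivity and the Lipschitz constant
    of [g]. *)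
Lemma lipschitz_inverse m (u : 'rV[R]_m -> 'rV[R]_m) :
  (forall x y, `|u x - u y| <= 2^-1 * `|x - y|) ->
  exists g : 'rV[R]_m -> 'rV[R]_m, [/\ forall y, g y + u (g y) = y,
    forall x, g (x + u x) = x & forall y z, `|g y - g z| <= 2 * `|y - z|].
Proof.
move=> uL.
pose V : completeNormedModType R := HB.pack 'rV[R]_m.
have fixp (y : 'rV[R]_m) : exists x, x + u x = y.
  pose f : {fun [set: V] >-> [set: V]} := [fun of totalfun_ [set: V] (fun x : 'rV[R]_m => y - u x : 'rV[R]_m)].
  have cf : is_contraction f.
    exists (2^-1)%:nng; split; first by rewrite /= invf_lt1// ltr1n.
    move=> [x z] _.
    suff : `|(y - u x) - (y - u z)| <= 2^-1 * `|x - z| by [].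
    by rewrite opprB addrC addrA subrK distrC; exact: uL.
  have [||x _ xE] := banach_fixed_point cf; first exact: closedT.
    by exists (0 : 'rV[R]_m).
  have {}xE : x = y - u x := xE.
  by exists x; rewrite {1}xE subrK.
pose g y := sval (cid (fixp y)); have gK y : g y + u (g y) = y by rewrite /g; case: cid.
have expand x z : `|x - z| <= 2 * `|(x + u x) - (z + u z)|.
  have -> : (x + u x) - (z + u z) = (x - z) + (u x - u z) by rewrite opprD addrACA.
  have := uL x z; have := lerB_normD (x - z) (u x - u z); lra.
exists g; split=> // [x|y z]; last by have := expand (g y) (g z); rewrite !gK.
apply/eqP; rewrite -subr_eq0 -normr_le0 (le_trans (expand _ _))//.
by rewrite gK subrr normr0 mulr0.
Qed.

(** A row [v] killed by [1 + J] satisfies [|v J| = |v|]. But [v J] is within [|v| / 4] of a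
    difference quotient of [u], whose norm is at most [|v| / 2]; this forces [v = 0]. *)
Lemma lipschitz_jacobian_unit m (u : 'rV[R]_m -> 'rV[R]_m) (x : 'rV[R]_m) :
  (forall x y, `|u x - u y| <= 2^-1 * `|x - y|) -> sm u x ->
  'J (fun y => y + u y) x \in unitmx.
Proof.
move=> uL su; rewrite (jacobian_add (sm_id x) su) jacobian_id -row_free_unit.
apply/inj_row_free => v; rewrite mulmxDr mulmx1 => /eqP; rewrite addr_eq0 => /eqP vE.
apply/eqP; apply/negPn/negP => v0.
have nv : 0 < `|v| / 4 by rewrite divr_gt0// normr_gt0.
have := diff_derivable (v := v) (sm_differentiable su); rewrite /derivable => du.
have {}du : (h^-1 *: ((u \o shift x) (h *: v) - u x)) @[h --> (0 : R)^'] --> 'D_v u x by exact: du.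
move: du; rewrite -(mulmx_jacobian v su) => /cvgrPdist_le/(_ _ nv) H.
have H0 : \forall h \near (0 : R)^', h != 0 by exact: nbhs_dnbhs_neq.
have [t [/= t1 t0]] := filter_ex (filterI H H0).
have := uL (t *: v + x) x; rewrite addrK normrZ => t2.
have t3 : `|t^-1 *: (u (t *: v + x) - u x)| <= 2^-1 * `|v|.
  by rewrite normrZ normfV ler_pdivrMl ?normr_gt0// mulrCA.
have := lerB_normD (v *m 'J u x) (- (t^-1 *: (u (t *: v + x) - u x))).
rewrite normrN.
have vn : `|v *m 'J u x| = `|v| by rewrite -normrN -vE.
rewrite vn; move: t1 t3 nv; lra.
Qed.

Theorem perturbation m (u : 'rV[R]_m -> 'rV[R]_m) :
  (forall x y, `|u x - u y| <= 2^-1 * `|x - y|) -> (forall x, sm u x) ->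
  exists g : 'rV[R]_m -> 'rV[R]_m, [/\ forall y, g y + u (g y) = y,
    forall x, g (x + u x) = x & forall y, sm g y].
Proof.
move=> uL su; have [g [gK Kg gL]] := lipschitz_inverse uL.
exists g; split=> // y; apply: (@inverse_sm _ _ (fun y => y + u y) g y 2) => //.
- by apply: near_all => z; apply: near_all => w.
- exact: near_all.
- by apply: sm_addv => //; exact: sm_id.
- exact: lipschitz_jacobian_unit.
Qed.

Lemma small_jacobian_lipschitz m n (w : 'rV[R]_m -> 'rV[R]_n) (e : R) : 0 < e ->
  sm w 0 -> 'J w 0 = 0 -> w 0 = 0 -> exists2 r : R, 0 < r &
  (forall x, `|x| <= r -> sm w x) /\
  forall x y, `|x| <= r -> `|y| <= r -> `|w x - w y| <= e * `|x - y|.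
Proof.
move=> e0 sw J0 w0; pose d := e / (m%:R + 1).
have m1 : 0 < m%:R + 1 :> R by rewrite ltr_wpDl.
have d0 : 0 < d by rewrite divr_gt0.
have sJ (i : 'I_m) (j : 'I_n) : \forall y \near (0 : 'rV[R]_m), `|'J w y i j| < d.
  apply: near_ltr; last by rewrite J0 mxE normr0.
  exact: (@cvg_norm _ _ _ _ _ _ _ (sm_cont (sm_jacobian i j sw))).
have sJ2 : \forall y \near (0 : 'rV[R]_m), forall i j, `|'J w y i j| < d.
  by apply: near_forall => i; apply: near_forall => j.
have : \forall y \near (0 : 'rV[R]_m), sm w y /\ forall i j, `|'J w y i j| < d.
  by apply: filterS2 (sm_near sw) sJ2.
move=> /nbhs_ballP[r /= r0 rP].
have {}rP y : `|y| < r -> sm w y /\ forall i j, `|'J w y i j| < d.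
  by move=> yr; apply: rP; rewrite -ball_normE/= sub0r normrN.
(* Every [z] with [|z - y| <= |x - y|] must lie in the ball of radius [r]; for [x] and [y] of norm
   at most [r / 4] one gets [|z| <= 3 r / 4]. *)
exists (r / 4); first by rewrite divr_gt0.
split=> [x xr|x y xr yr]; first by have [] := rP x _ => //; lra.
apply: norm_row_le => [|j]; first by rewrite mulr_ge0// ltW.
rewrite !mxE.
have := @small_partials R m (fun z => w z 0 j) y (x - y) d.
rewrite [y + _]addrC subrK => H; apply: (le_trans (H _)) => [z zx|].
  have zr : `|z| < r.
    rewrite -(subrK y z) (le_lt_trans (ler_normD _ _))//.
    have := ler_normB x y; move: zx; lra.
  have [sz Jz] := rP z zr.
  have szj : sm (fun z => w z 0 j : R) z by move/sm_rowP : sz; exact.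
  split; first exact: sm_cont szj.
  by move=> i; split; [exact: sm_derivable szj|rewrite -jacobianE// ltW].
rewrite ler_wpM2r// /d mulrA ler_pdivrMr// mulrC ler_wpM2l ?(ltW e0)// lerDl//.
Qed.

Lemma cut_scaled1 m (t : R) : 0 < t -> \forall x \near (0 : 'rV[R]_m), cut (t^-1 *: x) = 1.
Proof.
move=> t0; have c0 : {for (0 : 'rV[R]_m), continuous (fun x : 'rV[R]_m => N2 (t^-1 *: x))}.
  by apply: sm_cont; apply: sm_N2; apply: sm_scale; [exact: sm_cst|exact: sm_id].
have H : N2 (t^-1 *: (0 : 'rV[R]_m)) < 1 by rewrite scaler0 N20.
by apply: filterS (near_ltr c0 H) => x x1; rewrite cut1// ltW.
Qed.

Lemma cut_scaled0 m (t : R) (x : 'rV[R]_m) : 0 < t -> 2 * t <= `|x| -> cut (t^-1 *: x) = 0.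
Proof.
by move=> t0 tx; apply: cut0_norm; rewrite normrZ gtr0_norm ?invr_gt0// mulrC ler_pdivlMr.
Qed.

Lemma sm_cut_scaled m (t : R) (x : 'rV[R]_m) : sm (fun y : 'rV[R]_m => cut (t^-1 *: y)) x.
Proof.
apply: (@sm_compR _ _ _ (fun y : 'rV[R]_m => t^-1 *: y) (@cut m)); last exact: sm_cut.
by apply: sm_scale; [exact: sm_cst|exact: sm_id].
Qed.

Lemma sm_cut_mul m n (t : R) (w : 'rV[R]_m -> 'rV[R]_n) : 0 < t ->
  (forall x, `|x| <= 3 * t -> sm w x) -> forall x, sm (fun y => cut (t^-1 *: y) *: w y) x.
Proof.
move=> t0 sw x; have [xt|xt] := leP `|x| (3 * t).
  by apply: sm_scale; [exact: sm_cut_scaled|exact: sw].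
apply: sm_near_eq (sm_cst (0 : 'rV[R]_n) x).
have xt2 : 2 * t < `|x| by move: xt t0; lra.
by apply: filterS (near_gtr (norm_cont (x := x)) xt2) => y yt; rewrite cut_scaled0 ?scale0r// ltW.
Qed.

(** The difference [w = g - id] has zero differential at [0], so its Lipschitz constant on a small
    ball is as small as desired, and multiplication by a cutoff at the scale of that ball keeps it
    below [1/2]. *)
Lemma germ_extension m (g : 'rV[R]_m -> 'rV[R]_m) (e : R) : 0 < e ->
  sm g 0 -> g 0 = 0 -> 'J g 0 = 1%:M ->
  exists u : 'rV[R]_m -> 'rV[R]_m, [/\ forall x y, `|u x - u y| <= 2^-1 * `|x - y|,
    forall x, sm u x, (\forall x \near (0 : 'rV[R]_m), x + u x = g x) & forall x, e <= `|x| -> u x = 0].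
Proof.
move=> e0 sg g0 Jg; have [L L0 HL] := cut_lipschitz m.
pose w (x : 'rV[R]_m) := g x - x.
have sw : sm w 0 by apply: sm_subv => //; exact: sm_id.
have w0 : w 0 = 0 by rewrite /w g0 subr0.
have Jw : 'J w 0 = 0.
  have sN : sm (fun x : 'rV[R]_m => - x) 0 by apply: sm_oppv; exact: sm_id.
  rewrite /w (jacobian_add sg sN) Jg.
  have -> : 'J (fun x : 'rV[R]_m => - x) 0 = - 1%:M.
    rewrite -(jacobian_mulmx (- 1%:M) (0 : 'rV[R]_m)); apply: jacobian_near_eq => //.
    by apply: near_all => x; rewrite mulmxN mulmx1.
  by rewrite subrr.
(* Cutting off costs the factor [2 (L + 1)], so this [d] leads to the constant [1/2]. *)
pose d := (4 * (L + 1))^-1.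
have L1 : 0 < L + 1 by rewrite ltr_wpDl.
have d0 : 0 < d by rewrite invr_gt0 mulr_gt0.
have [r r0 [swr wr]] := small_jacobian_lipschitz d0 sw Jw w0.
(* [3 t <= r] keeps the support of the cutoff where [w] is controlled, and [3 t <= e] puts it inside
   the ball of radius [e]. *)
pose t := Num.min (r / 3) (e / 3).
have t0 : 0 < t by rewrite lt_min !divr_gt0.
have tr : 3 * t <= r by rewrite /t; case: (leP (r/3) (e/3)); lra.
have te : 3 * t <= e by rewrite /t; case: (leP (r/3) (e/3)); lra.
exists (fun x => cut (t^-1 *: x) *: w x); split.
- move=> x y.
  have H := @cut_mul_lipschitz m m L (2 * d) t w L0 t0 _ HL _ _ x y.
  apply: (le_trans (H _ _ _)).
  + by rewrite mulr_ge0// ltW.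
  + move=> z zt; have := wr z 0; rewrite w0 !subr0 normr0 => /(_ _ _)/le_trans; apply.
    * by move: zt tr t0; lra.
    * exact: ltW.
    * by rewrite (_ : 2 * d * t = d * (2 * t)) ?ler_wpM2l ?(ltW d0)//; ring.
  + move=> z z' zt zt'; apply: le_trans (wr _ _ _ _) _; try by move: zt zt' tr t0; lra.
    by rewrite ler_wpM2r// ler_peMl ?(ltW d0)//; lra.
  + rewrite ler_wpM2r// /d (_ : 2 * _ * _ = 2^-1)//; field.
    by rewrite gt_eqF.
- by apply: sm_cut_mul => // x xt; apply: swr; exact: le_trans tr.
- by apply: filterS (cut_scaled1 m t0) => x ->; rewrite scale1r addrC subrK.
- by move=> x xe; rewrite cut_scaled0 ?scale0r//; move: xe te t0; lra.
Qed.

(** Affine maps [T] at the source and [S] at the target turn [f] into a germ [F] fixing [0] with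
    Jacobian [1]. Such a germ extends to a small perturbation of the identity, which has a global
    inverse [k]; transported back by [T] and [S], it is the local inverse. *)
Theorem inverse_function m (f : 'rV[R]_m -> 'rV[R]_m) (x0 : 'rV[R]_m) :
  sm f x0 -> 'J f x0 \in unitmx ->
  exists g : 'rV[R]_m -> 'rV[R]_m, [/\ sm g (f x0), g (f x0) = x0,
    \forall x \near x0, g (f x) = x & \forall y \near f x0, f (g y) = y].
Proof.
move=> sf Jf; set J := 'J f x0 in Jf.
pose T (v : 'rV[R]_m) := x0 + v.
have sT v : sm T v by apply: sm_addv; [exact: sm_cst|exact: sm_id].
have T0 : T 0 = x0 by rewrite /T addr0.
have JT : 'J T 0 = 1%:M by rewrite /T (jacobian_add (sm_cst _ _) (sm_id _)) jacobian_cst jacobian_id add0r.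
pose S (y : 'rV[R]_m) := (y - f x0) *m invmx J.
have sS y : sm S y by apply: sm_mulmx; apply: sm_subv; [exact: sm_id|exact: sm_cst].
have JS y : 'J S y = invmx J.
  have sB : sm (fun y : 'rV[R]_m => y - f x0) y by apply: sm_subv; [exact: sm_id|exact: sm_cst].
  rewrite /S (jacobian_comp (g := fun z => z *m invmx J) sB); last by apply: sm_mulmx; exact: sm_id.
  by rewrite jacobian_mulmx (jacobian_add (sm_id _) (sm_cst _ _)) jacobian_cst jacobian_id addr0 mul1mx.
pose F v := S (f (T v)).
have sfT : sm (fun v => f (T v)) 0 by apply: sm_comp => //; rewrite T0.
have sF : sm F 0 by exact: sm_comp.
have F0 : F 0 = 0 by rewrite /F T0 /S subrr mul0mx.
have JF : 'J F 0 = 1%:M.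
  rewrite (jacobian_comp sfT (sS _)) JS (jacobian_comp (sT 0)) T0// JT mul1mx.
  exact: mulmxV.
have [u [uL su uF _]] := germ_extension ltr01 sF F0 JF.
have [k [hk kh sk]] := perturbation uL su.
have k0 : k 0 = 0.
  have E : 0 + u 0 = F 0 := nbhs_singleton uF.
  by rewrite -[X in k X]F0 -E kh.
have S0 : S (f x0) = 0 by rewrite /S subrr mul0mx.
exists (fun y => T (k (S y))); split.
- have skS : sm (fun y => k (S y)) (f x0) by apply: sm_comp.
  exact: (sm_comp skS (sT _)).
- by rewrite S0 k0.
- pose B (x : 'rV[R]_m) : 'rV[R]_m := x - x0.
  have c0 : {for x0, continuous B}.
    by apply: (@sm_cont _ _ _ B); apply: sm_subv; [exact: sm_id|exact: sm_cst].
  have H : \forall x \near x0, B x + u (B x) = F (B x).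
    have HP : \forall z \near B x0, z + u z = F z by rewrite /B subrr.
    exact: (c0 _ HP).
  apply: filterS H => x E.
  rewrite (_ : S (f x) = F (B x)); last by rewrite /F /T /B [x0 + _]addrC subrK.
  by rewrite -E kh /T /B addrC subrK.
- have c0 : {for f x0, continuous (fun y : 'rV[R]_m => k (S y))}.
    by apply: (@sm_cont _ _ _ (fun y => k (S y))); apply: sm_comp.
  have : \forall y \near f x0, k (S y) + u (k (S y)) = F (k (S y)).
    have HP : \forall z \near k (S (f x0)), z + u z = F z by rewrite S0 k0.
    exact: (c0 _ HP).
  apply: filterS => y; rewrite hk /F {1 2}/S => /(congr1 (mulmx ^~ J)).
  by rewrite !mulmxKV// => /addIr.
Qed.

End Cutoff.

(** * Smooth maps, immersions and orientations on manifolds *)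

Section Charts.
Context {R : realType} {n : nat} {T : topologicalType}.
Implicit Types (a : chart R n T) (x : T).

Lemma chart_near_dom a x : chart_dom a x -> \forall y \near x, chart_dom a y.
Proof. by move=> ax; apply: open_nbhs_nbhs; split=> //; exact: chart_dom_open. Qed.

Lemma chart_near_cod a x : chart_dom a x -> \forall y \near a x, chart_cod a y.
Proof.
by move=> ax; apply: open_nbhs_nbhs; split; [exact: chart_cod_open|exists x].
Qed.

Lemma chart_codK a y : chart_cod a y -> a (chart_inv a y) = y /\ chart_dom a (chart_inv a y).
Proof. by move=> [x ax <-]; rewrite chart_mapK. Qed.

Lemma chart_inv_near a x (P : T -> Prop) : chart_dom a x -> (\forall y \near x, P y) ->
  \forall v \near a x, P (chart_inv a v).
Proof.
move=> ax HP.
have H : \forall y \near chart_inv a (a x), P y by rewrite chart_mapK.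
by apply: (chart_inv_cont (y := a x)) H; exists x.
Qed.

Lemma chart_map_near a x (P : 'rV[R]_n -> Prop) : chart_dom a x -> (\forall v \near a x, P v) ->
  \forall y \near x, P (a y).
Proof. by move=> ax HP; exact: (chart_map_cont ax). Qed.

Lemma chart_image_open a (P : set T) : (forall x, chart_dom a x -> P x -> \forall y \near x, P y) ->
  open (a @` (chart_dom a `&` P)).
Proof.
move=> HP; rewrite openE => _ [x [ax Px] <-]; rewrite /interior.
apply: filterS2 (chart_near_cod ax) (chart_inv_near ax (HP _ ax Px)) => v cv Pv.
by exists (chart_inv a v); have [] := chart_codK cv.
Qed.

End Charts.

Section Manifolds.
Context {R : realType}.

(** Continuity is a separate clause: a chart is a total function with arbitrary values off its
    domain, so smoothness of the chart expression would not prevent [f] from leaving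
    [chart_dom b]. *)
Definition msm m n (M : manifold R m) (N : manifold R n) (f : M -> N) (x : M) : Prop :=
  {for x, continuous f} /\ forall a b, atlas a -> atlas b -> chart_dom a x ->
    chart_dom b (f x) -> sm (fun v => b (f (chart_inv a v))) (a x).

Lemma atlas_at n (M : manifold R n) (x : M) : exists a : chart R n M, atlas a /\ chart_dom a x.
Proof. by have [a ? ?] := atlas_cover x; exists a. Qed.

Lemma transition_sm n (M : manifold R n) (a b : chart R n M) (x : M) : atlas a -> atlas b ->
  chart_dom a x -> chart_dom b x -> sm (fun v => b (chart_inv a v)) (a x).
Proof.
move=> Aa Ab ax bx; have := atlas_compat Aa Ab.
rewrite Coo_onP; first by apply; exists x.
by apply: chart_image_open => y _; exact: chart_near_dom.
Qed.

Lemma smooth_onP m n (M : manifold R m) (N : manifold R n) (U : set M) (f : M -> N) : open U ->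
  smooth_on U f <-> forall x, U x -> msm f x.
Proof.
move=> oU; have nU x : U x -> \forall y \near x, U y by move=> Ux; exact: open_nbhs_nbhs.
have oP (a : chart R m M) (b : chart R n N) : (forall x, U x -> {for x, continuous f}) ->
    open (a @` (chart_dom a `&` U `&` f @^-1` chart_dom b)).
  move=> cf; rewrite -setIA; apply: chart_image_open => x _ [Ux bx].
  have : \forall y \near x, chart_dom b (f y) by exact: (cf x Ux) (chart_near_dom bx).
  by apply: filterS2 (nU _ Ux).
split=> [[cf sf] x Ux|sf].
  split; first exact: cf.
  by move=> a b Aa Ab ax bx; have /(Coo_onP _ (oP a b cf)) := sf a b Aa Ab; apply; exists x.
have cf x : U x -> {for x, continuous f} by move=> /sf[].
split=> // a b Aa Ab; apply/(Coo_onP _ (oP a b cf)) => _ [x [[ax Ux] bx] <-].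
by have [_] := sf x Ux; exact.
Qed.

Lemma msmP m n (M : manifold R m) (N : manifold R n) (f : M -> N) (x : M) a b :
  {for x, continuous f} -> atlas a -> atlas b -> chart_dom a x ->
  chart_dom b (f x) -> sm (fun v => b (f (chart_inv a v))) (a x) -> msm f x.
Proof.
move=> cf Aa Ab ax bx sf; split=> // a' b' Aa' Ab' ax' bx'.
have s1 := transition_sm Aa' Aa ax' ax.
have s2 := transition_sm Ab Ab' bx bx'.
have E1 : a (chart_inv a' (a' x)) = a x by rewrite chart_mapK.
have s3 : sm (fun v => b (f (chart_inv a (a (chart_inv a' v))))) (a' x).
  by apply: (sm_comp (f := fun v => a (chart_inv a' v)) (g := fun w => b (f (chart_inv a w)))) => //; rewrite E1.
have s4 := sm_comp s3 (g := fun w => b' (chart_inv b w)).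
apply: sm_near_eq (s4 _); last by rewrite chart_mapK// chart_mapK.
have n1 : \forall y \near x, chart_dom b (f y) by exact: cf (chart_near_dom bx).
apply: filterS2 (chart_inv_near ax' n1) (chart_inv_near ax' (chart_near_dom ax)) => v bv av.
by rewrite chart_mapK// chart_mapK.
Qed.

Lemma msm_near_eq m n (M : manifold R m) (N : manifold R n) (f g : M -> N) (x : M) :
  (\forall y \near x, f y = g y) -> msm f x -> msm g x.
Proof.
move=> fg [cf sf]; have [a [Aa ax]] := atlas_at x; have [b [Ab bx]] := atlas_at (f x).
have fgx : f x = g x := nbhs_singleton fg.
have cg : {for x, continuous g} by exact: near_eq_continuous cf.
apply: (@msmP _ _ _ _ _ _ a b) => //; first by rewrite -fgx.
apply: sm_near_eq (sf a b Aa Ab ax bx).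
by apply: filterS (chart_inv_near ax fg) => v ->.
Qed.

(** Continuity at the nearby points has to be recovered: there [f] takes its values in the domain of
    [b], and it is its chart expression preceded by [a] and followed by [chart_inv b]. *)
Lemma msm_near m n (M : manifold R m) (N : manifold R n) (f : M -> N) (x : M) :
  msm f x -> \forall y \near x, msm f y.
Proof.
move=> [cf sf]; have [a [Aa ax]] := atlas_at x; have [b [Ab bx]] := atlas_at (f x).
have sab := sf a b Aa Ab ax bx.
have n1 : \forall y \near x, chart_dom b (f y) by exact: cf (chart_near_dom bx).
have n2 := chart_map_near ax (sm_near sab).
apply: filterS3 (near_join n1) n2 (near_join (chart_near_dom ax)) => y nby say nay.
have ay := nbhs_singleton nay; have bfy := nbhs_singleton nby.
apply: (@msmP _ _ _ _ _ _ a b) => //.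
have c1 : {for y, continuous (fun z => b (f (chart_inv a (a z))))}.
  apply: (@continuous_comp _ _ _ a (fun v => b (f (chart_inv a v)))).
    exact: chart_map_cont.
  exact: sm_cont say.
have c2 : {for y, continuous (fun z => chart_inv b (b (f (chart_inv a (a z)))))}.
  apply: (@continuous_comp _ _ _ (fun z => b (f (chart_inv a (a z)))) (chart_inv b)) => //.
  by rewrite chart_mapK//; apply: chart_inv_cont; exists (f y).
apply: near_eq_continuous c2.
by apply: filterS2 nay nby => z az bz; rewrite chart_mapK// chart_mapK.
Qed.

Lemma msm_cont m n (M : manifold R m) (N : manifold R n) (f : M -> N) (x : M) :
  msm f x -> {for x, continuous f}.
Proof. by case. Qed.

Lemma msm_comp m n p (M : manifold R m) (N : manifold R n) (P : manifold R p)
    (f : M -> N) (g : N -> P) (x : M) :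
  msm f x -> msm g (f x) -> msm (fun y => g (f y)) x.
Proof.
move=> [cf sf] [cg sg]; have [a [Aa ax]] := atlas_at x; have [b [Ab bx]] := atlas_at (f x).
have [c [Ac cx]] := atlas_at (g (f x)).
apply: (@msmP _ _ _ _ _ _ a c) => //; first exact: continuous_comp cf cg.
have s := sm_comp (sf a b Aa Ab ax bx) (g := fun w => c (g (chart_inv b w))).
apply: sm_near_eq (s _); last by rewrite chart_mapK//; exact: sg.
have n1 : \forall y \near x, chart_dom b (f y) by exact: cf (chart_near_dom bx).
by apply: filterS (chart_inv_near ax n1) => v bv; rewrite chart_mapK.
Qed.

Lemma msm_id n (M : manifold R n) (x : M) : msm (fun y : M => y) x.
Proof.
have [a [Aa ax]] := atlas_at x; apply: (@msmP _ _ _ _ _ _ a a) => //.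
exact: transition_sm.
Qed.

Lemma msm_euclid m n (f : euclidean R m -> euclidean R n) (x : euclidean R m) :
  msm f x <-> sm (f : 'rV[R]_m -> 'rV[R]_n) x.
Proof.
split=> [[_ sf]|sf]; first exact: (sf (@id_chart R m) (@id_chart R n)).
by apply: (@msmP m n (euclidean R m) (euclidean R n) f x (@id_chart R m) (@id_chart R n)) => //; exact: sm_cont sf.
Qed.

Lemma msm_chart n (M : manifold R n) (a : chart R n M) (x : M) : atlas a -> chart_dom a x ->
  msm (a : M -> euclidean R n) x.
Proof.
move=> Aa ax; apply: (@msmP n n M (euclidean R n) a x a (@id_chart R n)) => //; first exact: chart_map_cont.
apply: sm_near_eq (sm_id _).
by apply: filterS (chart_near_cod ax) => v cv; have [-> _] := chart_codK cv.
Qed.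

Lemma msm_chart_inv n (M : manifold R n) (a : chart R n M) (v : euclidean R n) : atlas a ->
  chart_cod a v -> msm (chart_inv a : euclidean R n -> M) v.
Proof.
move=> Aa av; have [aK adom] := chart_codK av.
apply: (@msmP n n (euclidean R n) M (chart_inv a) v (@id_chart R n) a) => //; first exact: chart_inv_cont.
apply: sm_near_eq (sm_id _).
have := chart_near_cod adom; rewrite aK.
by apply: filterS => w cw; have [-> _] := chart_codK cw.
Qed.

(* Immersions and local diffeomorphisms are expressed by smooth local inverses,
   which compose without computing any derivative. *)
Definition imm m n (M : manifold R m) (N : manifold R n) (f : M -> N) (x : M) : Prop :=
  msm f x /\ exists g : N -> M, msm g (f x) /\ \forall y \near x, g (f y) = y.

Definition ldf m n (M : manifold R m) (N : manifold R n) (f : M -> N) (x : M) : Prop :=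
  msm f x /\ exists g : N -> M, [/\ msm g (f x), \forall y \near x, g (f y) = y &
    \forall z \near f x, f (g z) = z].

Lemma ldf_msm m n (M : manifold R m) (N : manifold R n) (f : M -> N) (x : M) : ldf f x -> msm f x.
Proof. by case. Qed.

Lemma ldf_cont m n (M : manifold R m) (N : manifold R n) (f : M -> N) (x : M) :
  ldf f x -> {for x, continuous f}.
Proof. by case=> -[]. Qed.

Lemma ldf_imm m n (M : manifold R m) (N : manifold R n) (f : M -> N) (x : M) : ldf f x -> imm f x.
Proof. by move=> [sf [g [sg gf _]]]; split=> //; exists g. Qed.

Lemma ldf_sym m n (M : manifold R m) (N : manifold R n) (f : M -> N) (g : N -> M) (x : M) :
  msm f x -> msm g (f x) -> (\forall y \near x, g (f y) = y) ->
  (\forall z \near f x, f (g z) = z) -> ldf g (f x).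
Proof.
move=> sf sg gf fg; have gfx : g (f x) = x := nbhs_singleton gf.
by split=> //; exists f; split; rewrite ?gfx.
Qed.

Lemma ldf_near_eq m n (M : manifold R m) (N : manifold R n) (f g : M -> N) (x : M) :
  (\forall y \near x, f y = g y) -> ldf f x -> ldf g x.
Proof.
move=> fg [sf [h [sh hf fh]]]; have fgx : f x = g x := nbhs_singleton fg.
split; first exact: msm_near_eq sf.
exists h; rewrite -fgx; split=> //.
  by apply: filterS2 fg hf => y ->.
have hfx : h (f x) = x := nbhs_singleton hf.
have n1 : \forall z \near h (f x), f z = g z by rewrite hfx.
have n2 : \forall z \near f x, f (h z) = g (h z) by exact: (msm_cont sh) n1.
by apply: filterS2 n2 fh => z ->.
Qed.

Lemma imm_near_eq m n (M : manifold R m) (N : manifold R n) (f g : M -> N) (x : M) :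
  (\forall y \near x, f y = g y) -> imm f x -> imm g x.
Proof.
move=> fg [sf [h [sh hf]]]; have fgx : f x = g x := nbhs_singleton fg.
split; first exact: msm_near_eq sf.
by exists h; rewrite -fgx; split=> //; apply: filterS2 fg hf => y ->.
Qed.

Lemma ldf_near m n (M : manifold R m) (N : manifold R n) (f : M -> N) (x : M) :
  ldf f x -> \forall y \near x, ldf f y.
Proof.
move=> [sf [g [sg gf fg]]].
have n1 : \forall y \near x, msm g (f y) by exact: (msm_cont sf) (msm_near sg).
have n2 : \forall y \near x, \forall z \near f y, f (g z) = z by exact: (msm_cont sf) (near_join fg).
apply: filterS2 (filterI (msm_near sf) n1) (filterI (near_join gf) n2) => y [sfy sgy] [gfy fgy].
by split=> //; exists g.
Qed.

Lemma imm_comp m n p (M : manifold R m) (N : manifold R n) (P : manifold R p)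
    (f : M -> N) (g : N -> P) (x : M) :
  imm f x -> imm g (f x) -> imm (fun y => g (f y)) x.
Proof.
move=> [sf [f' [sf' ff]]] [sg [g' [sg' gg]]]; split; first exact: msm_comp.
have gfx : g' (g (f x)) = f x := nbhs_singleton gg.
exists (fun z => f' (g' z)); split; first by apply: msm_comp => //; rewrite gfx.
have n1 : \forall y \near x, g' (g (f y)) = f y by exact: (msm_cont sf) gg.
by apply: filterS2 n1 ff => y ->.
Qed.

Lemma ldf_comp m n p (M : manifold R m) (N : manifold R n) (P : manifold R p)
    (f : M -> N) (g : N -> P) (x : M) :
  ldf f x -> ldf g (f x) -> ldf (fun y => g (f y)) x.
Proof.
move=> [sf [f' [sf' ff fi]]] [sg [g' [sg' gg gi]]]; split; first exact: msm_comp.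
have gfx : g' (g (f x)) = f x := nbhs_singleton gg.
exists (fun z => f' (g' z)); split; first by apply: msm_comp => //; rewrite gfx.
  have n1 : \forall y \near x, g' (g (f y)) = f y by exact: (msm_cont sf) gg.
  by apply: filterS2 n1 ff => y ->.
have n0 : \forall w \near g' (g (f x)), f (f' w) = w by rewrite gfx.
have n1 : \forall z \near g (f x), f (f' (g' z)) = g' z by exact: (msm_cont sg') n0.
by apply: filterS2 n1 gi => z ->.
Qed.

Lemma ldf_id n (M : manifold R n) (x : M) : ldf (fun y : M => y) x.
Proof.
by split; [exact: msm_id|exists (fun y => y); split; [exact: msm_id|exact: near_all|exact: near_all]].
Qed.

Lemma ldf_chart n (M : manifold R n) (a : chart R n M) (x : M) : atlas a -> chart_dom a x ->
  ldf (a : M -> euclidean R n) x.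
Proof.
move=> Aa ax; split; first exact: msm_chart.
exists (chart_inv a); split; first by apply: msm_chart_inv => //; exists x.
  by apply: filterS (chart_near_dom ax) => y; exact: chart_mapK.
by apply: filterS (chart_near_cod ax) => v /chart_codK[].
Qed.

Lemma ldf_chart_inv n (M : manifold R n) (a : chart R n M) (v : euclidean R n) : atlas a ->
  chart_cod a v -> ldf (chart_inv a : euclidean R n -> M) v.
Proof.
move=> Aa [x ax <-]; have [sa [g [sg ag ga]]] := ldf_chart Aa ax.
apply: (ldf_sym (f := a : M -> euclidean R n)) => //.
- by apply: msm_chart_inv => //; exists x.
- by apply: filterS (chart_near_dom ax) => y; exact: chart_mapK.
- by apply: filterS (chart_near_cod ax) => w /chart_codK[].
Qed.

Lemma ldf_euclid n (f : euclidean R n -> euclidean R n) (x : euclidean R n) :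
  sm (f : 'rV[R]_n -> 'rV[R]_n) x -> 'J (f : 'rV[R]_n -> 'rV[R]_n) x \in unitmx -> ldf f x.
Proof.
move=> sf Jf; have [g [sg gfx gf fg]] := inverse_function sf Jf.
by split; [exact/msm_euclid|exists g; split=> //; exact/msm_euclid].
Qed.

Lemma ldf_jacobian n (M N : manifold R n) (f : M -> N) (x : M) a b : msm f x ->
  atlas a -> atlas b -> chart_dom a x -> chart_dom b (f x) ->
  'J (fun v => b (f (chart_inv a v))) (a x) \in unitmx -> ldf f x.
Proof.
move=> [cf sf] Aa Ab ax bx Jf.
have l1 := ldf_chart Aa ax.
have l2 := @ldf_euclid n (fun v => b (f (chart_inv a v))) (a x) (sf a b Aa Ab ax bx) Jf.
have l12 := ldf_comp l1 l2.
have l3 : ldf (chart_inv b : euclidean R n -> N) (b (f (chart_inv a (a x)))).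
  by apply: ldf_chart_inv => //; rewrite chart_mapK//; exists (f x).
apply: ldf_near_eq (ldf_comp l12 l3).
have n1 : \forall y \near x, chart_dom b (f y) by exact: cf (chart_near_dom bx).
by apply: filterS2 n1 (chart_near_dom ax) => y bfy ay; rewrite (chart_mapK ay) chart_mapK.
Qed.

Lemma jacobian_left_inverse m n (f : 'rV[R]_m -> 'rV[R]_n) (g : 'rV[R]_n -> 'rV[R]_m) (x : 'rV[R]_m) :
  sm f x -> sm g (f x) -> (\forall y \near x, g (f y) = y) -> 'J f x *m 'J g (f x) = 1%:M.
Proof.
move=> sf sg gf; rewrite -(jacobian_comp sf sg) -(jacobian_id x).
by apply: jacobian_near_eq gf; exact: sm_comp.
Qed.

Lemma imm_row_free m n (M : manifold R m) (N : manifold R n) (f : M -> N) (x : M) a b : imm f x ->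
  atlas a -> atlas b -> chart_dom a x -> chart_dom b (f x) ->
  row_free ('J (fun v => b (f (chart_inv a v))) (a x)).
Proof.
move=> [[cf sf] [g [[cg sg] gf]]] Aa Ab ax bx.
have gfx : g (f x) = x := nbhs_singleton gf.
have fE : chart_inv a (a x) = x by rewrite chart_mapK.
have s2 := sg b a Ab Aa bx; rewrite gfx in s2.
have E := @jacobian_left_inverse _ _ (fun v => b (f (chart_inv a v))) (fun w => a (g (chart_inv b w))) (a x).
apply/row_freeP; eexists; apply: E.
- exact: sf.
- by rewrite fE; exact: s2.
have n1 : \forall y \near x, chart_dom b (f y) by exact: cf (chart_near_dom bx).
apply: filterS3 (chart_inv_near ax n1) (chart_inv_near ax gf) (chart_near_cod ax) => v bv gv cv.
by rewrite chart_mapK// gv; have [] := chart_codK cv.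
Qed.

Lemma ldf_unit n (M N : manifold R n) (f : M -> N) (x : M) a b : ldf f x ->
  atlas a -> atlas b -> chart_dom a x -> chart_dom b (f x) ->
  'J (fun v => b (f (chart_inv a v))) (a x) \in unitmx.
Proof. by move=> /ldf_imm fx Aa Ab ax bx; rewrite -row_free_unit; exact: imm_row_free. Qed.

End Manifolds.

(** * Open embeddings and embeddings of compact manifolds *)

Section OpenEmbeddings.
Context {R : realType}.

Lemma open_near (T : topologicalType) (A : set T) : (forall x, A x -> \forall y \near x, A y) -> open A.
Proof. by move=> H; rewrite openE => x Ax; exact: H. Qed.

Lemma near_open (T : topologicalType) (A : set T) (x : T) : open A -> A x -> \forall y \near x, A y.
Proof. by move=> oA Ax; exact: open_nbhs_nbhs. Qed.

(** A diffeomorphism onto an open image. Openness of the image and smoothness of the inverse follow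
    from these clauses, in [ldf_open_image] and [oemb_inv]. *)
Definition oemb m n (M : manifold R m) (N : manifold R n) (U : set M) (f : M -> N) : Prop :=
  [/\ open U, forall x, U x -> ldf f x & forall x y, U x -> U y -> f x = f y -> x = y].

Lemma ldf_image_near m n (M : manifold R m) (N : manifold R n) (f : M -> N) (x : M) (U : set M) :
  ldf f x -> (\forall y \near x, U y) -> \forall z \near f x, (f @` U) z.
Proof.
move=> [sf [g [sg gf fg]]] nU; have gfx : g (f x) = x := nbhs_singleton gf.
have n0 : \forall y \near g (f x), U y by rewrite gfx.
have n1 : \forall z \near f x, U (g z) by exact: (msm_cont sg) n0.
by apply: filterS2 n1 fg => z Uz fgz; exists (g z).
Qed.

Lemma ldf_open_image m n (M : manifold R m) (N : manifold R n) (f : M -> N) (V : set M) :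
  open V -> (forall x, V x -> ldf f x) -> open (f @` V).
Proof.
move=> oV lf; apply: open_near => _ [x Vx <-].
by apply: ldf_image_near; [exact: lf|exact: near_open].
Qed.

Lemma oemb_sub m n (M : manifold R m) (N : manifold R n) (U V : set M) (f : M -> N) :
  oemb U f -> open V -> V `<=` U -> oemb V f.
Proof.
move=> [oU lf injf] oV VU; split=> // [x /VU|x y /VU Ux /VU Uy]; [exact: lf|exact: injf].
Qed.

Lemma oemb_comp m n p (M : manifold R m) (N : manifold R n) (P : manifold R p)
    (U : set M) (V : set N) (f : M -> N) (g : N -> P) :
  oemb U f -> oemb V g -> (forall x, U x -> V (f x)) -> oemb U (fun x => g (f x)).
Proof.
move=> [oU lf injf] [oV lg injg] UV; split=> // [x Ux|x y Ux Uy].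
  by apply: ldf_comp; [exact: lf|apply: lg; exact: UV].
by move/(injg _ _ (UV _ Ux) (UV _ Uy)); exact: injf.
Qed.

(** The inverse is a choice function, with default value [x0] off the image; near a point of the
    image it coincides with the smooth local inverse. *)
Lemma oemb_inv m n (M : manifold R m) (N : manifold R n) (x0 : M) (U : set M) (f : M -> N) :
  oemb U f -> exists g : N -> M, (forall x, U x -> g (f x) = x) /\ oemb (f @` U) g.
Proof.
move=> [oU lf injf]; pose g z := xget x0 [set x | U x /\ f x = z].
have gK x : U x -> g (f x) = x.
  move=> Ux; rewrite /g; case: xgetP => [y _ [Uy fyx]|/(_ x)]; first exact: injf fyx.
  by move=> H; exfalso; exact: H.
exists g; split=> //; split; first exact: ldf_open_image.
  move=> _ [x Ux <-]; have [sf [h [sh hf fh]]] := lf _ Ux.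
  have hfx : h (f x) = x := nbhs_singleton hf.
  have lh : ldf h (f x) by apply: (@ldf_sym _ _ _ _ _ f).
  apply: ldf_near_eq lh.
  have n0 : \forall y \near h (f x), U y by rewrite hfx; exact: near_open.
  have n1 : \forall z \near f x, U (h z) by exact: (msm_cont sh) n0.
  by apply: filterS2 n1 fh => z Uz fhz; rewrite -{2}fhz gK.
by move=> _ _ [x Ux <-] [y Uy <-]; rewrite !gK// => ->.
Qed.

(** In equal dimensions an injective Jacobian is invertible and the inverse function theorem
    applies. Conversely, local diffeomorphisms are open maps, which yields the topological
    clause. *)
Lemma oemb_smooth_embedding n (M N : manifold R n) (U : set M) (f : M -> N) :
  open U -> smooth_embedding_on U f <-> oemb U f.
Proof.
move=> oU; split=> [[[sf rf] injf _]|[_ lf injf]].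
  have sfx := (smooth_onP f oU).1 sf; split=> // x Ux.
  have [a [Aa ax]] := atlas_at x; have [b [Ab bx]] := atlas_at (f x).
  apply: (@ldf_jacobian _ _ _ _ f x a b) => //; first exact: sfx.
  by rewrite -row_free_unit; exact: (rf x a b).
split=> //; first split.
- by apply/smooth_onP => // x Ux; exact: ldf_msm (lf x Ux).
- by move=> x a b Ux Aa ax Ab bx; apply: imm_row_free => //; exact: ldf_imm (lf x Ux).
- move=> V oV; exists (f @` (U `&` V)).
    by apply: ldf_open_image; [exact: openI|move=> x [/lf]].
  apply/seteqP; split=> x; first by move=> [Ux Vx]; split=> //; exists x.
  by move=> [Ux [y [Uy Vy] fyx]]; split=> //; rewrite -(injf _ _ Uy Ux fyx).
Qed.

(** The image of a closed set is compact, hence closed in a Hausdorff space; its complement is the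
    open set demanded by the topological clause. *)
Lemma compact_smooth_embedding m n (M : manifold R m) (N : manifold R n) (f : M -> N) :
  compact [set: M] -> (forall x, imm f x) -> injective f -> smooth_embedding f.
Proof.
move=> cM lf injf; split.
- split; first by apply/smooth_onP => [|x _]; [exact: openT|have [] := lf x].
  by move=> x a b _ Aa ax Ab bx; exact: imm_row_free.
- by move=> x y _ _; exact: injf.
- move=> V oV; exists (~` (f @` (~` V))).
    rewrite openC; apply: compact_closed; first exact: manifold_hausdorff.
    apply: continuous_compact.
      by apply: continuous_subspaceT => x; have [[]] := lf x.
    by apply: (subclosed_compact _ cM) => //; rewrite closedC.
  rewrite !setTI; apply/seteqP; split=> x /= => [Vx [y Vy /injf yx]|H].
    by apply: Vy; rewrite yx.
  by apply: contrapT => Vx; apply: H; exists x.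
Qed.

End OpenEmbeddings.

(** * Orientation signs of local diffeomorphisms *)

Section Orientations.
Context {R : realType}.

Definition csgn m (M N : manifold R m) (a : chart R m M) (b : chart R m N) (f : M -> N) (x : M) : bool :=
  0 < \det ('J (fun v => b (f (chart_inv a v))) (a x)).

(* e tells whether f preserves (true) or reverses (false) the orientation at x. *)
Definition osign n (M N : oriented_manifold R n) (e : bool) (f : M -> N) (x : M) : Prop :=
  forall a b, atlas a -> atlas b -> chart_dom a x -> chart_dom b (f x) ->
    ((orientation a x == orientation b (f x)) == e) = csgn a b f x.

Lemma orientation_preservingP n (M N : oriented_manifold R n) (U : set M) (f : M -> N) :
  orientation_preserving_on U f <-> forall x, U x -> osign true f x.
Proof.
split=> [H x Ux a b Aa Ab ax bx|H x a b Ux Aa ax Ab bx].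
  by rewrite eqb_id; exact: H.
by rewrite -[LHS]eqb_id; exact: H.
Qed.

Lemma pos_mulE (x y : R) : x != 0 -> y != 0 -> (0 < x * y) = ((0 < x) == (0 < y)).
Proof.
move=> x0 y0; have [xp|xn|xz] := ltgtP 0 x; last by rewrite xz eqxx in x0.
  by rewrite pmulr_rgt0.
rewrite nmulr_rgt0//; have [yp|yn|yz] := ltgtP 0 y => //.
by rewrite yz eqxx in y0.
Qed.

Lemma unitmx_det n (A : 'M[R]_n) : A \in unitmx -> \det A != 0.
Proof. by rewrite unitmxE unitfE. Qed.

Lemma jacobian_chart_comp m n p (M : manifold R m) (N : manifold R n) (P : manifold R p)
    (f : M -> N) (g : N -> P) (x : M) a b c :
  msm f x -> msm g (f x) -> atlas a -> atlas b -> atlas c ->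
  chart_dom a x -> chart_dom b (f x) -> chart_dom c (g (f x)) ->
  'J (fun v => c (g (f (chart_inv a v)))) (a x) =
  'J (fun v => b (f (chart_inv a v))) (a x) *m 'J (fun w => c (g (chart_inv b w))) (b (f x)).
Proof.
move=> [cf sf] [cg sg] Aa Ab Ac ax bx cx.
have s1 := sf a b Aa Ab ax bx; have s2 := sg b c Ab Ac bx cx.
have E : b (f (chart_inv a (a x))) = b (f x) by rewrite chart_mapK.
have s2' : sm (fun w => c (g (chart_inv b w))) (b (f (chart_inv a (a x)))) by rewrite E.
have := jacobian_comp s1 s2'; rewrite E => <-.
apply/esym; apply: jacobian_near_eq (sm_comp s1 s2') _.
have n1 : \forall y \near x, chart_dom b (f y) by exact: cf (chart_near_dom bx).
by apply: filterS (chart_inv_near ax n1) => v bv; rewrite (chart_mapK bv).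
Qed.

Lemma csgn_comp n (M N P : manifold R n) (f : M -> N) (g : N -> P) (x : M) a b c :
  ldf f x -> ldf g (f x) -> atlas a -> atlas b -> atlas c ->
  chart_dom a x -> chart_dom b (f x) -> chart_dom c (g (f x)) ->
  csgn a c (fun y => g (f y)) x = (csgn a b f x == csgn b c g (f x)).
Proof.
move=> lf lg Aa Ab Ac ax bx cx.
rewrite /csgn (jacobian_chart_comp (ldf_msm lf) (ldf_msm lg) Aa Ab Ac ax bx cx) det_mulmx.
have u1 := unitmx_det (ldf_unit lf Aa Ab ax bx).
have u2 := unitmx_det (ldf_unit lg Ab Ac bx cx).
exact: pos_mulE u1 u2.
Qed.

Lemma csgn_id n (M : oriented_manifold R n) (x : M) a b :
  atlas a -> atlas b -> chart_dom a x -> chart_dom b x ->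
  csgn a b (fun y : M => y) x = (orientation a x == orientation b x).
Proof. by move=> Aa Ab ax bx; rewrite (orientation_compat Aa Ab ax bx). Qed.

Lemma csgn_near_eq n (M N : manifold R n) (f g : M -> N) (x : M) a b :
  (\forall y \near x, f y = g y) -> msm f x -> atlas a -> atlas b -> chart_dom a x -> chart_dom b (f x) ->
  csgn a b f x = csgn a b g x.
Proof.
move=> fg [_ sf] Aa Ab ax bx; rewrite /csgn.
have -> // : 'J (fun v => b (f (chart_inv a v))) (a x) = 'J (fun v => b (g (chart_inv a v))) (a x).
apply: jacobian_near_eq; first exact: (sf a b Aa Ab ax bx).
by apply: filterS (chart_inv_near ax fg) => v ->.
Qed.

Lemma near_sign (T : topologicalType) (f : T -> R) (x : T) : {for x, continuous f} -> f x != 0 ->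
  \forall y \near x, (0 < f y) = (0 < f x).
Proof.
move=> cf f0; have [Dp|Dn|De] := ltgtP 0 (f x).
- exact: near_gtr cf Dp.
- by apply: filterS (near_ltr cf Dn) => v Dv; rewrite ltNge ltW.
- by rewrite De eqxx in f0.
Qed.

Lemma csgn_near n (M N : manifold R n) (f : M -> N) (x : M) a b : ldf f x ->
  atlas a -> atlas b -> chart_dom a x -> chart_dom b (f x) ->
  \forall y \near x, csgn a b f y = csgn a b f x.
Proof.
move=> lf Aa Ab ax bx; have [[cf sf] _] := lf; have sF := sf a b Aa Ab ax bx.
apply: (@near_sign _ (fun y => \det ('J (fun v => b (f (chart_inv a v))) (a y)))); last first.
  exact: unitmx_det (ldf_unit lf Aa Ab ax bx).
have sD : sm (fun w => \det ('J (fun v => b (f (chart_inv a v))) w)) (a x).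
  by apply: sm_det => i j; exact: sm_jacobian.
exact: (continuous_comp (chart_map_cont ax) (sm_cont sD)).
Qed.

Opaque csgn.

(** Changing charts multiplies the Jacobian sign by those of two transition maps, and the
    orientations of the charts change by the same signs; hence one pair of charts decides. *)
Lemma osignP n (M N : oriented_manifold R n) (e : bool) (f : M -> N) (x : M) a b : ldf f x ->
  atlas a -> atlas b -> chart_dom a x -> chart_dom b (f x) ->
  ((orientation a x == orientation b (f x)) == e) = csgn a b f x -> osign e f x.
Proof.
move=> lf Aa Ab ax bx + a' b' Aa' Ab' ax' bx'.
have -> := csgn_comp (f := fun y : M => y) (ldf_id x) lf Aa' Aa Ab' ax' ax bx'.
have -> := csgn_comp (g := fun y : N => y) lf (ldf_id (f x)) Aa Ab Ab' ax bx bx'.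
rewrite (csgn_id Aa' Aa ax' ax) (csgn_id Ab Ab' bx bx') => <-.
by move: (orientation a x) (orientation a' x) (orientation b (f x)) (orientation b' (f x)) e => [] [] [] [] [].
Qed.

Lemma osign_exists n (M N : oriented_manifold R n) (f : M -> N) (x : M) : ldf f x ->
  exists e, osign e f x.
Proof.
move=> lf; have [a [Aa ax]] := atlas_at x; have [b [Ab bx]] := atlas_at (f x).
exists ((orientation a x == orientation b (f x)) == csgn a b f x).
apply: (osignP lf Aa Ab ax bx).
by move: (orientation a x) (orientation b (f x)) (csgn a b f x) => [] [] [].
Qed.

(** Equality of booleans is the product of signs, with [true] standing for [+1]; this is
    multiplicativity of the determinant. *)
Lemma osign_comp n (M N P : oriented_manifold R n) (e e' : bool) (f : M -> N) (g : N -> P) (x : M) :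
  ldf f x -> ldf g (f x) -> osign e f x -> osign e' g (f x) -> osign (e == e') (fun y => g (f y)) x.
Proof.
move=> lf lg of_ og; have [a [Aa ax]] := atlas_at x; have [b [Ab bx]] := atlas_at (f x).
have [c [Ac cx]] := atlas_at (g (f x)).
apply: (osignP (ldf_comp lf lg) Aa Ac ax cx).
have -> := csgn_comp lf lg Aa Ab Ac ax bx cx.
rewrite -(of_ a b Aa Ab ax bx) -(og b c Ab Ac bx cx).
by move: (orientation a x) (orientation b (f x)) (orientation c (g (f x))) e e' {of_ og} => [] [] [] [] [].
Qed.

Lemma osign_id n (M : oriented_manifold R n) (x : M) : osign true (fun y : M => y) x.
Proof. by move=> a b Aa Ab ax bx; rewrite eqb_id (csgn_id Aa Ab ax bx). Qed.

Lemma osign_near_eq n (M N : oriented_manifold R n) (e : bool) (f g : M -> N) (x : M) :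
  ldf f x -> (\forall y \near x, f y = g y) -> osign e f x -> osign e g x.
Proof.
move=> lf fg of_ a b Aa Ab ax; have fgx : f x = g x := nbhs_singleton fg.
rewrite -fgx => bx.
exact: (etrans (of_ a b Aa Ab ax bx) (csgn_near_eq fg (ldf_msm lf) Aa Ab ax bx)).
Qed.

Lemma osign_uniq n (M N : oriented_manifold R n) (e e' : bool) (f : M -> N) (x : M) :
  osign e f x -> osign e' f x -> e = e'.
Proof.
have [a [Aa ax]] := atlas_at x; have [b [Ab bx]] := atlas_at (f x).
move=> /(_ a b Aa Ab ax bx) + /(_ a b Aa Ab ax bx) => <-.
by move: (orientation a x) (orientation b (f x)) e e' => [] [] [] [].
Qed.

Lemma osign_inv n (M N : oriented_manifold R n) (e : bool) (f : M -> N) (g : N -> M) (x : M) :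
  ldf f x -> ldf g (f x) -> (\forall y \near x, g (f y) = y) -> osign e f x -> osign e g (f x).
Proof.
move=> lf lg gf of_; have [e' og] := osign_exists lg.
have o1 := osign_comp lf lg of_ og.
have o2 := osign_near_eq (ldf_comp lf lg) gf o1.
by have := osign_uniq o2 (@osign_id _ _ x) => /eqP ->.
Qed.

Lemma negb_eqr (p q e : bool) : ((p == ~~ q) == e) = ((p == q) == ~~ e).
Proof. by case: p; case: q; case: e. Qed.

Lemma osign_opposite n (M N : oriented_manifold R n) (e : bool) (f : M -> N) (x : M) :
  osign e (f : M -> opposite N) x <-> osign (~~ e) f x.
Proof.
split=> H a b Aa Ab ax bx; have := H a b Aa Ab ax bx => /= <-.
  exact/esym/negb_eqr.
exact: negb_eqr.
Qed.

Lemma negb_eql (p q e : bool) : ((~~ p == q) == e) = ((p == q) == ~~ e).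
Proof. by case: p; case: q; case: e. Qed.

Lemma osign_opposite_dom n (M N : oriented_manifold R n) (e : bool) (f : M -> N) (x : M) :
  osign e (f : opposite M -> N) x <-> osign (~~ e) f x.
Proof.
split=> H a b Aa Ab ax bx; have := H a b Aa Ab ax bx => /= <-.
  exact/esym/negb_eql.
exact: negb_eql.
Qed.

Lemma osign_near n (M N : oriented_manifold R n) (e : bool) (f : M -> N) (x : M) :
  ldf f x -> osign e f x -> \forall y \near x, osign e f y.
Proof.
move=> lf of_; have [a [Aa ax]] := atlas_at x; have [b [Ab bx]] := atlas_at (f x).
have cf := ldf_cont lf.
have n1 : \forall y \near x, chart_dom b (f y) by exact: cf (chart_near_dom bx).
have n2 : \forall y \near x, orientation b (f y) = orientation b (f x).
  exact: cf (orientation_locally_constant Ab bx).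
have n3 := csgn_near lf Aa Ab ax bx.
apply: filterS3 (filterI (ldf_near lf) (chart_near_dom ax)) (filterI n1 n2) (filterI n3 (orientation_locally_constant Aa ax)).
move=> y [lfy ay] [by_ oby] [Dy oay].
apply: (osignP lfy Aa Ab ay by_); rewrite oby oay.
exact: (etrans (of_ a b Aa Ab ax bx) (esym Dy)).
Qed.

(** The set where the sign is [e] is open by [osign_near], and so is its complement, where the
    opposite sign holds. *)
Lemma osign_connected n (M N : oriented_manifold R n) (e : bool) (f : M -> N) (x0 : M) :
  connected [set: M] -> (forall x, ldf f x) -> osign e f x0 -> forall x, osign e f x.
Proof.
move=> cM lf o0; suff E : [set x | osign e f x] = [set: M].
  by move=> x; have : [set: M] x by []; rewrite -E.
apply: cM; first by exists x0.
  exists [set x | osign e f x]; last by rewrite setTI.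
  by apply: open_near => x; exact: osign_near.
exists [set x | osign e f x]; last by rewrite setTI.
rewrite -openC; apply: open_near => x /= Nx.
have [e' oe'] := osign_exists (lf x).
have ee' : e <> e' by move=> ee'; apply: Nx; rewrite ee'.
by apply: filterS (osign_near (lf x) oe') => y oy oy'; apply: ee'; exact: osign_uniq oy' oy.
Qed.

Lemma connected_rV n : connected [set: 'rV[R]_n].
Proof.
have -> : [set: 'rV[R]_n] = \bigcup_(v in setT) ((fun t : R => t *: v) @` `[0%R, 1%R]).
  apply/seteqP; split=> // v _; exists v => //; exists 1; last by rewrite scale1r.
  by rewrite /= in_itv/= ler01 lexx.
apply: bigcup_connected.
  exists 0 => v _; exists 0; last by rewrite scale0r.
  by rewrite /= in_itv/= ler01 lexx.
move=> v _; apply: connected_continuous_connected; first exact/segment_connected.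
by apply: continuous_subspaceT => t; exact: scalel_continuous.
Qed.

Lemma osign_euclid n (e : bool) (f : euclidean R n -> euclidean R n) (x : euclidean R n) :
  osign e f x <-> e = (0 < \det ('J (f : 'rV[R]_n -> 'rV[R]_n) x)).
Proof.
split=> [H|H a b -> -> _ _]; last by rewrite H.
by have := H (@id_chart R n) (@id_chart R n) erefl erefl I I.
Qed.

End Orientations.

(** * Inversion, radial contractions and discs *)

Section Inversion.
Context {R : realType}.

(** The matrix determinant lemma: a block matrix is factored along each of its two diagonal blocks,
    and the determinants are compared. *)
Lemma det_rank1 n (u w : 'rV[R]_n) : \det (1%:M + u^T *m w) = 1 + (w *m u^T) 0 0.
Proof.
pose B : 'M[R]_(1 + n) := block_mx 1%:M (- w) u^T 1%:M.
have E1 : B = block_mx 1%:M 0 u^T 1%:M *m block_mx 1%:M (- w) 0 (1%:M + u^T *m w).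
  rewrite mulmx_block !(mul1mx, mul0mx, mulmx1, mulmx0, addr0, add0r, mulmxN, mulNmx).
  by rewrite [X in block_mx _ _ _ X]addrC addrK.
have E2 : B = block_mx 1%:M (- w) 0 1%:M *m block_mx (1%:M + w *m u^T) 0 u^T 1%:M.
  rewrite mulmx_block !(mul1mx, mul0mx, mulmx1, mulmx0, addr0, add0r, mulmxN, mulNmx).
  by rewrite addrK.
have : \det B = \det B by [].
rewrite {1}E1 E2 !det_mulmx det_lblock det_ublock det_ublock det_lblock !det1 !mul1r !mulr1 => ->.
by rewrite det_mx11 !mxE eqxx.
Qed.

Lemma inversionE n (v : 'rV[R]_n) : inversion v = (N2 v)^-1 *: v. Proof. by []. Qed.

Lemma N2_inversion n (v : 'rV[R]_n) : N2 (inversion v) = (N2 v)^-1.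
Proof.
rewrite inversionE N2Z; have [->|v0] := eqVneq v 0; first by rewrite N20 mulr0 invr0.
by rewrite expr2 -mulrA mulVf ?mulr1// N2_eq0.
Qed.

Lemma inversion0 n : inversion (0 : 'rV[R]_n) = 0.
Proof. by rewrite inversionE scaler0. Qed.

(** The convention [0^-1 = 0] gives [inversion 0 = 0], so the inversion is an involution of the
    whole space, although it is smooth only off [0]. *)
Lemma inversionK n (v : 'rV[R]_n) : inversion (inversion v) = v.
Proof.
have [->|v0] := eqVneq v 0; first by rewrite !inversion0.
by rewrite inversionE N2_inversion invrK inversionE scalerA mulfV ?scale1r// N2_eq0.
Qed.

Lemma inversion_eq0 n (v : 'rV[R]_n) : (inversion v == 0) = (v == 0).
Proof. by rewrite -!N2_eq0 N2_inversion invr_eq0. Qed.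

Lemma sm_inversion n (v : 'rV[R]_n) : v != 0 -> sm (@inversion R n) v.
Proof.
move=> v0; apply: sm_scale; last exact: sm_id.
by apply: sm_inv; [exact: sm_N2 (sm_id v)|rewrite N2_eq0].
Qed.

Lemma derive_N2 n (v : 'rV[R]_n) (i : 'I_n) : 'D_(delta_mx 0 i) (@N2 R n) v = 2 * v 0 i.
Proof.
have dc (j : 'I_n) : derivable (fun y : 'rV[R]_n => y 0 j : R) v (delta_mx 0 i).
  exact: (@ex_derive _ _ _ _ _ _ _ (is_derive_coord j v _)).
rewrite (_ : @N2 R n = \sum_j ((fun y : 'rV[R]_n => y 0 j : R) ^+ 2)); last first.
  by rewrite funeqE => y; rewrite fct_sumE; apply: eq_bigr => j _; rewrite exprfctE.
rewrite derive_sum => [|j]; last exact: derivableX.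
rewrite (bigD1 i)//= big1 ?addr0 => [|j ji]; rewrite deriveX//.
  rewrite (@derive_val _ _ _ _ _ _ _ (is_derive_coord i v _)) mxE !eqxx/= expr1.
  by rewrite /GRing.scale/= mulr1 mulr_natl.
rewrite (@derive_val _ _ _ _ _ _ _ (is_derive_coord j v _)) mxE eqxx/= (negbTE ji).
exact: scaler0.
Qed.

(** Up to the factor [1 / N2 v] this is the reflection in the hyperplane orthogonal to [v]; hence
    the inversion reverses the orientation. *)
Lemma jacobian_inversion n (v : 'rV[R]_n) : v != 0 ->
  'J (@inversion R n) v = (N2 v)^-1 *: (1%:M + (- (2 * (N2 v)^-1) *: v)^T *m v).
Proof.
move=> v0; have N0 : N2 v != 0 by rewrite N2_eq0.
apply/matrixP => i j; rewrite jacobianE; last exact: sm_inversion.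
have dN : derivable (@N2 R n) v (delta_mx 0 i) by apply: sm_derivable; exact: sm_N2 (sm_id v).
have dV : derivable (fun y : 'rV[R]_n => (N2 y)^-1) v (delta_mx 0 i) by exact: derivableV.
have dc : derivable (fun y : 'rV[R]_n => y 0 j : R) v (delta_mx 0 i).
  exact: (@ex_derive _ _ _ _ _ _ _ (is_derive_coord j v _)).
rewrite (_ : (fun y : 'rV[R]_n => _) = (fun y : 'rV[R]_n => (N2 y)^-1) * (fun y : 'rV[R]_n => y 0 j : R)); last first.
  by rewrite funeqE => y; rewrite mxE.
rewrite (deriveM dV dc) (@derive_val _ _ _ _ _ _ _ (is_derive_coord j v _)) (deriveV N0 dN) derive_N2.
rewrite /GRing.scale/= !mxE big_ord1 !mxE eqxx/= [j == i]eq_sym.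
rewrite -exprVn; ring.
Qed.

Lemma det_jacobian_inversion n (v : 'rV[R]_n) : v != 0 ->
  \det ('J (@inversion R n) v) = - (N2 v)^-1 ^+ n.
Proof.
move=> v0; have N0 : N2 v != 0 by rewrite N2_eq0.
rewrite jacobian_inversion// detZ det_rank1.
have -> : (v *m (- (2 * (N2 v)^-1) *: v)^T) 0 0 = - 2.
  rewrite linearZ /= -scalemxAr !mxE (_ : \sum_j _ = N2 v); last first.
    by apply: eq_bigr => j _; rewrite !mxE expr2.
  by rewrite mulNr -mulrA mulVf// mulr1.
by rewrite (_ : 1 - 2 = -1 :> R) ?mulrN1//; ring.
Qed.

Lemma ldf_inversion n (v : euclidean R n) : v != 0 :> 'rV[R]_n ->
  ldf (@inversion R n : euclidean R n -> euclidean R n) v /\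
  osign false (@inversion R n : euclidean R n -> euclidean R n) v.
Proof.
move=> v0; have N0 : 0 < N2 (v : 'rV[R]_n) by rewrite N2_gt0.
have D := det_jacobian_inversion v0.
have Dn : \det ('J (@inversion R n) v) < 0 by rewrite D oppr_lt0 exprn_gt0// invr_gt0.
split; last by apply/osign_euclid; rewrite ltNge ltW.
by apply: ldf_euclid; [exact: sm_inversion|rewrite unitmxE unitfE lt_eqF].
Qed.

End Inversion.

(** * Radial contractions *)

Section Shrinking.
Context {R : realType}.

Lemma sm1_inverse (T S : R -> R) (t d : R) : (\forall s \near t, S (T s) = s) -> sm1 T t ->
  is_derive t (1 : R) T d -> d != 0 -> sm1 S (T t).
Proof.
move=> ST sT dT d0; pose F (w : 'rV[R]_1) : 'rV[R]_1 := const_mx (T (w 0 0)).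
have sF : sm F (const_mx t).
  by apply/sm_rowP => j; apply: sm_near_eq sT; apply: near_all => w; rewrite mxE.
have JF : 'J F (const_mx t) \in unitmx.
  rewrite unitmxE det_mx11 unitfE jacobianE//.
  have -> : (fun w : 'rV[R]_1 => F w 0 0) = (fun w => T (w 0 0)) by rewrite funeqE => w; rewrite mxE.
  have dT' : is_derive ((const_mx t : 'rV[R]_1) 0 0) (1 : R) T d by rewrite mxE.
  by rewrite (@derive_val _ _ _ _ _ _ _ (is_derive_lift 0 dT')).
have [g [sg gF gf fg]] := inverse_function sF JF.
have F0 : F (const_mx t) = const_mx (T t) by rewrite /F mxE.
rewrite F0 in sg gF fg.
have /sm_rowP/(_ 0) sg0 := sg.
apply: sm_near_eq sg0.
have n1 : nbhs (g (const_mx (T t))) (fun w : 'rV[R]_1 => S (T (w 0 0)) = w 0 0).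
  rewrite gF; exact: near_sm1 ST.
have n2 : \forall y \near (const_mx (T t) : 'rV[R]_1), S (T (g y 0 0)) = g y 0 0.
  exact: (sm_cont sg) n1.
apply: filterS2 n2 fg => y E1 E2.
by rewrite -E1 -[in RHS]E2 mxE.
Qed.

Lemma flat_derive (t : R) : exists2 d, 0 <= d & is_derive t (1 : R) (@flat R) d /\ (t <= 0 -> d = 0).
Proof.
exists (flatp ('X^2 * (1 - 1^`())) t); last first.
  split; first by rewrite flatE; exact: is_derive_flatp.
  by move=> t0; rewrite /flatp ltNge t0.
rewrite derivC subr0 mulr1 /flatp; case: ifP => // t0.
by rewrite hornerXn mulr_ge0 ?expR_ge0// exprn_ge0// invr_ge0 ltW.
Qed.

(* b is the factor of a radial diffeomorphism of the ball N2 < rho onto the whole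
   space; it does not depend on the dimension, and c is the factor of its
   inverse. *)
Lemma radial_factors (rho : R) : 0 < rho -> exists (d : R) (b c : R -> R),
  [/\ 0 < d, forall t, t < rho -> sm1 b t, forall s, sm1 c s,
    forall t, t <= d -> b t = 1 /\ c t = 1 &
    [/\ forall t, t < rho -> 0 < b t, forall s, 0 < c s,
      forall t, 0 <= t -> t < rho -> c (t * b t ^+ 2) * b t = 1 &
      forall s, 0 <= s -> s * c s ^+ 2 < rho /\ b (s * c s ^+ 2) * c s = 1]].
Proof.
move=> rho0; pose d := rho / 2.
have d0 : 0 < d by rewrite divr_gt0.
have dr : d < rho by rewrite /d; lra.
(* [b] is [1] up to [d] and tends to infinity at [rho]; the flat numerator makes the junction at [d]
   smooth. *)
pose b t := 1 + flat (t - d) / (rho - t).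
have sb t : t < rho -> sm1 b t.
  move=> tr; apply: sm1_add; first exact: sm1_cst.
  apply: sm1_mul.
    apply: (sm1_comp1 (v := fun t => t - d)); last exact: sm1_flat.
    by apply: sm1_sub; [exact: sm1_id|exact: sm1_cst].
  by apply: sm1_inv; [apply: sm1_sub; [exact: sm1_cst|exact: sm1_id]|rewrite subr_eq0 gt_eqF].
have b1 t : t < rho -> 1 <= b t.
  by move=> tr; rewrite lerDl divr_ge0 ?flat_ge0// subr_ge0 ltW.
have b0 t : t < rho -> 0 < b t by move=> /b1; exact: lt_le_trans.
have bd t : t <= d -> b t = 1 by move=> td; rewrite /b flat0 ?mul0r ?addr0// subr_le0.
have ble s t : s <= t -> t < rho -> b s <= b t.
  move=> st tr; rewrite lerD2l ler_pM ?flat_ge0 ?invr_ge0 ?subr_ge0 ?(le_trans st) ?(ltW tr)//.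
    by rewrite flat_le// lerD2r.
  by rewrite lef_pV2 ?posrE ?subr_gt0 ?(le_lt_trans st)// lerD2l lerN2.
(* The map [v -> b(N2 v) v] acts on [N2] by [T]. Once [T] is known to be an increasing bijection
   from [t < rho] onto the line, with inverse [S], the factor of the inverse map at [s] is
   [1 / b (S s)]. *)
pose T t := t * b t ^+ 2.
have Td t : t <= d -> T t = t by move=> td; rewrite /T bd// expr1n mulr1.
have Tlt s t : s < t -> t < rho -> T s < T t.
  move=> st tr; have [s0|s0] := leP 0 s.
    rewrite /T (@le_lt_trans _ _ (s * b t ^+ 2))//.
      by rewrite ler_wpM2l// ler_sqr ?nnegrE ?(ltW (b0 _ _)) ?ble ?(ltW st)// (lt_trans st).
    by rewrite ltr_pM2r// exprn_gt0// b0.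
  have [t0|t0] := leP 0 t.
    rewrite (@lt_le_trans _ _ 0)//; last by rewrite mulr_ge0// sqr_ge0.
    by rewrite nmulr_rlt0// exprn_gt0// b0// (lt_trans s0).
  by rewrite !Td// ltW// ?(lt_trans t0) ?(lt_trans s0).
have sT t : t < rho -> sm1 T t.
  move=> tr; apply: sm1_mul; first exact: sm1_id.
  apply: (@sm1_near_eq _ (fun s => b s * b s)); first exact: near_all.
  by apply: sm1_mul; exact: sb.
have cT t : t < rho -> {for t, continuous T}.
  move=> tr; have H := sm_cont (sT t tr).
  have c1 : {for t, continuous (fun s : R => (const_mx s : 'rV[R]_1))}.
    by apply/continuous_rowP => j; rewrite (_ : (fun y : R => _) = id) ?funeqE => [|y]; [exact: cvg_id|rewrite mxE].
  have := continuous_comp c1 H; apply: near_eq_continuous.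
  by apply: near_all => s /=; rewrite mxE.
have dT t : t < rho -> exists2 e, e != 0 & is_derive t (1 : R) T e.
  move=> tr; have [e e0 [de ez]] := flat_derive (t - d).
  have ds : is_derive t (1 : R) (fun t : R => t - d) 1.
    by apply: is_derive_eq; rewrite ?subr0.
  have d1 : is_derive t (1 : R) (fun t => flat (t - d)) e.
    by have := @is_derive1_comp _ (@flat R) (fun t => t - d) t e 1 de ds; rewrite mulr1.
  have d2 : is_derive t (1 : R) (fun t : R => rho - t) (-1).
    have := is_deriveB (is_derive_cst rho t (1 : R)) (is_derive_id t (1 : R)).
    by rewrite sub0r.
  have rt : rho - t != 0 by rewrite subr_eq0 gt_eqF.
  have d3 := @is_deriveV R (fun s : R => rho - s) t (-1) (1 : R) rt d2.
  have d4 := is_deriveM d1 d3.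
  set bv := (_ + _) in d4.
  have bv0 : 0 <= bv.
    rewrite /bv /GRing.scale/= addr_ge0// mulr_ge0 ?flat_ge0// ?invr_ge0 ?subr_ge0 ?(ltW tr)//.
    by rewrite mulrN1 opprK invr_ge0 sqr_ge0.
  have bvz : t <= d -> bv = 0.
    move=> td; rewrite /bv /GRing.scale/= ez ?subr_le0// flat0 ?subr_le0//; ring.
  have d5 : is_derive t (1 : R) b bv.
    rewrite -[bv]add0r; exact: (is_deriveD (is_derive_cst (1 : R) t 1) d4).
  have d6 := is_deriveM (is_derive_id t (1 : R)) (is_deriveM d5 d5).
  eexists; last first.
    by apply: (@near_eq_is_derive _ _ _ _ T _ _ _ _ d6); exact: near_all.
  rewrite /GRing.scale/= gt_eqF// (_ : (b * b) t = b t * b t)// mulr1.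
  have bb : 0 < b t * b t by rewrite mulr_gt0// b0.
  have [td|td] := leP t d; first by rewrite bvz// !mulr0 addr0 mulr0 add0r.
  have t0 : 0 < t := lt_trans d0 td.
  rewrite ltr_wpDl//; apply: mulr_ge0; first exact: ltW.
  by apply: addr_ge0; apply: mulr_ge0 => //; exact: ltW (b0 _ tr).
have surT s : exists t, t < rho /\ T t = s.
  have [sd|sd] := leP s d; first by exists s; rewrite Td// (le_lt_trans sd).
  have s0 := lt_trans d0 sd.
  pose t1 := (d + rho) / 2.
  have t1d : d < t1 by rewrite /t1; lra.
  have t1r : t1 < rho by rewrite /t1; lra.
  pose f1 := flat (t1 - d); have f10 : 0 < f1 by rewrite flat_gt0 subr_gt0.
  (* At [t2] the bound [rho - t2 <= d f1 / s] forces [b t2 >= s / d]. As [t2 >= d] and [b t2 >= 1],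
     it follows that [T t2 >= s], which the intermediate value theorem requires. *)
  pose t2 := Num.max t1 (rho - d * f1 / s).
  have p0 : 0 < d * f1 / s by rewrite divr_gt0// mulr_gt0.
  have t2r : t2 < rho by rewrite gt_max t1r/= ltrBlDr ltrDl.
  have t12 : t1 <= t2 by rewrite le_max lexx.
  have sT2 : s <= T t2.
    have q0 : 0 < rho - t2 by rewrite subr_gt0.
    have bt2 : f1 / (rho - t2) <= b t2.
      rewrite (@le_trans _ _ (flat (t2 - d) / (rho - t2)))//; last by rewrite lerDr.
      by rewrite ler_wpM2r ?invr_ge0 ?(ltW q0)// flat_le// lerD2r.
    have : s / d <= b t2.
      apply: le_trans bt2; rewrite ler_pdivlMr//.
      have H : rho - t2 <= d * f1 / s by rewrite lerBlDr -lerBlDl le_max lexx orbT.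
      apply: (@le_trans _ _ (s / d * (d * f1 / s))); first by rewrite ler_wpM2l// divr_ge0 ?ltW.
      by rewrite (_ : s / d * _ = f1)//; field; rewrite !gt_eqF.
    rewrite ler_pdivrMr// => H; apply: (le_trans H).
    have dt2 : d <= t2 by rewrite (le_trans _ t12)// ltW.
    rewrite (_ : T t2 = b t2 * (t2 * b t2)); last by rewrite /T; ring.
    rewrite ler_wpM2l ?(ltW (b0 _ t2r))// (le_trans dt2)// ler_peMr ?b1//.
    exact: ltW (lt_le_trans d0 dt2).
  have d2 : d <= t2 by rewrite ltW// (lt_le_trans t1d).
  have [||t] := @IVT _ T d t2 s d2.
  - by apply: continuous_in_subspaceT => t /set_mem; rewrite /= in_itv/= => /andP[_ tt]; apply: cT; exact: le_lt_trans tt t2r.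
  - rewrite Td// (min_idPl _) ?(max_idPr _) ?(ltW sd)//=; exact: le_trans (ltW sd) sT2.
  - by rewrite in_itv/= => /andP[_ tt] <-; exists t; split=> //; exact: le_lt_trans tt t2r.
pose S s := sval (cid (surT s)).
have [Sr TS] : (forall s, S s < rho) /\ forall s, T (S s) = s.
  by split=> s; rewrite /S; case: cid => ? [].
have ST t : t < rho -> S (T t) = t.
  move=> tr; have [H|H|//] := ltgtP (S (T t)) t.
    by have := Tlt _ _ H tr; rewrite TS ltxx.
  by have := Tlt _ _ H (Sr _); rewrite TS ltxx.
have sS s : sm1 S s.
  have [e e0 de] := dT _ (Sr s).
  have nS : \forall t \near S s, S (T t) = t.
    by apply: filterS (lt_nbhsl (Sr s)) => t; exact: ST.
  by have := sm1_inverse nS (sT _ (Sr s)) de e0; rewrite TS.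
exists d, b, (fun s => (b (S s))^-1); split=> //.
- by move=> s; apply: sm1_inv; [apply: sm1_comp1; [exact: sS|exact: sb]|rewrite gt_eqF// b0].
- move=> t td; split; first exact: bd.
  by have := ST t (le_lt_trans td dr); rewrite Td// => ->; rewrite bd// invr1.
split=> //.
- by move=> s; rewrite invr_gt0 b0.
- by move=> t t0 tr; rewrite ST// mulVf// gt_eqF// b0.
- move=> s s0; have bS := b0 _ (Sr s).
  have -> : s * (b (S s))^-1 ^+ 2 = S s.
    by rewrite -{1}(TS s) /T exprVn mulfK// expf_neq0// gt_eqF.
  by split=> //; rewrite mulfV// gt_eqF.
Qed.

End Shrinking.

Section Householder.
Context {R : realType}.

(** The reflection in the hyperplane orthogonal to [u]. It commutes with the inversion and with
    radial maps; it serves to reverse discs, to change the sign of the height and to bring a point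
    of the sphere to a pole. *)
Definition householder n (u : 'rV[R]_n) : 'M[R]_n := 1%:M + (- (2 * (N2 u)^-1) *: u)^T *m u.

Lemma mul_row_trmx n (u : 'rV[R]_n) : (u *m u^T) 0 0 = N2 u.
Proof. by rewrite mxE; apply: eq_bigr => j _; rewrite !mxE expr2. Qed.

Lemma N2_mulmx_tr n (u : 'rV[R]_n) : u *m u^T = (N2 u)%:M.
Proof. by rewrite [LHS]mx11_scalar mul_row_trmx. Qed.

Lemma det_householder n (u : 'rV[R]_n) : u != 0 -> \det (householder u) = -1.
Proof.
move=> u0; have N0 : N2 u != 0 by rewrite N2_eq0.
rewrite det_rank1 linearZ /= -scalemxAr mxE mul_row_trmx.
by rewrite mulNr -mulrA mulVf// mulr1; ring.
Qed.

Lemma householder_tr n (u : 'rV[R]_n) : (householder u)^T = householder u.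
Proof. by rewrite /householder linearD /= trmx1 trmx_mul trmxK [in RHS]linearZ/= -scalemxAl -scalemxAr. Qed.

Lemma householderK n (u : 'rV[R]_n) : u != 0 -> householder u *m householder u = 1%:M.
Proof.
move=> u0; have N0 : N2 u != 0 by rewrite N2_eq0.
rewrite /householder mulmxDl mul1mx mulmxDr mulmx1 linearZ /= -!scalemxAl -!scalemxAr -[in X in _ + X]mulmxA.
rewrite [u *m (u^T *m u)]mulmxA N2_mulmx_tr mul_scalar_mx -scalemxAr !scalerA -addrA -!scalerDl.
rewrite [c in _ + c *: _](_ : _ = 0) ?scale0r ?addr0//.
by field.
Qed.

Lemma N2_orthogonal n (A : 'M[R]_n) (v : 'rV[R]_n) : A *m A^T = 1%:M -> N2 (v *m A) = N2 v.
Proof. by move=> AA; rewrite -!mul_row_trmx trmx_mul -mulmxA [A *m _]mulmxA AA mul1mx. Qed.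

Lemma N2_householder n (u v : 'rV[R]_n) : u != 0 -> N2 (v *m householder u) = N2 v.
Proof. by move=> u0; apply: N2_orthogonal; rewrite householder_tr householderK. Qed.

Lemma inversion_householder n (u v : 'rV[R]_n) : u != 0 ->
  inversion (v *m householder u) = inversion v *m householder u.
Proof. by move=> u0; rewrite !inversionE N2_householder// scalemxAl. Qed.

Lemma ldf_mulmx n (A : 'M[R]_n) (v : euclidean R n) : A \in unitmx ->
  ldf (mulmx^~ A : euclidean R n -> euclidean R n) v /\
  osign (0 < \det A) (mulmx^~ A : euclidean R n -> euclidean R n) v.
Proof.
move=> uA; have sA : sm (mulmx^~ A : 'rV[R]_n -> 'rV[R]_n) v by apply: sm_mulmx; exact: sm_id.
split; last by apply/osign_euclid; rewrite jacobian_mulmx.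
by apply: ldf_euclid; rewrite ?jacobian_mulmx.
Qed.

Lemma unit_householder n (u : 'rV[R]_n) : u != 0 -> householder u \in unitmx.
Proof. by move=> u0; rewrite unitmxE det_householder// unitrN1. Qed.

End Householder.

Section Radial.
Context {R : realType}.

Definition radial (c : R -> R) n (v : 'rV[R]_n) : 'rV[R]_n := c (N2 v) *: v.

Lemma radial0 c n : radial c (0 : 'rV[R]_n) = 0.
Proof. by rewrite /radial scaler0. Qed.

Lemma N2_radial c n (v : 'rV[R]_n) : N2 (radial c v) = N2 v * c (N2 v) ^+ 2.
Proof. by rewrite /radial N2Z mulrC. Qed.

(** One factor [c] serves all dimensions at once: the contraction of [R^(n+1)] then restricts on the
    equator to that of [R^n], which links the discs of a hypersurface to those of the ambient
    manifold. *)
Record shrinker (rho d : R) (c : R -> R) : Prop := Shrinker {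
  shrinker_gt0 : 0 < d;
  shrinker_id : forall n (v : 'rV[R]_n), N2 v <= d -> radial c v = v;
  shrinker_pos : forall s, 0 < c s;
  shrinker_oemb : forall n, oemb setT (@radial c n : euclidean R n -> euclidean R n);
  shrinker_lt : forall n (v : 'rV[R]_n), N2 (radial c v) < rho;
  shrinker_onto : forall n (w : 'rV[R]_n), N2 w < rho -> exists v, radial c v = w }.

Lemma shrinker_exists (rho : R) : 0 < rho -> exists d c, shrinker rho d c.
Proof.
move=> rho0; have [d [b [c [d0 sb sc bc1 [b0 c0 cb bc]]]]] := radial_factors rho0.
exists d, c; apply: Shrinker; [exact: d0| |exact: c0| | |].
- by move=> n v vd; rewrite /radial (bc1 _ vd).2 scale1r.
- move=> n; have lt (v : 'rV[R]_n) : N2 (radial c v) < rho.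
    by rewrite N2_radial; have [] := bc _ (N2_ge0 v).
  have K1 (v : 'rV[R]_n) : radial b (radial c v) = v.
    have [_ E] := bc _ (N2_ge0 v).
    by rewrite {1}/radial N2_radial /radial scalerA E scale1r.
  have K2 (w : 'rV[R]_n) : N2 w < rho -> radial c (radial b w) = w.
    move=> wr; have E := cb _ (N2_ge0 w) wr.
    by rewrite {1}/radial N2_radial /radial scalerA E scale1r.
  have sR (f : R -> R) (v : 'rV[R]_n) : sm1 f (N2 v) -> sm (@radial f n) v.
    move=> sf; apply: sm_scale; last exact: sm_id.
    by apply: sm1_comp => //; exact: sm_N2 (sm_id v).
  split; [exact: openT| |move=> x y _ _ E]; last first.
    have : radial b (radial c (x : 'rV[R]_n)) = radial b (radial c (y : 'rV[R]_n)) by rewrite E.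
    by rewrite !K1.
  move=> v _.
  have s1 : @msm R n n (euclidean R n) (euclidean R n) (@radial c n) v by apply/msm_euclid; exact: sR.
  split=> //; exists (@radial b n); split.
  + by apply/msm_euclid; apply: sR; apply: sb; exact: lt.
  + by apply: near_all => y; exact: K1.
  + have := near_ltr (@N2_cont R n (radial c v)) (lt v).
    by apply: filterS => w; exact: K2.
- by move=> n v; rewrite N2_radial; have [] := bc _ (N2_ge0 v).
- move=> n w wr; exists (radial b w); have E := cb _ (N2_ge0 w) wr.
  by rewrite {1}/radial N2_radial /radial scalerA E scale1r.
Qed.

Lemma radial_eq0 c n (v : 'rV[R]_n) : (forall s, 0 < c s) -> (radial c v == 0) = (v == 0).
Proof. by move=> c0; rewrite /radial scaler_eq0 gt_eqF. Qed.

(** The contraction is the identity near [0], and the sign is constant on the connected space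
    [R^n]. *)
Lemma shrinker_osign rho d c n : shrinker rho d c ->
  forall v, osign true (@radial c n : euclidean R n -> euclidean R n) v.
Proof.
move=> [d0 cid _ oc _ _]; have [_ lc _] := oc n.
apply: (@osign_connected R n (euclidean R n) (euclidean R n) true (@radial c n) (0 : 'rV[R]_n)); first exact: connected_rV.
  by move=> x; exact: lc.
have E : \forall v \near (0 : euclidean R n), v = radial c v.
  have H : N2 (0 : 'rV[R]_n) < d by rewrite N20.
  have := near_ltr (@N2_cont R n 0) H.
  by apply: filterS => v vd; rewrite cid// ltW.
exact: (osign_near_eq (ldf_id _) E (@osign_id _ _ _ _)).
Qed.

End Radial.

(** * Discs in manifolds *)

Section Discs.
Context {R : realType}.

Lemma disc_ball_closed n (M : manifold R n) (phi : euclidean R n -> M) (e : R) :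
  (forall v, {for v, continuous phi}) -> closed (phi @` [set v | N2 v <= e]).
Proof.
move=> cphi; apply: compact_closed; first exact: manifold_hausdorff.
apply: continuous_compact; first by apply: continuous_subspaceT => v; exact: cphi.
apply: bounded_closed_compact.
  exists (e + 1); split; first exact: num_real.
  move=> K eK x /= xe; have := norm_le_N2 x.
  have := sqr_ge0 (`|x| - 1); nra.
apply: closed_comp (@closed_le R e) => x _; exact: N2_cont.
Qed.

Lemma disc_inv n (M : oriented_manifold R n) (phi : euclidean R n -> M) :
  oemb setT phi -> exists g : M -> euclidean R n, [/\ forall v, g (phi v) = v,
    forall v, ldf g (phi v) & forall e v, osign e phi v -> osign e g (phi v)].
Proof.
move=> ephi; have [_ lphi _] := ephi.
have [g [gK [_ lg _]]] := @oemb_inv R n n (euclidean R n) M (0 : 'rV[R]_n) setT phi ephi.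
have lgv v : ldf g (phi v) by apply: lg; exists v.
exists g; split=> // [v|e v ov]; first exact: gK.
by apply: (osign_inv (lphi v I) (lgv v) _ ov); apply: near_all => w; exact: gK.
Qed.

Lemma near_range n (M : manifold R n) (phi : euclidean R n -> M) v : oemb setT phi ->
  \forall y \near phi v, exists w, y = phi w.
Proof.
move=> [_ lphi _].
have : \forall y \near phi v, (range phi) y.
  by apply: ldf_image_near; [exact: lphi|exact: near_all].
by apply: filterS => y [w _ <-]; exists w.
Qed.

(** [h] is transported by [phi] and extended by the identity. The last clause is pointwise because
    [csum_shrink] uses an [h] that is a local diffeomorphism only away from [0]. *)
Lemma disc_extension n (M : oriented_manifold R n) (phi : euclidean R n -> M) (e0 : bool)
    (h : euclidean R n -> euclidean R n) (e : R) :
  oemb setT phi -> (forall v, osign e0 phi v) -> (forall v, e <= N2 v -> h v = v) ->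
  exists H : M -> M, [/\ forall v, H (phi v) = phi (h v),
    forall x, (forall v, x <> phi v) -> H x = x &
    forall x, (forall v, x = phi v -> ldf h v /\ osign true h v) -> ldf H x /\ osign true H x].
Proof.
move=> ephi ophi hid; have [_ lphi injphi] := ephi.
have [g [gK lg og]] := disc_inv ephi.
pose H x := if pselect (exists v, x = phi v) then phi (h (g x)) else x.
have HE v : H (phi v) = phi (h v).
  by rewrite /H; case: pselect => [?|nv]; [rewrite gK|case: nv; exists v].
have Hid x : (forall v, x <> phi v) -> H x = x.
  by move=> xv; rewrite /H; case: pselect => [e1|//]; exfalso; case: e1 => v /xv.
exists H; split=> // x xh.
have [[v xv]|nx] := pselect (exists v, x = phi v).
  have [lh oh] := xh v xv; rewrite {}xv {xh x}.
  have E : \forall y \near phi v, phi (h (g y)) = H y.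
    by apply: filterS (near_range v ephi) => y [w ->]; rewrite HE gK.
  have lgv := lg v.
  have gv : g (phi v) = v by exact: gK.
  have lh' : ldf h (g (phi v)) by rewrite gv.
  have lhg : ldf (fun y => h (g y)) (phi v) := ldf_comp lgv lh'.
  have l1 : ldf (fun y => phi (h (g y))) (phi v).
    by apply: (ldf_comp (g := phi) lhg); exact: lphi.
  split; first exact: ldf_near_eq E l1.
  apply: (osign_near_eq l1 E).
  have o1 := og e0 v (ophi v).
  have o2 : osign (e0 == true) (fun y => h (g y)) (phi v).
    have oh' : osign true h (g (phi v)) by rewrite gv.
    exact: (osign_comp lgv lh' o1 oh').
  have o3 := osign_comp (g := phi) lhg (lphi _ I) o2 (ophi _).
  by move: o3; rewrite eqb_id eqxx.
(* A point off the disc has a neighbourhood that misses the compact image of [N2 <= e]; there [H] is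
   the identity, whether or not the points belong to the disc. *)
have E : \forall y \near x, y = H y.
  have cl := @disc_ball_closed n M phi e (fun v => ldf_cont (lphi v I)).
  have : \forall y \near x, ~ (phi @` [set v | N2 v <= e]) y.
    by apply: (@near_open _ (~` _)) => [|[v _ xv]]; [rewrite openC|apply: nx; exists v].
  apply: filterS => y ny.
  have [[v yv]|nv] := pselect (exists v, y = phi v); last first.
    by rewrite Hid// => v yv; apply: nv; exists v.
  by rewrite yv HE hid// ltW// ltNge; apply/negP => ve; apply: ny; exists v.
split; first exact: ldf_near_eq E (ldf_id x).
exact: osign_near_eq (ldf_id x) E (@osign_id _ _ _ x).
Qed.

Definition translation n (a : 'rV[R]_n) : euclidean R n -> euclidean R n := fun w : 'rV[R]_n => a + w.

Lemma ldf_translation n (a : 'rV[R]_n) (v : euclidean R n) :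
  ldf (translation a) v /\ osign true (translation a) v.
Proof.
have sT : sm (fun w : 'rV[R]_n => a + w) v by apply: sm_addv; [exact: sm_cst|exact: sm_id].
have JT : 'J (fun w : 'rV[R]_n => a + w) v = 1%:M.
  by rewrite (jacobian_add (sm_cst _ _) (sm_id _)) jacobian_cst jacobian_id add0r.
split; last by apply/osign_euclid; rewrite JT det1 ltr01.
by apply: ldf_euclid => //; rewrite JT unitmx1.
Qed.

Lemma near0_ball n (P : 'rV[R]_n -> Prop) : (\forall v \near (0 : 'rV[R]_n), P v) ->
  exists2 r : R, 0 < r & forall v, N2 v < r -> P v.
Proof.
move=> /nbhs_ballP[r /= r0 rP]; exists (r ^+ 2); first exact: exprn_gt0.
move=> v vr; apply: rP; rewrite -ball_normE/= sub0r normrN.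
rewrite -ltr_sqr ?nnegrE ?(ltW r0)//; exact: le_lt_trans (norm_le_N2 v) vr.
Qed.

Lemma disc_at n (M : oriented_manifold R n) (x : M) :
  exists phi : euclidean R n -> M, oemb setT phi /\ phi 0 = x.
Proof.
have [a [Aa ax]] := atlas_at x.
pose T := translation (a x).
have T0 : T 0 = a x by rewrite /T /translation addr0.
have cT : {for (0 : euclidean R n), continuous T} := ldf_cont (ldf_translation (a x) 0).1.
have H : \forall v \near (0 : 'rV[R]_n), chart_cod a (T v).
  have H0 : \forall w \near T 0, chart_cod a w by rewrite T0; exact: chart_near_cod.
  exact: (cT _ H0).
have [r r0 rP] := near0_ball H.
have [d [c sc]] := shrinker_exists r0.
exists (fun v => chart_inv a (T (radial c v))); split; last by rewrite radial0 T0 chart_mapK.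
have o1 := shrinker_oemb sc n.
have o2 : oemb setT T.
  split; [exact: openT|by move=> v _; have [] := ldf_translation (a x) v|].
  by move=> v w _ _ /addrI.
have o3 : oemb (chart_cod a : set (euclidean R n)) (chart_inv a : euclidean R n -> M).
  split; [exact: chart_cod_open|by move=> v; exact: ldf_chart_inv|].
  by move=> v w av aw /(congr1 a); rewrite (chart_codK av).1 (chart_codK aw).1.
apply: (oemb_comp (oemb_comp o1 o2 _) o3) => // v _ /=.
by apply: rP; exact: shrinker_lt sc _ _.
Qed.

End Discs.

(** * Connected sums *)

Section ConnectedSums.
Context {R : realType}.

(* Here psi reverses the orientation, instead of preserving it as a map to the
   opposite of N. *)
Record csum n (M N P : oriented_manifold R n) (phi : euclidean R n -> M) (psi : euclidean R n -> N)
    (i : M -> P) (j : N -> P) : Prop := Csum {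
  csum_phi : oemb setT phi;
  csum_phi_sign : forall v, osign true phi v;
  csum_psi : oemb setT psi;
  csum_psi_sign : forall v, osign false psi v;
  csum_i : oemb [set~ phi 0] i;
  csum_i_sign : forall x, x <> phi 0 -> osign true i x;
  csum_j : oemb [set~ psi 0] j;
  csum_j_sign : forall y, y <> psi 0 -> osign true j y;
  csum_cover : forall p, (exists x, x <> phi 0 /\ i x = p) \/ (exists y, y <> psi 0 /\ j y = p);
  csum_glue : forall x y, x <> phi 0 -> y <> psi 0 ->
    (i x = j y <-> exists v : 'rV[R]_n, [/\ v <> 0, x = phi v & y = psi (inversion v)]) }.

Lemma open_setC1 n (M : manifold R n) (x : M) : open [set~ x].
Proof.
rewrite openC; apply: compact_closed; [exact: manifold_hausdorff|exact: compact_set1].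
Qed.

Lemma is_connected_sumP n (M N P : oriented_manifold R n) :
  is_connected_sum M N P <-> exists phi psi i j, @csum n M N P phi psi i j.
Proof.
split.
  move=> [phi [psi [i [j [[e1 o1] [e2 o2] [e3 o3] [e4 o4] [c r]]]]]].
  exists phi, psi, i, j; split.
  - exact/(oemb_smooth_embedding _ openT).
  - by move=> v; exact: (orientation_preservingP _ _).1 o1 v I.
  - exact/(@oemb_smooth_embedding _ _ (euclidean R n) N _ _ openT).
  - by move=> v; apply/(@osign_opposite _ _ (euclidean R n) N true); exact: (orientation_preservingP _ _).1 o2 v I.
  - exact/(oemb_smooth_embedding _ (open_setC1 _)).
  - exact: (orientation_preservingP _ _).1 o3.
  - exact/(oemb_smooth_embedding _ (open_setC1 _)).
  - exact: (orientation_preservingP _ _).1 o4.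
  - move=> p; have : [set: P] p by []. 
    by rewrite -c => -[[x /= xp <-]|[y /= yp <-]]; [left; exists x|right; exists y].
  - exact: r.
move=> [phi [psi [i [j [e1 o1 e2 o2 e3 o3 e4 o4 c r]]]]].
exists phi, psi, i, j; split.
- split; first exact/(oemb_smooth_embedding _ openT).
  by apply/orientation_preservingP => v _.
- split; first exact/(@oemb_smooth_embedding _ _ (euclidean R n) N _ _ openT).
  by apply/orientation_preservingP => v _; apply/(@osign_opposite _ _ (euclidean R n) N true).
- split; first exact/(oemb_smooth_embedding _ (open_setC1 _)).
  exact/orientation_preservingP.
- split; first exact/(oemb_smooth_embedding _ (open_setC1 _)).
  exact/orientation_preservingP.
- split=> //; apply/seteqP; split=> // p _.
  by have [[x [xp <-]]|[y [yp <-]]] := c p; [left; exists x|right; exists y].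
Qed.

Section Operations.
Context {n : nat} {M N P : oriented_manifold R n}.
Context {phi : euclidean R n -> M} {psi : euclidean R n -> N} {i : M -> P} {j : N -> P}.
Hypothesis MNP : csum phi psi i j.

Lemma csum_phi_inj v w : phi v = phi w -> v = w.
Proof. by have [_ _ H] := csum_phi MNP; exact: H. Qed.

Lemma csum_psi_inj v w : psi v = psi w -> v = w.
Proof. by have [_ _ H] := csum_psi MNP; exact: H. Qed.

Lemma csum_phi_neq0 (v : 'rV[R]_n) : v <> 0 -> phi v <> phi 0.
Proof. by move=> v0 /csum_phi_inj. Qed.

Lemma csum_psi_neq0 (v : 'rV[R]_n) : v <> 0 -> psi v <> psi 0.
Proof. by move=> v0 /csum_psi_inj. Qed.

Lemma csum_neck (v : 'rV[R]_n) : v <> 0 -> i (phi v) = j (psi (inversion v)).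
Proof.
move=> v0; apply/(csum_glue MNP); last by exists v.
  exact: csum_phi_neq0.
by apply: csum_psi_neq0; apply/eqP; rewrite inversion_eq0; exact/eqP.
Qed.

Lemma csum_neck2 (v : 'rV[R]_n) : v <> 0 -> j (psi v) = i (phi (inversion v)).
Proof.
move=> v0; rewrite csum_neck ?inversionK//.
by apply/eqP; rewrite inversion_eq0; exact/eqP.
Qed.

(* Exchanging the roles of M and N requires discs of the opposite signs; a
   reflection commutes with the inversion. *)
Lemma csum_sym (u : 'rV[R]_n) : u != 0 ->
  csum (fun v : euclidean R n => psi (v *m householder u : 'rV[R]_n))
       (fun v : euclidean R n => phi (v *m householder u : 'rV[R]_n)) j i.
Proof.
move=> u0; have uH := unit_householder u0.
have oH : oemb setT (mulmx^~ (householder u) : euclidean R n -> euclidean R n).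
  split; [exact: openT|by move=> v _; have [] := ldf_mulmx v uH|].
  move=> v w _ _ E; have : (v : 'rV[R]_n) *m householder u *m householder u = w *m householder u *m householder u.
    by rewrite E.
  by rewrite -!mulmxA householderK// !mulmx1.
have sH v : osign false (mulmx^~ (householder u) : euclidean R n -> euclidean R n) v.
  by have [_] := ldf_mulmx v uH; rewrite det_householder// ltr0N1.
have H0 : (0 : 'rV[R]_n) *m householder u = 0 by rewrite mul0mx.
have [_ lH _] := oH.
have [ o1 s1 o2 s2 o3 s3 o4 s4 c r] := MNP.
have [_ l1 _] := o1; have [_ l2 _] := o2.
split; rewrite ?H0 //.
- exact: (oemb_comp oH o2).
- move=> v; exact: (osign_comp (lH v I) (l2 _ I) (sH v) (s2 _)).
- exact: (oemb_comp oH o1).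
- move=> v; exact: (osign_comp (lH v I) (l1 _ I) (sH v) (s1 _)).
- by move=> p; have [?|?] := c p; [right|left].
- move=> y x yp xp; split.
    move=> /esym/(r _ _ xp yp)[v [v0 -> ->]].
    exists (inversion (v *m householder u)); split.
    + move/eqP; rewrite inversion_eq0 => /eqP E; apply: v0.
      by rewrite -[v]mulmx1 -(householderK u0) mulmxA E mul0mx.
    + by rewrite inversion_householder// -mulmxA householderK// mulmx1.
    + by rewrite inversionK -mulmxA householderK// mulmx1.
  move=> [v [v0 -> ->]]; rewrite -inversion_householder//; apply: csum_neck2 => E; apply: v0.
  by rewrite -[v]mulmx1 -(householderK u0) mulmxA E mul0mx.
Qed.

(* The gluing map phi v |-> psi (inversion v) changes by the conjugate h of the
   radial contraction under the inversion; h is the identity far from 0, so it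
   extends to N minus psi 0. *)
Lemma csum_shrink rho d c : shrinker rho d c ->
  exists j', csum (fun v => phi (radial c (v : 'rV[R]_n))) psi i j'.
Proof.
move=> sc; have [ o1 s1 o2 s2 o3 s3 o4 s4 cov r] := MNP.
have [d0 cid cpos oc clt conto] := sc.
pose h (w : euclidean R n) : euclidean R n := inversion (radial c (inversion (w : 'rV[R]_n))).
have hid w : d^-1 <= N2 (w : 'rV[R]_n) -> h w = w.
  move=> dw; rewrite /h cid ?inversionK// N2_inversion -[leRHS]invrK lef_pV2 ?posrE ?invr_gt0//.
  by apply: lt_le_trans dw; rewrite invr_gt0.
have [_ l2 _] := o2.
have [H [Hpsi Hid Hl]] := disc_extension o2 s2 hid.
have r0 (w : 'rV[R]_n) : w <> 0 -> radial c w <> 0.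
  by move=> w0 /eqP; rewrite radial_eq0// => /eqP.
have i0 (w : 'rV[R]_n) : w <> 0 -> inversion w <> 0.
  by move=> w0 /eqP; rewrite inversion_eq0 => /eqP.
have h0 (w : 'rV[R]_n) : w <> 0 -> h w <> (0 : 'rV[R]_n).
  by move=> w0; apply: (i0 (radial c (inversion w))); apply: r0; exact: i0.
have rinj (v w : 'rV[R]_n) : radial c v = radial c w -> v = w.
  by have [_ _] := oc n; exact.
have hinj (v w : 'rV[R]_n) : h v = h w -> v = w.
  rewrite /h => /(congr1 (@inversion R n)); rewrite !inversionK => /rinj/(congr1 (@inversion R n)).
  by rewrite !inversionK.
have lh (w : euclidean R n) : w <> (0 : 'rV[R]_n) -> ldf h w /\ osign true h w.
  move=> /eqP w0; have [l0 t0] := ldf_inversion w0.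
  have [_ lr _] := oc n.
  have w1 : radial c (inversion (w : 'rV[R]_n)) != 0 by apply/eqP; apply: r0; apply: i0; exact/eqP.
  have l1 := ldf_comp l0 (lr _ I).
  have t1 := osign_comp l0 (lr _ I) t0 (@shrinker_osign R rho d c n sc _).
  have [l3 t3] := @ldf_inversion R n (radial c (inversion (w : 'rV[R]_n))) w1.
  split; first exact: (ldf_comp l1 l3).
  exact: (osign_comp l1 l3 t1 t3).
have range_dec y : (exists v, y = psi v) \/ (forall v, y <> psi v).
  by have [?|ny] := pselect (exists v, y = psi v); [left|right => v yv; apply: ny; exists v].
have H0 y : y <> psi 0 -> H y <> psi 0.
  have [[w ->] wy|ny _] := range_dec y; last by rewrite Hid//; exact: ny.
  by rewrite Hpsi => /csum_psi_inj; apply: h0 => w0; apply: wy; rewrite w0.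
have Hl' y : y <> psi 0 -> ldf H y /\ osign true H y.
  by move=> yp; apply: Hl => w yw; apply: lh => w0; apply: yp; rewrite yw w0.
have [_ l4 inj4] := o4.
have Hinj y z : H y = H z -> y = z.
  have [[v ->]|ny] := range_dec y; have [[w ->]|nz] := range_dec z; rewrite ?Hpsi ?(Hid y)// ?(Hid z)//.
  - by move=> /csum_psi_inj/hinj ->.
  - by move=> E; case: (nz (h v)).
  - by move=> E; case: (ny (h w)).
exists (fun y => j (H y)); split=> //.
- exact: (oemb_comp (oc n) o1).
- move=> v; have [_ lr _] := oc n; have [_ l1 _] := o1.
  exact: (osign_comp (lr v I) (l1 _ I) (@shrinker_osign R rho d c n sc v) (s1 _)).
- by rewrite radial0.
- by rewrite radial0.
- split; first exact: open_setC1.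
    by move=> y yp; have [lH _] := Hl' y yp; apply: (ldf_comp lH); exact: l4 (H0 _ yp).
  by move=> y z yp zp /(inj4 _ _ (H0 _ yp) (H0 _ zp)); exact: Hinj.
- move=> y yp; have [lH sH] := Hl' y yp.
  exact: (osign_comp lH (l4 _ (H0 _ yp)) sH (s4 _ (H0 _ yp))).
- move=> p; rewrite radial0; have [[x [xp <-]]|[y [yp <-]]] := cov p; first by left; exists x.
  have [[w yw]|ny] := range_dec y; last by right; exists y; rewrite Hid.
  left; have w0 : w <> (0 : 'rV[R]_n) by move=> w0; apply: yp; rewrite yw w0.
  exists (phi (inversion (w : 'rV[R]_n))); rewrite yw csum_neck2//; split=> //.
  by apply: csum_phi_neq0; exact: i0.
- move=> x y; rewrite radial0 => xp yp; split.
    move=> /(r _ _ xp (H0 _ yp))[v [v0 xv Hy]].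
    have [[w yw]|ny] := range_dec y; last by move: Hy; rewrite Hid// => Hy; case: (ny _ Hy).
    move: Hy; rewrite yw Hpsi => /csum_psi_inj; rewrite /h => /(congr1 (@inversion R n)).
    rewrite !inversionK => E; exists (inversion (w : 'rV[R]_n)).
    rewrite E inversionK; split=> //; apply: i0 => w0; apply: yp; by rewrite yw w0.
  move=> [v [v0 xv yv]]; apply/(r _ _ xp (H0 _ yp)).
  exists (radial c v); split=> //; first exact: r0.
  by rewrite yv Hpsi /h inversionK.
Qed.

(** Precomposing [j] with a diffeomorphism of [N] moves the gluing disc without changing [P]. In (3)
    this makes the two discs of [M] coincide. *)
Lemma csum_diffeo (psi' : euclidean R n -> N) (h : N -> N) :
  oemb setT h -> (forall y, osign true h y) -> (forall y, exists z, h z = y) ->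
  (forall v, h (psi' v) = psi v) -> (forall v, ldf psi' v) ->
  csum phi psi' i (fun y => j (h y)).
Proof.
move=> oh sh honto hpsi lpsi'; have [ o1 s1 o2 s2 o3 s3 o4 s4 cov r] := MNP.
have [_ lh injh] := oh; have [_ l4 inj4] := o4.
have h0 y : y <> psi' 0 -> h y <> psi 0.
  by move=> yp; rewrite -hpsi => /injh E; apply: yp; exact: E.
split=> //.
- split; [exact: openT|by move=> v _; exact: lpsi'|].
  by move=> v w _ _ /(congr1 h); rewrite !hpsi; exact: csum_psi_inj.
(* [h] preserves the orientation, so [psi'] has the same sign as [psi], which is [h] after
   [psi']. *)
- move=> v; have [e oe] := osign_exists (lpsi' v).
  have o5 := osign_comp (lpsi' v) (lh _ I) oe (sh _).
  have E : \forall w \near v, h (psi' w) = psi w by exact: near_all.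
  have o6 := osign_near_eq (ldf_comp (lpsi' v) (lh _ I)) E o5.
  by have := osign_uniq o6 (s2 v); case: e oe {o5 o6}.
- apply: (oemb_comp (oemb_sub oh (open_setC1 _) _) o4) => // y; exact: h0.
- by move=> y yp; exact: (osign_comp (lh _ I) (l4 _ (h0 _ yp)) (sh y) (s4 _ (h0 _ yp))).
- move=> p; have [?|[y [yp <-]]] := cov p; [by left|right].
  have [z zy] := honto y; exists z; rewrite zy; split=> // zp; apply: yp.
  by rewrite -zy zp hpsi.
- move=> x y xp yp; split.
    move=> /(r _ _ xp (h0 _ yp))[v [v0 xv]]; rewrite -hpsi => /injh E.
    by exists v; split=> //; exact: E.
  move=> [v [v0 xv yv]]; apply/(r _ _ xp (h0 _ yp)).
  by exists v; split=> //; rewrite yv hpsi.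
Qed.

End Operations.
End ConnectedSums.

(** Compatibility of a chart of [T] is tested through one inclusion; [push_chart_compat2] carries it
    over to the other one. *)
Definition compat_half {R : realType} {n : nat} (X : oriented_manifold R n) (T : topologicalType)
    (A : set X) (i : X -> T) (c : chart R n T) : Prop := forall x, A x -> chart_dom c (i x) ->
  ldf ((fun x' => c (i x')) : X -> euclidean R n) x.

(** * Gluing two manifolds along open subsets *)

Section HalfGluing.
Context {R : realType} {n : nat}.

(* T is covered by the images of A and B. Everything needed from the side of B is
   obtained by exchanging the roles of A and B, and tau is the local transition. *)
Record half_gluing (X Y : oriented_manifold R n) (T : topologicalType) (A : set X) (B : set Y)
    (i : X -> T) (j : Y -> T) : Prop := HalfGluing {
  glue_openE : forall U : set T, open U <-> open (A `&` i @^-1` U) /\ open (B `&` j @^-1` U);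
  glue_openA : open A;
  glue_inj : forall x x', A x -> A x' -> i x = i x' -> x = x';
  glue_trans : forall x y, A x -> B y -> i x = j y -> exists tau : Y -> X,
    [/\ ldf tau y, osign true tau y, tau y = x &
      \forall y' \near y, B y' -> A (tau y') /\ i (tau y') = j y'] }.

Context {X Y : oriented_manifold R n} {T : topologicalType} {A : set X} {B : set Y}.
Context {i : X -> T} {j : Y -> T}.
Hypothesis H : half_gluing A B i j.
Hypothesis oB : open B.

Lemma glue_nearA x : A x -> \forall x' \near x, A x'.
Proof. by move=> Ax; apply: near_open => //; exact: glue_openA H. Qed.

Lemma glue_open_image (V : set X) : open V -> V `<=` A -> open (i @` V).
Proof.
move=> oV VA; apply/(glue_openE H); split.
  rewrite (_ : _ `&` _ = V)//; apply/seteqP; split=> [x [Ax [x' Vx']]|x Vx].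
    by move=> /(glue_inj H (VA _ Vx') Ax) <-.
  by split; [exact: VA|exists x].
apply: open_near => y [By [x Vx xy]].
have [tau [lt _ ty nt]] := glue_trans H (VA _ Vx) By xy.
have n1 : \forall y' \near y, V (tau y').
  have n0 : \forall x' \near tau y, V x' by rewrite ty; exact: near_open.
  exact: (ldf_cont lt n0).
apply: filterS3 (near_open oB By) n1 nt => y' By' Vy' /(_ By')[_ E].
by split=> //; exists (tau y').
Qed.

Lemma glue_near x (P : T -> Prop) : A x -> (\forall p \near i x, P p) -> \forall x' \near x, P (i x').
Proof.
move=> Ax HP; have : nbhs (i x) P by []; rewrite nbhsE => -[U [oU Ux] UP].
have [ o1 _ ] := (glue_openE H U).1 oU.
have : \forall x' \near x, (A `&` i @^-1` U) x' by exact: near_open.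
by apply: filterS => x' [_ /UP].
Qed.

Lemma glue_cont x : A x -> {for x, continuous i}.
Proof. by move=> Ax P HP; exact: glue_near. Qed.

Lemma glue_near_image x (P : X -> Prop) : A x -> (\forall x' \near x, P x') ->
  \forall p \near i x, exists x', [/\ A x', P x' & p = i x'].
Proof.
move=> Ax HP; have : \forall x' \near x, A x' /\ P x' by apply: filterI => //; exact: glue_nearA.
move=> HQ; have : nbhs x (fun x' => A x' /\ P x') by []; rewrite nbhsE => -[U [oU Ux] UP].
have : \forall p \near i x, (i @` U) p.
  by apply: near_open; [apply: glue_open_image => // x' /UP[]|exists x].
by apply: filterS => p [x' /UP[Ax' Px'] <-]; exists x'.
Qed.

Definition glue_inv (x0 : X) (p : T) : X := xget x0 [set x | A x /\ i x = p].

Lemma glue_invK x0 x : A x -> glue_inv x0 (i x) = x.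
Proof.
move=> Ax; rewrite /glue_inv; case: xgetP => [x' _ [Ax' E]|/(_ x)]; first exact: (glue_inj H Ax' Ax E).
by move=> E; exfalso; exact: E.
Qed.

Section PushChart.
Variables (x0 : X) (a : chart R n X).

Let dom := i @` (chart_dom a `&` A).
Let map p := a (glue_inv x0 p).
Let inv v := i (chart_inv a v).

Let dom_open : open dom.
Proof.
apply: glue_open_image; last by move=> x [].
by apply: openI; [exact: chart_dom_open|exact: glue_openA H].
Qed.

Let cod_open : open (map @` dom).
Proof.
have -> : map @` dom = a @` (chart_dom a `&` A).
  apply/seteqP; split=> [_ [_ [x [ax Ax] <-] <-]|_ [x [ax Ax] <-]].
    by rewrite /map glue_invK//; exists x.
  by exists (i x); [exists x|rewrite /map glue_invK].
by apply: chart_image_open => x _; exact: glue_nearA.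
Qed.

Let mapK p : dom p -> inv (map p) = p.
Proof. by move=> [x [ax Ax] <-]; rewrite /map glue_invK// /inv chart_mapK. Qed.

Let map_cont p : dom p -> {for p, continuous map}.
Proof.
move=> [x [ax Ax] <-] P; rewrite /map (glue_invK x0 Ax) => HP.
have := glue_near_image Ax (chart_map_near ax HP).
by apply: filterS => p' [x' [Ax' Px' ->]] /=; rewrite glue_invK.
Qed.

Let inv_cont v : (map @` dom) v -> {for v, continuous inv}.
Proof.
move=> [_ [x [ax Ax] <-] <-]; rewrite /map glue_invK// => P.
rewrite /inv chart_mapK// => HP; exact: (chart_inv_near ax (glue_near Ax HP)).
Qed.

Definition push_chart : chart R n T := Chart dom_open cod_open mapK map_cont inv_cont.

End PushChart.

Lemma push_chart_compat x0 a : atlas a -> compat_half A i (push_chart x0 a).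
Proof.
move=> Aa x Ax [x1 [ax1 Ax1] /(glue_inj H Ax1 Ax) x1x]; rewrite {}x1x {x1} in ax1 Ax1.
apply: ldf_near_eq (ldf_chart Aa ax1).
by apply: filterS (glue_nearA Ax) => x' Ax'; rewrite /= glue_invK.
Qed.

(** Near [y] the map [c j] is [c i] after [tau], and [tau] is an orientation-preserving local
    diffeomorphism. *)
Lemma push_chart_compat2 (c : chart R n T) : compat_half A i c -> forall y x, B y -> A x -> i x = j y ->
  chart_dom c (j y) -> ldf ((fun y' => c (j y')) : Y -> euclidean R n) y /\
  forall e, osign e ((fun x' => c (i x')) : X -> euclidean R n) x ->
            osign e ((fun y' => c (j y')) : Y -> euclidean R n) y.
Proof.
move=> cc y x By Ax xy cy; have [tau [lt ot ty nt]] := glue_trans H Ax By xy.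
rewrite -xy in cy; have l1 := cc x Ax cy.
have l1' : ldf ((fun x' => c (i x')) : X -> euclidean R n) (tau y) by rewrite ty.
have l2 := ldf_comp lt l1'.
have E : \forall y' \near y, c (i (tau y')) = c (j y').
  by apply: filterS2 (near_open oB By) nt => y' By' /(_ By')[_ ->].
split; first exact: (@ldf_near_eq R n n Y (euclidean R n) _ _ y E l2).
move=> e oe; have oe' : osign e ((fun x' => c (i x')) : X -> euclidean R n) (tau y) by rewrite ty.
exact: (@osign_near_eq R n Y (euclidean R n) e _ _ y l2 E (@osign_comp R n Y X (euclidean R n) true e _ _ y lt l1' ot oe')).
Qed.

(** Near [c (i x)] the transition is [d i] after the local inverse of [c i], so it inherits
    smoothness and sign from two local diffeomorphisms defined on [X]. *)
Lemma compat_transition (c d : chart R n T) x : compat_half A i c -> compat_half A i d -> A x ->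
  chart_dom c (i x) -> chart_dom d (i x) -> forall ec ed,
  osign ec ((fun x' => c (i x')) : X -> euclidean R n) x ->
  osign ed ((fun x' => d (i x')) : X -> euclidean R n) x ->
  sm (fun v => d (chart_inv c v)) (c (i x)) /\
  (ec == ed) = (0 < \det ('J (fun v => d (chart_inv c v)) (c (i x)))).
Proof.
move=> cc cd Ax cx dx ec ed oc od.
have l1 := cc x Ax cx; have l2 := cd x Ax dx.
have [s1 [h [sh h1 h2]]] := l1.
have hx : h (c (i x)) = x := nbhs_singleton h1.
have lh : ldf h (c (i x)) by apply: (@ldf_sym R n n X (euclidean R n) (fun x' => c (i x'))).
have l2' : ldf ((fun x' => d (i x')) : X -> euclidean R n) (h (c (i x))) by rewrite hx.
have l3 := @ldf_comp R n n n (euclidean R n) X (euclidean R n) h _ _ lh l2'.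
have ch := ldf_cont lh.
have E : \forall v \near c (i x), d (i (h v)) = d (chart_inv c v).
  have n0 : \forall x' \near h (c (i x)), chart_dom c (i x').
    by rewrite hx; apply: glue_near Ax _; exact: chart_near_dom.
  have n1 : \forall v \near c (i x), chart_dom c (i (h v)) by exact: ch n0.
  apply: filterS2 n1 h2 => v cv hv; congr (d _).
  by rewrite -[in RHS]hv chart_mapK.
have l4 := @ldf_near_eq R n n (euclidean R n) (euclidean R n) _ _ _ E l3.
split; first by have /msm_euclid := ldf_msm l4.
have oh := @osign_inv R n X (euclidean R n) ec (fun x' => c (i x')) h x l1 lh h1 oc.
have od' : osign ed ((fun x' => d (i x')) : X -> euclidean R n) (h (c (i x))) by rewrite hx.
have o3 := @osign_comp R n (euclidean R n) X (euclidean R n) ec ed h (fun x' => d (i x')) (c (i x)) lh l2' oh od'.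
have o4 := @osign_near_eq R n (euclidean R n) (euclidean R n) _ _ _ _ l3 E o3.
by move/osign_euclid : o4.
Qed.

End HalfGluing.

Section Gluing.
Context {R : realType} {n : nat} {X Y : oriented_manifold R n} {T : topologicalType}.
Context {A : set X} {B : set Y} {i : X -> T} {j : Y -> T}.
Hypothesis H1 : half_gluing A B i j.
Hypothesis H2 : half_gluing B A j i.
Variables (x0 : X) (y0 : Y).
Hypothesis cover : forall p, (exists x, A x /\ i x = p) \/ (exists y, B y /\ j y = p).
Hypothesis separated : forall x y, A x -> B y -> (forall y', B y' -> i x <> j y') ->
  (forall x', A x' -> i x' <> j y) -> exists (U : set X) (V : set Y),
  [/\ open U /\ U `<=` A, open V /\ V `<=` B, U x, V y & forall x' y', U x' -> V y' -> i x' <> j y'].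

Let oA : open A := glue_openA H1.
Let oB : open B := glue_openA H2.

Definition glue_atlas : set (chart R n T) := [set c |
  (exists2 a, atlas a & c = push_chart H1 oB x0 a) \/
  (exists2 b, atlas b & c = push_chart H2 oA y0 b)].

Lemma glue_atlas1 c : glue_atlas c -> compat_half A i c.
Proof.
case=> -[a Aa ->]; first exact: (@push_chart_compat _ _ _ _ _ _ _ _ _ H1 oB x0 a Aa).
move=> x Ax cx; have [y [by_ By] yx] := cx.
by have [] := push_chart_compat2 H2 oA (@push_chart_compat _ _ _ _ _ _ _ _ _ H2 oA y0 a Aa) Ax By yx cx.
Qed.

Lemma glue_atlas2 c : glue_atlas c -> compat_half B j c.
Proof.
case=> -[a Aa ->]; last exact: (@push_chart_compat _ _ _ _ _ _ _ _ _ H2 oA y0 a Aa).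
move=> y By cy; have [x [bx Ax] xy] := cy.
by have [] := push_chart_compat2 H1 oB (@push_chart_compat _ _ _ _ _ _ _ _ _ H1 oB x0 a Aa) By Ax xy cy.
Qed.

Lemma glue_atlas_cover p : exists2 c, glue_atlas c & chart_dom c p.
Proof.
have [[x [Ax <-]]|[y [By <-]]] := cover p.
  have [a [Aa ax]] := atlas_at x; exists (push_chart H1 oB x0 a); first by left; exists a.
  by exists x.
have [b [Ab bx]] := atlas_at y; exists (push_chart H2 oA y0 b); first by right; exists b.
by exists y.
Qed.

Lemma glue_atlas_compat c d : glue_atlas c -> glue_atlas d ->
  Coo_on (c @` (chart_dom c `&` chart_dom d)) (d \o chart_inv c).
Proof.
move=> Ac Ad; rewrite Coo_onP; last by apply: chart_image_open => p _; exact: chart_near_dom.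
move=> _ [p [cp dp] <-]; have [[x [Ax xp]]|[y [By yp]]] := cover p; subst p.
  have [ec oc] := osign_exists (glue_atlas1 Ac Ax cp).
  have [ed od] := osign_exists (glue_atlas1 Ad Ax dp).
  by have [] := compat_transition H1 (glue_atlas1 Ac) (glue_atlas1 Ad) Ax cp dp oc od.
have [ec oc] := osign_exists (glue_atlas2 Ac By cp).
have [ed od] := osign_exists (glue_atlas2 Ad By dp).
by have [] := compat_transition H2 (glue_atlas2 Ac) (glue_atlas2 Ad) By cp dp oc od.
Qed.

(** Two points with representatives on a common side are separated in [X] or in [Y]. The only other
    pairs consist of one point on each side, neither on the neck, and these are the subject of
    [separated]. *)
Lemma glue_hausdorff : hausdorff_space T.
Proof.
have sameX (Z W : oriented_manifold R n) (C : set Z) (D : set W) (k : Z -> T) (l : W -> T)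
    (HC : half_gluing C D k l) (oD : open D) z z' : C z -> C z' -> z <> z' ->
    exists2 AB : set T * set T, (k z \in AB.1 /\ k z' \in AB.2) & [/\ open AB.1, open AB.2 & AB.1 `&` AB.2 == set0].
  move=> Cz Cz' zz'; have := @manifold_hausdorff R n Z; rewrite open_hausdorff => /(_ z z' (introN eqP zz')).
  move=> [[U V] [/= zU zV] [oU oV /eqP UV]].
  exists (k @` (U `&` C), k @` (V `&` C)).
    by split; rewrite inE; [exists z|exists z'] => //; split=> //; rewrite -inE.
  have oC := glue_openA HC.
  split; [by apply: (glue_open_image HC oD) => [|? []//]; exact: openI|by apply: (glue_open_image HC oD) => [|? []//]; exact: openI|].
  apply/eqP/seteqP; split=> // p [[u [Uu Cu] up] [v [Vv Cv] vp]] /=.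
  have uv := glue_inj HC Cu Cv (etrans up (esym vp)).
  have : (U `&` V) u by split=> //; rewrite uv.
  by rewrite UV.
have swap (p q : T) : (exists2 AB : set T * set T, (q \in AB.1 /\ p \in AB.2) & [/\ open AB.1, open AB.2 & AB.1 `&` AB.2 == set0]) ->
    exists2 AB : set T * set T, (p \in AB.1 /\ q \in AB.2) & [/\ open AB.1, open AB.2 & AB.1 `&` AB.2 == set0].
  by move=> [[U V] [pU qV] [oU oV UV]]; exists (V, U) => //; split=> //; rewrite setIC.
have mixed x y : A x -> B y -> i x <> j y ->
    exists2 AB : set T * set T, (i x \in AB.1 /\ j y \in AB.2) & [/\ open AB.1, open AB.2 & AB.1 `&` AB.2 == set0].
  move=> Ax By xy.
  have [[y' [By' E]]|nx] := pselect (exists y', B y' /\ i x = j y').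
    by rewrite E; apply: (sameX _ _ _ _ _ _ H2 oA) => // yy'; apply: xy; rewrite E yy'.
  have [[x' [Ax' E]]|ny] := pselect (exists x', A x' /\ i x' = j y).
    by rewrite -E; apply: (sameX _ _ _ _ _ _ H1 oB) => // xx'; apply: xy; rewrite xx' E.
  have [||U [V [[oU UA] [oV VB] Ux Vy UV]]] := separated Ax By.
  - by move=> y' By' E; apply: nx; exists y'.
  - by move=> x' Ax' E; apply: ny; exists x'.
  exists (i @` U, j @` V); first by split; rewrite inE; [exists x|exists y].
  split; [exact: (glue_open_image H1 oB)|exact: (glue_open_image H2 oA)|].
  by apply/eqP/seteqP; split=> // p [[u Uu <-] [v Vv /esym E]]; exact: (UV _ _ Uu Vv E).
rewrite open_hausdorff => p q /eqP pq.
have [[x [Ax xp]]|[y [By yp]]] := cover p; have [[x' [Ax' xq]]|[y' [By' yq]]] := cover q; subst p q.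
- by apply: (sameX _ _ _ _ _ _ H1 oB) => // E; apply: pq; rewrite E.
- exact: mixed.
- by apply: swap; apply: mixed => //; exact/nesym.
- by apply: (sameX _ _ _ _ _ _ H2 oA) => // E; apply: pq; rewrite E.
Qed.

Lemma glue_second_countable : @second_countable T.
Proof.
have [BX cX [oX bX]] := @manifold_second_countable R n X.
have [BY cY [oY bY]] := @manifold_second_countable R n Y.
exists (((fun U => i @` (U `&` A)) @` BX) `|` ((fun U => j @` (U `&` B)) @` BY)).
  rewrite -bigcup2inE; apply: bigcup_countable => // -[|[|k]] /= _.
  - exact: sub_countable (card_image_le _ _) cX.
  - exact: sub_countable (card_image_le _ _) cY.
  - exact: countable0.
split=> [_ [[U BU <-]|[U BU <-]]|p V].
- by apply: (glue_open_image H1 oB) => [|? []//]; apply: openI => //; exact: oX.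
- by apply: (glue_open_image H2 oA) => [|? []//]; apply: openI => //; exact: oY.
have [[x [Ax <-]]|[y [By <-]]] := cover p => nV.
  have [U [BU Ux] UV] := bX x _ (glue_near H1 Ax nV).
  exists (i @` (U `&` A)); first by split; [left; exists U|exists x].
  by move=> _ [u [Uu Au] <-]; exact: UV.
have [U [BU Uy] UV] := bY y _ (glue_near H2 By nV).
exists (j @` (U `&` B)); first by split; [right; exists U|exists y].
by move=> _ [u [Uu Au] <-]; exact: UV.
Qed.

Definition glue_manifold : manifold R n :=
  Manifold glue_atlas_cover glue_atlas_compat glue_hausdorff glue_second_countable.

(** A chart is positive at [p] when its pull-back to one of the sides preserves the orientation. The
    disjunction makes sense on the neck because the two sides give the same answer there, as
    [glue_orientation1] and [glue_orientation2] show. *)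
Definition glue_orientation (c : chart R n glue_manifold) (p : glue_manifold) : bool :=
  `[< (exists x, [/\ A x, i x = p & osign true ((fun x' => c (i x')) : X -> euclidean R n) x]) \/
      (exists y, [/\ B y, j y = p & osign true ((fun y' => c (j y')) : Y -> euclidean R n) y]) >].

Lemma glue_orientation1 (c : chart R n glue_manifold) x e : atlas c -> A x -> chart_dom c (i x) ->
  osign e ((fun x' => c (i x')) : X -> euclidean R n) x -> glue_orientation c (i x) = e.
Proof.
move=> Ac Ax cx oe.
suff E e' : (exists x1, [/\ A x1, i x1 = i x & osign e' ((fun x' => c (i x')) : X -> euclidean R n) x1]) \/
      (exists y, [/\ B y, j y = i x & osign e' ((fun y' => c (j y')) : Y -> euclidean R n) y]) -> e' = e.
  case: e oe E => oe E; first by apply/asboolP; left; exists x.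
  by apply/asboolP => /E.
case=> [[x1 [Ax1 /(glue_inj H1 Ax1 Ax) -> oe']]|[y [By yx oe']]]; first exact: osign_uniq oe' oe.
have cy : chart_dom c (j y) by rewrite yx.
have [_ K] := push_chart_compat2 H1 oB (glue_atlas1 Ac) By Ax (esym yx) cy.
exact: osign_uniq oe' (K _ oe).
Qed.

Lemma glue_orientation2 (c : chart R n glue_manifold) y e : atlas c -> B y -> chart_dom c (j y) ->
  osign e ((fun y' => c (j y')) : Y -> euclidean R n) y -> glue_orientation c (j y) = e.
Proof.
move=> Ac By cy oe.
suff E e' : (exists x, [/\ A x, i x = j y & osign e' ((fun x' => c (i x')) : X -> euclidean R n) x]) \/
      (exists y1, [/\ B y1, j y1 = j y & osign e' ((fun y' => c (j y')) : Y -> euclidean R n) y1]) -> e' = e.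
  case: e oe E => oe E; first by apply/asboolP; right; exists y.
  by apply/asboolP => /E.
case=> [[x [Ax xy oe']]|[y1 [By1 /(glue_inj H2 By1 By) -> oe']]]; last exact: osign_uniq oe' oe.
have [_ K] := push_chart_compat2 H1 oB (glue_atlas1 Ac) By Ax xy cy.
exact: osign_uniq (K _ oe') oe.
Qed.

Lemma glue_orientation_locally_constant (c : chart R n glue_manifold) p : atlas c -> chart_dom c p ->
  \forall q \near p, glue_orientation c q = glue_orientation c p.
Proof.
move=> Ac; have [[x [Ax <-]]|[y [By <-]]] := cover p => cp.
  have lx := glue_atlas1 Ac Ax cp; have [e oe] := osign_exists lx.
  have n1 := glue_near_image H1 oB Ax (osign_near lx oe).
  apply: filterS2 n1 (chart_near_dom cp) => _ [x' [Ax' ox' ->]] cx'.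
  by rewrite (glue_orientation1 Ac Ax cp oe) (glue_orientation1 Ac Ax' cx' ox').
have ly := glue_atlas2 Ac By cp; have [e oe] := osign_exists ly.
have n1 := glue_near_image H2 oA By (osign_near ly oe).
apply: filterS2 n1 (chart_near_dom cp) => _ [y' [By' oy' ->]] cy'.
by rewrite (glue_orientation2 Ac By cp oe) (glue_orientation2 Ac By' cy' oy').
Qed.

Lemma glue_orientation_compat (c d : chart R n glue_manifold) p : atlas c -> atlas d ->
  chart_dom c p -> chart_dom d p -> (glue_orientation c p == glue_orientation d p) =
  (0 < \det ('J (d \o chart_inv c) (c p))).
Proof.
move=> Ac Ad; have [[x [Ax <-]]|[y [By <-]]] := cover p => cp dp.
  have [ec oc] := osign_exists (glue_atlas1 Ac Ax cp).
  have [ed od] := osign_exists (glue_atlas1 Ad Ax dp).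
  rewrite (glue_orientation1 Ac Ax cp oc) (glue_orientation1 Ad Ax dp od).
  by have [] := compat_transition H1 (glue_atlas1 Ac) (glue_atlas1 Ad) Ax cp dp oc od.
have [ec oc] := osign_exists (glue_atlas2 Ac By cp).
have [ed od] := osign_exists (glue_atlas2 Ad By dp).
rewrite (glue_orientation2 Ac By cp oc) (glue_orientation2 Ad By dp od).
by have [] := compat_transition H2 (glue_atlas2 Ac) (glue_atlas2 Ad) By cp dp oc od.
Qed.

Definition glued : oriented_manifold R n :=
  @OrientedManifold R n glue_manifold glue_orientation glue_orientation_locally_constant
    glue_orientation_compat.

(** A local inverse of [c k] preceded by the chart [c] is a local inverse of [k]. The two sides are
    abstracted as [Z] and [Z'] so that both inclusions are covered. *)
Lemma glue_oemb (W : oriented_manifold R n) (Z Z' : oriented_manifold R n) (C : set Z) (D : set Z')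
    (k : Z -> W) (l : Z' -> W) (HC : half_gluing C D k l) (oD : open D) :
  (forall c : chart R n W, atlas c -> compat_half C k c) ->
  (forall (c : chart R n W) z e, atlas c -> C z -> chart_dom c (k z) ->
     osign e ((fun z' => c (k z')) : Z -> euclidean R n) z -> orientation c (k z) = e) ->
  oemb C k /\ forall z, C z -> osign true k z.
Proof.
move=> kc ko; have lk z : C z -> ldf k z /\ osign true k z.
  move=> Cz; have [a [Aa az]] := atlas_at z; have [c [Ac ckz]] := atlas_at (k z).
  have lz := kc c Ac z Cz ckz; have [[_ sz] [h [sh h1 h2]]] := lz.
  have hz : h (c (k z)) = z := nbhs_singleton h1.
  have mk : msm k z.
    apply: (@msmP R n n Z W k z a c) => //; first exact: (glue_cont HC).
    exact: (sz a (@id_chart R n)).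
  have lk : ldf k z.
    split=> //; exists (fun p => h (c p)); split.
    - apply: (@msm_comp R n n n W (euclidean R n) Z c h (k z)) => //.
      exact: msm_chart.
    - exact: h1.
    - have n0 : \forall z' \near z, h (c (k z')) = z' by exact: h1.
      have := glue_near_image HC oD Cz n0.
      by apply: filterS => _ [z' [Cz' E ->]]; rewrite E.
  split=> //; have [e oe] := osign_exists lz.
  apply: (osignP lk Aa Ac az ckz).
  have := oe a (@id_chart R n) Aa erefl az I.
  rewrite (ko c z e Ac Cz ckz oe) => E.
  rewrite eqb_id; apply: etrans E.
  by move: (orientation a z) (e) => [] [].
split; last by move=> z /lk[].
split; [exact: glue_openA HC|by move=> z /lk[]|].
by move=> z z' Cz Cz'; exact: (glue_inj HC Cz Cz').
Qed.

Lemma glued_oemb : [/\ oemb A (i : X -> glued), forall x, A x -> osign true (i : X -> glued) x,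
  oemb B (j : Y -> glued) & forall y, B y -> osign true (j : Y -> glued) y].
Proof.
have [e1 o1] := @glue_oemb glued X Y A B i j H1 oB glue_atlas1 (fun c x e Ac Ax cx oe => glue_orientation1 Ac Ax cx oe).
have [e2 o2] := @glue_oemb glued Y X B A j i H2 oA glue_atlas2 (fun c x e Ac Ax cx oe => glue_orientation2 Ac Ax cx oe).
by split.
Qed.

End Gluing.

Section Pushout.
Context {X Y : topologicalType} {K : Type} {A : set X} {B : set Y}.
Variables (oA : open A) (oB : open B) (i : X -> K) (j : Y -> K).

(** A copy of [K] whose type records the two partial maps, so that their final topology can be
    attached to it as a canonical instance. *)
Definition pushout_of (_ : open A) (_ : open B) (_ : X -> K) (_ : Y -> K) : Type := K.
Local Notation pushout := (pushout_of oA oB i j).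

HB.instance Definition _ := gen_eqMixin pushout.
HB.instance Definition _ := gen_choiceMixin pushout.

Definition pushout_open (U : set pushout) : Prop :=
  open (A `&` i @^-1` U) /\ open (B `&` j @^-1` U).

Let pushout_openT : pushout_open setT.
Proof. by split; rewrite preimage_setT setIT. Qed.

Let pushout_openI : setI_closed pushout_open.
Proof.
by move=> U V [U1 U2] [V1 V2]; split; rewrite preimage_setI setIIr; exact: openI.
Qed.

Let pushout_bigU (I : Type) (f : I -> set pushout) :
  (forall k, pushout_open (f k)) -> pushout_open (\bigcup_k f k).
Proof.
move=> H; split; rewrite preimage_bigcup setI_bigcupr; apply: bigcup_open => k _;
  by have [] := H k.
Qed.

HB.instance Definition _ := isOpenTopological.Build pushout pushout_openT pushout_openI pushout_bigU.

End Pushout.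

(** * Existence of a connected sum along given discs *)

Section ConnectedSumExists.
Context {R : realType}.

Lemma ldf_neck n (X Y : oriented_manifold R n) (Phi : euclidean R n -> X) (g : Y -> euclidean R n)
    (e e' : bool) (y : Y) : (g y : 'rV[R]_n) <> 0 -> ldf g y -> osign e g y ->
  (forall v, ldf Phi v) -> (forall v, osign e' Phi v) ->
  ldf (fun z => Phi (inversion (g z : 'rV[R]_n))) y /\ osign ((e == false) == e') (fun z => Phi (inversion (g z : 'rV[R]_n))) y.
Proof.
move=> /eqP g0 lg og lPhi oPhi; have [l1 o1] := ldf_inversion g0.
pose h z : euclidean R n := inversion (g z : 'rV[R]_n).
have l2 : ldf h y := ldf_comp lg l1.
have o2 : osign (e == false) h y by exact: (@osign_comp R n Y _ _ e false g _ y lg l1 og o1).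
split; first exact: (@ldf_comp R n n n Y _ X h Phi y l2 (lPhi _)).
exact: (@osign_comp R n Y _ X (e == false) e' h Phi y l2 (lPhi _) o2 (oPhi _)).
Qed.

Context {n : nat} {X Y : oriented_manifold R n.+1}.
Context {Phi : euclidean R n.+1 -> X} {Psi : euclidean R n.+1 -> Y}.
Hypothesis ePhi : oemb setT Phi.
Hypothesis oPhi : forall v, osign true Phi v.
Hypothesis ePsi : oemb setT Psi.
Hypothesis oPsi : forall v, osign false Psi v.

Let good (p : X + Y) : Prop :=
  match p with inl x => x <> Phi 0 | inr y => forall v, y <> Psi v end.

Let Phi_inj v w : Phi v = Phi w -> v = w.
Proof. by have [_ _ H] := ePhi; exact: H. Qed.

Let Psi_inj v w : Psi v = Psi w -> v = w.
Proof. by have [_ _ H] := ePsi; exact: H. Qed.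

(** A nonzero vector, which exists because the dimension is positive; it provides the default
    element of the carrier. *)
Let one : 'rV[R]_n.+1 := const_mx 1.

Let one_neq0 : one <> 0.
Proof. by move=> /matrixP/(_ 0 0)/eqP; rewrite !mxE oner_eq0. Qed.

Let good_one : good (inl (Phi one)).
Proof. by move=> /= /Phi_inj; exact: one_neq0. Qed.

Let mk (p : X + Y) : {p | good p} :=
  match pselect (good p) with left h => exist good p h | right _ => exist good _ good_one end.

Let mkE p : good p -> sval (mk p) = p.
Proof. by move=> gp; rewrite /mk; case: pselect. Qed.

Let mk_inj p q : good p -> good q -> mk p = mk q -> p = q.
Proof. by move=> gp gq /(congr1 sval); rewrite !mkE. Qed.

Let inversion_neq0 (v : 'rV[R]_n.+1) : v <> 0 -> inversion v <> 0.
Proof. by move=> v0 /eqP; rewrite inversion_eq0 => /eqP. Qed.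

Let Phi_neq0 (v : 'rV[R]_n.+1) : v <> 0 -> Phi v <> Phi 0.
Proof. by move=> v0 /Phi_inj. Qed.

(* The quotient is avoided: the carrier consists of the points of X other than
   Phi 0 and of the points of Y outside the image of Psi. *)
Lemma connected_sum_exists : exists W i j, @csum R n.+1 X Y W Phi Psi i j.
Proof.
have [gP [gPK lgP ogP]] := disc_inv ePhi.
have [gS [gSK lgS ogS]] := disc_inv ePsi.
have [_ lPhi _] := ePhi; have [_ lPsi _] := ePsi.
pose A : set X := [set~ Phi 0]; pose B : set Y := [set~ Psi 0].
have oA : open A := open_setC1 _; have oB : open B := open_setC1 _.
pose k1 x := mk (inl x).
(* The points of the disc [Psi] are represented by their partners in [X], so that the two inclusions
   agree on the neck by construction. *)
pose k2 y := if pselect (exists v, y = Psi v) then mk (inl (Phi (inversion (gS y : 'rV[R]_n.+1)))) else mk (inr y).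
pose T : topologicalType := pushout_of oA oB k1 k2.
pose i : X -> T := k1; pose j : Y -> T := k2.
have iE x : A x -> good (inl x) by [].
have jE (v : 'rV[R]_n.+1) : v <> 0 -> j (Psi v) = i (Phi (inversion v)).
  by move=> v0; rewrite /j /i /k2; case: pselect => [e1|[]]; [rewrite gSK|exists v].
have jN y : (forall v, y <> Psi v) -> j y = mk (inr y).
  by move=> ny; rewrite /j /k2; case: pselect => [e1|//]; exfalso; case: e1 => v; exact: ny.
have iinj x x' : A x -> A x' -> i x = i x' -> x = x'.
  by move=> Ax Ax' E; case: (@mk_inj (inl x) (inl x') Ax Ax' E).
have ij x y : A x -> B y -> i x = j y ->
    exists v : 'rV[R]_n.+1, [/\ v <> 0, x = Phi v & y = Psi (inversion v)].
  move=> Ax By; have [[v yv]|ny] := pselect (exists v, y = Psi v).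
    have v0 : v <> (0 : 'rV[R]_n.+1) by move=> v0; apply: By; rewrite yv v0.
    rewrite yv jE// => /(iinj _ _ Ax) -> //; last exact/Phi_neq0/inversion_neq0.
    by exists (inversion (v : 'rV[R]_n.+1)); rewrite inversionK; split=> //; exact: inversion_neq0.
  rewrite jN; last by move=> v yv; apply: ny; exists v.
  by move=> /(@mk_inj (inl x) (inr y) Ax (fun v yv => ny (ex_intro _ v yv))).
have jinj y y' : B y -> B y' -> j y = j y' -> y = y'.
  move=> By By'.
  have [[v yv]|ny] := pselect (exists v, y = Psi v).
    have v0 : v <> (0 : 'rV[R]_n.+1) by move=> v0; apply: By; rewrite yv v0.
    rewrite {1}yv jE// => /ij; case => //; first exact/Phi_neq0/inversion_neq0.
    by move=> w [w0 /Phi_inj E ->]; rewrite -E inversionK.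
  have [[v yv]|ny'] := pselect (exists v, y' = Psi v).
    have v0 : v <> (0 : 'rV[R]_n.+1) by move=> v0; apply: By'; rewrite yv v0.
    rewrite {1}yv jE// => /esym/ij; case => //; first exact/Phi_neq0/inversion_neq0.
    by move=> w [w0 /Phi_inj E ->]; rewrite -E inversionK.
  have {}ny v : y <> Psi v by move=> yv; apply: ny; exists v.
  have {}ny' v : y' <> Psi v by move=> yv; apply: ny'; exists v.
  by rewrite !jN// => E; case: (@mk_inj (inr y) (inr y') ny ny' E).
have H1 : half_gluing A B i j.
  split=> //.
  move=> x y Ax By /(ij _ _ Ax By)[v [v0 xv yv]].
  have w0 := inversion_neq0 v0; set w := inversion v in yv w0.
  have gw : gS (Psi w) = w := gSK w.
  have gw0 : (gS (Psi w) : 'rV[R]_n.+1) <> 0 by rewrite gw.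
  have [lt ot] := @ldf_neck n.+1 X Y Phi gS false true (Psi w) gw0 (lgS w) (ogS _ _ (@oPsi w)) (fun v => lPhi v I) (@oPhi).
  exists (fun y' => Phi (inversion (gS y' : 'rV[R]_n.+1))); rewrite yv; split=> //.
  - by rewrite gw inversionK xv.
  - apply: filterS (near_range w ePsi) => _ [z ->] Bz.
    have z0 : z <> (0 : 'rV[R]_n.+1) by move=> z0; apply: Bz; rewrite z0.
    rewrite gSK jE//; split=> //; exact/Phi_neq0/inversion_neq0.
have H2 : half_gluing B A j i.
  split=> //; first by move=> U; rewrite and_comm.
  move=> y x By Ax /esym/(ij _ _ Ax By)[v [v0 xv yv]].
  have gw : gP (Phi v) = v := gPK v.
  have gw0 : (gP (Phi v) : 'rV[R]_n.+1) <> 0 by rewrite gw.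
  have [lt ot] := @ldf_neck n.+1 Y X Psi gP true false (Phi v) gw0 (lgP v) (ogP _ _ (@oPhi v)) (fun v => lPsi v I) (@oPsi).
  exists (fun x' => Psi (inversion (gP x' : 'rV[R]_n.+1))); rewrite xv; split=> //.
  - by rewrite gw yv.
  - apply: filterS (near_range v ePhi) => _ [z ->] Az.
    have z0 : z <> (0 : 'rV[R]_n.+1) by move=> z0; apply: Az; rewrite z0.
    have z1 := inversion_neq0 z0.
    rewrite gPK jE// inversionK; split=> // /Psi_inj; exact: z1.
have cover p : (exists x, A x /\ i x = p) \/ (exists y, B y /\ j y = p).
  case: p => -[x|y] gp; [left; exists x|right; exists y].
    split=> //; rewrite /i /k1 /mk; case: pselect => // h; congr exist; exact: Prop_irrelevance.
  split; first exact: gp.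
  rewrite jN; last exact: gp.
  by rewrite /mk; case: pselect => // h; congr exist; exact: Prop_irrelevance.
have separated x y : A x -> B y -> (forall y', B y' -> i x <> j y') ->
  (forall x', A x' -> i x' <> j y) -> exists (U : set X) (V : set Y),
  [/\ open U /\ U `<=` A, open V /\ V `<=` B, U x, V y & forall x' y', U x' -> V y' -> i x' <> j y'].
  move=> Ax By nx ny.
  (* The complements of the closed unit balls of the two discs separate the points: [v] and
     [inversion v] cannot both have [N2 > 1]. *)
  pose CX := Phi @` [set v | N2 v <= 1]; pose CY := Psi @` [set v | N2 v <= 1].
  have cX : closed CX by apply: disc_ball_closed => v; exact: ldf_cont (lPhi v I).
  have cY : closed CY by apply: disc_ball_closed => v; exact: ldf_cont (lPsi v I).
  have nPhi v : x <> Phi v.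
    move=> xv; have v0 : v <> (0 : 'rV[R]_n.+1) by move=> v0; apply: Ax; rewrite xv v0.
    have z1 := inversion_neq0 v0.
    apply: (nx (Psi (inversion (v : 'rV[R]_n.+1)))); first by move=> /Psi_inj; exact: z1.
    by rewrite jE// inversionK xv.
  have nPsi v : y <> Psi v.
    move=> yv; have v0 : v <> (0 : 'rV[R]_n.+1) by move=> v0; apply: By; rewrite yv v0.
    apply: (ny (Phi (inversion (v : 'rV[R]_n.+1)))); first exact/Phi_neq0/inversion_neq0.
    by rewrite yv jE.
  have N20' : N2 (0 : 'rV[R]_n.+1) <= 1 by rewrite N20.
  exists (~` CX), (~` CY); split.
  - split; first by rewrite openC.
    by move=> z nz zA; apply: nz; exists 0.
  - split; first by rewrite openC.
    by move=> z nz zA; apply: nz; exists 0.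
  - by move=> [v _ vx]; exact: (nPhi v).
  - by move=> [v _ vx]; exact: (nPsi v).
  move=> x' y' nx' ny' E.
  have Ax' : A x' by move=> zA; apply: nx'; exists 0.
  have By' : B y' by move=> zA; apply: ny'; exists 0.
  have [v [v0 xv yv]] := ij _ _ Ax' By' E.
  have [v1|v1] := leP (N2 v) 1; first by apply: nx'; exists v.
  apply: ny'; exists (inversion v) => //=.
  by rewrite N2_inversion invf_le1 ?ltW// (lt_trans ltr01).
pose W := glued H1 H2 (Phi 0) (Psi 0) cover separated.
have [e1 o1 e2 o2] := @glued_oemb R n.+1 X Y T A B i j H1 H2 (Phi 0) (Psi 0) cover separated.
exists W, (i : X -> W), (j : Y -> W); split=> //.
move=> x y Ax By; split; first exact: ij.
move=> [v [v0 -> ->]]; rewrite jE ?inversionK//; exact: inversion_neq0.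
Qed.

End ConnectedSumExists.

Section Descent.
Context {R : realType}.

(** Maps out of a glued manifold are known through their composites with the inclusions. These are
    local diffeomorphisms, so local properties descend by composing with a local inverse. *)
Lemma msm_descend m n p (M : manifold R m) (N : manifold R n) (P : manifold R p)
    (I : M -> N) (f : M -> P) (F : N -> P) (x : M) :
  ldf I x -> msm f x -> (\forall y \near x, F (I y) = f y) -> msm F (I x).
Proof.
move=> [sI [g [sg gI Ig]]] sf E; have gx : g (I x) = x := nbhs_singleton gI.
have sfg : msm (fun z => f (g z)) (I x) by apply: msm_comp => //; rewrite gx.
apply: msm_near_eq sfg.
have n1 : \forall z \near I x, F (I (g z)) = f (g z).
  have n0 : \forall y \near g (I x), F (I y) = f y by rewrite gx.
  exact: (msm_cont sg n0).
by apply: filterS2 n1 Ig => z <- ->.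
Qed.

Lemma imm_descend m n p (M : manifold R m) (N : manifold R n) (P : manifold R p)
    (I : M -> N) (f : M -> P) (F : N -> P) (x : M) :
  ldf I x -> imm f x -> (\forall y \near x, F (I y) = f y) -> imm F (I x).
Proof.
move=> lI [sf [h [sh hf]]] E; split; first exact: msm_descend sf E.
have Fx : F (I x) = f x := nbhs_singleton E.
have [sI [g [sg gI Ig]]] := lI; have gx : g (I x) = x := nbhs_singleton gI.
have hx : h (f x) = x := nbhs_singleton hf.
exists (fun z => I (h z)); rewrite Fx; split.
  by apply: msm_comp => //; rewrite hx.
have n1 : \forall z \near I x, F (I (g z)) = f (g z) /\ h (f (g z)) = g z.
  have n0 : \forall y \near g (I x), F (I y) = f y /\ h (f y) = y by rewrite gx; exact: filterI.
  exact: (msm_cont sg n0).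
by apply: filterS2 n1 Ig => z [E1 E2] Iz; rewrite -{1}Iz E1 E2.
Qed.

Lemma ldf_descend m n p (M : manifold R m) (N : manifold R n) (P : manifold R p)
    (I : M -> N) (f : M -> P) (F : N -> P) (x : M) :
  ldf I x -> ldf f x -> (\forall y \near x, F (I y) = f y) -> ldf F (I x).
Proof.
move=> [sI [g [sg gI Ig]]] lf E; have gx : g (I x) = x := nbhs_singleton gI.
have lg : ldf g (I x) by apply: (@ldf_sym _ _ _ _ _ I).
have lfg : ldf (fun z => f (g z)) (I x) by apply: ldf_comp => //; rewrite gx.
apply: ldf_near_eq lfg.
have n1 : \forall z \near I x, F (I (g z)) = f (g z).
  have n0 : \forall y \near g (I x), F (I y) = f y by rewrite gx.
  exact: (msm_cont sg n0).
by apply: filterS2 n1 Ig => z <- ->.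
Qed.

Lemma osign_descend n (M N P : oriented_manifold R n)
    (I : M -> N) (f : M -> P) (F : N -> P) (x : M) :
  ldf I x -> osign true I x -> ldf f x -> osign true f x -> (\forall y \near x, F (I y) = f y) ->
  osign true F (I x).
Proof.
move=> lI oI lf of_ E; have lF := ldf_descend lI lf E.
have [e oe] := osign_exists lF.
have o1 := osign_comp lI lF oI oe.
have o2 := osign_near_eq (ldf_comp lI lF) E o1.
by have := osign_uniq o2 of_; case: e oe {o1 o2}.
Qed.

End Descent.

(** * Weak associativity *)

Section Associativity.
Context {R : realType}.

Lemma householder2 n (u v : 'rV[R]_n) : u != 0 -> v *m householder u *m householder u = v.
Proof. by move=> u0; rewrite -mulmxA householderK// mulmx1. Qed.

Lemma row1_neq0 n : (const_mx 1 : 'rV[R]_n.+1) != 0.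
Proof. by apply/eqP => /matrixP/(_ 0 0)/eqP; rewrite !mxE oner_eq0. Qed.

(** Exchanging the summands turns the second disc into the first one; the reflection introduced by
    two exchanges cancels, since it commutes with radial maps. *)
Lemma csum_shrink2 n (M N P : oriented_manifold R n.+1) phi psi i j rho d c :
  @csum R n.+1 M N P phi psi i j -> shrinker rho d c ->
  exists i', csum phi (fun v => psi (radial c (v : 'rV[R]_n.+1))) i' j.
Proof.
move=> MNP sc; have u0 := row1_neq0 n; set u := const_mx 1 in u0.
have [i' s1] := csum_shrink (csum_sym MNP u0) sc.
have s2 := csum_sym s1 u0.
exists i'; move: s2; congr (csum _ _ _ _); apply/funext => v; rewrite ?householder2//.
congr (psi _); have := householder2 (radial c (v : 'rV[R]_n.+1)) u0.
by rewrite /radial -!scalemxAl N2_householder// householder2.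
Qed.

Section Core.
Context {n : nat} {X Y Y' Z' W : oriented_manifold R n.+1}.
Context {phi : euclidean R n.+1 -> X} {psi : euclidean R n.+1 -> Y} {i : X -> W} {j : Y -> W}.
Hypothesis XYW : csum phi psi i j.
Context {phi' : euclidean R n.+1 -> Y'} {psi' : euclidean R n.+1 -> Z'} {i' : Y' -> Y} {j' : Z' -> Y}.
Hypothesis YZY : csum phi' psi' i' j'.
Variable Q : euclidean R n.+1 -> Y'.
Hypothesis eQ : oemb setT Q.
Hypothesis oQ : forall v, osign false Q v.
Hypothesis QE : forall v, i' (Q v) = psi v.
Hypothesis Qphi : forall v w, Q v <> phi' w.

(* The disc psi of Y is the disc Q of Y', disjoint from the neck of Y' # Z'. *)
Lemma csum_assoc_core : exists V,
  (exists f g h k, @csum R n.+1 X Y' V f g h k) /\ (exists f g h k, @csum R n.+1 V Z' W f g h k).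
Proof.
have [ o1 s1 o2 s2 o3 s3 o4 s4 cov r] := XYW.
have [ o1' s1' o2' s2' o3' s3' o4' s4' cov' r'] := YZY.
have [V [I [J IJ]]] := connected_sum_exists o1 s1 eQ oQ.
exists V; split; first by exists phi, Q, I, J.
have [_ _ _ _ oI sI oJ sJ covV rV] := IJ.
have [gI [gIK _]] := oemb_inv (phi 0) oI.
have [gJ [gJK _]] := oemb_inv (phi' 0) oJ.
have [_ l3 inj3] := o3; have [_ l4 inj4] := o4; have [_ l3' inj3'] := o3'; have [_ l4' inj4'] := o4'.
have [_ lI injI] := oI; have [_ lJ injJ] := oJ.
have Q0 v : Q v <> phi' 0 by exact: Qphi.
have psi0 y : y <> phi' 0 -> y <> Q 0 -> i' y <> psi 0.
  by move=> yp yq; rewrite -QE => /(inj3' _ _ yp (Q0 0)).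
have i'z z : z <> psi' 0 -> j' z <> psi 0.
  by move=> zp; rewrite -QE => /esym/(r' _ _ (Q0 0) zp)[v [_ /Qphi]].
(* [V] is glued from [X] and [Y']: on [X] its inclusion into [W] is [i], and on [Y'] it passes
   through [Y] as [j i']. *)
pose iW p := if pselect (exists x, x <> phi 0 /\ I x = p) then i (gI p) else j (i' (gJ p)).
have iWI x : x <> phi 0 -> iW (I x) = i x.
  by move=> xp; rewrite /iW; case: pselect => [e1|[]]; [rewrite gIK|exists x].
have iWJ y : y <> Q 0 -> iW (J y) = j (i' y).
  move=> yq; rewrite /iW; case: pselect => [e1|e1]; last by rewrite gJK.
  have [x [xp E]] := e1; rewrite /= -{1}E gIK//.
  have [v [v0 -> ->]] := (rV _ _ xp yq).1 E.
  by rewrite QE (csum_neck XYW).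
have phi'Q v : phi' v <> Q 0 by move=> /esym/Qphi.
have nI x : x <> phi 0 -> I x <> J (phi' 0).
  by move=> xp /(rV _ _ xp (phi'Q _))[v [_ _ /esym/Qphi]].
have lW p : p <> J (phi' 0) -> ldf iW p /\ osign true iW p.
  move=> pJ; have [[x [xp xp']]|[y [yq yp']]] := covV p; subst p.
    have E : \forall x' \near x, iW (I x') = i x'.
      by apply: filterS (near_open (open_setC1 _) xp) => x' /iWI.
    split; first exact: (ldf_descend (lI _ xp) (l3 _ xp) E).
    exact: (osign_descend (lI _ xp) (sI _ xp) (l3 _ xp) (s3 _ xp) E).
  have yp : y <> phi' 0 by move=> yp; apply: pJ; rewrite yp.
  have yp2 := psi0 _ yp yq.
  have E : \forall y' \near y, iW (J y') = j (i' y').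
    by apply: filterS (near_open (open_setC1 _) yq) => y' /iWJ.
  have l5 : ldf (fun y => j (i' y)) y := ldf_comp (l3' _ yp) (l4 _ yp2).
  have o5 : osign true (fun y => j (i' y)) y := osign_comp (l3' _ yp) (l4 _ yp2) (s3' _ yp) (s4 _ yp2).
  split; first exact: (ldf_descend (lJ _ yq) l5 E).
  exact: (osign_descend (lJ _ yq) (sJ _ yq) l5 o5 E).
have mixed x y : x <> phi 0 -> y <> Q 0 -> y <> phi' 0 -> i x = j (i' y) -> I x = J y.
  move=> xp yq yp /(r _ _ xp (psi0 _ yp yq))[v [v0 -> ]]; rewrite -QE => /(inj3' _ _ yp (Q0 _)) ->.
  exact: (csum_neck IJ).
exists (fun v => J (phi' v)), psi', iW, (fun z => j (j' z)); split=> //.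
- by apply: oemb_comp o1' oJ _ => v _; exact: phi'Q.
- by move=> v; have [_ l _] := o1'; exact: (osign_comp (l _ Logic.I) (lJ _ (@phi'Q v)) (s1' _) (sJ _ (@phi'Q v))).
- split; [exact: open_setC1|by move=> p /lW[]|].
  move=> p q pJ qJ; have [[x [xp xp']]|[y [yq yp']]] := covV p;
    have [[x' [xp1 xq]]|[y' [yq' yp1]]] := covV q; subst p q.
  + by rewrite !iWI// => /(inj3 _ _ xp xp1) ->.
  + have yp : y' <> phi' 0 by move=> yp; apply: qJ; rewrite yp.
    by rewrite iWI// iWJ//; exact: mixed.
  + have yp : y <> phi' 0 by move=> yp; apply: pJ; rewrite yp.
    by rewrite iWI// iWJ// => /esym/(mixed _ _ xp1 yq yp).
  + have yp : y <> phi' 0 by move=> yp; apply: pJ; rewrite yp.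
    have yp2 : y' <> phi' 0 by move=> yp2; apply: qJ; rewrite yp2.
    by rewrite !iWJ// => /(inj4 _ _ (psi0 _ yp yq) (psi0 _ yp2 yq'))/(inj3' _ _ yp yp2) ->.
- by move=> p /lW[].
- by apply: oemb_comp o4' o4 _ => z; exact: i'z.
- by move=> z zp; exact: (osign_comp (l4' _ zp) (l4 _ (i'z _ zp)) (s4' _ zp) (s4 _ (i'z _ zp))).
- move=> p; have [[x [xp <-]]|[y [yp <-]]] := cov p.
    by left; exists (I x); split; [exact: nI|exact: iWI].
  have [[y' [yp' E]]|[z [zp E]]] := cov' y; last by right; exists z; rewrite E.
  have yq : y' <> Q 0 by move=> yq; apply: yp; rewrite -E yq QE.
  left; exists (J y'); split; last by rewrite iWJ// E.
  by move=> /(injJ _ _ yq (@phi'Q 0)).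
- move=> p z pJ zp; split; last first.
    move=> [v [v0 -> ->]]; rewrite iWJ//; congr (j _); exact: (csum_neck YZY).
  have [[x [xp xp']]|[y [yq yp']]] := covV p; subst p.
    rewrite iWI// => /(r _ _ xp (i'z _ zp))[v [_ _]]; rewrite -QE => /esym/(r' _ _ (Q0 _) zp).
    by move=> [w [_ /Qphi]].
  have yp : y <> phi' 0 by move=> yp; apply: pJ; rewrite yp.
  rewrite iWJ// => /(inj4 _ _ (psi0 _ yp yq) (i'z _ zp))/(r' _ _ yp zp)[v [v0 -> ->]].
  by exists v.
Qed.

End Core.

(** The centre of the disc of [Y] lies in the part coming from [Y']. Shrinking [phi'] frees a
    neighbourhood of that point from the neck of [Y], and shrinking [psi] puts its whole disc into
    this neighbourhood, where it lifts to [Y']. *)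
Lemma csum_assoc_case n (X Y Y' Z' W : oriented_manifold R n.+1) phi psi i j phi' psi' i' j' y :
  @csum R n.+1 X Y W phi psi i j -> @csum R n.+1 Y' Z' Y phi' psi' i' j' ->
  y <> phi' 0 -> i' y = psi 0 ->
  exists V, is_connected_sum X Y' V /\ is_connected_sum V Z' W.
Proof.
move=> XYW YZY yp iy.
have [_ lphi' _] := csum_phi YZY; have [_ lpsi _] := csum_psi XYW.
have n1 : \forall v \near (0 : 'rV[R]_n.+1), phi' v <> y.
  have n0 : \forall z \near phi' 0, [set~ y] z.
    by apply: near_open; [exact: open_setC1|exact/nesym].
  exact: (ldf_cont (lphi' 0 I) n0).
have [r0 r00 r0P] := near0_ball n1.
(* Half of [r0], so that the closed ball [N2 <= r0 / 2] still avoids [y]. *)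
have r20 : 0 < r0 / 2 by rewrite divr_gt0.
have [d [c sc]] := shrinker_exists r20.
have [j1 YZY1] := csum_shrink YZY sc.
pose K := phi' @` [set v | N2 v <= r0 / 2].
have cK : closed K by apply: disc_ball_closed => v; exact: ldf_cont (lphi' v I).
have yK : ~ K y.
  move=> [v /= vr]; apply: r0P; apply: le_lt_trans vr _.
  by rewrite ltr_pdivrMr// ltr_pMr// ltr1n.
have K0 : K (phi' 0) by exists 0 => //=; rewrite N20 ltW.
have [_ li' inji'] := csum_i YZY.
have n2 : \forall v \near (0 : 'rV[R]_n.+1), (i' @` ~` K) (psi v).
  have n0 : \forall z \near psi 0, (i' @` ~` K) z.
    rewrite -iy; apply: ldf_image_near; first exact: li'.
    by apply: near_open => //; rewrite openC.
  exact: (ldf_cont (lpsi 0 I) n0).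
have [r1 r10 r1P] := near0_ball n2.
have [d1 [c1 sc1]] := shrinker_exists r10.
have [i1 XYW1] := csum_shrink2 XYW sc1.
have KC z : ~ K z -> z <> phi' 0 by move=> zK z0; apply: zK; rewrite z0.
have [g [gK og]] := oemb_inv (phi' 0) (csum_i YZY).
have Qex v : exists2 z, ~ K z & i' z = psi (radial c1 (v : 'rV[R]_n.+1)).
  by apply: r1P; exact: (shrinker_lt sc1).
pose Q (v : euclidean R n.+1) := g (psi (radial c1 (v : 'rV[R]_n.+1))).
have QP v : ~ K (Q v) /\ i' (Q v) = psi (radial c1 (v : 'rV[R]_n.+1)).
  by have [z zK zE] := Qex v; rewrite /Q -zE gK//; exact: KC.
have QE v : i' (Q v) = psi (radial c1 (v : 'rV[R]_n.+1)) by have [] := QP v.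
have eQ : oemb setT Q.
  apply: oemb_comp (csum_psi XYW1) og _ => v _.
  by have [z zK <-] := Qex v; exists z => //; exact: KC.
have oQ v : osign false Q v.
  have [_ lQ _] := eQ.
  have [e oe] := osign_exists (lQ v I).
  have Q0 : Q v <> phi' 0 by apply: KC; have [] := QP v.
  have o1 := @osign_comp R n.+1 (euclidean R n.+1) Y' Y e true Q i' v (lQ v I) (li' _ Q0) oe (csum_i_sign YZY Q0).
  have E : \forall w \near v, i' (Q w) = psi (radial c1 (w : 'rV[R]_n.+1)) by exact: near_all.
  have o2 := @osign_near_eq R n.+1 (euclidean R n.+1) Y _ _ _ v (ldf_comp (lQ v I) (li' _ Q0)) E o1.
  have s2 : osign false (fun w : euclidean R n.+1 => psi (radial c1 (w : 'rV[R]_n.+1))) v.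
    by apply: csum_psi_sign XYW1 _.
  by have := osign_uniq o2 s2; case: e oe {o1 o2}.
have Qphi v w : Q v <> phi' (radial c (w : 'rV[R]_n.+1)).
  move=> Qv; have [QK _] := QP v; apply: QK; rewrite Qv; exists (radial c (w : 'rV[R]_n.+1)) => //=.
  exact/ltW/(shrinker_lt sc).
have [V [[f [g1 [h [k S1]]]] [f' [g1' [h' [k' S2]]]]]] := csum_assoc_core XYW1 YZY1 eQ oQ QE Qphi.
by exists V; split; apply/is_connected_sumP; [exists f, g1, h, k|exists f', g1', h', k'].
Qed.

Lemma connected_sum_assoc n (X Y Y' Z' W : oriented_manifold R n.+1) :
  is_connected_sum X Y W -> is_connected_sum Y' Z' Y ->
  (exists V, is_connected_sum X Y' V /\ is_connected_sum V Z' W) \/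
  (exists V, is_connected_sum X Z' V /\ is_connected_sum V Y' W).
Proof.
move=> /is_connected_sumP[phi [psi [i [j XYW]]]] /is_connected_sumP[phi' [psi' [i' [j' YZY]]]].
have [[y [yp iy]]|[z [zp jz]]] := csum_cover YZY (psi 0).
  by left; exact: csum_assoc_case XYW YZY yp iy.
right; apply: (csum_assoc_case XYW (csum_sym YZY (row1_neq0 n)) _ jz).
by rewrite mul0mx.
Qed.

(** In the second case of [connected_sum_assoc] the copy [Z'] is first attached to [X], so that [k]
    grows while [l] decreases; hence the generalisation over [k]. *)
Lemma is_sum_S2xS2_add k l (X Y W : oriented_manifold R 4) :
  is_sum_S2xS2 k.+1 X -> is_sum_S2xS2 l.+1 Y -> is_connected_sum X Y W ->
  is_sum_S2xS2 (k.+1 + l.+1) W.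
Proof.
elim: l k X Y W => [|l IH] k X Y W sX sY XYW; first by rewrite addn1; exists X, Y.
have [Y' [Z' [sY' sZ' YZY]]] := sY.
have [[V [XV VW]]|[V [XV VW]]] := connected_sum_assoc XYW YZY.
  rewrite addnS addSn; exists V, Z'; split=> //.
  by have := IH _ _ _ _ sX sY' XV; rewrite addSn.
by rewrite addnS -addSn; apply: (IH k.+1 V Y' W) => //; exists X, Z'.
Qed.

End Associativity.

(** * Hypersurfaces and slices *)

Section Height.
Context {R : realType}.

(** Coordinates adapted to a hypersurface: the first one is the height, and slice charts map the
    equator, of height [0], to the hypersurface. *)
Definition ht n (t : R) (v : 'rV[R]_n) : 'rV[R]_n.+1 := row_mx (t%:M : 'rV[R]_1) v.
Definition hgt n (w : 'rV[R]_n.+1) : R := w 0 0.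
Definition base n (w : 'rV[R]_n.+1) : 'rV[R]_n := rsubmx (w : 'rV[R]_(1 + n)).

Lemma ht_ord0 n t (v : 'rV[R]_n) : ht t v 0 ord0 = t.
Proof.
rewrite /ht (_ : ord0 = lshift n (0 : 'I_1)); last exact: val_inj.
by rewrite (row_mxEl (t%:M : 'rV[R]_1) v) mxE.
Qed.

Lemma ht_lift n t (v : 'rV[R]_n) k : ht t v 0 (lift ord0 k) = v 0 k.
Proof.
rewrite /ht (_ : lift ord0 k = rshift 1 k); last exact: val_inj.
exact: (row_mxEr (t%:M : 'rV[R]_1) v).
Qed.

Lemma hgt_ht n t (v : 'rV[R]_n) : hgt (ht t v) = t.
Proof. exact: ht_ord0. Qed.

Lemma base_ht n t (v : 'rV[R]_n) : base (ht t v) = v.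
Proof. exact: row_mxKr. Qed.

Lemma baseE n (w : 'rV[R]_n.+1) k : base w 0 k = w 0 (lift ord0 k).
Proof. by rewrite /base mxE; congr (w _ _); exact: val_inj. Qed.

Lemma htK n (w : 'rV[R]_n.+1) : ht (hgt w) (base w) = w.
Proof.
by apply/rowP => k; case: (unliftP ord0 k) => [l|] ->; rewrite ?ht_lift ?baseE ?ht_ord0.
Qed.

Lemma ht_inj n t s (v u : 'rV[R]_n) : ht t v = ht s u -> t = s /\ v = u.
Proof.
by move=> E; split; [have := congr1 (@hgt n) E; rewrite !hgt_ht|have := congr1 (@base n) E; rewrite !base_ht].
Qed.

Lemma ht_scale n c t (v : 'rV[R]_n) : c *: ht t v = ht (c * t) (c *: v).
Proof. by rewrite /ht (scale_row_mx c (t%:M : 'rV[R]_1) v) scale_scalar_mx. Qed.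

Lemma N2_ht n t (v : 'rV[R]_n) : N2 (ht t v) = t ^+ 2 + N2 v.
Proof.
rewrite /N2 big_ord_recl ht_ord0; congr (_ + _).
by apply: eq_bigr => k _; rewrite ht_lift.
Qed.

Lemma ht00 n : ht 0 (0 : 'rV[R]_n) = 0.
Proof. by apply/eqP; rewrite -N2_eq0 N2_ht N20 expr0n addr0. Qed.

Lemma sm_ht n m (t : 'rV[R]_m -> R) (v : 'rV[R]_m -> 'rV[R]_n) (x : 'rV[R]_m) :
  sm t x -> sm v x -> sm (fun y => ht (t y) (v y)) x.
Proof.
move=> st sv; apply: (@sm_row_mx R m 1 n (fun y => (t y)%:M) v x) => //.
apply/sm_rowP => k; rewrite ord1; apply: sm_near_eq st; apply: near_all => y.
by rewrite mxE.
Qed.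

Lemma sm_base n (w : 'rV[R]_n.+1) : sm (@base n) w.
Proof. by apply: (@sm_rsubmx R n.+1 1 n (fun w => w) w); exact: sm_id. Qed.

Lemma sm_hgt n (w : 'rV[R]_n.+1) : sm (@hgt n : 'rV[R]_n.+1 -> R) w.
Proof. exact: sm_coord. Qed.

Lemma hgtM n (v : 'rV[R]_n.+1) : hgt v = (v *m (delta_mx 0 0 : 'cV[R]_n.+1)) 0 0.
Proof.
rewrite /hgt mxE (bigD1 0)//= big1 ?addr0 ?mxE ?eqxx ?mulr1// => k k0.
by rewrite mxE (negbTE k0) mulr0.
Qed.

Lemma imm_ht0 n (v : euclidean R n) : imm (ht 0 : euclidean R n -> euclidean R n.+1) v.
Proof.
split; first by apply/msm_euclid; apply: sm_ht; [exact: sm_cst|exact: sm_id].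
exists (@base n : euclidean R n.+1 -> euclidean R n); split; first exact/msm_euclid/sm_base.
by apply: near_all => w; exact: base_ht.
Qed.

(** The rank of [A] is less than [n.+1], so some row of the identity is outside its row space. *)
Lemma complete_row_free n (A : 'M[R]_(n, n.+1)) : row_free A ->
  exists u : 'rV[R]_n.+1, (col_mx u A : 'M[R]_(1 + n)) \in unitmx.
Proof.
move=> fA; have [k kA] : exists k, ~~ (row k (1%:M : 'M[R]_n.+1) <= A)%MS.
  apply/existsP; rewrite -negb_forall; apply/negP => /forallP H.
  have /mxrankS : (1%:M <= A)%MS by apply/row_subP => k; exact: H.
  by rewrite mxrank1 => h; have := leq_trans h (rank_leq_row A); rewrite ltnn.
exists (row k 1%:M); set u := row k 1%:M in kA *.
rewrite -row_free_unit -row_leq_rank -addsmxE.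
have u0 : u != 0 by apply: contraNneq kA => ->; exact: sub0mx.
have d : \rank (u :&: A)%MS = 0%N.
  apply/eqP; rewrite mxrank_eq0; apply/rowV0P => w.
  rewrite sub_capmx => /andP[/sub_rVP[c ->] cA]; apply/eqP; rewrite scaler_eq0 (negbTE u0) orbF.
  apply: contraNT kA => c0; rewrite -[u]scale1r -(mulVf c0) -scalerA; exact: scalemx_sub.
have := mxrank_sum_cap u A; rewrite d addn0 => ->.
by rewrite (rank_rV u) u0 (eqP fA).
Qed.

(** The immersion is thickened along a vector [u] transverse to its image; the Jacobian at height
    [0] is then ['J q] completed by the row [u]. *)
Lemma complete_immersion n (q : 'rV[R]_n -> 'rV[R]_n.+1) (v : 'rV[R]_n) : sm q v ->
  row_free ('J q v) -> exists u : 'rV[R]_n.+1,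
  ldf (fun w : euclidean R n.+1 => q (base (w : 'rV[R]_n.+1)) + hgt (w : 'rV[R]_n.+1) *: u : euclidean R n.+1) (ht 0 v : 'rV[R]_n.+1).
Proof.
move=> sq fq; have [u Au] := complete_row_free fq; exists u.
pose B : 'M[R]_(n.+1, n) := (col_mx 0 1%:M : 'M[R]_(1 + n, n)).
pose C : 'M[R]_(n.+1) := (col_mx u 0 : 'M[R]_(1 + n, n.+1)).
have wB w : w *m B = base w.
  rewrite -{1}(htK w) /ht /B; have := mul_row_col ((hgt w)%:M : 'rV[R]_1) (base w) 0 (1%:M : 'M[R]_n).
  by rewrite mulmx0 add0r mulmx1.
have wC w : w *m C = hgt w *: u.
  rewrite -{1}(htK w) /ht /C; have := mul_row_col ((hgt w)%:M : 'rV[R]_1) (base w) u (0 : 'M[R]_(n, n.+1)).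
  by rewrite mulmx0 addr0 mul_scalar_mx.
have E : (fun w : 'rV[R]_n.+1 => q (base w) + hgt w *: u) = (fun w => q (w *m B) + w *m C).
  by apply/funext => w; rewrite wB wC.
have s1 : sm (fun w : 'rV[R]_n.+1 => w *m B) (ht 0 v) by apply: sm_mulmx; exact: sm_id.
have s2 : sm (fun w : 'rV[R]_n.+1 => w *m C) (ht 0 v) by apply: sm_mulmx; exact: sm_id.
have q1 : sm q (ht 0 v *m B) by rewrite wB base_ht.
have s3 : sm (fun w : 'rV[R]_n.+1 => q (w *m B)) (ht 0 v) := sm_comp s1 q1.
move: E; rewrite -/(_ = _) => E; rewrite [X in ldf X]E; apply: ldf_euclid; first exact: sm_addv.
rewrite (jacobian_add s3 s2) (jacobian_comp s1 q1) !jacobian_mulmx wB base_ht.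
have -> : B *m 'J q v + C = col_mx u ('J q v) :> 'M[R]_(1 + n, n.+1).
  transitivity (col_mx (0 *m 'J q v) (1%:M *m 'J q v) + col_mx u 0 : 'M[R]_(1 + n, n.+1)).
    by congr (_ + _); exact: mul_col_mx.
  by rewrite add_col_mx mul0mx mul1mx add0r addr0.
exact: Au.
Qed.

(** The thickening [G] is a local diffeomorphism restricting to [q] on the equator, and the equator
    has the left inverse [base]; together they give a smooth local left inverse of [q]. *)
Lemma imm_of_row_free n (M : manifold R n) (N : manifold R n.+1) (f : M -> N) (x : M) a b :
  msm f x -> atlas a -> atlas b -> chart_dom a x -> chart_dom b (f x) ->
  row_free ('J (fun v => b (f (chart_inv a v))) (a x)) -> imm f x.
Proof.
move=> [cf sf] Aa Ab ax bx fq; set q := (fun v => _) in fq.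
have sq : sm q (a x) by exact: sf.
have [u lG] := complete_immersion sq fq; set G := (fun w => _) in lG.
have Gq v : G (ht 0 v) = q v by rewrite /G base_ht hgt_ht scale0r addr0.
have i1 : imm (q : euclidean R n -> euclidean R n.+1) (a x).
  have i0 := @imm_comp R n n.+1 n.+1 (euclidean R n) (euclidean R n.+1) (euclidean R n.+1) (ht 0) G (a x)
    (imm_ht0 (a x)) (ldf_imm lG).
  by apply: imm_near_eq i0; apply: near_all => v.
have i2 : imm (fun y => q (a y) : euclidean R n.+1) x := imm_comp (ldf_imm (ldf_chart Aa ax)) i1.
have qx : q (a x) = b (f x) by rewrite /q chart_mapK.
have i3 : imm (chart_inv b : euclidean R n.+1 -> N) (q (a x)).
  by apply/ldf_imm/ldf_chart_inv => //; rewrite qx; exists (f x).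
have := imm_comp i2 i3; apply: imm_near_eq.
have n1 : \forall y \near x, chart_dom b (f y) by exact: cf (chart_near_dom bx).
by apply: filterS2 n1 (chart_near_dom ax) => y by_ ay; rewrite /q chart_mapK// chart_mapK.
Qed.

Lemma smooth_embedding_imm n (M : manifold R n) (N : manifold R n.+1) (f : M -> N) :
  smooth_embedding f -> forall x, imm f x.
Proof.
move=> [[sf rf] _ _] x; have sfx := (smooth_onP f openT).1 sf x I.
have [a [Aa ax]] := atlas_at x; have [b [Ab bx]] := atlas_at (f x).
by apply: (@imm_of_row_free n M N f x a b) => //; exact: rf.
Qed.

Lemma ht_householder n t (v : 'rV[R]_n) : ht t v *m householder (ht 1 0) = ht (- t) v.
Proof.
rewrite /householder mulmxDr mulmx1 N2_ht N20 addr0 expr1n invr1 mulr1.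
have -> : (- 2 *: ht 1 (0 : 'rV[R]_n))^T = (-2) *: (delta_mx 0 0 : 'cV[R]_n.+1).
  apply/matrixP => k l; rewrite ord1 [LHS]mxE [LHS]mxE [RHS]mxE; congr (_ * _).
  rewrite [RHS]mxE eqxx andbT; case: (unliftP ord0 k) => [k'|] ->; first by rewrite ht_lift mxE.
  by rewrite ht_ord0 eqxx.
rewrite mulmxA -scalemxAr.
have -> : ht t v *m (delta_mx 0 0 : 'cV[R]_n.+1) = (t)%:M.
  by apply/matrixP => k l; rewrite !ord1 -hgtM hgt_ht mxE mulr1n.
rewrite scale_scalar_mx mul_scalar_mx ht_scale mulr1 scaler0.
have htD s s' (w w' : 'rV[R]_n) : ht s w + ht s' w' = ht (s + s') (w + w').
  by rewrite /ht (add_row_mx (s%:M : 'rV[R]_1) w s'%:M w') -raddfD.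
by rewrite htD addr0; congr (ht _ _); ring.
Qed.

End Height.

(** * Slice charts *)

Section Slices.
Context {R : realType}.

Lemma ldf_oemb_ball n (M : manifold R n) (f : euclidean R n -> M) : ldf f (0 : 'rV[R]_n) ->
  exists2 r : R, 0 < r & oemb [set v : euclidean R n | N2 (v : 'rV[R]_n) < r] f.
Proof.
move=> l0; have [_ [g [_ gf _]]] := l0.
have n1 : \forall v \near (0 : 'rV[R]_n), ldf f v /\ g (f v) = v.
  exact: (filterI (ldf_near l0) gf).
have [r r0 rP] := near0_ball n1; exists r => //; split.
- apply: open_near => v /= vr; have := near_open (@openT (euclidean R n)) (x := v) Logic.I.
  by move=> _; exact: (near_ltr (@N2_cont R n v) vr).
- by move=> v /rP[].
- by move=> v w /rP[_ gv] /rP[_ gw] E; rewrite -gv E gw.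
Qed.

(** Reflecting the height corrects the sign and fixes the equator pointwise, so that slice
    properties survive. *)
Lemma disc_reflect n (X : oriented_manifold R n.+1) (Phi : euclidean R n.+1 -> X) e :
  oemb setT Phi -> exists Phi' : euclidean R n.+1 -> X, [/\ oemb setT Phi', forall w, osign e Phi' w &
    (forall t v, Phi' (ht t v) = Phi (ht t v)) \/ (forall t v, Phi' (ht t v) = Phi (ht (- t) v))].
Proof.
move=> oPhi; have [_ l inj] := oPhi; have [e0 oe0] := osign_exists (l 0 Logic.I).
have cn : connected [set: euclidean R n.+1] := @connected_rV R n.+1.
have oe w : osign e0 Phi w by apply: (osign_connected cn _ oe0) => w'; exact: l.
have [<-|ne] := eqVneq e0 e; first by exists Phi; split=> //; left.
pose u : 'rV[R]_n.+1 := ht 1 0.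
have u0 : u != 0 by rewrite -N2_eq0 /u N2_ht N20 addr0 expr1n oner_eq0.
have uH := unit_householder u0.
pose H : euclidean R n.+1 -> euclidean R n.+1 := fun w : 'rV[R]_n.+1 => w *m householder u.
have lH w : ldf H w by have [] := ldf_mulmx w uH.
have sH w : osign false H w by have [_] := ldf_mulmx w uH; rewrite det_householder// ltr0N1.
have oH : oemb setT H.
  split; [exact: openT|by move=> w _|].
  by move=> v w _ _ /(congr1 (mulmx^~ (householder u))); rewrite /H !householder2.
exists (fun w => Phi (H w)); split; first exact: oemb_comp oH oPhi _.
  move=> w; have := osign_comp (lH w) (l _ Logic.I) (sH w) (oe _).
  by case: e ne {oe0} => //; case: e0 oe.
by right=> t v; rewrite /H ht_householder.
Qed.

(** A disc of [M] is thickened in a chart of [X] and contracted. Because the radial factor is the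
    same in both dimensions, the equator of the contracted thick disc is the contracted disc of
    [M]. *)
Lemma slice n (M : oriented_manifold R n) (X : oriented_manifold R n.+1) (f : M -> X)
    (phi : euclidean R n -> M) (e : bool) : smooth_embedding f -> oemb setT phi ->
  exists rho d c, shrinker rho d c /\ exists Phi : euclidean R n.+1 -> X,
  [/\ oemb setT Phi, forall w, osign e Phi w,
      forall v : 'rV[R]_n, Phi (ht 0 v) = f (phi (radial c v)) &
      forall w x, Phi w = f x -> exists v, w = ht 0 v].
Proof.
move=> ef ophi; have immf := smooth_embedding_imm ef.
have [_ lphi injphi] := ophi.
have [_ injf topf] := ef.
have [b [Ab bx]] := atlas_at (f (phi 0)).
have i1 := imm_comp (ldf_imm (lphi 0 I)) (immf (phi 0)).
have i2 := imm_comp (g := b : X -> euclidean R n.+1) i1 (ldf_imm (ldf_chart Ab bx)).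
pose q v := b (f (phi v)).
have fq : row_free ('J q 0).
  exact: (@imm_row_free R n n.+1 (euclidean R n) (euclidean R n.+1) q 0 (@id_chart R n) (@id_chart R n.+1) i2).
have sq : sm q 0 by have [/msm_euclid] := i2.
have [u lG] := complete_immersion sq fq; set G := (fun w => _) in lG.
have Gq v : G (ht 0 v) = q v by rewrite /G base_ht hgt_ht scale0r addr0.
have G0 : G (ht 0 0) = b (f (phi 0)) by rewrite Gq.
have l1 : ldf (chart_inv b : euclidean R n.+1 -> X) (G (ht 0 0)).
  by apply: ldf_chart_inv => //; rewrite G0; exists (f (phi 0)).
have l2 := @ldf_comp R n.+1 n.+1 n.+1 (euclidean R n.+1) (euclidean R n.+1) X G _ _ lG l1.
rewrite ht00 in l2; set F := (fun y => _) in l2.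
have cfphi : {for (0 : euclidean R n), continuous (fun v => f (phi v))} by have [[]] := i1.
have n1 : \forall v \near (0 : 'rV[R]_n), F (ht 0 v) = f (phi v).
  have n0 : \forall v \near (0 : 'rV[R]_n), chart_dom b (f (phi v)) by exact: cfphi (chart_near_dom bx).
  by apply: filterS n0 => v bv; rewrite /F Gq /q chart_mapK.
have [r0 r00 r0P] := near0_ball n1.
have [r1 r10 oF] := ldf_oemb_ball l2; have [_ _ injF] := oF.
pose r2 := Num.min r0 r1.
have r20 : 0 < r2 by rewrite lt_min r00.
have oV : open (phi @` [set v : euclidean R n | N2 (v : 'rV[R]_n) < r2]).
  apply: ldf_open_image; last by move=> v _; exact: lphi.
  by apply: open_near => v /= vr; exact: (near_ltr (@N2_cont R n v) vr).
(* This is where the topological clause of the embedding enters: points of [M] far from the disc may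
   have images close to it only outside [W]. *)
have [W oW WE] := topf _ oV; rewrite !setTI in WE.
have F0 : F 0 = f (phi 0) by rewrite -(nbhs_singleton n1) ht00.
have n2 : \forall w \near (0 : 'rV[R]_n.+1), W (F w).
  have n0 : \forall z \near F 0, W z.
    rewrite F0; apply: near_open => //.
    suff : (f @^-1` W) (phi 0) by [].
    by rewrite -WE; exists 0 => //=; rewrite N20.
  exact: (ldf_cont l2 n0).
have [r3 r30 r3P] := near0_ball n2.
(* Below [r0] the equator is [f phi], below [r1] the map [F] is injective, and below [r3] its values
   lie in [W]. *)
pose rho := Num.min r2 r3.
have rho0 : 0 < rho by rewrite lt_min r20.
have [d [c sc]] := shrinker_exists rho0.
exists rho, d, c; split=> //.
have lt w : N2 (radial c w : 'rV[R]_n.+1) < rho by exact: shrinker_lt sc _ _.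
have oP : oemb setT (fun w : euclidean R n.+1 => F (radial c (w : 'rV[R]_n.+1))).
  apply: oemb_comp (shrinker_oemb sc n.+1) oF _ => w _ /=.
  by have := lt w; rewrite !lt_min => /andP[/andP[]].
have rht t (v : 'rV[R]_n) : exists s, radial c (ht t v) = ht (s * t) (s *: v).
  by exists (c (N2 (ht t v))); rewrite /radial ht_scale.
have rh0 (v : 'rV[R]_n) : radial c (ht 0 v) = ht 0 (radial c v).
  by rewrite /radial N2_ht expr0n add0r ht_scale mulr0.
have Fh (v : 'rV[R]_n) : F (radial c (ht 0 v)) = f (phi (radial c v)).
  rewrite rh0; apply: r0P; have := shrinker_lt sc v.
  by rewrite !lt_min => /andP[/andP[]].
have Fo w x : F (radial c w) = f x -> exists v, w = ht 0 v.
  move=> E; have := lt w; rewrite !lt_min => /andP[/andP[w0 w1] w3].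
  have Wx : (f @^-1` W) x by rewrite /= -E; exact: r3P.
  rewrite -WE in Wx; have [v vr vx] := Wx.
  move: (vr); rewrite /= lt_min => /andP[v0 v1].
  rewrite -vx -(r0P _ v0) in E.
  have h1 : N2 (ht 0 v) < r1 by rewrite N2_ht expr0n add0r.
  have := injF _ _ w1 h1 E => wv.
  exists (base w); rewrite -[LHS]htK; congr (ht _ _).
  have := congr1 (@hgt R n) wv; rewrite hgt_ht -{1}(htK w).
  rewrite /radial ht_scale hgt_ht => /eqP; rewrite mulf_eq0 gt_eqF ?(shrinker_pos sc)//=.
  by move=> /eqP.
have [Phi [oPhi sPhi PhiE]] := disc_reflect e oP.
exists Phi; split=> //.
  by move=> v; case: PhiE => ->; rewrite ?oppr0 Fh.
move=> w x; rewrite -{1}(htK w); case: PhiE => -> /Fo[v] /ht_inj[h _]; exists (base w).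
  by rewrite -{1}(htK w) h.
by rewrite -{1}(htK w) -[hgt w]opprK h oppr0.
Qed.

End Slices.

(** * Compactness of connected sums and maps out of them *)

Section ConnectedSumMaps.
Context {R : realType}.

Lemma disc_ball_open n (M : manifold R n) (phi : euclidean R n -> M) (e : R) :
  oemb setT phi -> open (phi @` [set v | N2 (v : 'rV[R]_n) < e]).
Proof.
move=> [_ lphi _]; apply: (@ldf_open_image R n n (euclidean R n) M); last by move=> v _; exact: lphi.
by apply: open_near => v /= vr; exact: (near_ltr (@N2_cont R n v) vr).
Qed.

Context {n : nat} {M N P : oriented_manifold R n}.
Context {phi : euclidean R n -> M} {psi : euclidean R n -> N} {i : M -> P} {j : N -> P}.
Hypothesis MNP : csum phi psi i j.

(** The complements of the open unit discs are compact, and their images cover [P] because the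
    inversion exchanges the inside and the outside of the unit sphere. *)
Lemma csum_compact : compact [set: M] -> compact [set: N] -> compact [set: P].
Proof.
move=> cM cN; have [_ li _] := csum_i MNP; have [_ lj _] := csum_j MNP.
pose K := ~` (phi @` [set v | N2 (v : 'rV[R]_n) < 1]).
pose L := ~` (psi @` [set v | N2 (v : 'rV[R]_n) < 1]).
have K0 x : K x -> x <> phi 0.
  by move=> Kx x0; apply: Kx; exists 0; rewrite //= N20.
have L0 x : L x -> x <> psi 0.
  by move=> Lx x0; apply: Lx; exists 0; rewrite //= N20.
have inv_gt1 v : v <> (0 : 'rV[R]_n) -> N2 v < 1 -> ~ (N2 (inversion v) < 1).
  move=> v0 v1; rewrite N2_inversion; apply/negP; rewrite -leNgt invf_ge1 ?ltW// N2_gt0.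
  exact/eqP.
have iK : compact (i @` K).
  apply: continuous_compact; last first.
    by apply: (subclosed_compact _ cM) => //; rewrite closedC; exact: disc_ball_open (csum_phi MNP).
  apply: continuous_in_subspaceT => x; rewrite inE => /K0 xp; exact: ldf_cont (li _ xp).
have jL : compact (j @` L).
  apply: continuous_compact; last first.
    by apply: (subclosed_compact _ cN) => //; rewrite closedC; exact: disc_ball_open (csum_psi MNP).
  apply: continuous_in_subspaceT => x; rewrite inE => /L0 xp; exact: ldf_cont (lj _ xp).
suff -> : [set: P] = i @` K `|` j @` L by exact: compactU.
apply/seteqP; split=> // p _; have [[x [xp <-]]|[y [yp <-]]] := csum_cover MNP p.
  have [Kx|/contrapT[v v1 vx]] := pselect (K x); [by left; exists x|right].
  have v0 : v <> (0 : 'rV[R]_n) by move=> v0; apply: xp; rewrite -vx v0.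
  exists (psi (inversion (v : 'rV[R]_n))); last by rewrite -vx (csum_neck MNP).
  by move=> [w w1 /(csum_psi_inj MNP) wv]; apply: (inv_gt1 _ v0 v1); rewrite -wv.
have [Ly|/contrapT[v v1 vy]] := pselect (L y); [by right; exists y|left].
have v0 : v <> (0 : 'rV[R]_n) by move=> v0; apply: yp; rewrite -vy v0.
exists (phi (inversion (v : 'rV[R]_n))); last by rewrite -vy (csum_neck2 MNP).
by move=> [w w1 /(csum_phi_inj MNP) wv]; apply: (inv_gt1 _ v0 v1); rewrite -wv.
Qed.

(** The two maps need only be compatible on a smaller neck: [A] and [B] may omit more than the
    centres of the discs, provided that they still cover [P]. *)
Lemma csum_embedding m (W : manifold R m) (A : set M) (B : set N) (a : M -> W) (b : N -> W) :
  compact [set: P] -> open A -> open B -> A `<=` [set~ phi 0] -> B `<=` [set~ psi 0] ->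
  (forall p, (exists x, A x /\ i x = p) \/ (exists y, B y /\ j y = p)) ->
  (forall x, A x -> imm a x) -> (forall y, B y -> imm b y) ->
  (forall x x', A x -> A x' -> a x = a x' -> x = x') ->
  (forall y y', B y -> B y' -> b y = b y' -> y = y') ->
  (forall x y, A x -> B y -> i x = j y <-> a x = b y) ->
  exists F : P -> W, smooth_embedding F.
Proof.
move=> cP oA oB A0 B0 cov immA immB injA injB ab.
have [_ li inji] := csum_i MNP; have [_ lj injj] := csum_j MNP.
pose gi p := xget (phi 0) [set x | A x /\ i x = p].
pose gj p := xget (psi 0) [set y | B y /\ j y = p].
have giK x : A x -> gi (i x) = x.
  move=> Ax; rewrite /gi; case: xgetP => [y _ [Ay E]|/(_ x) H]; last by exfalso; exact: H.
  exact: inji (A0 _ Ay) (A0 _ Ax) E.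
have gjK y : B y -> gj (j y) = y.
  move=> By; rewrite /gj; case: xgetP => [z _ [Bz E]|/(_ y) H]; last by exfalso; exact: H.
  exact: injj (B0 _ Bz) (B0 _ By) E.
pose F p := if pselect (exists x, A x /\ i x = p) then a (gi p) else b (gj p).
have Fi x : A x -> F (i x) = a x.
  by move=> Ax; rewrite /F; case: pselect => [e1|[]]; [rewrite giK|exists x].
have Fj y : B y -> F (j y) = b y.
  move=> By; rewrite /F; case: pselect => [e1|e1] /=; last by rewrite gjK.
  by have [x [Ax E]] := e1; rewrite -E giK//; apply/ab.
exists F; apply: compact_smooth_embedding => // [p|p q].
  have [[x [Ax <-]]|[y [By <-]]] := cov p.
    apply: (imm_descend (li _ (A0 _ Ax)) (immA _ Ax)).
    by apply: filterS (near_open oA Ax) => x' /Fi.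
  apply: (imm_descend (lj _ (B0 _ By)) (immB _ By)).
  by apply: filterS (near_open oB By) => y' /Fj.
have [[x [Ax <-]]|[y [By <-]]] := cov p; have [[x' [Ax' <-]]|[y' [By' <-]]] := cov q.
- by rewrite !Fi// => /injA ->.
- by rewrite Fi// Fj// => /ab; exact.
- by rewrite Fi// Fj// => /esym/ab E; apply/esym/E.
- by rewrite !Fj// => /injB ->.
Qed.

End ConnectedSumMaps.

Section SumOfEmbeddings.
Context {R : realType}.

Lemma embeds_connected_sum n (M N P : oriented_manifold R n.+1) (X Y : oriented_manifold R n.+2)
    (f : M -> X) (g : N -> Y) :
  compact [set: M] -> compact [set: N] -> is_connected_sum M N P ->
  smooth_embedding f -> smooth_embedding g ->
  exists (W : oriented_manifold R n.+2) (F : P -> W), is_connected_sum X Y W /\ smooth_embedding F.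
Proof.
move=> cM cN /is_connected_sumP[phi [psi [i [j MNP]]]] ef eg.
have cP := csum_compact MNP cM cN.
have [rho [d [c [sc [Phi [oPhi sPhi Phif Phis]]]]]] := slice true ef (csum_phi MNP).
have [rho' [d' [c' [sc' [Psi [oPsi sPsi Psig Psis]]]]]] := slice false eg (csum_psi MNP).
have [j1 S1] := csum_shrink MNP sc.
have [i2 S] := csum_shrink2 S1 sc'.
have [W [I [J IJ]]] := connected_sum_exists oPhi sPhi oPsi sPsi.
have [_ injf _] := ef; have [_ injg _] := eg.
have injf' x y : f x = f y -> x = y by exact: injf.
have injg' x y : g x = g y -> x = y by exact: injg.
have Phi0 : Phi 0 = f (phi (radial c 0)) by rewrite -Phif ht00.
have Psi0 : Psi 0 = g (psi (radial c' 0)) by rewrite -Psig ht00.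
have f0 x : x <> phi (radial c 0) -> f x <> Phi 0 by rewrite Phi0 => xp /injf'.
have g0 y : y <> psi (radial c' 0) -> g y <> Psi 0 by rewrite Psi0 => yp /injg'.
have [_ lI injI] := csum_i IJ; have [_ lJ injJ] := csum_j IJ.
(* The inversion preserves the equator and restricts to the inversion there, so the neck of [X # Y]
   induces on the hypersurfaces the neck of [M # N]. *)
have ht_inv (v : 'rV[R]_n.+1) : inversion (ht 0 v) = ht 0 (inversion v).
  by rewrite !inversionE N2_ht expr0n add0r ht_scale mulr0.
have ht_neq0 (v : 'rV[R]_n.+1) : v <> 0 -> ht 0 v <> 0.
  by move=> v0 E; apply: v0; have := congr1 (@base R n.+1) E; rewrite base_ht -ht00 base_ht.
have immf := smooth_embedding_imm ef; have immg := smooth_embedding_imm eg.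
have ab x y : x <> phi (radial c 0) -> y <> psi (radial c' 0) -> i2 x = j1 y <-> I (f x) = J (g y).
  move=> xp yp; split.
    move=> /(csum_glue S xp yp)[v [v0 -> ->]].
    by rewrite -Phif -Psig -ht_inv; apply: (csum_neck IJ); exact: ht_neq0.
  move=> /(csum_glue IJ (f0 _ xp) (g0 _ yp))[w [w0 fx gy]].
  have [v wv] := Phis _ _ (esym fx).
  rewrite {}wv {w} in w0 fx gy.
  move: fx gy; rewrite ht_inv Phif Psig => /injf' -> /injg' ->.
  by apply: (csum_neck S) => v0; apply: w0; rewrite v0 ht00.
have [F eF] := @csum_embedding R n.+1 M N P _ _ _ _ S n.+2 W [set~ phi (radial c 0)]
  [set~ psi (radial c' 0)] (fun x => I (f x)) (fun y => J (g y)) cP (open_setC1 _) (open_setC1 _)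
  (fun _ H => H) (fun _ H => H) (csum_cover S)
  (fun x xp => imm_comp (immf x) (ldf_imm (lI _ (f0 _ xp))))
  (fun y yp => imm_comp (immg y) (ldf_imm (lJ _ (g0 _ yp))))
  (fun x x' xp xp' E => injf' _ _ (injI _ _ (f0 _ xp) (f0 _ xp') E))
  (fun y y' yp yp' E => injg' _ _ (injJ _ _ (g0 _ yp) (g0 _ yp') E))
  ab.
exists W, F; split=> //; apply/is_connected_sumP; by exists Phi, Psi, I, J.
Qed.

Lemma embeds_connected_sum_pos k l (M N P : oriented_manifold R 3) :
  compact [set: M] -> compact [set: N] -> is_connected_sum M N P ->
  embeds_in_sum_S2xS2 k.+1 M -> embeds_in_sum_S2xS2 l.+1 N -> embeds_in_sum_S2xS2 (k.+1 + l.+1) P.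
Proof.
move=> cM cN MNP [X [f [sX ef]]] [Y [g [sY eg]]].
have [W [F [XYW eF]]] := embeds_connected_sum cM cN MNP ef eg.
by exists W, F; split=> //; exact: is_sum_S2xS2_add sX sY XYW.
Qed.

End SumOfEmbeddings.

(** * Extension of germs of diffeomorphisms *)

Section CompactlySupported.
Context {R : realType}.

Record cdiff n (D : 'rV[R]_n -> 'rV[R]_n) : Prop := Cdiff {
  cdiff_sm : forall x, sm D x;
  cdiff_inverse : exists D', [/\ cancel D D', cancel D' D & forall x, sm D' x];
  cdiff_support : exists K, forall x, K <= N2 x -> D x = x }.

Lemma cdiff_comp n (D E : 'rV[R]_n -> 'rV[R]_n) : cdiff D -> cdiff E -> cdiff (fun x => E (D x)).
Proof.
move=> [sD [D' [DK KD sD']] [K HK]] [sE [E' [EK KE sE']] [L HL]]; split.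
- by move=> x; exact: sm_comp.
- exists (fun x => D' (E' x)); split=> [x|x|x]; rewrite ?EK ?DK ?KD ?KE//.
  exact: sm_comp.
- by exists (Num.max K L) => x; rewrite ge_max => /andP[Kx Lx]; rewrite HK// HL.
Qed.

Lemma cdiff_inv n (D D' : 'rV[R]_n -> 'rV[R]_n) : cdiff D -> cancel D D' -> cdiff D'.
Proof.
move=> [sD [D2 [DK KD sD2]] [K HK]] DK'.
have -> : D' = D2 by apply/funext => x; rewrite -{1}(KD x) DK'.
by split=> //; [exists D; split|exists K => x /HK E; rewrite -{1}E DK].
Qed.

Lemma cdiff_id n : cdiff (fun x : 'rV[R]_n => x).
Proof.
split; [exact: sm_id| |by exists 0].
by exists (fun x => x); split=> // x; exact: sm_id.
Qed.

Lemma cdiff_perturbation n (u : 'rV[R]_n -> 'rV[R]_n) (e : R) :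
  (forall x y, `|u x - u y| <= 2^-1 * `|x - y|) -> (forall x, sm u x) ->
  (forall x, e <= `|x| -> u x = 0) -> cdiff (fun x => x + u x).
Proof.
move=> uL su u0; have [g [gK Kg sg]] := perturbation uL su; split.
- by move=> x; apply: sm_addv => //; exact: sm_id.
- by exists g; split.
(* [N2 x <= n |x|^2], so a value of [N2 x] beyond this bound forces [|x| >= e]. *)
- exists (n%:R * e ^+ 2 + 1) => x xe; rewrite u0 ?addr0//.
  rewrite leNgt; apply/negP => xlt.
  have := N2_le_norm x; have : `|x| ^+ 2 <= e ^+ 2.
    by rewrite ler_sqr ?nnegrE ?(ltW xlt)//; exact: le_trans (ltW xlt).
  move=> /(ler_wpM2l (ler0n R n)); move: xe; lra.
Qed.

Lemma cdiff_ldf n (D : 'rV[R]_n -> 'rV[R]_n) (x : euclidean R n) : cdiff D ->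
  ldf (D : euclidean R n -> euclidean R n) x.
Proof.
move=> [sD [D' [DK KD sD']] _]; split; first exact/msm_euclid.
exists (D' : euclidean R n -> euclidean R n); split; first exact/msm_euclid.
  by apply: near_all => y; exact: DK.
by apply: near_all => y; exact: KD.
Qed.

Lemma cdiff_jacobian_unit n (D : 'rV[R]_n -> 'rV[R]_n) x : cdiff D -> 'J D x \in unitmx.
Proof.
move=> cD; exact: (@ldf_unit R n (euclidean R n) (euclidean R n) D x (@id_chart R n)
  (@id_chart R n) (cdiff_ldf x cD)).
Qed.

(* Every matrix of positive determinant is the germ at 0 of a compactly supported
   diffeomorphism: such matrices form an open subgroup of the invertible ones, to
   which the elementary matrices below belong by connectedness of segments. *)
Definition realize n (A : 'M[R]_n) : Prop :=
  exists D, cdiff D /\ \forall x \near (0 : 'rV[R]_n), D x = x *m A.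

Lemma realize1 n : realize (1%:M : 'M[R]_n).
Proof. by exists id; split; [exact: cdiff_id|apply: near_all => x; rewrite mulmx1]. Qed.

Lemma realize_unit n (A : 'M[R]_n) : realize A -> A \in unitmx.
Proof.
move=> [D [cD DA]]; have := cdiff_jacobian_unit 0 cD.
by rewrite (jacobian_near_eq (cdiff_sm cD 0) DA) jacobian_mulmx.
Qed.

Lemma mulmx_cont0 n (A : 'M[R]_n) (P : 'rV[R]_n -> Prop) :
  (\forall x \near (0 : 'rV[R]_n), P x) -> \forall x \near (0 : 'rV[R]_n), P (x *m A).
Proof.
move=> HP; have s : sm (fun x : 'rV[R]_n => x *m A) 0 by apply: sm_mulmx; exact: sm_id.
have H0 : \forall y \near (0 : 'rV[R]_n) *m A, P y by rewrite mul0mx.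
exact: (sm_cont s H0).
Qed.

Lemma realize_mul n (A B : 'M[R]_n) : realize A -> realize B -> realize (A *m B).
Proof.
move=> [D [cD DA]] [E [cE EB]]; exists (fun x => E (D x)); split; first exact: cdiff_comp.
by apply: filterS2 DA (mulmx_cont0 A EB) => x -> ->; rewrite mulmxA.
Qed.

Lemma realize_inv n (A : 'M[R]_n) : realize A -> realize (invmx A).
Proof.
move=> rA; have uA := realize_unit rA; have [D [cD DA]] := rA.
have [D' [DK KD sD']] := cdiff_inverse cD.
exists D'; split; first exact: cdiff_inv DK.
by apply: filterS (mulmx_cont0 (invmx A) DA) => x; rewrite mulmxKV// => E; rewrite -{1}E DK.
Qed.

Lemma realize_cancel n (A B : 'M[R]_n) : realize A -> realize (A *m B) -> realize B.
Proof.
move=> rA rAB; rewrite -[B](mulKmx (realize_unit rA)); apply: realize_mul => //.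
exact: realize_inv.
Qed.

Lemma realize_near1 n (F : 'M[R]_n) : \forall s \near (0 : R), realize (1%:M + s *: F).
Proof.
have [L L0 HL] := @cut_lipschitz R n.
have [C C0 HC] := @norm_mulmx_le R n n (0 : 'rV[R]_n) F.
(* For [|s| < d] the Lipschitz constant [2 |s| C (L + 1)] of the cut-off perturbation is at most
   [1/2]. *)
pose d := (4 * (C + 1) * (L + 1))^-1.
have C1 : 0 < C + 1 by rewrite ltr_wpDl.
have L1 : 0 < L + 1 by rewrite ltr_wpDl.
have d0 : 0 < d by rewrite invr_gt0 !mulr_gt0.
apply/nbhs_ballP; exists d => //= s; rewrite /ball/= sub0r normrN => sd.
pose w (x : 'rV[R]_n) := x *m (s *: F).
have wL x : `|w x| <= `|s| * C * `|x|.
  by rewrite /w -scalemxAr normrZ -mulrA ler_wpM2l.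
have w2 x y : `|w x - w y| <= 2 * (`|s| * C) * `|x - y|.
  rewrite /w -mulmxBl; apply: (le_trans (wL _)); rewrite ler_wpM2r//.
  by rewrite ler_peMl ?mulr_ge0// ler1n.
pose u (x : 'rV[R]_n) := cut (1^-1 *: x) *: w x.
have uL x y : `|u x - u y| <= 2^-1 * `|x - y|.
  have := @cut_mul_lipschitz R n n L (2 * (`|s| * C)) 1 w L0 ltr01 _ HL _ (fun x y _ _ => w2 x y) x y.
  move=> H; apply: (le_trans (H _ _)).
  - by rewrite !mulr_ge0.
  - move=> z; rewrite !mulr1 => z2; apply: (le_trans (wL z)).
    by rewrite mulrC ler_wpM2r ?mulr_ge0.
  - rewrite ler_wpM2r//.
    have e1 : `|s| * C <= d * (C + 1).
      by rewrite ler_pM// ?(ltW sd)// lerDl.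
    have -> : 2^-1 = 2 * (d * (C + 1)) * (L + 1) by rewrite /d; field; rewrite !gt_eqF.
    by rewrite ler_wpM2r ?(ltW L1)// ler_wpM2l.
exists (fun x => x + u x); split.
  apply: (@cdiff_perturbation n u 2) => //.
    move=> x; apply: sm_scale; first exact: sm_cut_scaled.
    by apply: sm_mulmx; exact: sm_id.
  by move=> x x2; rewrite /u cut_scaled0 ?scale0r// mulr1.
by apply: filterS (@cut_scaled1 R n 1 ltr01) => x E; rewrite /u E scale1r mulmxDr mulmx1.
Qed.

(** For [s] near [t] the matrix [B s] is a realizable matrix close to [1] times [B t]. Hence
    realizability is locally constant along the segment, and it holds at [t = 0]. *)
Lemma realize_segment n (F : 'M[R]_n) :
  (forall t : R, 0 <= t <= 1 -> 1%:M + t *: F \in unitmx) -> realize (1%:M + F).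
Proof.
move=> uF; pose B (t : R) := 1%:M + t *: F.
have loc (t : R) : 0 <= t <= 1 -> \forall s \near t, realize (B s) <-> realize (B t).
  move=> /uF ut; have H := realize_near1 (F *m invmx (B t)).
  have c : {for t, continuous (fun s : R => s - t)}.
    by apply: cvgB; [exact: cvg_id|exact: cvg_cst].
  have H0 : \forall s \near t - t, realize (1%:M + s *: (F *m invmx (B t))) by rewrite subrr.
  have n1 : \forall s \near t, realize (1%:M + (s - t) *: (F *m invmx (B t))) by exact: (c _ H0).
  apply: filterS n1 => s rs.
  have E : B s = (1%:M + (s - t) *: (F *m invmx (B t))) *m B t.
    rewrite mulmxDl mul1mx -scalemxAl -mulmxA mulVmx// mulmx1 /B -addrA -scalerDl.
    by rewrite [t + _]addrC subrK.
  split=> r; last by rewrite E; exact: realize_mul.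
  by apply: (realize_cancel rs); rewrite -E.
pose T : set R := [set t | realize (B t)].
pose U : set R := [set` `[0, 1]].
have c01 : connected U by exact: segment_connected.
have E : U `&` T = U.
  apply: c01.
  - exists 0; split; first by rewrite /U /= in_itv/= lexx ler01.
    by rewrite /T /B/= scale0r addr0; exact: realize1.
  - exists (T°); first exact: open_interior.
    apply/seteqP; split=> t [t01 Tt]; split=> //; last exact: interior_subset.
    by apply: filterS (loc t _) => [s /iffRL|]; [exact|move: t01; rewrite /U /= in_itv].
  - exists (~` ((~` T)°)); first by rewrite closedC; exact: open_interior.
    apply/seteqP; split=> t [t01 Tt]; split=> //.
      by move=> /interior_subset; exact.
    apply: contrapT => nT; apply: Tt.
    by apply: filterS (loc t _) => [s h1 /h1|]; [exact: nT|move: t01; rewrite /U /= in_itv].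
have : (U `&` T) 1 by rewrite E /U /= in_itv/= ler01 lexx.
by move=> [_]; rewrite /T /B/= scale1r.
Qed.

(** The identity with row [i] replaced by [b], written as a rank one perturbation so that
    [det_rank1] applies; multiplying [A] by it on the left replaces row [i] of [A] by [b *m A]. *)
Definition rowrep n (i : 'I_n) (b : 'rV[R]_n) : 'M[R]_n :=
  1%:M + (delta_mx 0 i : 'rV[R]_n)^T *m (b - delta_mx 0 i).

Lemma row_rowrep n (i k : 'I_n) (b : 'rV[R]_n) (A : 'M[R]_n) :
  row k (rowrep i b *m A) = if k == i then b *m A else row k A.
Proof.
rewrite /rowrep mulmxDl mul1mx raddfD/= -mulmxA row_mul.
have -> : row k (delta_mx 0 i : 'rV[R]_n)^T = ((k == i)%:R)%:M.
  by apply/matrixP => r c; rewrite !ord1 !mxE eqxx eq_sym.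
rewrite mul_scalar_mx; case: eqP => [->|_]; last by rewrite scale0r addr0.
by rewrite scale1r mulmxBl -rowE addrC subrK.
Qed.

Lemma det_rowrep n (i : 'I_n) (b : 'rV[R]_n) (t : R) : \det (1%:M + t *: ((delta_mx 0 i : 'rV[R]_n)^T *m (b - delta_mx 0 i))) = 1 + t * (b 0 i - 1).
Proof.
rewrite scalemxAr det_rank1 -scalemxAl mxE; congr (_ + t * _).
have -> : ((b - delta_mx 0 i) *m (delta_mx 0 i : 'rV[R]_n)^T) 0 0 = (b - delta_mx 0 i) 0 i.
  rewrite mxE (bigD1 i)//= big1 ?addr0 ?mxE ?eqxx ?mulr1// => k ki.
  by rewrite !mxE (negbTE ki) mulr0.
by rewrite !mxE !eqxx.
Qed.

(** Along the segment from [1] the determinant is [1 + t (b 0 i - 1)], which is positive on the unit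
    interval. *)
Lemma realize_rowrep n (i : 'I_n) (b : 'rV[R]_n) : 0 < b 0 i -> realize (rowrep i b).
Proof.
move=> b0; apply: realize_segment => t t01; rewrite unitmxE unitfE det_rowrep gt_eqF//.
move: t01 => /andP[t0 t1]; have : 0 <= t * b 0 i by rewrite mulr_ge0// ltW.
have [->|] := eqVneq t 1; first by rewrite !mul1r addrC subrK.
move=> tn; have : t < 1 by rewrite lt_neqAle tn.
by rewrite mulrBr mulr1; lra.
Qed.

Lemma det_rowrep1 n (i : 'I_n) (b : 'rV[R]_n) : \det (rowrep i b) = b 0 i.
Proof. by rewrite /rowrep -[X in _ + X]scale1r det_rowrep mul1r addrC subrK. Qed.

(* Gaussian elimination, using only row replacements with a positive coefficient
   on the replaced row; the rows of index less than k are already those of 1. *)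
Lemma realize_elimination n d k (A : 'M[R]_n) : (k + d)%N = n -> 0 < \det A ->
  (forall j : 'I_n, (j < k)%N -> row j A = delta_mx 0 j) -> realize A.
Proof.
elim: d k A => [|d IH] k A kd dA rA.
  rewrite (_ : A = 1%:M); first exact: realize1.
  by apply/row_matrixP => j; rewrite rA ?rowE ?mulmx1//; rewrite -(addn0 k) kd.
have kn : (k < n)%N by rewrite -kd addnS ltnS leq_addr.
pose i : 'I_n := Ordinal kn; pose e (j : 'I_n) : 'rV[R]_n := delta_mx 0 j.
have eE j l : e j 0 l = (l == j)%:R by rewrite mxE eqxx.
(* [c] writes [e i] as a combination of the rows of [B]. If row [i] has a positive coefficient, it
   may be replaced by [e i], and the elimination continues with [k.+1]. *)
have C1 (B : 'M[R]_n) c : 0 < \det B -> (forall j : 'I_n, (j < k)%N -> row j B = e j) ->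
    c *m B = e i -> 0 < c 0 i -> realize B.
  move=> dB rB cB c0; have rc := realize_rowrep c0; apply: (realize_cancel rc).
  apply: (IH k.+1); first by rewrite addSnnS.
    by rewrite det_mulmx det_rowrep1 mulr_gt0.
  move=> j jk; rewrite row_rowrep; case: eqP => [->|/eqP ji]; first exact: cB.
  by apply: rB; rewrite ltn_neqAle -ltnS jk andbT; exact: ji.
(* Replacing row [j] by row [j] minus [s] times row [i] changes the coefficient of row [i] into
   [c 0 i + s c 0 j], which is [1] for the [s] chosen here. *)
have C2 (B : 'M[R]_n) c (j : 'I_n) : 0 < \det B -> (forall j : 'I_n, (j < k)%N -> row j B = e j) ->
    c *m B = e i -> (k < j)%N -> c 0 j != 0 -> realize B.
  move=> dB rB cB kj cj; have ij : i != j by rewrite -val_eqE/= ltn_eqF.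
  pose s := (1 - c 0 i) / c 0 j.
  have bj : (e j - s *: e i) 0 j = 1.
    by rewrite mxE eE eqxx mxE mxE eE eq_sym (negbTE ij) mulr0 subr0.
  have b0 : 0 < (e j - s *: e i) 0 j by rewrite bj ltr01.
  have rb := realize_rowrep b0; apply: (realize_cancel rb).
  apply: (C1 _ (c + (s * c 0 j) *: e i)).
  - by rewrite det_mulmx det_rowrep1 bj mul1r.
  - by move=> l lk; rewrite row_rowrep -val_eqE/= ltn_eqF ?(ltn_trans lk)// rB.
  - rewrite mulmxDl -scalemxAl -rowE row_rowrep (negbTE ij).
    rewrite /rowrep mulmxA mulmxDr mulmx1 mulmxDl cB mulmxA.
    have -> : c *m (delta_mx 0 j : 'rV[R]_n)^T = (c 0 j)%:M.
      apply/matrixP => r l; rewrite !ord1 mxE (bigD1 j)//= big1 ?addr0 => [|q qj].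
        by rewrite !mxE !eqxx mulr1.
      by rewrite !mxE (negbTE qj) mulr0.
    rewrite mul_scalar_mx [_ - _ - _]addrAC subrr sub0r -scalemxAl mulNmx -scalemxAl -rowE.
    by rewrite scalerN scalerA mulrC subrK.
  - rewrite mxE [X in _ + X]mxE eE eqxx mulr1 /s mulfVK// addrC subrK; exact: ltr01.
have uA : A \in unitmx by rewrite unitmxE unitfE gt_eqF.
pose c := e i *m invmx A; have cA : c *m A = e i by rewrite mulmxKV.
have [ci|ci] := ltP 0 (c 0 i); first exact: (C1 A c).
have [[j kj cj]|nj] := pselect (exists2 j : 'I_n, (k < j)%N & c 0 j != 0).
  exact: (C2 A c j).
(* The coefficients beyond [i] vanish and the rows before [i] are those of the identity, so a single
   term contributes to the entry [i] of [c *m A]. *)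
have cAi : c 0 i * A i i = 1.
  have := congr1 (fun v : 'rV[R]_n => v 0 i) cA; rewrite eE eqxx mxE (bigD1 i)//= big1 ?addr0//.
  move=> j ji; have [jk|kj] := ltnP j k.
    have := congr1 (fun v : 'rV[R]_n => v 0 i) (rA _ jk); rewrite mxE => ->.
    by rewrite !mxE eq_sym (negbTE ji) andbF mulr0.
  have [->|cj] := eqVneq (c 0 j) 0; first by rewrite mul0r.
  by exfalso; apply: nj; exists j => //; rewrite ltn_neqAle kj andbT eq_sym.
have ci0 : c 0 i != 0 by apply/eqP => c0; move/eqP: cAi; rewrite c0 mul0r eq_sym oner_eq0.
(* If row [i] is the last one, [A] is triangular with determinant [A i i]; its positivity
   contradicts [c 0 i * A i i = 1] and [c 0 i <= 0]. *)
case: d IH kd => [|d] IH kd.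
  have tA : is_trig_mx A.
    apply/is_trig_mxP => j l jl; have jk : (j < k)%N.
      by apply: (leq_trans jl); rewrite -ltnS -[k.+1]addn1 kd.
    have := congr1 (fun v : 'rV[R]_n => v 0 l) (rA _ jk); rewrite mxE => ->.
    by rewrite mxE eqxx -val_eqE/= gtn_eqF.
  move: dA; rewrite (det_trig tA) (bigD1 i)//= big1 ?mulr1 => [Ai|j ji].
    by move: ci; rewrite leNgt -(pmulr_lgt0 _ Ai) cAi ltr01.
  have jk : (j < k)%N.
    by rewrite ltn_neqAle; apply/andP; split; [exact: ji|rewrite -ltnS -[k.+1]addn1 kd].
  by have := congr1 (fun v : 'rV[R]_n => v 0 j) (rA _ jk); rewrite !mxE !eqxx.
(* Otherwise row [i] is first replaced by row [i] minus row [j], which gives row [j] the nonzero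
   coefficient [c 0 i]. *)
have kn1 : (k.+1 < n)%N by rewrite -kd !addnS !ltnS leq_addr.
pose j : 'I_n := Ordinal kn1; have ij : i != j by rewrite -val_eqE/= ltn_eqF.
have bi : (e i - e j) 0 i = 1 by rewrite mxE eE eqxx mxE eE (negbTE ij) subr0.
have b0 : 0 < (e i - e j) 0 i by rewrite bi ltr01.
have rb := realize_rowrep b0; apply: (realize_cancel rb).
apply: (C2 _ (c + c 0 i *: e j) j) => //.
- by rewrite det_mulmx det_rowrep1 bi mul1r.
- by move=> l lk; rewrite row_rowrep -val_eqE/= ltn_eqF// rA.
- rewrite mulmxDl -scalemxAl -rowE row_rowrep eq_sym (negbTE ij).
  rewrite /rowrep mulmxA mulmxDr mulmx1 mulmxDl cA mulmxA.
  have -> : c *m (delta_mx 0 i : 'rV[R]_n)^T = (c 0 i)%:M.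
    apply/matrixP => r l; rewrite !ord1 mxE (bigD1 i)//= big1 ?addr0 => [|q qj].
      by rewrite !mxE !eqxx mulr1.
    by rewrite !mxE (negbTE qj) mulr0.
  rewrite mul_scalar_mx [_ - _ - _]addrAC subrr sub0r -scalemxAl mulNmx -rowE.
  by rewrite scalerN subrK.
- have cj : c 0 j = 0 by apply/eqP; apply: contrapT => /negP cj; apply: nj; exists j.
  by rewrite mxE cj add0r mxE eE eqxx mulr1.
Qed.

Lemma realize_det_gt0 n (A : 'M[R]_n) : 0 < \det A -> realize A.
Proof. by move=> dA; apply: (@realize_elimination n n 0) => // j. Qed.

(** The linear part is realized by [D]; the remaining germ, [g] after [invmx A], is tangent to the
    identity and is extended by [germ_extension]. *)
Lemma germ_cdiff n (g : 'rV[R]_n -> 'rV[R]_n) : sm g 0 -> g 0 = 0 -> 0 < \det ('J g 0) ->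
  exists D, cdiff D /\ \forall x \near (0 : 'rV[R]_n), D x = g x.
Proof.
move=> sg g0 Jg; have [D [cD DA]] := realize_det_gt0 Jg.
set A := 'J g 0 in Jg DA; have uA : A \in unitmx by rewrite unitmxE unitfE gt_eqF.
have D0 : D 0 = 0 by rewrite (nbhs_singleton DA) mul0mx.
have s1 : sm (fun x : 'rV[R]_n => x *m invmx A) 0 by apply: sm_mulmx; exact: sm_id.
have sg' : sm g (0 *m invmx A) by rewrite mul0mx.
have [||u [uL su ug u0]] := @germ_extension R n (fun x => g (x *m invmx A)) 1 ltr01 (sm_comp s1 sg').
- by rewrite mul0mx.
- by rewrite (jacobian_comp s1 sg') jacobian_mulmx mul0mx -/A mulVmx.
exists (fun x => D x + u (D x)); split.
  exact: (cdiff_comp cD (cdiff_perturbation uL su u0)).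
have n1 : \forall x \near (0 : 'rV[R]_n), D x + u (D x) = g (D x *m invmx A).
  have n0 : \forall y \near D 0, y + u y = g (y *m invmx A) by rewrite D0.
  exact: (sm_cont (cdiff_sm cD 0) n0).
by apply: filterS2 n1 DA => x ->  ->; rewrite mulmxK.
Qed.

End CompactlySupported.

(** * Connected sums of embeddings in the sphere *)

Section Spheres.
Context {R : realType}.

Lemma imm_ldf n (M N : manifold R n) (f : M -> N) (x : M) : imm f x -> ldf f x.
Proof.
move=> fx; have [sf _] := fx; have [a [Aa ax]] := atlas_at x; have [b [Ab bx]] := atlas_at (f x).
apply: (@ldf_jacobian R n M N f x a b) => //.
by rewrite -row_free_unit; exact: imm_row_free.
Qed.

Lemma htD n s s' (w w' : 'rV[R]_n) : ht s w + ht s' w' = ht (s + s') (w + w').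
Proof. by rewrite /ht (add_row_mx (s%:M : 'rV[R]_1) w s'%:M w') -raddfD. Qed.

(* Stereographic projection of the unit sphere from its pole of height e, for
   e = 1 or -1, and its inverse. *)
Definition stereo n (e : R) (z : 'rV[R]_n.+1) : 'rV[R]_n := (1 - e * hgt z)^-1 *: base z.
Definition unstereo n (e : R) (w : 'rV[R]_n) : 'rV[R]_n.+1 :=
  (N2 w + 1)^-1 *: ht (e * (N2 w - 1)) (2 *: w).

Lemma sm_stereo n (e : R) (z : 'rV[R]_n.+1) : 1 - e * hgt z != 0 -> sm (@stereo n e) z.
Proof.
move=> e0; apply: sm_scale; last exact: sm_base.
have s1 : sm (fun y : 'rV[R]_n.+1 => 1 + (- e) * hgt y) z.
  by apply: sm_add; [exact: sm_cst|apply: sm_mul; [exact: sm_cst|exact: sm_hgt]].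
have s2 : sm (fun y : 'rV[R]_n.+1 => 1 - e * hgt y) z.
  by apply: sm_near_eq s1; apply: near_all => y; rewrite mulNr.
exact: sm_inv.
Qed.

Lemma sm_unstereo n (e : R) (w : 'rV[R]_n) : sm (@unstereo n e) w.
Proof.
have N1 : N2 w + 1 != 0 by rewrite gt_eqF// ltr_wpDl// N2_ge0.
apply: sm_scale.
  apply: sm_inv => //; apply: sm_add; [exact: (sm_N2 (sm_id w))|exact: sm_cst].
apply: sm_ht; last by apply: sm_scale; [exact: sm_cst|exact: sm_id].
apply: sm_mul; first exact: sm_cst.
by apply: sm_add; [exact: (sm_N2 (sm_id w))|exact: sm_cst].
Qed.

Lemma stereoK n (e : R) (z : 'rV[R]_n.+1) : e ^+ 2 = 1 -> N2 z = 1 -> 1 - e * hgt z != 0 ->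
  unstereo e (stereo e z) = z.
Proof.
rewrite -(htK z); move: (hgt z) (base z) => t v e2; rewrite /unstereo /stereo N2_ht hgt_ht base_ht.
move=> tv t1; rewrite N2Z; have -> : N2 v = 1 - t ^+ 2 by rewrite -tv addrC addKr.
have ee : e * e = 1 by rewrite -expr2.
have d1 : 2 - 2 * (e * t) != 0 by rewrite (_ : _ - _ = 2 * (1 - e * t)) ?mulf_neq0//; ring.
have N1 : (1 - e * t)^-1 ^+ 2 * (1 - t ^+ 2) + 1 = 2 * (1 - e * t)^-1.
  have -> : 1 - t ^+ 2 = (1 - e * t) * (1 + e * t).
    have -> : (1 - e * t) * (1 + e * t) = 1 - e ^+ 2 * t ^+ 2 by ring.
    by rewrite e2 mul1r.
  by field.
rewrite N1 ht_scale; congr ht.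
  have -> : (1 - e * t)^-1 ^+ 2 * (1 - t ^+ 2) - 1 = 2 * (1 - e * t)^-1 - 2 by rewrite -N1; ring.
  transitivity (e * e * t); last by rewrite ee mul1r.
  by field; rewrite t1.
rewrite !scalerA [X in X *: _](_ : _ = 1) ?scale1r//.
by field; rewrite t1.
Qed.

(** The projections from opposite poles are the multiples of [v] by [1/(1 - t)] and [1/(1 + t)], and
    [N2 v = (1 - t)(1 + t)] on the sphere. *)
Lemma inversion_stereo n (z : 'rV[R]_n.+1) : N2 z = 1 -> 1 - hgt z != 0 ->
  inversion (stereo 1 z) = stereo (-1) z.
Proof.
rewrite -(htK z); move: (hgt z) (base z) => t v; rewrite /stereo N2_ht hgt_ht base_ht inversionE N2Z !mul1r.
move=> tv t1; have Nv : N2 v = (1 - t) * (1 + t) by rewrite -[N2 v](addKr (t ^+ 2)) tv; ring.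
have [t2|t2] := eqVneq (1 + t) 0.
  have -> : v = 0 by apply/eqP; rewrite -N2_eq0 Nv t2 mulr0.
  by rewrite !scaler0.
rewrite scalerA Nv; congr (_ *: _); rewrite mulN1r opprK; field.
by rewrite t1 t2.
Qed.

Lemma householder_swap n (a b : 'rV[R]_n) : N2 a = N2 b -> a != b -> a *m householder (a - b) = b.
Proof.
move=> ab neq; have u0 : N2 (a - b) != 0 by rewrite N2_eq0 subr_eq0.
have D : (a *m (a - b)^T) 0 0 = N2 (a - b) / 2.
  apply: (@mulIf _ 2) => //; rewrite mulfVK// mxE mulr_suml; apply/eqP; rewrite -subr_eq0 -sumrB.
  rewrite (eq_bigr (fun i => a 0 i ^+ 2 - b 0 i ^+ 2)) => [|i _].
    by rewrite sumrB [X in X - _]ab subrr.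
  by rewrite !mxE; ring.
rewrite /householder mulmxDr mulmx1 mulmxA linearZ/= -scalemxAr (mx11_scalar (a *m _)) D.
rewrite scale_scalar_mx mul_scalar_mx (_ : _ * _ = -1); last by field.
by rewrite scaleN1r opprB addrC subrK.
Qed.

(** After a reflection bringing [q] to the pole, [sigma] is the projection from [q], and [kappa] the
    one from the antipode of [q], hence a chart centred at [q]. *)
Lemma stereo_charts n (X : manifold R n) (s : X -> euclidean R n.+1) (q : X) :
  (forall x, imm s x) -> injective s -> (forall x, N2 (s x : 'rV[R]_n.+1) = 1) ->
  exists sigma kappa : X -> euclidean R n,
  [/\ forall x, x <> q -> ldf sigma x,
      forall x y, x <> q -> y <> q -> sigma x = sigma y -> x = y,
      ldf kappa q /\ kappa q = 0 :> 'rV[R]_n &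
      forall x, x <> q -> inversion (sigma x : 'rV[R]_n) = kappa x].
Proof.
move=> is_ injs Ns.
have [A [uA NA qA]] : exists A : 'M[R]_n.+1, [/\ A \in unitmx, forall v, N2 (v *m A) = N2 v &
    (s q : 'rV[R]_n.+1) *m A = ht 1 0].
  have [E|ne] := eqVneq (s q : 'rV[R]_n.+1) (ht 1 0).
    by exists 1%:M; rewrite unitmx1; split=> // [v|]; rewrite mulmx1.
  pose u : 'rV[R]_n.+1 := (s q : 'rV[R]_n.+1) - ht 1 0.
  have u0 : u != 0 by rewrite subr_eq0.
  exists (householder u); split; [exact: unit_householder|by move=> v; exact: N2_householder|].
  by apply: householder_swap => //; rewrite Ns N2_ht N20 addr0 expr1n.
pose z x : 'rV[R]_n.+1 := (s x : 'rV[R]_n.+1) *m A.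
have Nz x : N2 (z x) = 1 by rewrite NA.
have zq : z q = ht 1 0 by [].
have iz x : imm (z : X -> euclidean R n.+1) x.
  have [lA _] := ldf_mulmx (s x) uA.
  exact: (@imm_comp R n n.+1 n.+1 X (euclidean R n.+1) (euclidean R n.+1) s _ x (is_ x) (ldf_imm lA)).
have injz x y : z x = z y -> x = y.
  by move=> /(congr1 (mulmx^~ (invmx A))); rewrite !mulmxK// => /injs.
have ldf_st e x : e ^+ 2 = 1 -> 1 - e * hgt (z x) != 0 -> ldf (fun x => stereo e (z x) : euclidean R n) x.
  move=> e2 ex; apply: imm_ldf; have [sz [g [sg gz]]] := iz x.
  have ss : msm (@stereo n e : euclidean R n.+1 -> euclidean R n) (z x).
    by apply/msm_euclid; exact: sm_stereo.
  have su : msm (@unstereo n e : euclidean R n -> euclidean R n.+1) (stereo e (z x)).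
    by apply/msm_euclid; exact: sm_unstereo.
  split; first exact: msm_comp sz ss.
  exists (fun w => g (unstereo e (w : 'rV[R]_n))); split.
    by apply: msm_comp su _; rewrite stereoK.
  have n1 : \forall y \near x, 1 - e * hgt (z y) != 0.
    have cz : {for z x, continuous (fun w : 'rV[R]_n.+1 => 1 + (- e) * hgt w)}.
      apply: sm_cont; apply: sm_add; [exact: sm_cst|apply: sm_mul; [exact: sm_cst|exact: sm_hgt]].
    have n0 : \forall w \near z x, 1 + (- e) * hgt w != 0.
      by apply: near_neq0 => //; rewrite mulNr.
    have : \forall y \near x, 1 + (- e) * hgt (z y) != 0 by exact: (msm_cont sz n0).
    by apply: filterS => y; rewrite mulNr.
  by apply: filterS2 n1 gz => y ey; rewrite stereoK.
have t1 x : x <> q -> 1 - 1 * hgt (z x) != 0.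
  move=> xq; apply: contra_notN xq; rewrite mul1r subr_eq0 => /eqP h1; apply: injz.
  rewrite zq -[LHS]htK -h1; congr ht; apply/eqP; rewrite -N2_eq0.
  have E : N2 (ht (hgt (z x)) (base (z x))) = 1 by rewrite htK.
  by move: E; rewrite N2_ht -h1 expr1n => E; apply/eqP; move: E; lra.
exists (fun x => stereo 1 (z x)), (fun x => stereo (-1) (z x)); split.
- by move=> x xq; apply: ldf_st; [rewrite expr1n|exact: t1].
- move=> x y xq yq E; apply: injz; rewrite -(stereoK (expr1n _ 2) (Nz x) (t1 _ xq)).
  by rewrite -(stereoK (expr1n _ 2) (Nz y) (t1 _ yq)) E.
- split; last by rewrite /stereo zq base_ht scaler0.
  apply: ldf_st; first by rewrite sqrrN expr1n.
  by rewrite zq hgt_ht mulN1r opprK gt_eqF// addr_gt0.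
- by move=> x xq; apply: inversion_stereo => //; have := t1 _ xq; rewrite mul1r.
Qed.

(** Away from [0] this is a composite of local diffeomorphisms. Near [0] it is the identity, because
    [D] is the identity near infinity. *)
Lemma cdiff_inversion n (D : 'rV[R]_n -> 'rV[R]_n) (z : euclidean R n) : cdiff D -> D 0 = 0 ->
  ldf (fun z : euclidean R n => inversion (D (inversion (z : 'rV[R]_n))) : euclidean R n) z.
Proof.
move=> cD D0; have [D' [DK KD sD']] := cdiff_inverse cD.
have [->|z0] := eqVneq (z : 'rV[R]_n) 0.
  have [K HK] := cdiff_support cD.
  pose r := (Num.max K 1)^-1; have r0 : 0 < r by rewrite invr_gt0 lt_max ltr01 orbT.
  have n0 : \forall y \near (0 : 'rV[R]_n), N2 y < r.
    by apply: near_ltr; [exact: N2_cont|rewrite N20].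
  have E : \forall y \near (0 : euclidean R n), (y : 'rV[R]_n) = inversion (D (inversion y)).
    apply: filterS n0 => y yr; have [->|y0] := eqVneq y 0; first by rewrite inversion0 D0 inversion0.
    rewrite HK ?inversionK// N2_inversion.
    have : K <= Num.max K 1 by rewrite le_max lexx.
    move=> /le_trans; apply; rewrite -[leLHS]invrK lef_pV2 ?posrE ?N2_gt0//; exact: ltW.
  exact: (@ldf_near_eq R n n (euclidean R n) (euclidean R n) _ _ 0 E (ldf_id _)).
have [l1 _] := ldf_inversion z0.
have l2 := @ldf_comp R n n n (euclidean R n) (euclidean R n) (euclidean R n) _ D z l1 (cdiff_ldf _ cD).
have w0 : D (inversion (z : 'rV[R]_n)) != 0.
  by apply: contra_neq z0 => E; rewrite -[LHS]inversionK -[inversion z]DK E -D0 DK D0 inversion0.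
have [l3 _] := @ldf_inversion R n (D (inversion (z : 'rV[R]_n))) w0.
exact: (@ldf_comp R n n n (euclidean R n) (euclidean R n) (euclidean R n) _ _ z l2 l3).
Qed.

(* tau is the stereographic projection from Phi 0, corrected so that it is the
   inversion in the chart Phi near its pole. It follows that Psi o tau o f agrees
   on the neck with g far from the centre of the disc of N. *)
Lemma embeds_sphere_sum n (M N P : oriented_manifold R n.+1) (X Y : oriented_manifold R n.+2)
    (f : M -> X) (g : N -> Y) (s : X -> euclidean R n.+3) :
  compact [set: M] -> compact [set: N] -> is_connected_sum M N P ->
  smooth_embedding f -> smooth_embedding g ->
  (forall x, imm s x) -> injective s -> (forall x, N2 (s x : 'rV[R]_n.+3) = 1) ->
  exists F : P -> Y, smooth_embedding F.
Proof.
move=> cM cN /is_connected_sumP[phi [psi [i [j MNP]]]] ef eg is_ injs Ns.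
have cP := csum_compact MNP cM cN.
have [sigma [kappa [lsigma isigma [lkappa kappa0] sk]]] := stereo_charts (f (phi 0)) is_ injs Ns.
set q := f (phi 0) in lsigma isigma lkappa kappa0 sk.
have [e oe] := @osign_exists R n.+2 X (euclidean R n.+2) kappa q lkappa.
have [rho [d [c [sc [Phi [oPhi sPhi Phif Phis]]]]]] := slice e ef (csum_phi MNP).
have [rho' [d' [c' [sc' [Psi [oPsi sPsi Psig Psis]]]]]] := slice false eg (csum_psi MNP).
have [j1 S1] := csum_shrink MNP sc.
have [i2 S] := csum_shrink2 S1 sc'.
have [_ lPhi injPhi] := oPhi; have [_ lPsi injPsi] := oPsi.
have injf' x y : f x = f y -> x = y by have [_ injf _] := ef; exact: injf.
have injg' x y : g x = g y -> x = y by have [_ injg _] := eg; exact: injg.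
have Phi0 : Phi 0 = q by rewrite -ht00 Phif radial0.
have lk : ldf kappa (Phi 0) by rewrite Phi0.
have ok : osign e kappa (Phi 0) by rewrite Phi0.
(* The sign [e] of [kappa] was given to the slice [Phi], so that [h] preserves the orientation and
   its germ extends. *)
pose h (w : euclidean R n.+2) := kappa (Phi w).
have lh : ldf h 0 := ldf_comp (lPhi 0 I) lk.
have oh : osign true h 0.
  by have := osign_comp (lPhi 0 I) lk (@sPhi 0) ok; rewrite eqxx.
have h0 : h 0 = 0 :> 'rV[R]_n.+2 by rewrite /h Phi0.
have sh : sm (h : 'rV[R]_n.+2 -> 'rV[R]_n.+2) 0 by have [/msm_euclid] := lh.
have [D [cD Dh]] := germ_cdiff sh h0 (esym ((osign_euclid true h 0).1 oh)).
have D0 : D 0 = 0 by rewrite (nbhs_singleton Dh).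
have [D' [DK KD sD']] := cdiff_inverse cD.
have cD' := cdiff_inv cD DK.
have D'0 : D' 0 = 0 by rewrite -{1}D0 DK.
pose tau x : euclidean R n.+2 := inversion (D' (inversion (sigma x : 'rV[R]_n.+2))).
have ltau x : x <> q -> ldf tau x.
  move=> xq; exact: (@ldf_comp R n.+2 n.+2 n.+2 X (euclidean R n.+2) (euclidean R n.+2) sigma _ x
    (lsigma _ xq) (cdiff_inversion _ cD' D'0)).
have injtau x y : x <> q -> y <> q -> tau x = tau y -> x = y.
  move=> xq yq /(congr1 (@inversion R n.+2)); rewrite !inversionK => /(can_inj KD).
  move=> /(congr1 (@inversion R n.+2)); rewrite !inversionK; exact: isigma.
have Phiq w : w <> (0 : 'rV[R]_n.+2) -> Phi w <> q.
  by move=> w0; rewrite -Phi0 => /(injPhi _ _ I I).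
have [r r0 rP] := near0_ball Dh.
have tauPhi w : w <> (0 : 'rV[R]_n.+2) -> N2 w < r -> tau (Phi w) = inversion w.
  by move=> w0 wr; rewrite /tau (sk _ (Phiq _ w0)) -[kappa _](rP _ wr) DK.
have ht_inv (v : 'rV[R]_n.+1) : inversion (ht 0 v) = ht 0 (inversion v).
  by rewrite !inversionE N2_ht expr0n add0r ht_scale mulr0.
have ht_neq0 (v : 'rV[R]_n.+1) : v <> 0 -> ht 0 v <> 0.
  by move=> v0 E; apply: v0; have := congr1 (@base R n.+1) E; rewrite base_ht -ht00 base_ht.
have inv0 (v : 'rV[R]_n.+1) : v <> 0 -> inversion v <> 0.
  by move=> v0 /eqP; rewrite inversion_eq0 => /eqP.
pose psi1 (v : euclidean R n.+1) := psi (radial c' (v : 'rV[R]_n.+1)).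
pose phi1 (v : euclidean R n.+1) := phi (radial c (v : 'rV[R]_n.+1)).
(* [tau Phi] is known to be the inversion only on [N2 w < r], that is, on the side of [N] where
   [N2 u > 1 / r]. With a margin, the ball [N2 <= 2 / r] is removed from [N]; except for the centre,
   [M] covers it. *)
pose C := psi1 @` [set v | N2 v <= 2 / r].
have cC : closed C.
  by apply: disc_ball_closed => v; have [_ l _] := csum_psi S; exact: ldf_cont (l v I).
have C0 : C (psi1 0) by exists 0 => //=; rewrite N20 divr_ge0// ltW.
have r20 : 0 < 2 / r by rewrite divr_gt0.
have small (u : 'rV[R]_n.+1) : 2 / r < N2 u -> N2 (inversion u) < r.
  move=> ur; have u0 := lt_trans r20 ur.
  rewrite N2_inversion -[ltRHS]invrK ltf_pV2 ?posrE ?invr_gt0//; apply: le_lt_trans ur.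
  by rewrite ler_peMl ?invr_ge0 ?ltW// ltr1n.
have nC u : ~ C (psi1 u) -> 2 / r < N2 (u : 'rV[R]_n.+1).
  by move=> uC; rewrite ltNge; apply/negP => ur; apply: uC; exists u.
pose a x := Psi (tau (f x)).
have fq x : x <> phi1 0 -> f x <> q.
  by rewrite /phi1 radial0 => xp /injf'.
have ab x y : x <> phi1 0 -> ~ C y -> i2 x = j1 y <-> a x = g y.
  move=> xp yC; have yp : y <> psi1 0 by move=> yp; apply: yC; rewrite yp.
  split.
    move=> /(csum_glue S xp yp)[v [v0 xv yv]]; rewrite yv in yC *; rewrite xv /a.
    have := small _ (nC _ yC); rewrite inversionK => vr.
    rewrite -Phif tauPhi; first by rewrite ht_inv Psig.
      exact: ht_neq0.
    by rewrite N2_ht expr0n add0r.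
  rewrite /a => E; have [u uE] := Psis _ _ E; move: E; rewrite uE Psig => /injg' yu.
  have uC : ~ C (psi1 u) by rewrite /psi1 yu.
  have ur := nC _ uC; have vr := small _ ur.
  have u0 : u <> 0 by move=> u0; move: (lt_trans r20 ur); rewrite u0 N20 ltxx.
  have v0 := inv0 _ u0; set v := inversion u in vr v0.
  have uv : inversion v = u by rewrite /v inversionK.
  have tw : tau (Phi (ht 0 v)) = tau (f x).
    rewrite uE tauPhi; [by rewrite ht_inv uv|exact: ht_neq0|by rewrite N2_ht expr0n add0r].
  have := injtau _ _ (Phiq _ (ht_neq0 _ v0)) (fq _ xp) tw; rewrite Phif => /injf' <-.
  by rewrite -yu -uv; exact: (csum_neck S v0).
have oC : open (~` C) by rewrite openC.
have C1 : ~` C `<=` [set~ psi1 0] by move=> y yC yp; apply: yC; rewrite yp.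
have cov p : (exists x, x <> phi1 0 /\ i2 x = p) \/ (exists y, ~ C y /\ j1 y = p).
  have [?|[y [yp <-]]] := csum_cover S p; first by left.
  have [[u _ uy]|yC] := pselect (C y); last by right; exists y.
  have u0 : u <> (0 : 'rV[R]_n.+1) by move=> u0; apply: yp; rewrite -uy u0.
  have v0 := inv0 _ u0; left; exists (phi1 (inversion (u : 'rV[R]_n.+1))); split.
    exact: (csum_phi_neq0 S v0).
  by rewrite -uy; apply/esym; exact: (csum_neck2 S u0).
have la x : x <> phi1 0 -> imm a x.
  move=> xp; have l1 := @ldf_comp R n.+2 n.+2 n.+2 X (euclidean R n.+2) Y tau Psi (f x) (ltau _ (fq _ xp)) (lPsi _ I).
  exact: (imm_comp (smooth_embedding_imm ef x) (ldf_imm l1)).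
apply: (@csum_embedding R n.+1 M N P _ _ _ _ S n.+2 Y [set~ phi1 0] (~` C) a g cP (open_setC1 _) oC
  (fun _ H => H) C1 cov la (fun y _ => smooth_embedding_imm eg y) _ _ ab).
  by move=> x x' xp xp' /(injPsi _ _ I I)/(injtau _ _ (fq _ xp) (fq _ xp'))/injf'.
by move=> y y' _ _ /injg'.
Qed.

End Spheres.

(** * Subadditivity *)

Section PartTwo.
Context {R : realType}.

Lemma is_connected_sumC n (M N P : oriented_manifold R n.+1) :
  is_connected_sum M N P -> is_connected_sum N M P.
Proof.
move=> /is_connected_sumP[phi [psi [i [j S]]]]; apply/is_connected_sumP.
have S' := csum_sym S (row1_neq0 n).
by exists (fun v : euclidean R n.+1 => psi ((v : 'rV[R]_n.+1) *m householder (const_mx 1))),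
  (fun v : euclidean R n.+1 => phi ((v : 'rV[R]_n.+1) *m householder (const_mx 1))), j, i.
Qed.

Lemma is_sphere_embedding n (X : oriented_manifold R n) : is_sphere X ->
  exists s : X -> euclidean R n.+1, [/\ forall x, imm s x, injective s &
    forall x, N2 (s x : 'rV[R]_n.+1) = 1].
Proof.
move=> [s [es rs _]]; exists s; split.
- exact: smooth_embedding_imm.
- by move=> x y; have [_ injs _] := es; exact: injs.
- by move=> x; have : range s (s x) by [exists x]; rewrite rs.
Qed.

Lemma embeds_in_sum_S2xS2_connected_sum k l (M N P : oriented_manifold R 3) :
  compact [set: M] -> compact [set: N] -> is_connected_sum M N P ->
  embeds_in_sum_S2xS2 k M -> embeds_in_sum_S2xS2 l N -> embeds_in_sum_S2xS2 (k + l) P.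
Proof.
(* If one of the numbers is [0], its sphere is absorbed and [P] is embedded in the ambient manifold
   of the other summand, after exchanging [M] and [N] if necessary. *)
move=> cM cN MNP eM eN; case: k eM => [|k] eM.
  have [X [f [/is_sphere_embedding[s [is_ injs Ns]] ef]]] := eM; have [Y [g [sY eg]]] := eN.
  have [F eF] := @embeds_sphere_sum R 2 M N P X Y f g s cM cN MNP ef eg is_ injs Ns.
  by exists Y, F.
case: l eN => [|l] eN; last exact: (embeds_connected_sum_pos cM cN MNP eM eN).
have [X [f [/is_sphere_embedding[s [is_ injs Ns]] ef]]] := eN; have [Y [g [sY eg]]] := eM.
have [F eF] := @embeds_sphere_sum R 2 N M P X Y f g s cN cM (is_connected_sumC MNP) ef eg is_ injs Ns.
by rewrite addn0; exists Y, F.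
Qed.

End PartTwo.

(** * Homogeneity and straightening of discs *)

Section Diffeomorphisms.
Context {R : realType}.

Record mdiff n (M : oriented_manifold R n) (h : M -> M) : Prop := Mdiff {
  mdiff_ldf : forall x, ldf h x;
  mdiff_sign : forall x, osign true h x;
  mdiff_inverse : exists h', cancel h h' /\ cancel h' h }.

Lemma mdiff_inj n (M : oriented_manifold R n) (h : M -> M) : mdiff h -> injective h.
Proof. by move=> [_ _ [h' [hK _]]]; exact: can_inj hK. Qed.

Lemma mdiff_comp n (M : oriented_manifold R n) (h k : M -> M) :
  mdiff h -> mdiff k -> mdiff (fun x => k (h x)).
Proof.
move=> [lh oh [h' [hK Kh]]] [lk ok [k' [kK Kk]]]; split.
- by move=> x; exact: ldf_comp.
- by move=> x; exact: (osign_comp (lh x) (lk _) (@oh x) (@ok _)).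
- by exists (fun x => h' (k' x)); split=> x; rewrite ?kK ?hK ?Kh ?Kk.
Qed.

Lemma mdiff_id n (M : oriented_manifold R n) : mdiff (fun x : M => x).
Proof. by split; [exact: ldf_id|move=> x; exact: osign_id|exists (fun x => x)]. Qed.

Lemma mdiff_inv n (M : oriented_manifold R n) (h h' : M -> M) : mdiff h ->
  cancel h h' -> cancel h' h -> mdiff h'.
Proof.
move=> [lh oh _] hK Kh.
have E (x : M) : \forall y \near x, h' (h y) = y by apply: filterE => y; exact: hK.
have l x : ldf h' x.
  have [sh [g [sg gh hg]]] := lh (h' x); rewrite Kh in sg hg.
  have lg : ldf g x by rewrite -(Kh x); apply: (@ldf_sym _ _ _ _ _ h) => //; rewrite Kh.
  by apply: ldf_near_eq lg; apply: filterS hg => z hgz; rewrite -{2}hgz hK.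
split=> //; last by exists h.
move=> x; rewrite -(Kh x); apply: (osign_inv (lh _) _ (E _) (@oh _)).
by rewrite Kh.
Qed.

(** The Lipschitz constant of the cut-off translation is at most [|v| (L + 1) / t], hence at most
    [1/2] once [t >= 2 (L + 1) |v|]. *)
Lemma cdiff_bump n : exists2 C : R, 0 < C & forall (v : 'rV[R]_n) (t : R), 0 < t -> C * `|v| <= t ->
  cdiff (fun w : 'rV[R]_n => w + cut (t^-1 *: w) *: v).
Proof.
have [L L0 HL] := @cut_lipschitz R n; have L1 : 0 < L + 1 by rewrite ltr_wpDl.
exists (2 * (L + 1)); first by rewrite mulr_gt0.
move=> v t t0 tv; apply: (@cdiff_perturbation R n (fun w => cut (t^-1 *: w) *: v) (2 * t)).
- move=> x y; have := @cut_mul_lipschitz R n n L (`|v| / t) t (fun=> v) L0 t0 _ HL _ _ x y.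
  move=> H; apply: (le_trans (H _ _ _)).
  + by rewrite divr_ge0// ltW.
  + by move=> _ _; rewrite mulfVK// gt_eqF.
  + by move=> a b _ _; rewrite subrr normr0 !mulr_ge0// invr_ge0 ltW.
  + by rewrite ler_wpM2r// mulrAC ler_pdivrMr// ler_pdivlMl// mulrA mulrAC.
- by move=> x; apply: sm_scale; [exact: sm_cut_scaled|exact: sm_cst].
- by move=> x xt; rewrite cut_scaled0 ?scale0r.
Qed.

(** [D] is the identity near a far point, which exists in positive dimension, and the sign is
    constant by connectedness. *)
Lemma cdiff_sign n (D : 'rV[R]_n.+1 -> 'rV[R]_n.+1) (x : euclidean R n.+1) : cdiff D ->
  osign true (D : euclidean R n.+1 -> euclidean R n.+1) x.
Proof.
move=> cD; have lD y : ldf (D : euclidean R n.+1 -> euclidean R n.+1) y := cdiff_ldf y cD.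
have [K HK] := cdiff_support cD.
pose w : 'rV[R]_n.+1 := ht (`|K| + 1) 0.
have Kw : K < N2 w.
  rewrite N2_ht N20 addr0; have := ler_norm K; have := normr_ge0 K; nra.
have n1 : \forall y \near (w : euclidean R n.+1), y = D y.
  by apply: filterS (near_gtr (@N2_cont R _ w) Kw) => y Ky; rewrite HK// ltW.
have ow : osign true (D : euclidean R n.+1 -> euclidean R n.+1) w.
  apply: (@osign_near_eq R n.+1 (euclidean R n.+1) (euclidean R n.+1) true id D w (ldf_id _) n1).
  exact: osign_id.
have cn : connected [set: euclidean R n.+1] := @connected_rV R n.+1.
exact: (osign_connected cn lD ow).
Qed.

Lemma disc_sign n (M : oriented_manifold R n) (phi : euclidean R n -> M) : oemb setT phi ->
  exists e, forall v, osign e phi v.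
Proof.
move=> [_ l _]; have [e0 oe0] := osign_exists (l 0 I); exists e0 => v.
have cn : connected [set: euclidean R n] := @connected_rV R n.
by apply: (osign_connected cn _ oe0) => w; exact: l.
Qed.

Lemma disc_mdiff n (M : oriented_manifold R n.+1) (phi : euclidean R n.+1 -> M) D :
  oemb setT phi -> cdiff D -> exists H : M -> M, [/\ mdiff H, forall v, H (phi v) = phi (D v) &
    forall x, (forall v, x <> phi v) -> H x = x].
Proof.
move=> ophi cD; have [e oe] := disc_sign ophi; have [D' [DK KD _]] := cdiff_inverse cD.
have cD' := cdiff_inv cD DK.
have [K HK] := cdiff_support cD; have [K' HK'] := cdiff_support cD'.
have [H [Hphi Hid Hl]] := @disc_extension R n.+1 M phi e D K ophi oe HK.
have [H' [Hphi' Hid' _]] := @disc_extension R n.+1 M phi e D' K' ophi oe HK'.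
have HP x : ldf H x /\ osign true H x.
  by apply: Hl => v _; split; [exact: cdiff_ldf|exact: cdiff_sign].
have dec x : (exists v, x = phi v) \/ (forall v, x <> phi v).
  by have [?|nx] := pselect (exists v, x = phi v); [left|right => v xv; apply: nx; exists v].
exists H; split=> //; split; [by move=> x; have [] := HP x|by move=> x; have [] := HP x|].
exists H'; split=> x; have [[v ->]|nx] := dec x.
- by rewrite Hphi Hphi' DK.
- by rewrite Hid// Hid'.
- by rewrite Hphi' Hphi KD.
- by rewrite Hid'// Hid.
Qed.

(** Cut-off translations inside discs show that the orbit of [x] and its complement are both
    open. *)
Lemma homogeneous n (M : oriented_manifold R n.+1) (x y : M) : connected [set: M] ->
  exists h : M -> M, mdiff h /\ h x = y.
Proof.
move=> cM; pose O : set M := [set z | exists h : M -> M, mdiff h /\ h x = z].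
have loc z : \forall z' \near z, O z' <-> O z.
  have [phi [ophi phi0]] := disc_at z.
  rewrite -phi0; apply: filterS (near_range 0 ophi) => _ [v ->].
  (* The scale must be at least [C |v|] and positive even for [v = 0], hence the [+ 1]. *)
  have [C C0 /(_ (v : 'rV[R]_n.+1) (C * `|v : 'rV[R]_n.+1| + 1)) cD] := cdiff_bump n.+1.
  have {}cD := cD (ltr_wpDl (mulr_ge0 (ltW C0) (normr_ge0 _)) ltr01) (eq_ind_r is_true ler01 (lerDl _ _)).
  have [H [mH Hphi _]] := disc_mdiff ophi cD.
  have H0 : H (phi 0) = phi v.
    by rewrite Hphi; congr phi; rewrite add0r scaler0 cut1 ?scale1r// N20.
  have [H' [HK KH]] := mdiff_inverse mH; have mH' := mdiff_inv mH HK KH.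
  split=> -[h [mh hx]].
    by exists (fun u => H' (h u)); split; [exact: mdiff_comp|rewrite hx -H0 HK].
  by exists (fun u => H (h u)); split; [exact: mdiff_comp|rewrite hx H0].
suff E : O = [set: M] by have : [set: M] y by []; rewrite -E.
apply: cM.
- by exists x, (fun u => u); split=> //; exact: mdiff_id.
- exists O; last by rewrite setTI.
  by apply: open_near => z Oz; apply: filterS (loc z) => z' [_]; exact.
- exists O; last by rewrite setTI.
  by rewrite -openC; apply: open_near => z Oz; apply: filterS (loc z) => z' [h _] /h.
Qed.

(** Homogeneity makes the centres coincide. In the disc [psi] the discrepancy is then a germ [g]
    fixing [0] with positive determinant; it is undone by the inverse of an extension of [g],
    transported to [M]. *)
Lemma straighten n (M : oriented_manifold R n.+1) (phi psi : euclidean R n.+1 -> M) :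
  connected [set: M] -> oemb setT phi -> oemb setT psi ->
  (forall v, osign true phi v) -> (forall v, osign true psi v) ->
  exists h : M -> M, mdiff h /\ \forall v \near (0 : 'rV[R]_n.+1), h (phi v) = psi v.
Proof.
move=> cM ophi opsi sphi spsi; have [h1 [mh1 h1E]] := homogeneous (phi 0) (psi 0) cM.
have [k [kK lk ok]] := disc_inv opsi.
have [_ lphi _] := ophi; have [_ lpsi _] := opsi.
have lh := mdiff_ldf mh1; have oh := mdiff_sign mh1.
pose hphi v := h1 (phi v).
have l1 : ldf hphi 0 := ldf_comp (lphi 0 I) (lh _).
have o1 : osign true hphi 0 := osign_comp (lphi 0 I) (lh _) (@sphi 0) (@oh _).
have k0 : ldf k (hphi 0) by rewrite /hphi h1E; exact: lk.
have ok0 : osign true k (hphi 0) by rewrite /hphi h1E; exact: ok.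
pose g v := k (hphi v).
have lg : ldf g 0 := ldf_comp l1 k0.
have og : osign true g 0 := osign_comp l1 k0 o1 ok0.
have sg : sm (g : 'rV[R]_n.+1 -> 'rV[R]_n.+1) 0 by have [/msm_euclid] := lg.
have g0 : g 0 = 0 :> 'rV[R]_n.+1 by rewrite /g /hphi h1E kK.
have [D [cD Dg]] := germ_cdiff sg g0 (esym ((osign_euclid true g 0).1 og)).
have [D' [DK KD _]] := cdiff_inverse cD.
have [H [mH Hpsi _]] := disc_mdiff opsi (cdiff_inv cD DK).
exists (fun x => H (h1 x)); split; first exact: mdiff_comp.
have n1 : \forall v \near (0 : euclidean R n.+1), exists w, hphi v = psi w.
  have n0 : \forall y \near hphi 0, exists w, y = psi w.
    by rewrite /hphi h1E; exact: near_range.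
  exact: (ldf_cont l1 n0).
apply: filterS2 n1 Dg => v [w hw] Dv.
rewrite -/(hphi v) hw Hpsi -[w]kK -hw -/(g v) -[g v]Dv; congr psi; exact: DK.
Qed.

End Diffeomorphisms.

(** * Parallel copies of a hypersurface *)

Section HeightSign.
Context {R : realType}.

Lemma near_N2_ball n (x : 'rV[R]_n) (r : R) : 0 < r -> \forall y \near x, N2 (y - x) < r.
Proof.
move=> r0; have c : {for x, continuous (fun y : 'rV[R]_n => N2 (y - x))}.
  by apply: sm_cont; apply: sm_N2; apply: sm_subv; [exact: sm_id|exact: sm_cst].
by apply: near_ltr => //; rewrite subrr N20.
Qed.

Lemma near_within n (x : 'rV[R]_n) (P : 'rV[R]_n -> Prop) : (\forall y \near x, P y) ->
  exists2 r : R, 0 < r & forall y, N2 (y - x) < r -> P y.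
Proof.
move=> HP; have c : {for (0 : 'rV[R]_n), continuous (fun u : 'rV[R]_n => x + u)}.
  by apply: sm_cont; apply: sm_addv; [exact: sm_cst|exact: sm_id].
have H0 : \forall y \near x + 0, P y by rewrite addr0.
have n0 : \forall u \near (0 : 'rV[R]_n), P (x + u) by exact: (c _ H0).
have [r r0 rP] := near0_ball n0; exists r => // y yr.
by have := rP _ yr; rewrite addrC subrK.
Qed.

Lemma delta_ht n : delta_mx 0 0 = ht 1 0 :> 'rV[R]_n.+1.
Proof.
apply/rowP => k; case: (unliftP ord0 k) => [l|] ->; first by rewrite ht_lift !mxE.
by rewrite ht_ord0 mxE !eqxx.
Qed.

Lemma delta_lift n (k : 'I_n) : ht 0 (delta_mx 0 k) = delta_mx 0 (lift ord0 k) :> 'rV[R]_n.+1.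
Proof.
apply/rowP => l; case: (unliftP ord0 l) => [m|] ->; last by rewrite ht_ord0 mxE.
by rewrite ht_lift !mxE (inj_eq (@lift_inj _ ord0)).
Qed.

(* The derivative of T is block triangular, with diagonal blocks the derivative of
   the height and that of tau; the former is positive by the determinants. *)
Lemma height_sign n (T : 'rV[R]_n.+1 -> 'rV[R]_n.+1) (tau : 'rV[R]_n -> 'rV[R]_n) (v : 'rV[R]_n) :
  sm T (ht 0 v) -> sm tau v -> 0 < \det ('J T (ht 0 v)) * \det ('J tau v) ->
  (\forall u \near v, T (ht 0 u) = ht 0 (tau u)) ->
  \forall z \near ht 0 v, (0 < hgt (T z)) = (0 < hgt z).
Proof.
move=> sT st dets E.
pose Z : 'M[R]_(n, n.+1) := (row_mx 0 1%:M : 'M[R]_(n, 1 + n)).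
have uZ u : u *m Z = ht 0 u.
  have := mul_mx_row u (0 : 'M[R]_(n, 1)) (1%:M : 'M[R]_n).
  by rewrite mulmx0 mulmx1 /ht raddf0.
have sZ u : sm (fun u : 'rV[R]_n => u *m Z) u by apply: sm_mulmx; exact: sm_id.
have sT' : sm T (v *m Z) by rewrite uZ.
have JE : Z *m 'J T (ht 0 v) = 'J tau v *m Z.
  have := jacobian_comp (sZ v) sT'; rewrite jacobian_mulmx uZ => <-.
  have := jacobian_comp st (sZ (tau v)); rewrite jacobian_mulmx => <-.
  apply: jacobian_near_eq; first exact: sm_comp (sZ v) sT'.
  by apply: filterS E => u; rewrite !uZ.
set JT := 'J T (ht 0 v) in dets JE.
have rJ k : row (lift ord0 k) JT = ht 0 (row k ('J tau v)).
  by rewrite !rowE -delta_lift -uZ -mulmxA JE mulmxA uZ.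
have a0 : 0 < JT 0 0.
  have D : \det JT = JT 0 0 * \det ('J tau v).
    rewrite (expand_det_col JT 0) big_ord_recl big1 => [|k _]; last first.
      have := congr1 (fun w : 'rV[R]_n.+1 => w 0 0) (rJ k); rewrite [LHS]mxE => ->.
      by rewrite ht_ord0 mul0r.
    rewrite addr0 /cofactor expr0 mul1r; congr (_ * \det _); apply/matrixP => k l.
    rewrite [LHS]mxE [LHS]mxE; have := congr1 (fun w : 'rV[R]_n.+1 => w 0 (lift ord0 l)) (rJ k).
    rewrite [LHS]mxE [RHS]ht_lift [RHS]mxE; exact.
  move: dets; rewrite D -mulrA -expr2 => dets.
  have d0 : 0 < \det ('J tau v) ^+ 2.
    by rewrite lt_neqAle sqr_ge0 andbT eq_sym; apply: contraTneq dets => ->; rewrite mulr0 ltxx.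
  by move: dets; rewrite pmulr_lgt0.
pose H (z : 'rV[R]_n.+1) : R := T z 0 0.
have sH : sm H (ht 0 v) by have /sm_rowP := sT; exact.
have dH : 0 < 'D_(delta_mx 0 0) H (ht 0 v) by rewrite -(jacobianE 0 0 sT).
have n1 := near_gtr (sm_cont (sm_derive 0 sH)) dH.
have [r r0 rP] := near_within (filterI n1 (sm_near sH)).
have [r' r'0 r'P] := near_within E.
have m0 : 0 < Num.min r r' by rewrite lt_min r0.
apply: filterS (near_N2_ball (ht 0 v) m0) => z.
rewrite -(htK z); set h := hgt z; set b := base z.
have htB s : ht s b - ht 0 v = ht s (b - v).
  by rewrite -scaleN1r ht_scale mulr0 scaleN1r htD addr0.
rewrite htB N2_ht lt_min => /andP[hr hr'].
have Tb : H (ht 0 b) = 0.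
  rewrite /H r'P; first by rewrite [LHS](hgt_ht 0 (tau b)).
  by apply: le_lt_trans hr'; rewrite lerDr sqr_ge0.
have line s : ht 0 b + s *: delta_mx 0 0 = ht s b.
  by rewrite delta_ht ht_scale htD mulr1 add0r scaler0 addr0.
(* The height of [T] vanishes on the equator and has positive derivative in the vertical direction;
   on a vertical segment it is therefore [h] times a positive number. *)
have [s hs|s sh] := @line_increment R n.+1 H (ht 0 b) (delta_mx 0 0) h.
  rewrite line; have [|_ sHs] := rP (ht s b).
    rewrite htB N2_ht; apply: le_lt_trans hr; rewrite lerD2r.
    by rewrite -[s ^+ 2]real_normK ?num_real// -[h ^+ 2]real_normK ?num_real// ler_sqr ?nnegrE.
  by split; [exact: sm_cont sHs|exact: sm_derivable].
rewrite !line Tb subr0 => HE.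
have [|ds _] := rP (ht s b).
  rewrite htB N2_ht; apply: le_lt_trans hr; rewrite lerD2r.
  by rewrite -[s ^+ 2]real_normK ?num_real// -[h ^+ 2]real_normK ?num_real// ler_sqr ?nnegrE.
have -> : hgt (T (ht h b)) = h * 'D_(delta_mx 0 0) H (ht s b) by rewrite -HE.
by rewrite hgt_ht pmulr_lgt0.
Qed.

End HeightSign.

(** * Slice charts with matching signs *)

Section Slicings.
Context {R : realType} {n : nat} {M : oriented_manifold R n.+1} {X : oriented_manifold R n.+2}.
Context {f : M -> X}.
Hypothesis ef : smooth_embedding f.

(** The common sign [sl_sign] is the convention that selects a positive side of [f(M)]: whichever
    value it has, positive heights lie on the same side. *)
Record slicing : Type := Slicing {
  sl_phi : euclidean R n.+1 -> M;
  sl_Phi : euclidean R n.+2 -> X;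
  sl_sign : bool;
  sl_oemb : oemb setT sl_phi;
  sl_Oemb : oemb setT sl_Phi;
  sl_phi_sign : forall v, osign sl_sign sl_phi v;
  sl_Phi_sign : forall w, osign sl_sign sl_Phi w;
  slE : forall v : 'rV[R]_n.+1, sl_Phi (ht 0 v) = f (sl_phi v);
  sl_slice : forall w x, sl_Phi w = f x -> exists v, w = ht 0 v }.

Lemma sl_inj (S : slicing) v w : sl_phi S v = sl_phi S w -> v = w.
Proof. by have [_ _ H] := sl_oemb S; exact: H. Qed.

Lemma sl_Inj (S : slicing) v w : sl_Phi S v = sl_Phi S w -> v = w.
Proof. by have [_ _ H] := sl_Oemb S; exact: H. Qed.

Lemma sl_height0 (S : slicing) w x : sl_Phi S w = f x -> w = ht 0 (base w) /\ x = sl_phi S (base w).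
Proof.
move=> E; have [v wv] := sl_slice E; rewrite wv base_ht; split=> //.
by move: E; rewrite wv slE; have [_ injf _] := ef; move/(injf _ _ I I).
Qed.

Lemma shrink_slicing (S : slicing) rho d c : shrinker rho d c -> exists S' : slicing,
  [/\ sl_phi S' = (fun v => sl_phi S (radial c (v : 'rV[R]_n.+1))),
      sl_Phi S' = (fun w => sl_Phi S (radial c (w : 'rV[R]_n.+2))) & sl_sign S' = sl_sign S].
Proof.
move=> sc; case: S => phi Phi e ophi oPhi sphi sPhi E sl.
have rh0 (v : 'rV[R]_n.+1) : radial c (ht 0 v) = ht 0 (radial c v).
  by rewrite /radial N2_ht expr0n add0r ht_scale mulr0.
have lr k v := let: And3 _ l _ := shrinker_oemb sc k in l v I.
have o1 : oemb setT (fun v : euclidean R n.+1 => phi (radial c (v : 'rV[R]_n.+1))).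
  by apply: oemb_comp (shrinker_oemb sc _) ophi _.
have o2 : oemb setT (fun v : euclidean R n.+2 => Phi (radial c (v : 'rV[R]_n.+2))).
  by apply: oemb_comp (shrinker_oemb sc _) oPhi _.
have s1 v : osign e (fun v : euclidean R n.+1 => phi (radial c (v : 'rV[R]_n.+1))) v.
  have [_ l _] := ophi.
  have := osign_comp (lr _ v) (l _ I) (@shrinker_osign R rho d c n.+1 sc v) (sphi _).
  by case: (e).
have s2 v : osign e (fun v : euclidean R n.+2 => Phi (radial c (v : 'rV[R]_n.+2))) v.
  have [_ l _] := oPhi.
  have := osign_comp (lr _ v) (l _ I) (@shrinker_osign R rho d c n.+2 sc v) (sPhi _).
  by case: (e).
have E' (v : 'rV[R]_n.+1) : Phi (radial c (ht 0 v)) = f (phi (radial c v)) by rewrite rh0 E.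
have sl' (w : euclidean R n.+2) x : Phi (radial c (w : 'rV[R]_n.+2)) = f x -> exists v, w = ht 0 v.
  move=> /sl[v wv]; exists (base w); rewrite -[LHS]htK; congr (ht _ _).
  have := congr1 (@hgt R n.+1) wv; rewrite hgt_ht -{1}(htK w).
  by rewrite /radial ht_scale hgt_ht => /eqP; rewrite mulf_eq0 gt_eqF ?(shrinker_pos sc)//= => /eqP.
by exists (Slicing o1 o2 s1 s2 E' sl').
Qed.

Lemma slicing_of_disc (phi : euclidean R n.+1 -> M) : oemb setT phi -> (forall v, osign true phi v) ->
  exists rho d c (S : slicing), [/\ shrinker rho d c, sl_sign S &
    sl_phi S = (fun v => phi (radial c (v : 'rV[R]_n.+1)))].
Proof.
move=> ophi sphi; have [rho [d [c [sc [Phi [oPhi sPhi E sl]]]]]] := slice true ef ophi.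
have o1 : oemb setT (fun v : euclidean R n.+1 => phi (radial c (v : 'rV[R]_n.+1))).
  by apply: oemb_comp (shrinker_oemb sc _) ophi _.
have s1 v : osign true (fun v : euclidean R n.+1 => phi (radial c (v : 'rV[R]_n.+1))) v.
  have [_ l _] := ophi; have [_ lr _] := shrinker_oemb sc n.+1.
  exact: (osign_comp (lr v I) (l _ I) (@shrinker_osign R rho d c n.+1 sc v) (sphi _)).
by exists rho, d, c, (Slicing o1 oPhi s1 sPhi E sl).
Qed.

Lemma slicing_at x (U : set X) : open U -> U (f x) ->
  exists S : slicing, sl_phi S 0 = x /\ forall w, U (sl_Phi S w).
Proof.
move=> oU Ux; have [phi [ophi phi0]] := disc_at x.
have [e oe] := disc_sign ophi.
have [rho [d [c [sc [Phi [oPhi sPhi E sl]]]]]] := slice e ef ophi.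
have o1 : oemb setT (fun v : euclidean R n.+1 => phi (radial c (v : 'rV[R]_n.+1))).
  by apply: oemb_comp (shrinker_oemb sc _) ophi _.
have s1 v : osign e (fun v : euclidean R n.+1 => phi (radial c (v : 'rV[R]_n.+1))) v.
  have [_ l _] := ophi; have [_ lr _] := shrinker_oemb sc n.+1.
  have := osign_comp (lr v I) (l _ I) (@shrinker_osign R rho d c n.+1 sc v) (oe _).
  by case: (e).
pose S0 : slicing := Slicing o1 oPhi s1 sPhi E sl.
have [_ lPhi _] := oPhi.
have P0 : Phi 0 = f x by rewrite -ht00 E radial0 phi0.
have n1 : \forall w \near (0 : 'rV[R]_n.+2), U (Phi w).
  have n0 : \forall p \near Phi 0, U p by rewrite P0; exact: near_open.
  exact: (ldf_cont (lPhi 0 I) n0).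
have [r r0 rP] := near0_ball n1.
have [d2 [c2 sc2]] := shrinker_exists r0.
have [S [S1 S2 _]] := shrink_slicing S0 sc2.
exists S; rewrite S1 S2 /= !radial0; split=> // w.
by apply: rP; exact: (shrinker_lt sc2).
Qed.

(** The transition between two slicings restricts to a transition [tau] of the discs of [M]. By the
    matching of signs both have determinants of the same sign, so [height_sign] applies. *)
Lemma slicing_height_sign (S S' : slicing) w w' x : sl_Phi S w = f x -> sl_Phi S' w' = f x ->
  \forall p \near f x, forall z z', sl_Phi S z = p -> sl_Phi S' z' = p ->
    (0 < hgt (z : 'rV[R]_n.+2)) = (0 < hgt (z' : 'rV[R]_n.+2)).
Proof.
move=> wx wx'; have [wv xv] := sl_height0 wx; have [wv' xv'] := sl_height0 wx'.
set v := base w in wv xv; set v' := base w' in wv' xv'.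
have [g [gK lg og]] := disc_inv (sl_Oemb S'); have [k [kK lk ok]] := disc_inv (sl_oemb S').
have [g2 [gK2 lg2 og2]] := disc_inv (sl_Oemb S).
have [_ lphi _] := sl_oemb S; have [_ lPhi _] := sl_Oemb S.
pose T (z : euclidean R n.+2) := g (sl_Phi S z); pose tau (u : euclidean R n.+1) := k (sl_phi S u).
have lgw : ldf g (sl_Phi S w) by rewrite wx -wx'; exact: lg.
have ogw : osign (sl_sign S') g (sl_Phi S w) by rewrite wx -wx'; apply: og; exact: sl_Phi_sign.
have lkv : ldf k (sl_phi S v) by rewrite -xv xv'; exact: lk.
have okv : osign (sl_sign S') k (sl_phi S v) by rewrite -xv xv'; apply: ok; exact: sl_phi_sign.
have lT : ldf T w := ldf_comp (lPhi w I) lgw.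
have ltau : ldf tau v := ldf_comp (lphi v I) lkv.
have oT := osign_comp (lPhi w I) lgw (@sl_Phi_sign S w) ogw.
have otau := osign_comp (lphi v I) lkv (@sl_phi_sign S v) okv.
have uT := @ldf_unit R n.+2 (euclidean R n.+2) (euclidean R n.+2) T w (@id_chart R n.+2) (@id_chart R n.+2)
  lT erefl erefl I I.
have utau := @ldf_unit R n.+1 (euclidean R n.+1) (euclidean R n.+1) tau v (@id_chart R n.+1) (@id_chart R n.+1)
  ltau erefl erefl I I.
have dets : 0 < \det ('J (T : 'rV[R]_n.+2 -> 'rV[R]_n.+2) w) * \det ('J (tau : 'rV[R]_n.+1 -> 'rV[R]_n.+1) v).
  rewrite pos_mulE; [|exact: unitmx_det uT|exact: unitmx_det utau].
  by rewrite -((osign_euclid _ T w).1 oT) -((osign_euclid _ tau v).1 otau) eqxx.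
have E : \forall u \near (v : 'rV[R]_n.+1), T (ht 0 u) = ht 0 (tau u) :> 'rV[R]_n.+2.
  have n0 : \forall y \near sl_phi S v, exists u', y = sl_phi S' u'.
    by rewrite -xv xv'; exact: near_range (sl_oemb S').
  have n1 : \forall u \near (v : euclidean R n.+1), exists u', sl_phi S u = sl_phi S' u'.
    exact: (ldf_cont (lphi v I) n0).
  by apply: filterS n1 => u [u' uu]; rewrite /T /tau slE uu kK -slE gK.
have sT : sm (T : 'rV[R]_n.+2 -> 'rV[R]_n.+2) (ht 0 v) by rewrite -wv; have [/msm_euclid] := lT.
have stau : sm (tau : 'rV[R]_n.+1 -> 'rV[R]_n.+1) v by have [/msm_euclid] := ltau.
rewrite wv in dets.
have n2 := height_sign sT stau dets E.
have n3 : \forall p \near f x, (0 < hgt (T (g2 p) : 'rV[R]_n.+2)) = (0 < hgt (g2 p : 'rV[R]_n.+2)).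
  have n0 : \forall z \near (g2 (f x) : 'rV[R]_n.+2), (0 < hgt (T z : 'rV[R]_n.+2)) = (0 < hgt z).
    by rewrite -wx gK2 wv.
  have lg2x : ldf g2 (f x) by rewrite -wx; exact: lg2.
  exact: (ldf_cont lg2x n0).
apply: filterS n3 => p pE z z' zp zp'.
have g2p : g2 p = z by rewrite -zp gK2.
by move: pE; rewrite g2p => <-; rewrite /T zp -zp' gK.
Qed.

End Slicings.

(** * The push in one chart *)

Section Push.
Context {R : realType}.

(** At scale [4] it is [1] for [N2 <= 16] and vanishes for [N2 >= 32]. The tube will lie in
    [N2 <= 10], well inside the region where the push is a translation. *)
Definition bump n (w : 'rV[R]_n) : R := cut (4^-1 *: w).
Definition push n (t : R) (w : 'rV[R]_n.+1) : 'rV[R]_n.+1 := w + bump w *: ht t 0.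

Lemma N2_quarter n (w : 'rV[R]_n) : N2 (4^-1 *: w) = N2 w / 16.
Proof. by rewrite N2Z mulrC; congr (_ * _); field. Qed.

Lemma bump1 n (w : 'rV[R]_n) : N2 w <= 16 -> bump w = 1.
Proof. by move=> w1; apply: cut1; rewrite N2_quarter ler_pdivrMr// mul1r. Qed.

Lemma bump0 n (w : 'rV[R]_n) : 32 <= N2 w -> bump w = 0.
Proof. by move=> w1; apply: cut0; rewrite N2_quarter ler_pdivlMr//; move: w1; lra. Qed.

Lemma bump_gt0 n (w : 'rV[R]_n) : N2 w < 32 -> 0 < bump w.
Proof. by move=> w1; apply: step_gt0; rewrite N2_quarter subr_gt0 ltr_pdivrMr//; move: w1; lra. Qed.

Lemma pushE n (t : R) (w : 'rV[R]_n.+1) : push t w = ht (hgt w + bump w * t) (base w).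
Proof. by rewrite /push ht_scale scaler0 -{1}(htK w) htD addr0. Qed.

Lemma push_id n (t : R) (w : 'rV[R]_n.+1) : 32 <= N2 w -> push t w = w.
Proof. by move=> w1; rewrite /push bump0// scale0r addr0. Qed.

Lemma push_cdiff n : exists2 d : R, 0 < d & forall t, 0 < t -> t < d -> cdiff (@push n t).
Proof.
have [C C0 H] := @cdiff_bump R n.+1.
pose e := `|ht 1 (0 : 'rV[R]_n)|.
have Ce : 0 < C * e + 1 by rewrite ltr_wpDl// mulr_ge0 ?(ltW C0)// normr_ge0.
exists (4 / (C * e + 1)) => [|t t0 td]; first by rewrite divr_gt0.
apply: H => //; have -> : ht t (0 : 'rV[R]_n) = t *: ht 1 0 by rewrite ht_scale mulr1 scaler0.
rewrite normrZ gtr0_norm// -/e; move: td; rewrite ltr_pdivlMr//.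
by move: t0; rewrite mulrDr mulr1 mulrCA mulrA; lra.
Qed.

(** [push t] is injective and fixes every point with [N2 >= 32], so no point of the ball is sent
    there. *)
Lemma push_ball n (t : R) (w : 'rV[R]_n.+1) : cdiff (@push n t) -> N2 w < 32 -> N2 (push t w) < 32.
Proof.
move=> cD w1; rewrite ltNge; apply/negP => w2.
have [D' [DK _ _]] := cdiff_inverse cD.
have /(can_inj DK) E := push_id t w2.
by move: w2; rewrite E leNgt w1.
Qed.

Lemma htB n s s' (w w' : 'rV[R]_n) : ht s w - ht s' w' = ht (s - s') (w - w').
Proof. by rewrite -scaleN1r ht_scale htD !mulN1r scaleN1r. Qed.

Lemma push_near n (w0 : 'rV[R]_n.+1) (P : 'rV[R]_n.+1 -> Prop) : (\forall w \near w0, P w) ->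
  exists2 d : R, 0 < d & forall w t, N2 (w - w0) < d -> 0 <= t -> t < d -> P (push t w).
Proof.
(* The height satisfies [(a + q)^2 <= 2 a^2 + 2 q^2] with [q^2 <= t] because [t <= 1]; the total is
   less than [4 d], whence [r / 4]. *)
move=> /near_within[r r0 rP]; pose d := Num.min 1 (r / 4).
have d0 : 0 < d by rewrite lt_min ltr01 divr_gt0.
exists d => // w t wd t0 td; apply: rP.
have Ew : w - w0 = ht (hgt w - hgt w0) (base w - base w0) by rewrite -htB !htK.
have -> : push t w - w0 = ht (hgt w - hgt w0 + bump w * t) (base w - base w0).
  by rewrite pushE -{1}(htK w0) htB addrAC.
rewrite N2_ht; have N2E := N2_ht (hgt w - hgt w0) (base w - base w0); rewrite -Ew in N2E.
have b0 : 0 <= bump w by exact: cut_ge0.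
have b1 : bump w <= 1 by exact: cut_le1.
have bt : (bump w * t) ^+ 2 <= t.
  have t1 : t <= 1 by rewrite ltW// (lt_le_trans td)// ge_min lexx.
  rewrite exprMn; apply: (@le_trans _ _ (1 * t ^+ 2)).
    by rewrite ler_wpM2r ?sqr_ge0// expr_le1.
  by rewrite mul1r expr2 ler_piMl.
have d4 : d <= r / 4 by rewrite ge_min lexx orbT.
have := sqr_ge0 (hgt w - hgt w0 - bump w * t).
move: N2E wd td d4 bt; set a := hgt w - hgt w0; set q := bump w * t; set z := N2 (base w - base w0).
have z0 : 0 <= z by exact: N2_ge0.
have -> : (a + q) ^+ 2 = 2 * a ^+ 2 + 2 * q ^+ 2 - (a - q) ^+ 2 by ring.
move: z0; clearbody a q z d; lra.
Qed.

End Push.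

(** * The parallel copy by successive pushes *)

Section ParallelCopy.
Context {R : realType} {n : nat} {M : oriented_manifold R n.+1} {X : oriented_manifold R n.+2}.
Context {f : M -> X}.
Hypothesis ef : smooth_embedding f.
Hypothesis cM : compact [set: M].
Local Notation sl := (@slicing R n M X f).

Lemma near_In (T : topologicalType) (x : T) (A : Type) (L : list A) (P : A -> T -> Prop) :
  (forall S, List.In S L -> \forall y \near x, P S y) -> \forall y \near x, forall S, List.In S L -> P S y.
Proof.
elim: L => [|S L IH] H; first by apply: filterE.
have H1 := H S (or_introl erefl); have H2 := IH (fun S' i => H S' (or_intror i)).
by apply: filterS2 H1 H2 => y y1 y2 S' [<-|/y2].
Qed.

Section Stage.
Variable L : list sl.

(* The positive sides of f(M) given by the charts of L agree at p. *)
Definition cons_at (p : X) : Prop := forall S, List.In S L -> forall S', List.In S' L ->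
  forall z z', N2 (z : 'rV[R]_n.+2) <= 32 -> N2 (z' : 'rV[R]_n.+2) <= 32 ->
  sl_Phi S z = p -> sl_Phi S' z' = p -> (0 < hgt (z : 'rV[R]_n.+2)) = (0 < hgt (z' : 'rV[R]_n.+2)).

(** The interior makes this an open condition, so that it survives small pushes. *)
Definition good : set X := [set p | cons_at p]°.

Definition above (p : X) : Prop := exists S, List.In S L /\ exists z : 'rV[R]_n.+2,
  [/\ N2 z <= 32, sl_Phi S z = p & 0 < hgt z].

(* The charts in D have been used: every point of M which is seen by one of them
   has been moved to the positive side of f(M), and the other points either too,
   or not at all. *)
Definition pushed (D : list sl) (g : M -> X) : Prop := forall x, (good (g x) /\ above (g x)) \/
  (g x = f x /\ forall S, List.In S D -> forall v, x = sl_phi S v -> 32 <= N2 (v : 'rV[R]_n.+1)).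

Lemma ball_closed (S : sl) (e : R) : closed (sl_Phi S @` [set w | N2 (w : 'rV[R]_n.+2) <= e]).
Proof. by apply: disc_ball_closed => v; have [_ l _] := sl_Oemb S; exact: ldf_cont (l v I). Qed.

(** For each pair of the finite list, either one of the closed balls misses a neighbourhood of
    [f x], or both charts contain [f x] and [slicing_height_sign] applies. *)
Lemma good_f x : good (f x).
Proof.
have loc (S : sl) : (exists w, sl_Phi S w = f x) \/
    \forall p \near f x, forall z, N2 (z : 'rV[R]_n.+2) <= 32 -> sl_Phi S z <> p.
  have [?|nw] := pselect (exists w, sl_Phi S w = f x); [by left|right].
  have : \forall p \near f x, ~ (sl_Phi S @` [set w | N2 (w : 'rV[R]_n.+2) <= 32]) p.
    apply: (@near_open _ (~` _)); first by rewrite openC; exact: ball_closed.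
    by move=> [w _ wx]; apply: nw; exists w.
  by apply: filterS => p np z z1 zp; apply: np; exists z.
apply: near_In => S _; apply: near_In => S' _.
have [[w wx]|n1] := loc S; last by apply: filterS n1 => p np z z' z1 _ /(np _ z1).
have [[w' wx']|n1] := loc S'; last by apply: filterS n1 => p np z z' _ z1 _ /(np _ z1).
by apply: filterS (slicing_height_sign ef wx wx') => p H z z' _ _; exact: H.
Qed.

Lemma above_f p x : above p -> p <> f x.
Proof.
move=> [S [_ [z [_ <- z0]]]] /(sl_slice (s := S))[v zv].
by move: z0; rewrite zv hgt_ht ltxx.
Qed.

(** [good] is open, so each point of [M] has a neighbourhood with its own bound on [t]; compactness
    of [M] makes the bound uniform. *)
Lemma push_good (S : sl) (g : M -> X) : (forall x, {for x, continuous g}) -> (forall x, good (g x)) ->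
  exists2 d : R, 0 < d & forall t, 0 < t -> t < d -> forall x w, g x = sl_Phi S w ->
    good (sl_Phi S (push t (w : 'rV[R]_n.+2))).
Proof.
move=> cg gg; have [k [kK lk _]] := disc_inv (sl_Oemb S); have [_ lPhi _] := sl_Oemb S.
have oG : open good by exact: open_interior.
pose P (t : R) x := 0 <= t -> forall w, g x = sl_Phi S w -> good (sl_Phi S (push t (w : 'rV[R]_n.+2))).
have H : near_covering [set: M] by exact/compact_near_coveringP.
have : \forall t \near (0 : R), [set: M] `<=` P t.
  apply: (H R (nbhs (0 : R)) P (nbhs_filter _)) => x0 _.
  have [[w0 gw0]|nw] := pselect (exists w0, g x0 = sl_Phi S w0).
    have n0 : \forall w \near (w0 : euclidean R n.+2), good (sl_Phi S w).
      have n1 : \forall p \near sl_Phi S w0, good p by apply: near_open => //; rewrite -gw0.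
      exact: (ldf_cont (lPhi w0 I) n1).
    have [d d0 dP] := @push_near R n.+1 w0 (fun w => good (sl_Phi S w)) n0.
    have n2 : \forall x \near x0, N2 ((k (g x) : 'rV[R]_n.+2) - w0) < d.
      have n1 : \forall p \near g x0, N2 ((k p : 'rV[R]_n.+2) - w0) < d.
        have lk0 : ldf k (g x0) by rewrite gw0; exact: lk.
        have n3 : \forall w \near (k (g x0) : 'rV[R]_n.+2), N2 (w - w0) < d.
          by rewrite gw0 kK; exact: near_N2_ball.
        exact: (ldf_cont lk0 n3).
      exact: (cg x0 _ n1).
    exists ([set x | N2 ((k (g x) : 'rV[R]_n.+2) - w0) < d], [set t : R | t < d]) => /=.
      split=> //; have := near_ltr (T := R) (f := id) (x := 0) (r := d); apply=> //; exact: cvg_id.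
    move=> [x t] /= [xd td] t0 w gw; apply: dP => //.
    by move: xd; rewrite gw kK.
  have n1 : \forall x \near x0, ~ (sl_Phi S @` [set w | N2 (w : 'rV[R]_n.+2) <= 32]) (g x) /\ good (g x).
    have n0 : \forall p \near g x0, ~ (sl_Phi S @` [set w | N2 (w : 'rV[R]_n.+2) <= 32]) p /\ good p.
      apply: filterI; last by apply: near_open; [|exact: gg].
      apply: (@near_open _ (~` _)); first by rewrite openC; exact: ball_closed.
      by move=> [w _ wx]; apply: nw; exists w.
    exact: (cg x0 _ n0).
  exists ([set x | ~ (sl_Phi S @` [set w | N2 (w : 'rV[R]_n.+2) <= 32]) (g x) /\ good (g x)], setT) => /=.
    by split=> //; exact: filterT.
  move=> [x t] /= [[xn xg] _] t0 w gw; rewrite push_id -?gw//.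
  by rewrite leNgt; apply/negP => w32; apply: xn; exists w => //=; exact: ltW.
move=> /nbhs_ballP[d /= d0 dP]; exists d => // t t0 td x w gw.
have bt : ball (0 : R) d t by rewrite /ball/= sub0r normrN gtr0_norm.
exact: (dP t bt x I (ltW t0) w gw).
Qed.

(** A point [g x] seen by [S] has nonnegative height there: either it is already above in some
    chart, and goodness transfers the sign to [S], or it is still on [f(M)], at height [0]. The push
    raises it strictly, and a small [t] keeps it good. *)
Lemma push_stage (S : sl) (D : list sl) (g : M -> X) : List.In S L -> (forall x, {for x, continuous g}) ->
  pushed D g -> exists2 d : R, 0 < d & forall t, 0 < t -> t < d -> exists H : X -> X,
    [/\ mdiff H, forall w, H (sl_Phi S w) = sl_Phi S (push t (w : 'rV[R]_n.+2)),
      forall p, (forall w, p <> sl_Phi S w) -> H p = p & pushed (S :: D) (fun x => H (g x))].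
Proof.
move=> SL cg gD.
have gg x : good (g x) by have [[]//|[-> _]] := gD x; exact: good_f.
have [d1 d10 d1P] := push_good S cg gg; have [d2 d20 d2P] := @push_cdiff R n.+1.
exists (Num.min d1 d2) => [|t t0]; first by rewrite lt_min d10.
rewrite lt_min => /andP[td1 td2]; have cD := d2P _ t0 td2.
have [H [mH HPhi Hid]] := disc_mdiff (sl_Oemb S) cD; exists H; split=> // x.
have gx := gg x; have cx : cons_at (g x) by exact: interior_subset gx.
have [[w [w32 gw]]|nw] := pselect (exists w : 'rV[R]_n.+2, N2 w < 32 /\ g x = sl_Phi S w); last first.
  have Hx : H (g x) = g x.
    have [[w gw]|nw2] := pselect (exists w, g x = sl_Phi S w); last first.
      by apply: Hid => w gw; apply: nw2; exists w.
    rewrite gw HPhi push_id// leNgt; apply/negP => w32; apply: nw; by exists w.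
  rewrite Hx; have [?|[gf gN]] := gD x; [by left|right; split=> // S' [<-|/gN]//].
  move=> v xv; rewrite leNgt; apply/negP => v32; apply: nw; exists (ht 0 v).
  by rewrite N2_ht expr0n add0r gf xv slE.
have w0 : 0 <= hgt w.
  have [[_ [S' [S'L [z [z1 zg z0]]]]]|[gf _]] := gD x.
    by apply: ltW; rewrite (cx S SL S' S'L w z (ltW w32) z1 (esym gw) zg).
  by have [v ->] := sl_slice (etrans (esym gw) gf); rewrite hgt_ht.
left; rewrite gw HPhi; split; first exact: (d1P t t0 td1 x).
exists S; split=> //; exists (push t w); split=> //; first by apply: ltW; exact: push_ball.
by rewrite pushE hgt_ht ltr_wpDl// mulr_gt0// bump_gt0.
Qed.

Lemma mdiff_cont (H : X -> X) (g : M -> X) : mdiff H -> (forall x, {for x, continuous g}) ->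
  forall x, {for x, continuous (fun x => H (g x))}.
Proof. by move=> mH cg x; apply: continuous_comp; [exact: cg|exact: ldf_cont (mdiff_ldf mH _)]. Qed.

Lemma push_stages (K : set X) (Q D : list sl) (g : M -> X) :
  (forall S, List.In S Q -> List.In S L /\ forall w, ~ K (sl_Phi S w)) ->
  (forall x, {for x, continuous g}) -> pushed D g -> exists H : X -> X,
    [/\ mdiff H, forall p, K p -> H p = p & pushed (Q ++ D) (fun x => H (g x))].
Proof.
elim: Q g => [|S Q IH] g QL cg gD; first by exists id; split=> //; exact: mdiff_id.
have [H [mH HK HQ]] := IH g (fun S' i => QL S' (or_intror i)) cg gD.
have [SL SK] := QL S (or_introl erefl).
have [d d0 /(_ (d / 2))] := push_stage SL (mdiff_cont mH cg) HQ.
move=> [||H' [mH' _ Hid HP]]; [by rewrite divr_gt0|by rewrite ltr_pdivrMr// ltr_pMr// ltr1n|].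
exists (fun p => H' (H p)); split=> //; first exact: mdiff_comp.
by move=> p Kp; rewrite HK//; apply: Hid => w pw; apply: (SK w); rewrite -pw.
Qed.

End Stage.

(** A point outside the ball [N2 < 32] of [S1] has its image off the closed ball [N2 <= 20], so a
    chart around it can be chosen that avoids the latter. Compactness leaves finitely many
    charts. *)
Lemma slicing_cover (S1 : sl) : exists Q : list sl,
  (forall S, List.In S Q -> forall w, ~ (sl_Phi S1 @` [set w | N2 (w : 'rV[R]_n.+2) <= 20]) (sl_Phi S w)) /\
  forall x, exists S, List.In S (S1 :: Q) /\ exists2 v : 'rV[R]_n.+1, N2 v < 32 & x = sl_phi S v.
Proof.
set K := sl_Phi S1 @` _.
pose ok (S : sl) := S = S1 \/ forall w, ~ K (sl_Phi S w).
have loc x : exists S, ok S /\ exists2 v : 'rV[R]_n.+1, N2 v < 32 & x = sl_phi S v.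
  have [[v v32 xv]|nx] := pselect (exists2 v : 'rV[R]_n.+1, N2 v < 32 & x = sl_phi S1 v).
    by exists S1; split; [left|exists v].
  have oK : open (~` K) by rewrite openC; exact: ball_closed.
  have Kx : ~ K (f x).
    move=> [w /= w20 /(sl_height0 ef)[wE xE]]; apply: nx; exists (base w) => //.
    by apply: (@le_lt_trans _ _ 20); [move: w20; rewrite wE N2_ht expr0n add0r base_ht|rewrite ltr_nat].
  have [S [S0 SK]] := slicing_at ef oK Kx.
  by exists S; split; [right|exists 0; rewrite ?N20].
pose P (Q : list sl) x := exists S, List.In S Q /\ exists2 v : 'rV[R]_n.+1, N2 v < 32 & x = sl_phi S v.
(* The filter of the finite lists of admissible charts that contain a given one; with it,
   [near_covering] delivers a finite subcover. *)
pose F : set_system (list sl) := [set U | exists2 Q0, (forall S, List.In S Q0 -> ok S) &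
  forall Q, (forall S, List.In S Q -> ok S) -> (forall S, List.In S Q0 -> List.In S Q) -> U Q].
have FF : Filter F.
  split; first by exists nil.
    move=> U V [Q0 ok0 H0] [Q1 ok1 H1]; exists (Q0 ++ Q1) => [S /List.in_app_iff[/ok0|/ok1]//|Q okQ sub].
    by split; [apply: H0|apply: H1] => // S SQ; apply: sub; apply/List.in_app_iff; [left|right].
  by move=> U V UV [Q0 ok0 H0]; exists Q0 => // Q okQ sub; apply: UV; exact: H0.
have H : near_covering [set: M] by exact/compact_near_coveringP.
have [|Q0 ok0 /(_ Q0 ok0 (fun _ i => i)) H0] := H _ F P FF.
  move=> x _; have [S [okS [v v32 xv]]] := loc x.
  exists (sl_phi S @` [set v | N2 (v : 'rV[R]_n.+1) < 32], [set Q | List.In S Q]) => /=.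
    split; last by exists [:: S] => [S' [<-//|[]]|Q _]; apply; left.
    by apply: near_open; [exact: disc_ball_open (sl_oemb S)|exists v].
  by move=> [y Q] /= [[u u32 <-] SQ]; exists S; split=> //; exists u.
have [Q1 Q1P] : exists Q1, (forall S, List.In S Q1 -> forall w, ~ K (sl_Phi S w)) /\
    forall S, List.In S Q0 -> List.In S (S1 :: Q1).
  elim: Q0 ok0 {H0} => [|S Q0 IH] ok0; first by exists nil.
  have [Q1 [H1 H2]] := IH (fun S' i => ok0 S' (or_intror i)).
  have [E|nK] := ok0 S (or_introl erefl).
    by exists Q1; split=> // S' [<-|/H2//]; left.
  exists (S :: Q1); split=> [S' [<-//|/H1//]|S' [<-|/H2[]]]; [by right; left|by left|by right; right].
exists Q1; split=> [|x]; first by have [] := Q1P.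
by have [S [SQ Sx]] := H0 x I; exists S; split=> //; have [_] := Q1P; apply.
Qed.

(* All the charts but S1 avoid a ball of S1, in which the push is therefore a mere
   translation by t. *)
Lemma parallel_copy (S1 : sl) : exists (t : R) (f' : M -> X), 0 < t /\
  [/\ forall x, imm f' x, injective f', forall x y, f x <> f' y,
    forall u : 'rV[R]_n.+1, N2 u <= 9 -> f' (sl_phi S1 u) = sl_Phi S1 (ht t u) &
    forall s (b : 'rV[R]_n.+1) y, 0 <= s <= t -> N2 b <= 9 -> sl_Phi S1 (ht s b) = f' y ->
      s = t /\ y = sl_phi S1 b].
Proof.
have [Q [QK cov]] := slicing_cover S1; pose L := S1 :: Q.
have immf := smooth_embedding_imm ef.
have injf x y : f x = f y -> x = y by have [_ H _] := ef; exact: H.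
have cf x : {for x, continuous f} by have [[]] := immf x.
have f0 : pushed L nil f by move=> x; right.
have S1L : List.In S1 L by left.
have [d d0 dP] := push_stage S1L cf f0.
(* Below the bound of the stage, and at most [1], so that heights up to [t] over [N2 b <= 9] remain
   in [N2 <= 10], where [bump] is [1] and which the other charts avoid. *)
pose t := Num.min (d / 2) 1.
have t0 : 0 < t by rewrite lt_min divr_gt0 ?ltr01.
have td : t < d by rewrite gt_min ltr_pdivrMr// ltr_pMr// ltr1n.
have t1 : t <= 1 by rewrite ge_min lexx orbT.
have [H [mH HPhi Hid HP]] := dP t t0 td.
have QL S : List.In S Q -> List.In S L /\ forall w, ~ (sl_Phi S1 @` [set w | N2 (w : 'rV[R]_n.+2) <= 20]) (sl_Phi S w).
  by move=> SQ; split; [right|exact: QK].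
have [H' [mH' H'K H'P]] := push_stages QL (mdiff_cont mH cf) HP.
pose f' x := H' (H (f x)).
have N2t s (b : 'rV[R]_n.+1) : `|s| <= 1 -> N2 b <= 9 -> N2 (ht s b) <= 10.
  move=> s1 b9; rewrite N2_ht.
  have : s ^+ 2 <= 1 by rewrite -real_normK ?num_real// expr_le1.
  by move: b9; lra.
have H'Phi s (b : 'rV[R]_n.+1) : `|s| <= 1 -> N2 b <= 9 -> H' (sl_Phi S1 (ht s b)) = sl_Phi S1 (ht s b).
  move=> s1 b9; apply: H'K; exists (ht s b) => //=; apply: le_trans (N2t _ _ s1 b9) _.
  by rewrite ler_nat.
have HPhi' s (b : 'rV[R]_n.+1) : `|s| <= 1 -> N2 b <= 9 -> H (sl_Phi S1 (ht s b)) = sl_Phi S1 (ht (s + t) b).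
  move=> s1 b9; rewrite HPhi pushE hgt_ht base_ht bump1 ?mul1r//.
  by apply: le_trans (N2t _ _ s1 b9) _; rewrite ler_nat.
exists t, f'; split=> //; split.
- move=> x; have l1 : ldf (fun p => H' (H p)) (f x) := ldf_comp (mdiff_ldf mH _) (mdiff_ldf mH' _).
  exact: (imm_comp (immf x) (ldf_imm l1)).
- by move=> x y /(mdiff_inj mH')/(mdiff_inj mH)/injf.
- move=> x y E; have [S [SL [v v32 yv]]] := cov y.
  have [[_ ab]|[_ H0]] := H'P y; first exact: (above_f ab (esym E)).
  have SQ : List.In S (Q ++ [:: S1]) by apply/List.in_app_iff; case: SL => [<-|?]; [right; left|left].
  by have := H0 S SQ v yv; rewrite leNgt v32.
- move=> u u9; rewrite /f' -slE HPhi' ?normr0 ?ler01// add0r H'Phi// gtr0_norm//.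
- move=> s b y /andP[s0 st] b9.
  have s1 : `|s| <= 1 by rewrite ger0_norm// (le_trans st).
  (* After undoing [H'] and the translation, the point at [ht (s - t) b] lies on [f(M)], so that its
     height vanishes. *)
  have st1 : `|s - t| <= 1 by rewrite ler_norml; apply/andP; split; move: s0 st t1 t0; lra.
  rewrite -H'Phi// => /(mdiff_inj mH'); have := HPhi' _ _ st1 b9; rewrite subrK => <-.
  move=> /(mdiff_inj mH)/(sl_height0 ef)[E ->]; rewrite base_ht; split=> //.
  by move: E; rewrite base_ht => /ht_inj[/eqP]; rewrite subr_eq0 => /eqP.
Qed.

End ParallelCopy.

(** * The double of an embedding *)

Section Profile.
Context {R : realType}.

Lemma step_le (s t : R) : s <= t -> step s <= step t.
Proof.
move=> st; rewrite /step ler_pdivrMr ?step_den// mulrAC ler_pdivlMr ?step_den//.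
have := flat_le st; have := @flat_le R (1 - t) (1 - s); rewrite lerD2l lerN2 => /(_ st).
have := flat_ge0 s; have := flat_ge0 t; have := flat_ge0 (1 - s); have := flat_ge0 (1 - t); nra.
Qed.

(* The tube maps the sphere N2 v = r to the sphere of height t * height r and of
   radius multiplied by width r: height r is 1 for r <= 1, 0 for 6 <= r, affine on
   [2, 5] and decreasing on [1, 6], while width r is 1/r for r <= 3 and 1 for
   4 <= r. *)
Definition height (r : R) : R := (7 - r) / 7 * step (6 - r) * step (r - 1) + (1 - step (r - 1)).
Definition width (r : R) : R := (1 - step (r - 3)) * r^-1 + step (r - 3).

Lemma height_low r : r <= 5 -> height r = 1 - r / 7 * step (r - 1).
Proof. by move=> r5; rewrite /height step1; [field|move: r5; lra]. Qed.

Lemma height_high r : 2 <= r -> height r = (7 - r) / 7 * step (6 - r).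
Proof. by move=> r2; rewrite /height (step1 (t := r - 1)); [ring|move: r2; lra]. Qed.

Lemma height_mid r : 2 <= r -> r <= 5 -> 7 - 7 * height r = r.
Proof.
by move=> r2 r5; rewrite height_low// step1; [field|move: r2; lra].
Qed.

Lemma height1 r : r <= 1 -> height r = 1.
Proof.
by move=> r1; rewrite height_low ?step0 ?mulr0 ?subr0//; move: r1; lra.
Qed.

Lemma height0 r : 6 <= r -> height r = 0.
Proof.
by move=> r1; rewrite height_high ?step0 ?mulr0//; move: r1; lra.
Qed.

Lemma height_low_lt r s : 1 <= r -> r < s -> s <= 5 -> height s < height r.
Proof.
move=> r1 rs s5; rewrite !height_low//; last by move: rs s5; lra.
have s0 : 0 < step (s - 1) by apply: step_gt0; move: r1 rs; lra.
have le : step (r - 1) <= step (s - 1) by apply: step_le; move: rs; lra.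
have := step_ge0 (r - 1); move: s0 le r1 rs; set p := step _; set q := step _; nra.
Qed.

Lemma height_high_lt r s : 2 <= r -> r < s -> s <= 6 -> height s < height r.
Proof.
move=> r1 rs s5; rewrite !height_high//; last by move: rs r1; lra.
have s0 : 0 < step (6 - r) by apply: step_gt0; move: rs s5; lra.
have le : step (6 - s) <= step (6 - r) by apply: step_le; move: rs; lra.
have := step_ge0 (6 - s); move: s0 le s5 rs; set p := step _; set q := step _; nra.
Qed.

Lemma height_lt r s : 1 <= r -> r < s -> s <= 6 -> height s < height r.
Proof.
move=> r1 rs s6; have [s5|s5] := leP s 5; first exact: height_low_lt.
have [r2|r2] := leP 2 r; first exact: height_high_lt.
apply: (@lt_trans _ _ (height 3)); [apply: height_high_lt|apply: height_low_lt] => //; move: r2 s5; lra.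
Qed.

(** [height] is strictly decreasing on [[1, 6]], so a coincidence can come only from one of its two
    constant pieces. *)
Lemma height_eq r s : height r = height s -> [\/ r = s, r <= 1 /\ s <= 1 | 6 <= r /\ 6 <= s].
Proof.
have key a b : a < b -> height a = height b -> a <= 1 /\ b <= 1 \/ 6 <= a /\ 6 <= b.
  move=> ab E; have [b1|b1] := leP b 1; first by left; split=> //; exact: ltW (lt_le_trans ab b1).
  have [a6|a6] := leP 6 a; first by right; split=> //; exact: ltW (le_lt_trans a6 ab).
  (* Clamping to the interval of strict decrease changes neither value. *)
  have : height (Num.min b 6) < height (Num.max a 1).
    apply: height_lt; rewrite ?le_max ?lexx ?orbT// ?ge_min ?lexx ?orbT//.
    by rewrite lt_min !gt_max ab b1 a6 ltr1n.
  rewrite (_ : height (Num.min b 6) = height b); last first.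
    by case: leP => // b6; rewrite !height0// ltW.
  have -> : height (Num.max a 1) = height a.
    by case: leP => // a1; rewrite !height1.
  by rewrite E ltxx.
move=> E; have [rs|rs|->] := ltgtP r s; last by constructor 1.
  by have [?|?] := key _ _ rs E; [constructor 2|constructor 3].
by have [[? ?]|[? ?]] := key _ _ rs (esym E); [constructor 2|constructor 3].
Qed.

Lemma height_ge0 r : 0 <= height r.
Proof.
have [r6|r6] := leP 6 r; first by rewrite height0.
have [r1|r1] := leP r 1; first by rewrite height1.
by apply: ltW; rewrite -(height0 (lexx 6)); apply: height_lt => //; exact: ltW.
Qed.

Lemma height_le1 r : height r <= 1.
Proof.
have [r6|r6] := leP 6 r; first by rewrite height0.
have [r1|r1] := leP r 1; first by rewrite height1.
by apply: ltW; rewrite -(height1 (lexx 1)); apply: height_lt => //; exact: ltW.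
Qed.

Lemma sm1_step_sub a r : sm1 (fun s : R => step (s - a)) r.
Proof.
by apply: (@sm1_comp1 R step (fun s => s - a)); [apply: sm1_sub; [exact: sm1_id|exact: sm1_cst]|exact: sm1_step].
Qed.

Lemma sm1_height r : sm1 height r.
Proof.
apply: sm1_add; last by apply: sm1_sub; [exact: sm1_cst|exact: sm1_step_sub].
apply: sm1_mul; last exact: sm1_step_sub.
apply: sm1_mul; first by apply: sm1_mul; [apply: sm1_sub; [exact: sm1_cst|exact: sm1_id]|exact: sm1_cst].
by apply: (@sm1_comp1 R step (fun s => 6 - s)); [apply: sm1_sub; [exact: sm1_cst|exact: sm1_id]|exact: sm1_step].
Qed.

Lemma sm1_width r : 0 < r -> sm1 width r.
Proof.
move=> r0; apply: sm1_add; last exact: sm1_step_sub.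
apply: sm1_mul; first by apply: sm1_sub; [exact: sm1_cst|exact: sm1_step_sub].
by apply: sm1_inv; [exact: sm1_id|rewrite gt_eqF].
Qed.

Lemma width_low r : r <= 3 -> width r = r^-1.
Proof. by move=> r3; rewrite /width step0 ?subr0 ?mul1r ?addr0// subr_le0. Qed.

Lemma width_high r : 4 <= r -> width r = 1.
Proof. by move=> r4; rewrite /width step1 ?subrr ?mul0r ?add0r//; move: r4; lra. Qed.

Lemma width_gt0 r : 0 < r -> 0 < width r.
Proof.
move=> r0; have ri : 0 < r^-1 by rewrite invr_gt0.
have := step_ge0 (r - 3); have := step_le1 (r - 3); rewrite /width.
have [->|p1] := eqVneq (step (r - 3)) 1; first by lra.
move=> p2 p0; apply: ltr_pwDl => //; rewrite mulr_gt0// subr_gt0 lt_neqAle p1//.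
Qed.

(** Up to [1] the quantity is [1/r < 4]; beyond [1] the width is at most [1], which gives [r < 6].
    The number [9] is the radius bound under which [parallel_copy] describes the slab. *)
Lemma width_bound r : 4^-1 < r -> r < 6 -> r * width r ^+ 2 <= 9.
Proof.
move=> r4 r6; have r0 : 0 < r by apply: lt_trans r4; rewrite invr_gt0.
have [r1|r1] := leP r 1.
  rewrite width_low; last by move: r1; lra.
  rewrite expr2 mulrA mulfV ?gt_eqF// mul1r; apply: (@le_trans _ _ 4); last by rewrite ler_nat.
  by rewrite -[4]invrK lef_pV2 ?posrE ?invr_gt0// ltW.
have w1 : width r <= 1.
  have ri : r^-1 <= 1 by rewrite invf_le1// ltW.
  have := step_ge0 (r - 3); have := step_le1 (r - 3); rewrite /width; move: ri; nra.
have w0 := ltW (width_gt0 r0).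
apply: (@le_trans _ _ (r * 1)); last by rewrite mulr1; move: r6; lra.
by rewrite ler_pM2l// expr_le1.
Qed.

Section Tube.
Context {n : nat}.
Variable t : R.
Hypothesis t0 : 0 < t.

Definition tube (v : 'rV[R]_n) : 'rV[R]_n.+1 := ht (t * height (N2 v)) (width (N2 v) *: v).

Lemma tube_low v : N2 v <= 1 -> tube v = ht t (inversion v).
Proof.
move=> v1; rewrite /tube height1// mulr1 width_low//; apply: le_trans v1 _; rewrite ler1n//.
Qed.

Lemma tube_high v : 6 <= N2 v -> tube v = ht 0 v.
Proof.
move=> v6; rewrite /tube height0// mulr0 width_high ?scale1r//; apply: le_trans v6; rewrite ler_nat//.
Qed.

Lemma tube_inj v w : v <> 0 -> w <> 0 -> tube v = tube w -> v = w.
Proof.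
move=> v0 w0 E; move: (E) => /ht_inj[/(mulfI (lt0r_neq0 t0))/height_eq].
case=> [NE|[v1 w1]|[v6 w6]] WE.
- move: WE; rewrite NE => /(scalerI _); apply; rewrite gt_eqF// width_gt0// -NE N2_gt0; exact/eqP.
- by move: E; rewrite !tube_low// => /ht_inj[_ /(congr1 (@inversion R n))]; rewrite !inversionK.
- by move: E; rewrite !tube_high// => /ht_inj[].
Qed.

(* A smooth left inverse is base for r > 4, inversion o base for r < 3, and for
   2 < r < 5 it recovers r from the height, which is affine there. *)
Lemma imm_tube (v : euclidean R n) : v <> (0 : 'rV[R]_n) -> imm (tube : euclidean R n -> euclidean R n.+1) v.
Proof.
move=> /eqP v0; have r0 : 0 < N2 (v : 'rV[R]_n) by rewrite N2_gt0.
have sN : sm (fun w : 'rV[R]_n => N2 w) v := sm_N2 (sm_id _).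
have sw : sm (fun w : 'rV[R]_n => width (N2 w)) v by apply: (sm1_comp _ sN); exact: sm1_width.
have sT : sm tube v.
  apply: sm_ht; first by apply: sm_mul; [exact: sm_cst|apply: (sm1_comp _ sN); exact: sm1_height].
  by apply: sm_scale => //; exact: sm_id.
have cN : {for (v : 'rV[R]_n), continuous (@N2 R n)} := @N2_cont R n v.
split; first exact/msm_euclid.
have [r4|r4] := ltP 4 (N2 (v : 'rV[R]_n)).
  exists (@base R n : euclidean R n.+1 -> euclidean R n); split; first exact/msm_euclid/sm_base.
  apply: filterS (near_gtr cN r4) => w w4; rewrite /tube base_ht width_high ?scale1r//; exact: ltW.
have [r3|r3] := ltP (N2 (v : 'rV[R]_n)) 3.
  exists (fun z => inversion (base (z : 'rV[R]_n.+1)) : euclidean R n); split.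
    apply/msm_euclid; apply: (@sm_comp R _ _ _ (@base R n) (@inversion R n)); first exact: sm_base.
    apply: sm_inversion; rewrite /tube base_ht scaler_eq0 negb_or v0 andbT gt_eqF// width_gt0//.
  apply: filterS (near_ltr cN r3) => w w3; rewrite /tube base_ht width_low ?ltW//; exact: inversionK.
pose g (z : 'rV[R]_n.+1) : 'rV[R]_n := (width (7 - 7 * (hgt z * t^-1)))^-1 *: base z.
have gT w : 2 <= N2 w -> N2 w <= 5 -> g (tube w) = w.
  move=> w2 w5; rewrite /g /tube hgt_ht base_ht [t * _]mulrC mulfK ?gt_eqF// height_mid//.
  rewrite scalerA mulVf ?scale1r// gt_eqF// width_gt0//; apply: lt_le_trans w2; rewrite ltr0n//.
exists (g : euclidean R n.+1 -> euclidean R n); split.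
  apply/msm_euclid; apply: sm_scale; last exact: sm_base.
  pose k (z : 'rV[R]_n.+1) := 7 - 7 * (hgt z * t^-1).
  have kT : k (tube v) = N2 (v : 'rV[R]_n).
    rewrite /k /tube hgt_ht [t * _]mulrC mulfK ?gt_eqF// height_mid//; move: r3 r4; lra.
  have sk : sm k (tube v).
    apply: sm_sub; first exact: sm_cst.
    by apply: sm_mul; [exact: sm_cst|apply: sm_mul; [exact: sm_hgt|exact: sm_cst]].
  have : sm (fun z => width (k z)) (tube v) by apply: (sm1_comp _ sk); rewrite kT; exact: sm1_width.
  by move=> /sm_inv; apply; rewrite kT gt_eqF// width_gt0.
have r2 : 2 < N2 (v : 'rV[R]_n) by move: r3; lra.
have r5 : N2 (v : 'rV[R]_n) < 5 by move: r4; lra.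
by apply: filterS2 (near_gtr cN r2) (near_ltr cN r5) => w w2 w5; apply: gT; exact: ltW.
Qed.

End Tube.
End Profile.

Section Doubling.
Context {R : realType}.

(** The first copy follows [f] outside the disc and the tube inside; the second follows [f']. Where
    [N2 v < 1] the tube is at height [t] over [inversion v], which is the point of the parallel copy
    glued to [phi v]. *)
Lemma embeds_double n (M P : oriented_manifold R n.+1) (X : oriented_manifold R n.+2) (f : M -> X)
    (S : @slicing R n M X f) (i : M -> P) (j : M -> P) :
  smooth_embedding f -> compact [set: M] ->
  @csum R n.+1 M (opposite M) P (sl_phi S) (sl_phi S) i j -> exists F : P -> X, smooth_embedding F.
Proof.
move=> ef cM MMP; have cP := csum_compact MMP cM cM.
have [t [f' [t0 [immf' injf' ff' f'S f'slab]]]] := parallel_copy ef cM S.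
have immf := smooth_embedding_imm ef.
have injf x y : f x = f y -> x = y by have [_ H _] := ef; exact: H.
have [_ lPhi _] := sl_Oemb S; have [_ lphi _] := sl_oemb S.
set phi := sl_phi S in MMP *; set Phi := sl_Phi S.
have [g [gK _ _]] := disc_inv (sl_oemb S).
pose a x := if pselect (exists v, x = phi v) then Phi (tube t (g x : 'rV[R]_n.+1)) else f x.
have aE v : a (phi v) = Phi (tube t (v : 'rV[R]_n.+1)).
  by rewrite /a; case: pselect => [e1|[]]; [rewrite gK|exists v].
have aN x : (forall v, x <> phi v) -> a x = f x.
  by move=> nx; rewrite /a; case: pselect => [e1|//]; exfalso; have [v /nx] := e1.
have dec x : (exists v, x = phi v) \/ (forall v, x <> phi v).
  by have [?|nx] := pselect (exists v, x = phi v); [left|right => v xv; apply: nx; exists v].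
have af v : 6 <= N2 (v : 'rV[R]_n.+1) -> a (phi v) = f (phi v).
  by move=> v6; rewrite aE tube_high// /Phi slE.
(* The necks of [A] and [B] overlap exactly for [1/4 < N2 v < 1]. There the tube has height [t], and
   [N2 (inversion v) < 4] stays within the bound [9] of the slab. *)
pose A := ~` (phi @` [set v | N2 (v : 'rV[R]_n.+1) <= 4^-1]).
pose B : set (opposite M) := ~` (phi @` [set v | N2 (v : 'rV[R]_n.+1) <= 1]).
have cball e : closed (phi @` [set v | N2 (v : 'rV[R]_n.+1) <= e]).
  by apply: disc_ball_closed => v; exact: ldf_cont (lphi v I).
have oA : open A by rewrite openC; exact: cball.
have oB : open B by rewrite openC; exact: cball.
have A0 : A `<=` [set~ phi 0].
  by move=> x xA x0; apply: xA; exists 0; rewrite ?x0//= N20 invr_ge0.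
have B0 : B `<=` [set~ phi 0].
  by move=> x xA x0; apply: xA; exists 0; rewrite ?x0//= N20 ler01.
have Aphi v : A (phi v) -> 4^-1 < N2 (v : 'rV[R]_n.+1).
  by move=> vA; rewrite ltNge; apply/negP => v4; apply: vA; exists v.
have neq0 (v : 'rV[R]_n.+1) e : 0 <= e -> e < N2 v -> v <> 0.
  by move=> e0 ev v0; move: ev; rewrite v0 N20 ltNge e0.
have q0 : 0 <= 4^-1 :> R by rewrite invr_ge0.
have cov p : (exists x, A x /\ i x = p) \/ (exists y, B y /\ j y = p).
  have [[x [xp <-]]|[y [yp <-]]] := csum_cover MMP p.
    have [xA|/contrapT[v /= v4 vx]] := pselect (A x); [by left; exists x|right].
    have v0 : v <> (0 : 'rV[R]_n.+1) by move=> v0; apply: xp; rewrite -vx v0.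
    exists (phi (inversion (v : 'rV[R]_n.+1))); split; last by rewrite -vx; apply/esym; exact: (csum_neck MMP v0).
    move=> [w /= w1 /(sl_inj (S := S)) wv]; move: w1; rewrite wv N2_inversion invf_le1; last first.
      by rewrite N2_gt0; exact/eqP.
    by rewrite leNgt; apply/negP; rewrite negbK; apply: le_lt_trans v4 _; rewrite invf_lt1 ?ltr1n.
  have [yB|/contrapT[v /= v1 vy]] := pselect (B y); [by right; exists y|left].
  have v0 : v <> (0 : 'rV[R]_n.+1) by move=> v0; apply: yp; rewrite -vy v0.
  exists (phi (inversion (v : 'rV[R]_n.+1))); split; last by rewrite -vy; apply/esym; exact: (csum_neck2 MMP v0).
  move=> [w /= w4 /(sl_inj (S := S)) wv]; move: w4; rewrite wv N2_inversion lef_pV2 ?posrE ?N2_gt0//; last exact/eqP.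
  by move: v1; lra.
have imma x : A x -> imm a x.
  move=> xA; have [[v xv]|nx] := dec x.
    rewrite {}xv {x} in xA *; have v0 := neq0 _ _ q0 (Aphi _ xA).
    have iT : imm (fun v : euclidean R n.+1 => Phi (tube t (v : 'rV[R]_n.+1))) v.
      apply: (@imm_comp R n.+1 n.+2 n.+2 (euclidean R n.+1) (euclidean R n.+2) X (tube t) Phi v).
        exact: imm_tube.
      exact/ldf_imm/lPhi.
    by apply: (imm_descend (lphi v I) iT); apply: near_all => w; exact: aE.
  have n1 : \forall y \near x, f y = a y.
    have : \forall y \near x, ~ (phi @` [set v | N2 (v : 'rV[R]_n.+1) <= 6]) y.
      apply: (@near_open _ (~` _)); first by rewrite openC; exact: cball.
      by move=> [v _ /esym]; exact: nx.
    apply: filterS => y ny; have [[v yv]|ny2] := dec y; last by rewrite aN.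
    rewrite yv af// ltW// ltNge; apply/negP => v6; apply: ny; by exists v.
  exact: imm_near_eq n1 (immf x).
have Phi_tube_f v x : A (phi v) -> Phi (tube t (v : 'rV[R]_n.+1)) = f x -> 6 <= N2 (v : 'rV[R]_n.+1).
  move=> vA /(sl_slice (s := S))[u]; rewrite /tube => /ht_inj[/eqP + _].
  rewrite mulf_eq0 gt_eqF//= -(height0 (lexx 6)) => /eqP/height_eq[->|[_]|[]]//.
  by move=> H; exfalso; move: H; lra.
have inja x y : A x -> A y -> a x = a y -> x = y.
  move=> xA yA; have [[v xv]|nx] := dec x; have [[w yw]|ny] := dec y.
  - subst x y; rewrite !aE => /(sl_Inj (S := S))/(tube_inj t0) -> //.
      exact: (neq0 _ _ q0 (Aphi _ xA)).
    exact: (neq0 _ _ q0 (Aphi _ yA)).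
  - subst x; rewrite (aN y)// aE => E; have v6 := Phi_tube_f _ _ xA E.
    by move: E; rewrite -aE af// => /injf.
  - subst y; rewrite (aN x)// aE => /esym E; have v6 := Phi_tube_f _ _ yA E.
    by move: E; rewrite -aE af// => /injf.
  - by rewrite !aN// => /injf.
have ab x y : A x -> B y -> i x = j y <-> a x = f' y.
  move=> xA yB; split.
    move=> /(csum_glue MMP (A0 _ xA) (B0 _ yB))[v [v0 xv yv]].
    rewrite {}xv {x} in xA *; rewrite {}yv {y} in yB *.
    have v4 := Aphi _ xA; have Nv : 0 < N2 v by rewrite N2_gt0; exact/eqP.
    have v1 : N2 v < 1.
      rewrite ltNge; apply/negP => v1; apply: yB; exists (inversion v) => //=.
      by rewrite N2_inversion invf_le1.
    rewrite aE tube_low ?(ltW v1)// f'S// N2_inversion; apply: (@le_trans _ _ 4); last by rewrite ler_nat.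
    by rewrite -[4]invrK lef_pV2 ?posrE ?invr_gt0// ltW.
  have [[v xv]|nx] := dec x; last by rewrite aN// => /ff'.
  rewrite {}xv {x} in xA *; have v4 := Aphi _ xA.
  have v0 := neq0 _ _ q0 v4.
  have [v6|v6] := leP 6 (N2 (v : 'rV[R]_n.+1)); first by rewrite af// => /ff'.
  rewrite aE /tube => E.
  (* The tube stays in the slab, so it can meet the parallel copy only at height [t], that is, where
     [height] is [1] and [N2 v <= 1]. *)
  have [||s1 ->] := f'slab _ _ _ _ _ E.
  - by rewrite mulr_ge0 ?(ltW t0) ?height_ge0//= ler_piMr ?(ltW t0)// height_le1.
  - by rewrite N2Z mulrC; exact: width_bound.
  have : height (N2 (v : 'rV[R]_n.+1)) = height 1.
    by rewrite (height1 (lexx 1)); apply: (mulfI (lt0r_neq0 t0)); rewrite mulr1.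
  move=> /height_eq h1; have v1 : N2 (v : 'rV[R]_n.+1) <= 1.
    by case: h1 => [->//|[]//|[_ H]]; exfalso; move: H; lra.
  rewrite width_low; last by apply: le_trans v1 _; rewrite ler1n.
  exact: (csum_neck MMP v0).
exact: (@csum_embedding R n.+1 M (opposite M) P _ _ _ _ MMP n.+2 X A B a f' cP oA oB A0 B0 cov imma
  (fun y _ => immf' y) inja (fun y y' _ _ => @injf' y y') ab).
Qed.

(** The disc [psi] reverses the orientation as a map to [opposite M], so it preserves that of [M]:
    both gluing discs are positive in [M], and [straighten] applies. *)
Lemma embeds_connected_sum_opposite n (M P : oriented_manifold R n.+1) (X : oriented_manifold R n.+2)
    (f : M -> X) :
  compact [set: M] -> connected [set: M] -> is_connected_sum M (opposite M) P ->
  smooth_embedding f -> exists F : P -> X, smooth_embedding F.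
Proof.
move=> cM kM /is_connected_sumP[phi [psi [i [j S]]]] ef.
have ophi := csum_phi S; have opsi : oemb setT (psi : euclidean R n.+1 -> M) := csum_psi S.
have sphi v : osign true phi v by apply: csum_phi_sign S _.
have spsi v : osign true (psi : euclidean R n.+1 -> M) v.
  by apply/(@osign_opposite R n.+1 (euclidean R n.+1) M false); apply: csum_psi_sign S _.
have [h [mh nh]] := straighten kM ophi opsi sphi spsi.
(* Contracting both discs by the same factor makes [h] carry the first exactly onto the second, so
   that [csum_diffeo] replaces the second by the first. A last contraction turns both into the disc
   of a slicing. *)
have [r r0 rP] := near0_ball nh; have [d [c sc]] := shrinker_exists r0.
have [j1 S1] := csum_shrink S sc; have [i2 S2] := csum_shrink2 S1 sc.
pose phi0 (v : euclidean R n.+1) := phi (radial c (v : 'rV[R]_n.+1)).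
have ophi0 : oemb setT phi0 := csum_phi S2.
have sphi0 v : osign true phi0 v by apply: csum_phi_sign S2 _.
have oh : oemb setT (h : opposite M -> opposite M).
  by split; [exact: openT|move=> x _; exact: mdiff_ldf mh x|move=> x y _ _ E; exact: (mdiff_inj mh E)].
have sh (y : opposite M) : osign true (h : opposite M -> opposite M) y.
  apply/(@osign_opposite R n.+1 (opposite M) M true).
  by apply/(@osign_opposite_dom R n.+1 M M false); exact: mdiff_sign mh y.
have honto (y : opposite M) : exists z : opposite M, h z = y.
  by have [h' [_ Kh]] := mdiff_inverse mh; exists (h' y).
have hphi v : h (phi0 v) = psi (radial c (v : 'rV[R]_n.+1)).
  by apply: rP; exact: (shrinker_lt sc).
have lphi0 v : ldf (phi0 : euclidean R n.+1 -> opposite M) v by have [_ l _] := ophi0; exact: l.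
have S3 := csum_diffeo S2 oh sh honto hphi lphi0.
have [rho [d' [c' [T [sc' _ TE]]]]] := slicing_of_disc ef ophi0 sphi0.
have [j4 S4] := csum_shrink S3 sc'; have [i5 S5] := csum_shrink2 S4 sc'.
apply: (@embeds_double n M P X f T i5 j4 ef cM); rewrite TE; exact: S5.
Qed.

End Doubling.

Local Open Scope ereal_scope.

(** * Embedding numbers *)

Section EmbeddingNumbers.
Context {R : realType}.

Lemma embedding_number_le k (M : manifold R 3) : embeds_in_sum_S2xS2 k M ->
  embedding_number M <= (k%:R)%:E.
Proof. by move=> eM; apply: ereal_inf_lbound; exists k. Qed.

(** A nonempty set of natural numbers has a least element; the infimum of the empty set is [+oo]. *)
Lemma embedding_number_attained (M : manifold R 3) :
  (exists2 k, embeds_in_sum_S2xS2 k M & embedding_number M = (k%:R)%:E) \/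
  embedding_number M = +oo.
Proof.
have [[k eM]|nM] := pselect (exists k, embeds_in_sum_S2xS2 k M); [left|right].
  have ex : exists k, `[< embeds_in_sum_S2xS2 k M >] by exists k; exact/asboolP.
  case: (ex_minnP ex) => m /asboolP em mmin; exists m => //.
  apply/eqP; rewrite eq_le embedding_number_le//=; apply: le_ereal_inf_tmp => _ [l el <-].
  by rewrite lee_fin ler_nat; apply: mmin; exact/asboolP.
rewrite /embedding_number (_ : [set _ | _ in _] = set0) ?ereal_inf0//.
by apply/seteqP; split=> // x [k ek _]; apply: nM; exists k.
Qed.

End EmbeddingNumbers.

Theorem proposition2p3 (R : realType) (M N : oriented_manifold R 3)
    (hM : closed_connected M) (hN : closed_connected N) :
  [/\ embedding_number M = embedding_number (opposite M),
      (forall P : oriented_manifold R 3, is_connected_sum M N P ->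
         embedding_number P <= embedding_number M + embedding_number N) &
      (forall P : oriented_manifold R 3, is_connected_sum M (opposite M) P ->
         embedding_number P <= embedding_number M)].
Proof.
(* The equality (1) holds by conversion: [opposite M] has the same underlying manifold as [M]. *)
have [cM kM] := hM; have [cN _] := hN; split=> [//|P MNP|P MMP].
  have [[k ek ->]|->] := embedding_number_attained M; have [[l el ->]|->] := embedding_number_attained N;
    rewrite ?leey//.
  rewrite -EFinD -natrD; apply: embedding_number_le.
  exact: (embeds_in_sum_S2xS2_connected_sum cM cN MNP ek el).
have [[k [X [f [sX ef]]] ->]|->] := embedding_number_attained M; last by rewrite leey.
have [F eF] := embeds_connected_sum_opposite cM kM MMP ef.
by apply: embedding_number_le; exists X, F.
Qed.
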